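(* Fix either version $B=X$ or $B=D$. Let $\mathcal K\subseteq\mathcal P$ be a compact semialgebraic (not necessarily finite) upper semilattice with $\mathfrak g\in\mathcal K$, and $\mathcal K^\#=\mathcal K\setminus\{\mathfrak g\}$. Then the compact set $/\mathcal K^\#/=\bigcup_{\varphi\in\Delta(\mathcal K^\#)}/\varphi/$ is a strong deformation retract of: (i) $B[\mathcal K]:=\bigcup_{\mathfrak k\in\mathcal K^\#}B[\mathfrak k]$, in general; (ii) $X_\varepsilon$ (for every $\varepsilon\in\,]0,1[$) and $X_1=B[\mathcal P\setminus\mathcal I]=\bigcup_{\mathfrak f\in\mathcal P\setminus\mathcal I}B[\mathfrak f]$, provided $[\mathfrak g,\mathfrak g]\not\subseteq\mathfrak h$ and $\mathcal K^{\min}\subseteq\mathcal K\subseteq\mathcal P\setminus\mathcal I$.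
   Context: $\mathfrak g$ is the Lie algebra of a compact Lie group with Euclidean inner product $Q$ satisfying $Q([X,Y],Z)=Q(X,[Y,Z])$; symmetric operators satisfy $Q(AX,Y)=Q(X,AY)$. For symmetric $A$, $F_a$ is the span of eigenvectors with eigenvalue $\le a$; $A$ is filtering if $[F_a,F_b]\subseteq F_{a+b}$ for all $a,b$; $\mathfrak F_+$ = filtering symmetric operators with nonnegative spectrum and trace $1$. $\mathfrak h\subsetneq\mathfrak g$ fixed subalgebra, $\mathcal A$ compact group of automorphisms of $\mathfrak g$ preserving $\mathfrak h$ and $Q$. $\mathcal P$ = set of $\mathcal A$-invariant subalgebras $\mathfrak k$ with $\mathfrak h\subsetneq\mathfrak k\subseteq\mathfrak g$, a subset of the disjoint union of Grassmannians of $\mathfrak g$ (compactness and semialgebraicity of $\mathcal K$ refer to this). Upper semilattice: for $\mathfrak k,\mathfrak l\in\mathcal K$ the smallest subalgebra containing both lies in $\mathcal K$. $\mathcal I=\{\mathfrak k\in\mathcal P:[\mathfrak k,\mathfrak k]\subseteq\mathfrak h\}$ (toral subalgebras). $\mathcal K^{\min}$ is the smallest upper semilattice in $\mathcal P\setminus\mathcal I$ containing $\mathfrak g$ and all minimal elements of $\mathcal P\setminus\mathcal I$. For $\mathfrak k\in\mathcal P\setminus\{\mathfrak g\}$: $\bar\chi^{\mathfrak k}=\frac{1}{\dim(\mathfrak g/\mathfrak k)}(1_{\mathfrak g}-1_{\mathfrak k})$ ($Q$-orthogonal projections); $D[\mathfrak k]$ = symmetric operators with nonnegative spectrum, trace $1$,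 commuting with $\mathcal A$, annihilating $\mathfrak k$ and commuting with $\mathrm{ad}(X)$, $X\in\mathfrak k$; $X[\mathfrak k]=D[\mathfrak k]\cap\mathfrak F_+$; $D[\mathfrak g]=X[\mathfrak g]=\emptyset$. Flags $\varphi=(\mathfrak f_1\supsetneq\dots\supsetneq\mathfrak f_r)$, $r\ge1$, $\mathfrak f_i\in\mathcal P$, $\max\varphi=\mathfrak f_1$; $\Delta(\mathcal S)$ = flags with all members in $\mathcal S$; $/\chi/$ = convex hull of $\{\bar\chi^{\mathfrak f}:\mathfrak f\in\chi\}$ for $\chi\not\ni\mathfrak g$. Butterflies: $B[(\mathfrak f)]=B[\mathfrak f]$; if $r>1$, $\mathfrak f_1=\mathfrak g$: $B[\varphi]=/(\mathfrak f_2,\dots,\mathfrak f_r)/$; if $r>1$, $\mathfrak f_1\neq\mathfrak g$: the union of closed segments joining $B[\mathfrak f_1]$ to $/(\mathfrak f_2,\dots,\mathfrak f_r)/$ (their join). $\mathbb I=\{\varphi\in\Delta(\mathcal P)\setminus\Delta(\mathcal I):\varphi\setminus\{\max\varphi\}\subseteq\mathcal I\}$, $B[\mathbb I]=\bigcup_{\varphi\in\mathbb I}B[\varphi]$. $\kappa:B[\mathbb I]\to[0,1]$: for $A\in B[\varphi]$, $\varphi\in\mathbb I$: $\kappa(A)=0$ if $\max\varphi=\mathfrak g$, $=1$ if $\varphi$ has length $1$, otherwise the coefficient $\kappa$ in $A=(1-\kappa)A_1+\kappa A_2$ with $A_1\in/(\mathfrak f_2,\dots,\mathfrak f_r)/$,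 $A_2\in B[\mathfrak f_1]$ (independent of $\varphi$). $L$ is an upper bound for the lengths of flags in $\Delta(\mathcal I)$ and $X_\varepsilon=\{A\in B[\mathbb I]:\kappa(A)\ge\varepsilon^L\}$. *)

(* Defs.v *)
From Stdlib Require List.
From HB Require Import structures.
From mathcomp Require Import all_boot all_order all_algebra.
From mathcomp Require Import all_classical all_reals all_analysis.
Set Implicit Arguments. Unset Strict Implicit. Unset Printing Implicit Defensive.
Import Order.TTheory GRing.Theory Num.Theory.
Import numFieldNormedType.Exports.
Local Open Scope classical_set_scope.
Local Open Scope ring_scope.

(* g is modelled as 'rV[R]_n with Q the standard dot product (an orthonormal
   basis for Q has been chosen); operators are n x n matrices acting on row
   vectors on the right: A X := X *m A.  A subspace k of g is represented by its
   Q-orthogonal projection matrix P (P^T = P, P *m P = P); this is the standard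
   embedding of the Grassmannians, which carries their topology and their
   semialgebraic structure. *)

Section Defs.
Variable R : realType.
Variable n : nat.
Notation vec := 'rV[R]_n.
Notation mat := 'M[R]_n.

Definition Qf (x y : vec) : R := (x *m y^T) 0 0.

Definition compact_lie_bracket (br : vec -> vec -> vec) : Prop :=
  [/\ (forall a x y z, br (a *: x + y) z = a *: br x z + br y z),
      (forall a x y z, br z (a *: x + y) = a *: br z x + br z y),
      (forall x, br x x = 0),
      (forall x y z, br x (br y z) + br y (br z x) + br z (br x y) = 0)
    & (forall x y z, Qf (br x y) z = Qf x (br y z))].

Definition is_proj (P : mat) : Prop := P^T = P /\ P *m P = P.
Definition inS (P : mat) (x : vec) : Prop := x *m P = x.
Definition subS (P P' : mat) : Prop := forall x, inS P x -> inS P' x.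
Definition psubS (P P' : mat) : Prop := subS P P' /\ P <> P'.

Variable br : vec -> vec -> vec.

Definition is_subalg (P : mat) : Prop :=
  is_proj P /\ forall x y, inS P x -> inS P y -> inS P (br x y).

(* the whole algebra g is represented by the identity matrix *)
Definition gP : mat := 1%:M.

Definition is_aut_group (h : mat) (Aut : set mat) : Prop :=
  [/\ compact Aut, Aut 1%:M,
      (forall a b, Aut a -> Aut b -> Aut (a *m b)),
      (forall a, Aut a -> Aut (invmx a)) &
      (forall a, Aut a ->
         [/\ a *m a^T = 1%:M,
             (forall x y, br (x *m a) (y *m a) = br x y *m a) &
             (forall x, inS h x -> inS h (x *m a))])].

Variable h : mat.
Variable Aut : set mat.

Definition Aut_inv (P : mat) : Prop := forall a x, Aut a -> inS P x -> inS P (x *m a).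

Definition Pset : set mat := [set k | is_subalg k /\ Aut_inv k /\ psubS h k].

Definition Iset : set mat :=
  [set k | Pset k /\ forall x y, inS k x -> inS k y -> inS h (br x y)].

Definition symmetric (A : mat) : Prop := A^T = A.
Definition is_eigvec (A : mat) (l : R) (v : vec) : Prop := v *m A = l *: v.
Definition nonneg_spec (A : mat) : Prop :=
  forall l v, v != 0 -> is_eigvec A l v -> 0 <= l.

Definition Fa (A : mat) (a : R) (x : vec) : Prop :=
  exists s : seq (R * vec),
    (forall p, p \in s -> p.1 <= a /\ is_eigvec A p.1 p.2) /\
    x = \sum_(p <- s) p.2.

Definition filtering (A : mat) : Prop :=
  forall a b x y, Fa A a x -> Fa A b y -> Fa A (a + b) (br x y).

Definition Fplus : set mat :=
  [set A | [/\ symmetric A, filtering A, nonneg_spec A & \tr A = 1]].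

Definition chibar (k : mat) : mat := ((n - \rank k)%:R)^-1 *: (1%:M - k).

Definition Dset (k : mat) : set mat :=
  [set A | [/\ symmetric A, nonneg_spec A, \tr A = 1,
              (forall a, Aut a -> A *m a = a *m A) &
              [/\ (forall x, inS k x -> x *m A = 0) &
                  (forall X y, inS k X -> br X y *m A = br X (y *m A))]]].

Definition Xset (k : mat) : set mat := Dset k `&` Fplus.

Definition Bk (b : bool) (k : mat) : set mat := if b then Xset k else Dset k.

Definition is_flag (S : set mat) (phi : seq mat) : Prop :=
  [/\ (0 < size phi)%N,
      (forall f, f \in phi -> S f) &
      (forall i, (i.+1 < size phi)%N -> psubS (nth 0 phi i.+1) (nth 0 phi i))].

Definition convS (s : seq mat) : set mat :=
  [set A | exists t : 'I_(size s) -> R,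
     [/\ (forall i, 0 <= t i), \sum_i t i = 1 &
         A = \sum_i t i *: nth 0 s i]].

Definition hull (chi : seq mat) : set mat := convS (map chibar chi).

Definition joinS (S1 S2 : set mat) : set mat :=
  [set A | exists s : R, exists A1, exists A2,
     [/\ 0 <= s <= 1, S1 A1, S2 A2 & A = (1 - s) *: A1 + s *: A2]].

Definition butterfly (b : bool) (phi : seq mat) : set mat :=
  match phi with
  | [::] => set0
  | [:: f] => Bk b f
  | f :: tl => if f == gP then hull tl else joinS (hull tl) (Bk b f)
  end.

Definition flagI (phi : seq mat) : Prop :=
  is_flag Pset phi /\ ~ is_flag Iset phi /\
  (forall f, f \in behead phi -> Iset f).

(* kappa(A) >= c, given that kappa is well defined (independent of phi) *)
Definition kappa_ge (b : bool) (c : R) (A : mat) : Prop :=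
  exists phi, flagI phi /\
    match phi with
    | [::] => False
    | [:: f] => Bk b f A /\ c <= 1
    | f :: tl =>
        if f == gP then hull tl A /\ c <= 0
        else exists s A1 A2,
          [/\ c <= s <= 1, hull tl A1, Bk b f A2 & A = (1 - s) *: A1 + s *: A2]
    end.

Definition X_eps (b : bool) (L : nat) (eps : R) : set mat :=
  kappa_ge b (eps ^+ L).

Definition B_PminusI (b : bool) : set mat :=
  [set A | exists f, (Pset `\` Iset) f /\ Bk b f A].

Definition is_join_alg (k l m : mat) : Prop :=
  [/\ is_subalg m, subS k m, subS l m &
      forall m', is_subalg m' -> subS k m' -> subS l m' -> subS m m'].

Definition upper_semilattice (K : set mat) : Prop :=
  forall k l m, K k -> K l -> is_join_alg k l m -> K m.

Definition minimal_in (S : set mat) (k : mat) : Prop :=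
  S k /\ forall l, S l -> subS l k -> l = k.

Definition Kmin : set mat :=
  [set k | forall S : set mat,
     S `<=` Pset `\` Iset -> upper_semilattice S -> S gP ->
     (forall m, minimal_in (Pset `\` Iset) m -> S m) -> S k].

Inductive polyexpr :=
  | PConst of R | PVar of 'I_n & 'I_n
  | PAdd of polyexpr & polyexpr | PMul of polyexpr & polyexpr.

Fixpoint peval (p : polyexpr) (M : mat) : R :=
  match p with
  | PConst c => c
  | PVar i j => M i j
  | PAdd p q => peval p M + peval q M
  | PMul p q => peval p M * peval q M
  end.

Definition semialgebraic (S : set mat) : Prop :=
  exists cells : seq (polyexpr * seq polyexpr),
    S = [set M | exists c, List.In c cells /\
                  peval c.1 M = 0 /\ forall q, List.In q c.2 -> 0 < peval q M].

Definition strong_def_retract (Y X : set mat) : Prop :=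
  Y `<=` X /\
  exists H : R -> mat -> mat,
    [/\ {within `[0, 1]%classic `*` X, continuous (fun p : R * mat => H p.1 p.2)},
        (forall t x, 0 <= t <= 1 -> X x -> X (H t x)),
        (forall x, X x -> H 0 x = x),
        (forall x, X x -> Y (H 1 x)) &
        (forall t y, 0 <= t <= 1 -> Y y -> H t y = y)].

Definition hullK (K : set mat) : set mat :=
  [set A | exists phi, is_flag (K `\` [set gP]) phi /\ hull phi A].

Definition BK (b : bool) (K : set mat) : set mat :=
  [set A | exists k, (K `\` [set gP]) k /\ Bk b k A].

End Defs.

(* Main.v *)
Require Import Defs.
From HB Require Import structures.
From mathcomp Require Import all_boot all_order all_algebra.
From mathcomp Require Import all_classical all_reals all_analysis.
From mathcomp Require ordered_qelim qe_rcf.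
From mathcomp Require Import lra ring.
Set Implicit Arguments. Unset Strict Implicit. Unset Printing Implicit Defensive.
Import Order.TTheory GRing.Theory Num.Theory.
Import numFieldNormedType.Exports.
Local Open Scope classical_set_scope.
Local Open Scope ring_scope.

(** Two facts about the sets B[k] drive the proof: B[k] and B[l] intersect in
    B[k v l], and B[k] is star-shaped about the vertex [chibar k].  Weight the
    members [k] of finite nets of [K] by how nearly [A] lies in B[k], serving
    large dimensions first and with scales that shrink with the dimension.
    Two members to which [A] nearly belongs and which are not nearly nested have
    a join of larger dimension to which [A] nearly belongs, so the weights
    concentrate near a flag and define a continuous map [g] with [g A] close to
    a simplex of that flag.  By star-shapedness the segment from [A] to [g A]
    stays near B[K], and near the union of the simplices if [A] lies in it.

    Both sets are compact and semialgebraic, hence neighbourhood retracts, and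
    this upgrades the approximate deformation to a strong deformation
    retraction.  The neighbourhood retractions come from quantifier elimination:
    a compact definable set is the projection of the zero set of a polynomial
    [f >= 0], definable functions of one variable are eventually monotone, which
    gives the gradient inequality [|grad f| >= c f ^ (1 - 1/N)], and this makes
    gradient descent converge.

    For [X_eps], write [A = c - N + s B] with [N] supported on toral
    subalgebras and [B] in B[f], [f] not toral.  Then [- N] and [s B] are the
    negative and positive parts of [A - c], and [c] is determined because [f] is
    not contained in a toral subalgebra.  So [B] is a function of [A], continuous
    by compactness, and the segments from [A] to [B] deform [X_eps] to [X_1]. *)

(** * Definable predicates and quantifier elimination *)

Section Definability.
Variable R : realType.
Local Notation env := (nat -> R).

(** The obstacle is that [K] may be infinite: there is no finite complex of flags, and the weights
    select a flag only up to an error. So the deformation is built approximately and then repaired,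
    and the repair needs tameness: a compact set need not be a neighbourhood retract, a compact
    semialgebraic one is.

    In place of a cell decomposition, one statement carries the tame geometry: a definable predicate
    is constant on some cusp [0 < s < t ^+ N]. In [t] alone it yields the monotonicity theorem; in
    both variables it yields Lojasiewicz inequalities, with [N] as the exponent. Descent goes by
    discrete steps, so no flow has to be integrated.

    The error estimates are qualitative: a sequence of counterexamples is sent to its limit along an
    ultrafilter, where closedness of the relation between [A] and [k], together with the semilattice
    property, gives exact statements. Flags are indexed by dimension, so that each weight, and each
    member whose weight survives, has a limit of its own. *)

Definition scons (x : R) (e : env) : env := fun i => if i is j.+1 then e j else x.

(** Definability is a property of the semantic object, a function or a predicate on environments, so
    closure rules apply by unification and no formula is written down. Variables are de Bruijn
    indices: a quantifier binds index [0]. *)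
Inductive polyf : (env -> R) -> Prop :=
| polyf_cst c : polyf (fun=> c)
| polyf_var i : polyf (fun e => e i)
| polyf_add p q : polyf p -> polyf q -> polyf (fun e => p e + q e)
| polyf_mul p q : polyf p -> polyf q -> polyf (fun e => p e * q e).

Inductive qf : (env -> Prop) -> Prop :=
| qf_pos p : polyf p -> qf (fun e => 0 < p e)
| qf_and P Q : qf P -> qf Q -> qf (fun e => P e /\ Q e)
| qf_not P : qf P -> qf (fun e => ~ P e).

Inductive dfn : (env -> Prop) -> Prop :=
| dfn_pos p : polyf p -> dfn (fun e => 0 < p e)
| dfn_and P Q : dfn P -> dfn Q -> dfn (fun e => P e /\ Q e)
| dfn_not P : dfn P -> dfn (fun e => ~ P e)
| dfn_ex P : dfn P -> dfn (fun e => exists x, P (scons x e)).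

Lemma qf_ext (P Q : env -> Prop) : qf P -> (forall e, P e <-> Q e) -> qf Q.
Proof. by move=> h PQ; rewrite (_ : Q = P)//; apply/funext => e; apply/propext; split => /PQ. Qed.

Lemma dfn_ext (P Q : env -> Prop) : dfn P -> (forall e, P e <-> Q e) -> dfn Q.
Proof. by move=> h PQ; rewrite (_ : Q = P)//; apply/funext => e; apply/propext; split => /PQ. Qed.

Lemma polyf_opp p : polyf p -> polyf (fun e => - p e).
Proof.
move=> hp; rewrite (_ : (fun _ => _) = (fun e => -1 * p e)).
  by apply: polyf_mul => //; exact: polyf_cst.
by apply/funext => e; rewrite mulN1r.
Qed.

Lemma polyf_sub p q : polyf p -> polyf q -> polyf (fun e => p e - q e).
Proof. by move=> hp hq; apply: polyf_add => //; exact: polyf_opp. Qed.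

Lemma polyf_exp p n : polyf p -> polyf (fun e => p e ^+ n).
Proof.
move=> hp; elim: n => [|n ih].
  by under [X in polyf X]eq_fun do rewrite expr0; exact: polyf_cst.
by under [X in polyf X]eq_fun do rewrite exprS; exact: polyf_mul.
Qed.

Lemma polyf_sum (I : Type) (s : seq I) (F : I -> env -> R) :
  (forall i, polyf (F i)) -> polyf (fun e => \sum_(i <- s) F i e).
Proof.
move=> h; elim: s => [|a s ih].
  by under [X in polyf X]eq_fun do rewrite big_nil; exact: polyf_cst.
by under [X in polyf X]eq_fun do rewrite big_cons; exact: polyf_add.
Qed.

Lemma polyf_term n (t : GRing.term R) : GRing.rterm t ->
  polyf (fun e => GRing.eval (mkseq (scons 0 e) n) t).
Proof.
elim: t => //=.
- move=> i _; have [ltin|lein] := ltnP i n; last first.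
    under [X in polyf X]eq_fun do rewrite nth_default ?size_mkseq//.
    exact: polyf_cst.
  under [X in polyf X]eq_fun do rewrite nth_mkseq//.
  case: i {ltin} => [|i] /=; [exact: polyf_cst | exact: polyf_var].
- by move=> c _; exact: polyf_cst.
- by move=> k _; exact: polyf_cst.
- by move=> t1 h1 t2 h2 /andP[/h1 ? /h2 ?]; exact: polyf_add.
- by move=> t1 h1 /h1; exact: polyf_opp.
- move=> t1 h1 k /h1 h; under [X in polyf X]eq_fun do rewrite -mulr_natr.
  by apply: polyf_mul => //; exact: polyf_cst.
- by move=> t1 h1 t2 h2 /andP[/h1 ? /h2 ?]; exact: polyf_mul.
- by move=> t1 h1 k /h1 h; exact: polyf_exp.
Qed.

Lemma qf_false : qf (fun=> False).
Proof.
by apply: (qf_ext (qf_pos (polyf_cst 0))) => e; rewrite ltxx; split.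
Qed.

(** In the formula language a quantifier overwrites one position of the list of values. Position [0]
    is set aside for it with the dummy value [0], and [e i] is read at position [i.+1]. *)
Lemma qf_formula n (f : ordered_qelim.ord.formula R) :
  ordered_qelim.ord.qf_form f -> ordered_qelim.ord.rformula f ->
  qf (fun e => ordered_qelim.ord.qf_eval (mkseq (scons 0 e) n) f).
Proof.
elim: f => //=.
- case=> _ _; last by apply: qf_ext qf_false _ => e; split.
  by apply: qf_ext (qf_not qf_false) _ => e; split => // _ [].
- move=> t1 t2 _ /andP[r1 r2].
  have h1 := qf_not (qf_pos (polyf_sub (polyf_term n r1) (polyf_term n r2))).
  have h2 := qf_not (qf_pos (polyf_sub (polyf_term n r2) (polyf_term n r1))).
  apply: qf_ext (qf_and h1 h2) _ => e; rewrite !subr_gt0; split.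
    by case=> /negP; rewrite -leNgt => a /negP; rewrite -leNgt => c; rewrite eq_le a c.
  by move=> /eqP ->; rewrite ltxx.
- move=> t1 t2 _ /andP[r1 r2].
  have h2 := (qf_pos (polyf_sub (polyf_term n r2) (polyf_term n r1))).
  by apply: qf_ext h2 _ => e; rewrite subr_gt0.
- move=> t1 t2 _ /andP[r1 r2].
  have h1 := qf_not (qf_pos (polyf_sub (polyf_term n r1) (polyf_term n r2))).
  apply: qf_ext h1 _ => e; rewrite subr_gt0; split; first by move=> /negP; rewrite -leNgt.
  by rewrite leNgt => /negP.
- move=> f1 h1 f2 h2 /andP[q1 q2] /andP[r1 r2].
  by apply: qf_ext (qf_and (h1 q1 r1) (h2 q2 r2)) _ => e; split => /andP.
- move=> f1 h1 f2 h2 /andP[q1 q2] /andP[r1 r2].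
  apply: qf_ext (qf_not (qf_and (qf_not (h1 q1 r1)) (qf_not (h2 q2 r2)))) _ => e.
  split; last by move=> /orP[a|a] [].
  by move=> h; apply/negPn/negP => /norP[/negP ? /negP ?]; exact: h.
- move=> f1 h1 f2 h2 /andP[q1 q2] /andP[r1 r2].
  apply: qf_ext (qf_not (qf_and (h1 q1 r1) (qf_not (h2 q2 r2)))) _ => e.
  split; last by move=> /implyP h [/h].
  by move=> h; apply/implyP => a; apply/negPn/negP => /negP c; exact: h.
- move=> f1 h1 q1 r1; apply: qf_ext (qf_not (h1 q1 r1)) _ => e.
  by split => /negP.
Qed.

(** The bound [N] on the variables that occur lets the infinite environment be truncated to any list
    of length at least [N]. *)
Lemma polyf_to_term p : polyf p -> exists (t : GRing.term R) N,
  forall e n, (N <= n)%N -> p e = GRing.eval (mkseq e n) t.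
Proof.
elim=> [c|i|p1 p2 _ [t1 [N1 h1]] _ [t2 [N2 h2]]|p1 p2 _ [t1 [N1 h1]] _ [t2 [N2 h2]]].
- by exists (GRing.Const c), 0%N.
- by exists (GRing.Var _ i), i.+1 => e n ltin /=; rewrite nth_mkseq.
- exists (GRing.Add t1 t2), (maxn N1 N2) => e n; rewrite geq_max => /andP[? ?] /=.
  by rewrite -h1// -h2.
- exists (GRing.Mul t1 t2), (maxn N1 N2) => e n; rewrite geq_max => /andP[? ?] /=.
  by rewrite -h1// -h2.
Qed.

Lemma qf_to_formula P : qf P -> exists (f : ordered_qelim.ord.formula R) N,
  forall e n, (N <= n)%N -> P e <-> ordered_qelim.ord.holds (mkseq e n) f.
Proof.
elim=> [p hp|P1 P2 _ [f1 [N1 h1]] _ [f2 [N2 h2]]|P1 _ [f1 [N1 h1]]].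
- have [t [N h]] := polyf_to_term hp.
  exists (ordered_qelim.ord.Lt (GRing.NatConst _ 0) t), N => e n Nn /=.
  by rewrite (h e n).
- exists (ordered_qelim.ord.And f1 f2), (maxn N1 N2) => e n; rewrite geq_max.
  by move=> /andP[n1 n2] /=; split => -[/(h1 e n n1) ? /(h2 e n n2)].
- by exists (ordered_qelim.ord.Not f1), N1 => e n Nn /=; split=> h /(h1 e n Nn).
Qed.

(** The only use of quantifier elimination for real closed fields; [dfn_qf] then removes the
    quantifiers one by one. *)
Lemma qf_ex P : qf P -> qf (fun e => exists x, P (scons x e)).
Proof.
move=> /qf_to_formula[f [N h]].
pose g := ordered_qelim.ord.to_rform (ordered_qelim.ord.Exists 0 f).
have := ordered_qelim.ord.quantifier_elim_wf (@qe_rcf.wf_QE_wproj R)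
  (ordered_qelim.ord.to_rform_rformula (ordered_qelim.ord.Exists 0 f)).
move=> /= /andP[q1 q2].
apply: qf_ext (qf_formula N.+1 q1 q2) _ => e.
have := qe_rcf.rcf_satP (mkseq (scons 0 e) N.+1) (ordered_qelim.ord.Exists 0 f).
rewrite /qe_rcf.rcf_sat /ordered_qelim.ord.proj_sat => {}hr.
split.
- move=> /hr /= [x hx]; exists x; apply/(h _ N.+1) => //.
  rewrite (_ : mkseq _ _ = set_nth 0 (mkseq (scons 0 e) N.+1) 0 x)//.
  rewrite /mkseq /=; congr cons.
  by rewrite -[1%N]addn0 iotaDl -!map_comp.
- case=> x /(h _ N.+1 (leqnSn _)) hx; apply/hr => /=; exists x.
  rewrite (_ : mkseq _ _ = set_nth 0 (mkseq (scons 0 e) N.+1) 0 x) in hx => //.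
  rewrite /mkseq /=; congr cons.
  by rewrite -[1%N]addn0 iotaDl -!map_comp.
Qed.

Lemma dfn_qf P : dfn P -> qf P.
Proof.
elim=> [p|P1 P2 _ h1 _ h2|P1 _ h1|P1 _ h1].
- exact: qf_pos.
- exact: qf_and.
- exact: qf_not.
- exact: qf_ex.
Qed.

End Definability.

(** * Closure properties, and constancy of definable predicates on cusps *)

Section Closure.
Variable R : realType.
Local Notation env := (nat -> R).
Implicit Types (P Q : env -> Prop) (p q : env -> R).

Lemma dfn_lt p q : polyf p -> polyf q -> dfn (fun e => p e < q e).
Proof. by move=> hp hq; apply: dfn_ext (dfn_pos (polyf_sub hq hp)) _ => e; rewrite subr_gt0. Qed.

Lemma dfn_le p q : polyf p -> polyf q -> dfn (fun e => p e <= q e).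
Proof.
move=> hp hq; apply: dfn_ext (dfn_not (dfn_lt hq hp)) _ => e.
by rewrite leNgt; split => [/negP|/negP].
Qed.

Lemma dfn_eq p q : polyf p -> polyf q -> dfn (fun e => p e = q e).
Proof.
move=> hp hq; apply: dfn_ext (dfn_and (dfn_le hp hq) (dfn_le hq hp)) _ => e.
by split=> [[a c]|->//]; apply/eqP; rewrite eq_le a c.
Qed.

Lemma dfn_or P Q : dfn P -> dfn Q -> dfn (fun e => P e \/ Q e).
Proof.
move=> hP hQ; apply: dfn_ext (dfn_not (dfn_and (dfn_not hP) (dfn_not hQ))) _ => e.
by split => [/not_andP[]/contrapT|[?|?] []]; tauto.
Qed.

Lemma dfn_imp P Q : dfn P -> dfn Q -> dfn (fun e => P e -> Q e).
Proof.
move=> hP hQ; apply: dfn_ext (dfn_or (dfn_not hP) hQ) _ => e.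
by split=> [[]//|]; case: (EM (P e)); tauto.
Qed.

Lemma dfn_all P : dfn P -> dfn (fun e => forall x, P (scons x e)).
Proof.
move=> hP; apply: dfn_ext (dfn_not (dfn_ex (dfn_not hP))) _ => e.
by split => [/forallNP h x|h [x]]; [apply: contrapT|exact].
Qed.

Lemma dfn_cst (T : Prop) : dfn (fun _ : env => T).
Proof.
case: (EM T) => h.
  by apply: dfn_ext (dfn_lt (polyf_cst 0) (polyf_cst 1)) _ => e; rewrite ltr01; split.
by apply: dfn_ext (dfn_lt (polyf_cst 0) (polyf_cst 0)) _ => e; rewrite ltxx; split.
Qed.

Lemma dfn_allI (I : finType) (P : I -> env -> Prop) :
  (forall i, dfn (P i)) -> dfn (fun e => forall i, P i e).
Proof.
move=> h; suff H : forall s : seq I, dfn (fun e => forall i, i \in s -> P i e).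
  by apply: dfn_ext (H (enum I)) _ => e; split => [g i|g i _]; rewrite ?g ?mem_enum//; apply: g; rewrite mem_enum.
elim=> [|a s ih]; first by apply: dfn_ext (dfn_cst True) _ => e; split => // _ i.
apply: dfn_ext (dfn_and (h a) ih) _ => e; split => [[ha hs] i|hh].
  by rewrite inE => /predU1P[->//|]; exact: hs.
by split => [|i si]; apply: hh; rewrite inE ?eqxx ?si ?orbT.
Qed.

Lemma polyf_subst p (s : nat -> env -> R) : polyf p -> (forall i, polyf (s i)) ->
  polyf (fun e => p (fun i => s i e)).
Proof.
move=> hp hs; elim: hp => [c|i|p1 p2 _ h1 _ h2|p1 p2 _ h1 _ h2].
- exact: polyf_cst.
- exact: hs.
- exact: polyf_add.
- exact: polyf_mul.
Qed.

Lemma dfn_subst P (s : nat -> env -> R) : dfn P -> (forall i, polyf (s i)) ->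
  dfn (fun e => P (fun i => s i e)).
Proof.
move=> hP; elim: hP s => [p hp|P1 P2 _ h1 _ h2|P1 _ h1|P1 _ h1] s hs.
- by apply: dfn_pos; exact: polyf_subst.
- by apply: dfn_and; [exact: h1|exact: h2].
- by apply: dfn_not; exact: h1.
- pose s' i e := if i is j.+1 then s j (fun k => e k.+1) else e 0%N.
  have hs' : forall i, polyf (s' i).
    case=> [|i]; first exact: polyf_var.
    by apply: (polyf_subst (hs i)) => k; exact: polyf_var.
  apply: dfn_ext (dfn_ex (h1 _ hs')) _ => e.
  suff H x : (fun i : nat => s' i (scons x e)) = scons x (fun i => s i e).
    by split => -[x hx]; exists x; rewrite ?H// -H.
  by apply/funext => -[].
Qed.

Lemma poly_bounded01 (p : {poly R}) :
  exists2 M : R, 0 < M & forall x : R, 0 <= x <= 1 -> `|p.[x]| <= M.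
Proof.
elim/poly_ind: p => [|p c [M M0 h]]; first by exists 1 => // x _; rewrite horner0 normr0.
exists (M + `|c|); first by rewrite ltr_wpDr.
move=> x /andP[x0 x1]; rewrite !hornerE (le_trans (ler_normD _ _))// lerD//.
rewrite normrM -[leRHS]mulr1 ler_pM//; first by apply: h; rewrite x0.
by rewrite ger0_norm.
Qed.

Lemma poly2_bounded01 (p : {poly {poly R}}) :
  exists2 M : R, 0 < M & forall x y : R, 0 <= x <= 1 -> 0 <= y <= 1 -> `|p.[y%:P].[x]| <= M.
Proof.
elim/poly_ind: p => [|p c [M M0 h]].
  by exists 1 => // x y _ _; rewrite !horner0 normr0.
have [M' M'0 h'] := poly_bounded01 c.
exists (M + M'); first by rewrite addr_gt0.
move=> x y hx /andP[y0 y1]; rewrite !hornerE (le_trans (ler_normD _ _))// lerD//; last exact: h'.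
rewrite normrM -[leRHS]mulr1 ler_pM//; first by apply: h; rewrite ?y0.
by rewrite ger0_norm.
Qed.

(** The outer variable of [q] is [s] and the inner one [t]: the power of [s] can be factored out
    first, and the coefficient left at [s = 0] is a polynomial in [t]. *)
Lemma polyf_bivariate p (e : env) : polyf p ->
  exists q : {poly {poly R}}, forall t s, p (scons t (scons s e)) = q.[s%:P].[t].
Proof.
elim=> [c|[|[|i]]|p1 p2 _ [q1 h1] _ [q2 h2]|p1 p2 _ [q1 h1] _ [q2 h2]].
- by exists c%:P%:P => t s; rewrite !hornerE.
- by exists 'X%:P => t s /=; rewrite !hornerE.
- by exists 'X => t s /=; rewrite !hornerE.
- by exists (e i)%:P%:P => t s /=; rewrite !hornerE.
- by exists (q1 + q2) => t s; rewrite !hornerD h1 h2.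
- by exists (q1 * q2) => t s; rewrite !hornerM h1 h2.
Qed.

(* On the cusp [0 < s < t ^ N] the monomial of least degree in [s], then in
   [t], dominates, so every polynomial has a constant sign there. *)
Lemma poly2_sign_cusp (q : {poly {poly R}}) : exists N (eps : R), 0 < eps <= 1 /\
  ((forall t s : R, 0 < t < eps -> 0 < s < t ^+ N -> 0 < q.[s%:P].[t]) \/
   (forall t s : R, 0 < t < eps -> 0 < s < t ^+ N -> ~ 0 < q.[s%:P].[t])).
Proof.
have [->|q0] := eqVneq q 0.
  by exists 0%N, 1; split; [rewrite ltr01 lexx|right=> t s _ _; rewrite !horner0 ltxx].
have [a [q1 + qE]] := multiplicity_XsubC q 0.
rewrite q0 /= subr0 in qE * => q10.
set c := q1.[0] in q10; have c0 : c != 0 by [].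
have [b [c1 + cE]] := multiplicity_XsubC c 0.
rewrite c0 /= subr0 in cE * => c10.
have c100 : c1.[0] != 0 by [].
have [r rE] : exists r, q1 = r * 'X + c%:P.
  have /factor_theorem[r hr] : root (q1 - c%:P) 0 by rewrite rootE !hornerE subrr.
  by exists r; rewrite -(subr0 'X) -hr subrK.
have [u uE] : exists u, c1 = u * 'X + (c1.[0])%:P.
  have /factor_theorem[r' hr] : root (c1 - (c1.[0])%:P) 0 by rewrite rootE !hornerE subrr.
  by exists r'; rewrite -(subr0 'X) -hr subrK.
set k := c1.[0] in c100 uE.
have [M M0 hM] := poly2_bounded01 r.
have [M' M'0 hM'] := poly_bounded01 u.
have k0 : 0 < `|k| by rewrite normr_gt0.
(* The exponent [b.+1] gives [s / t ^+ b < t], so the relative error [w] is at most [(M + M') * t],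
   which the choice of [eps] keeps below half of the absolute value of [k]. *)
exists b.+1, (Num.min 1 (`|k| / (2 * (M + M')))).
have MM : 0 < 2 * (M + M') by rewrite mulr_gt0// addr_gt0.
split; first by rewrite lt_min ltr01 divr_gt0//= ge_min lexx.
have main t s : 0 < t < Num.min 1 (`|k| / (2 * (M + M'))) -> 0 < s < t ^+ b.+1 ->
   exists2 w, `|w| < `|k| & q.[s%:P].[t] = s ^+ a * t ^+ b * (k + w).
  move=> /andP[t0]; rewrite lt_min => /andP[t1 tk] /andP[s0 st].
  have s1 : s <= 1.
    by rewrite (le_trans (ltW st))// exprn_ile1// ltW.
  have tb0 : 0 < t ^+ b by rewrite exprn_gt0.
  have Er : `|r.[s%:P].[t]| <= M by apply: hM; rewrite ?(ltW t0) ?(ltW t1) ?(ltW s0).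
  have Eu : `|u.[t]| <= M' by apply: hM'; rewrite ?(ltW t0) ?(ltW t1).
  exists (u.[t] * t + r.[s%:P].[t] * (s / t ^+ b)).
    have st' : `|s / t ^+ b| < t.
      by rewrite ger0_norm ?divr_ge0 ?ltW// ltr_pdivrMr// -exprS.
    apply: (le_lt_trans (ler_normD _ _)); rewrite !normrM.
    apply: (@le_lt_trans _ _ (M' * t + M * t)).
      by apply: lerD; apply: ler_pM => //; first [by rewrite gtr0_norm|by rewrite -normrM ltW].
    rewrite -mulrDl addrC; move: tk; rewrite ltr_pdivlMr// => tk.
    have : 0 < (M + M') * t by rewrite mulr_gt0// addr_gt0.
    lra.
  have -> : q.[s%:P].[t] = (r.[s%:P].[t] * s + (u.[t] * t + k) * t ^+ b) * s ^+ a.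
    by rewrite qE rE !hornerE cE uE !hornerE.
  field.
  by rewrite lt0r_neq0.
have kw (w : R) : `|w| < `|k| -> 0 < k -> 0 < k + w.
  move=> + k00; rewrite (gtr0_norm k00) ltr_norml => /andP[]; lra.
have kw' (w : R) : `|w| < `|k| -> k < 0 -> k + w < 0.
  move=> + k00; rewrite (ltr0_norm k00) ltr_norml => /andP[]; lra.
have [kn|kp|/eqP] := ltgtP k 0; last by rewrite (negbTE c100).
- right => t s ht hs; have [w hw ->] := main t s ht hs.
  move: ht hs => /andP[t0 _] /andP[s0 _].
  by rewrite pmulr_rgt0 ?mulr_gt0 ?exprn_gt0//; apply/negP; rewrite -leNgt ltW// kw'.
- left => t s ht hs; have [w hw ->] := main t s ht hs.
  move: ht hs => /andP[t0 _] /andP[s0 _].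
  by rewrite !mulr_gt0 ?exprn_gt0// kw.
Qed.

(** Boolean combinations preserve constancy of the truth value on some cusp, so quantifier
    elimination extends it from sign conditions to all definable predicates. When [t] and [s] are
    two competing quantities, [N] is the exponent of a Lojasiewicz inequality. *)
Lemma dfn_const_cusp P (e : env) : dfn P -> exists N (eps : R), 0 < eps <= 1 /\
  ((forall t s, 0 < t < eps -> 0 < s < t ^+ N -> P (scons t (scons s e))) \/
   (forall t s, 0 < t < eps -> 0 < s < t ^+ N -> ~ P (scons t (scons s e)))).
Proof.
move=> /dfn_qf; elim=> [p /(polyf_bivariate e)[q hq]|P1 P2 _ h1 _ h2|P1 _ h1].
- have [N [eps [he h]]] := poly2_sign_cusp q; exists N, eps; split => //.
  by case: h => h; [left|right] => t s ht hs; rewrite hq; exact: h.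
- move: h1 h2 => [N1 [e1 [/andP[e10 e11] h1]]] [N2 [e2 [/andP[e20 e21] h2]]].
  exists (maxn N1 N2), (Num.min e1 e2); split; first by rewrite lt_min e10 e20 ge_min e11.
  have A t s : 0 < t < Num.min e1 e2 -> 0 < s < t ^+ maxn N1 N2 ->
     [/\ 0 < t < e1, 0 < t < e2, 0 < s < t ^+ N1 & 0 < s < t ^+ N2].
    move=> /andP[t0]; rewrite lt_min => /andP[te1 te2] /andP[s0 st]; rewrite t0 te1 te2 s0.
    have t01 : 0 <= t <= 1 by rewrite (ltW t0) (le_trans (ltW te1)).
    split => //=; apply: (lt_le_trans st); rewrite ler_wiXn2l ?leq_maxl ?leq_maxr//.
    - by case/andP: t01.
    - by case/andP: t01.
    - by case/andP: t01.
    - by case/andP: t01.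
  case: h1 => h1; last first.
    by right => t s ht hs; have [a1 a2 a3 a4] := A t s ht hs; case=> /(h1 _ _ a1 a3).
  case: h2 => h2; last first.
    by right => t s ht hs; have [a1 a2 a3 a4] := A t s ht hs; case=> _ /(h2 _ _ a2 a4).
  by left => t s ht hs; have [a1 a2 a3 a4] := A t s ht hs; split; [exact: h1|exact: h2].
- move: h1 => [N1 [e1 [e10 h1]]]; exists N1, e1; split => //.
  case: h1 => h1; [right|left] => t s ht hs; last exact: h1.
  by apply; exact: h1.
Qed.

(** The predicate is viewed as one in two variables that ignores [s]; the point [s = t ^+ N / 2]
    lies in the cusp. *)
Lemma dfn_const_right P (e : env) : dfn P -> exists2 eps : R, 0 < eps &
  (forall t, 0 < t < eps -> P (scons t e)) \/
  (forall t, 0 < t < eps -> ~ P (scons t e)).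
Proof.
move=> hP; pose s i (e' : env) := if i is j.+1 then e' j.+2 else e' 0%N.
have hs : forall i, polyf (s i) by case=> [|i]; exact: polyf_var.
have [N [eps [/andP[e0 _] h]]] := dfn_const_cusp e (dfn_subst hP hs).
exists eps => //.
have E t s' : (fun i => s i (scons t (scons s' e))) = scons t e by apply/funext => -[].
by case: h => h; [left|right] => t ht; move: (h t (t ^+ N / 2) ht);
  rewrite E; apply; move: ht => /andP[t0 _];
  have : 0 < t ^+ N by [rewrite exprn_gt0]; lra.
Qed.

End Closure.

(** * Definable functions of one real variable *)

Section DefinableFunctions.
Variable R : realType.
Local Notation env := (nat -> R).
Implicit Types (P Q : env -> Prop) (F G : env -> R) (f : R -> R).

Lemma dfn_exR (Q : env -> R -> Prop) :
  dfn (fun e => Q (fun i => e i.+1) (e 0%N)) -> dfn (fun e => exists x, Q e x).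
Proof. by move=> h; apply: dfn_ext (dfn_ex h) _. Qed.

Lemma dfn_allR (Q : env -> R -> Prop) :
  dfn (fun e => Q (fun i => e i.+1) (e 0%N)) -> dfn (fun e => forall x, Q e x).
Proof. by move=> h; apply: dfn_ext (dfn_all h) _. Qed.

Definition dff F := dfn (fun e => F (fun i => e i.+1) = e 0%N).

Lemma dff_shift F (s : nat -> nat) j : dff F ->
  dfn (fun e => F (fun i => e (s i)) = e j).
Proof.
move=> h; pose r i (e : env) := if i is k.+1 then e (s k) else e j.
have hr : forall i, polyf (r i) by case=> [|i]; exact: polyf_var.
by apply: dfn_ext (dfn_subst h hr) _ => e.
Qed.

Lemma dff_poly F : polyf F -> dff F.
Proof.
move=> h; apply: dfn_eq; last exact: polyf_var.
by apply: (polyf_subst h) => i; exact: polyf_var.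
Qed.

(** A definable function cannot be substituted for a variable directly; its value is named by an
    existential quantifier and tied to it by the graph. *)
Lemma dff_rel F G (r : R -> R -> Prop) : dff F -> dff G ->
  dfn (fun e => r (e 0%N) (e 1%N)) -> dfn (fun e => r (F e) (G e)).
Proof.
move=> hF hG hr.
have h : dfn (fun e => exists y x, F e = x /\ G e = y /\ r x y).
  apply: dfn_exR; apply: dfn_exR => /=; apply: dfn_and; first exact: dff_shift.
  apply: dfn_and; first exact: dff_shift.
  exact: hr.
apply: dfn_ext h _ => e; split; first by move=> [y [x [-> [->]]]].
by move=> ?; exists (G e), (F e).
Qed.

Lemma dff_lt F G : dff F -> dff G -> dfn (fun e => F e < G e).
Proof.
by move=> hF hG; apply: (@dff_rel F G (fun x y => x < y)) => //; apply: dfn_lt; exact: polyf_var.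
Qed.

Lemma dff_le F G : dff F -> dff G -> dfn (fun e => F e <= G e).
Proof.
by move=> hF hG; apply: (@dff_rel F G (fun x y => x <= y)) => //; apply: dfn_le; exact: polyf_var.
Qed.

Lemma dff_eq F G : dff F -> dff G -> dfn (fun e => F e = G e).
Proof.
by move=> hF hG; apply: (@dff_rel F G (fun x y => x = y)) => //; apply: dfn_eq; exact: polyf_var.
Qed.

Lemma dff_sub F G : dff F -> dff G -> dff (fun e => F e - G e).
Proof.
move=> hF hG; rewrite /dff.
have h : dfn (fun e => exists x y, F (fun i => e i.+1) = x /\ G (fun i => e i.+1) = y /\ x - y = e 0%N).
  apply: dfn_exR; apply: dfn_exR => /=.
  apply: dfn_and; first exact: (dff_shift (fun i => i.+3)).
  apply: dfn_and; first exact: (dff_shift (fun i => i.+3)).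
  by apply: dfn_eq; [apply: polyf_sub; exact: polyf_var|exact: polyf_var].
by apply: dfn_ext h _ => e; split => [[x [y [-> [->]]]]//|<-]; do 2!eexists.
Qed.

Lemma dff_norm F : dff F -> dff (fun e => `|F e|).
Proof.
move=> hF; rewrite /dff.
have h : dfn (fun e => exists x, F (fun i => e i.+1) = x /\ ((0 <= x /\ x = e 0%N) \/ (x < 0 /\ - x = e 0%N))).
  apply: dfn_exR => /=; apply: dfn_and; first exact: (dff_shift (fun i => i.+2)).
  have pv i : polyf (fun e : env => e i) by exact: polyf_var.
  apply: dfn_or; apply: dfn_and.
  - by apply: dfn_le => //; exact: polyf_cst.
  - exact: dfn_eq.
  - by apply: dfn_lt => //; exact: polyf_cst.
  - by apply: dfn_eq => //; exact: polyf_opp.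
apply: dfn_ext h _ => e; split => [[x [-> [[x0 <-]|[x0 <-]]]]|<-].
- by rewrite ger0_norm.
- by rewrite ltr0_norm.
- eexists; split; first by [].
  have [x0|x0] := leP 0 (F (fun i => e i.+1)); [left|right].
    by rewrite ger0_norm.
  by rewrite ltr0_norm.
Qed.

Definition dff1 f := dff (fun e => f (e 0%N)).

Lemma dff_app f F : dff1 f -> dff F -> dff (fun e => f (F e)).
Proof.
move=> hf hF; rewrite /dff.
have h : dfn (fun e => exists x, F (fun i => e i.+1) = x /\ f x = e 0%N).
  apply: dfn_exR => /=; apply: dfn_and; first exact: (dff_shift (fun i => i.+2)).
  exact: (@dff_shift (fun e => f (e 0%N)) (fun=> 0%N) 1%N).
by apply: dfn_ext h _ => e; split => [[x [->]]//|<-]; eexists.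
Qed.

Lemma dff_var i : dff (fun e => e i). Proof. by apply: dff_poly; exact: polyf_var. Qed.
Lemma dff_cst c : dff (fun=> c). Proof. by apply: dff_poly; exact: polyf_cst. Qed.
Lemma dff_add F G : dff F -> dff G -> dff (fun e => F e + G e).
Proof.
move=> hF hG; rewrite (_ : (fun _ => _) = fun e => F e - (0 - G e)).
  by apply: dff_sub => //; apply: dff_sub => //; exact: dff_cst.
by apply/funext => e; rewrite sub0r opprK.
Qed.

Definition dfn1 (D : R -> Prop) := dfn (fun e => D (e 0%N)).

Lemma dfn1_const_right D (a : R) : dfn1 D -> exists2 eps : R, 0 < eps &
  (forall t, a < t < a + eps -> D t) \/ (forall t, a < t < a + eps -> ~ D t).
Proof.
move=> hD.
have hs i : polyf (fun e : env => a + e i).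
  by apply: polyf_add; [exact: polyf_cst|exact: polyf_var].
have [eps e0 h] := dfn_const_right (fun=> 0) (dfn_subst hD hs).
exists eps => //.
by case: h => h; [left|right] => t ht; move: (h (t - a)) => /=; rewrite subrKC; apply; lra.
Qed.

Lemma dfn1_const_left D (a : R) : dfn1 D -> exists2 eps : R, 0 < eps &
  (forall t, a - eps < t < a -> D t) \/ (forall t, a - eps < t < a -> ~ D t).
Proof.
move=> hD.
have hs i : polyf (fun e : env => a - e i).
  by apply: polyf_sub; [exact: polyf_cst|exact: polyf_var].
have [eps e0 h] := dfn_const_right (fun=> 0) (dfn_subst hD hs).
exists eps => //.
by case: h => h; [left|right] => t ht; move: (h (a - t)) => /=; rewrite subKr; apply; lra.
Qed.

Lemma dfn1_const_right0 D : dfn1 D -> exists2 eps : R, 0 < eps &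
  (forall t, 0 < t < eps -> D t) \/ (forall t, 0 < t < eps -> ~ D t).
Proof. by move=> /(dfn1_const_right 0)[eps]; rewrite add0r => e0 h; exists eps. Qed.

End DefinableFunctions.

Ltac dfn_step :=
  match goal with
  | |- dfn (fun e => _ /\ _) => apply: dfn_and
  | |- dfn (fun e => _ \/ _) => apply: dfn_or
  | |- dfn (fun e => ~ _) => apply: dfn_not
  | |- dfn (fun e => exists x : Real.sort _, _) => apply: dfn_exR => /=
  | |- dfn (fun e => forall x : Real.sort _, _) => apply: dfn_allR => /=
  | |- dfn (fun e => _ -> _) => apply: dfn_imp
  | |- dfn (fun e => is_true (_ < _)) => apply: dff_lt
  | |- dfn (fun e => is_true (_ <= _)) => apply: dff_le
  | |- dfn (fun e => _ = _ :> Real.sort _) => apply: dff_eq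
  | |- dff (fun e => e _) => exact: dff_var
  | |- dff (fun e => _ - _) => apply: dff_sub
  | |- dff (fun e => _ + _) => apply: dff_add
  | |- dff (fun e => `|_|) => apply: dff_norm
  | |- dff (fun e => ?f _) => apply: (@dff_app _ f); first by []
  | |- dff (fun e => _) => exact: dff_cst
  end.
Ltac dfn_tac := rewrite /dfn1; repeat dfn_step.

(** * The monotonicity theorem *)

Section Monotonicity.
Variable R : realType.
Implicit Types (f : R -> R) (a b t s : R).

(** Connectedness of the interval: the supremum of the points up to which [f] stays above [f s] is
    attained by the left condition and passed by the right one, unless it is [t]. *)
Lemma loc_nondecreasing f a b :
  (forall t, a < t < b -> exists2 d : R, 0 < d & forall s, a < s < b ->
     (t < s < t + d -> f t <= f s) /\ (t - d < s < t -> f s <= f t)) ->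
  forall s t, a < s -> s <= t -> t < b -> f s <= f t.
Proof.
move=> h s t as_ st tb.
pose E := [set u | s <= u <= t /\ forall v, s <= v <= u -> f s <= f v].
have Es : E s by split; [rewrite lexx st|move=> v; rewrite -eq_le => /eqP->].
have supE : has_sup E by split; [exists s|exists t => u [/andP[]]].
set u := sup E.
have su : s <= u by apply: ub_le_sup => //; case: supE.
have ut : u <= t by apply: ge_sup; [exists s|move=> v [/andP[]]].
have hu : a < u < b by rewrite (lt_le_trans as_ su) (le_lt_trans ut tb).
have below v : s <= v -> v < u -> f s <= f v.
  move=> sv vu; have [w [_ hw] vw] : exists2 w, E w & v < w.
    by have := sup_adherent (eps := u - v) _ supE; rewrite subr_gt0 -/u opprB addrCA subrr addr0; apply.
  by apply: hw; rewrite sv ltW.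
have [d d0 hd] := h u hu.
have fsu : f s <= f u.
  have [->//|su'] := eqVneq s u.
  have su2 : s < u by rewrite lt_neqAle su'.
  have [hm _] : Num.max s (u - d / 2) < u /\ True by split=> //; rewrite gt_max su2; lra.
  set v := Num.max s (u - d / 2) in hm.
  have sv : s <= v by rewrite le_max lexx.
  apply: (le_trans (below v sv hm)).
  have : u - d / 2 <= v by rewrite le_max lexx orbT.
  by move=> ?; apply: (hd v _).2; lra.
have Eu : E u.
  split; first by rewrite su.
  move=> v /andP[sv]; rewrite le_eqVlt => /predU1P[->//|]; exact: below.
have [<-//|ut'] := eqVneq u t.
have ut2 : u < t by rewrite lt_neqAle ut'.
pose w := Num.min t (u + d / 2).
have uw : u < w by rewrite lt_min ut2; lra.
have wt : w <= t by rewrite ge_min lexx.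
have wd : w <= u + d / 2 by rewrite ge_min lexx orbT.
have Ew : E w.
  split; first by rewrite wt; lra.
  move=> v /andP[sv vw]; have [vu|uv] := leP v u; first by apply: Eu.2; rewrite sv.
  by apply: (le_trans fsu); apply: (hd v _).1; lra.
suff : w <= u by rewrite leNgt uw.
by apply: ub_le_sup => //; case: supE.
Qed.

(** Strict local minima are countable: a radius [1 / (k + 1)] and the cell of that mesh containing
    the point determine it. A nonempty open interval has positive Lebesgue measure. *)
Lemma no_strict_local_min f a b : a < b ->
  (forall t, a < t < b -> exists2 d : R, 0 < d & forall s, 0 < `|s - t| < d -> f t < f s) ->
  False.
Proof.
move=> ab h.
have /choice[k hk] : forall t, exists k : nat,
    a < t < b -> forall s, 0 < `|s - t| < k.+1%:R^-1 -> f t < f s.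
  move=> t.
  case: (boolP (a < t < b)) => [/h[d d0 hd]|_]; last by exists 0%N.
  have [k kd] : exists k : nat, k.+1%:R^-1 < d.
    exists (Num.truncn d^-1); rewrite invf_plt ?posrE//.
    exact: truncnS_gt.
  by exists k => _ s /andP[s0 sk]; apply: hd; rewrite s0 (lt_trans sk).
pose g t : nat * int := (k t, Num.floor (t * (k t).+1%:R)).
suff cab : countable `]a, b[%classic.
  have := countable_lebesgue_measure0 cab.
  rewrite lebesgue_measure_itv /= lte_fin ab -EFinD => -[]/eqP.
  by rewrite subr_eq0 (gt_eqF ab).
apply/countable_injP; exists (pickle \o g) => s t.
rewrite !inE /= !in_itv /= => hs ht /(pcan_inj pickleK) [ek ef].
apply/eqP/negPn/negP => st.
have st0 : 0 < `|s - t| by rewrite normr_gt0 subr_eq0.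
suff st1 : `|s - t| < (k t).+1%:R^-1.
  have h1 : f t < f s by apply: (hk t ht); rewrite st0.
  have h2 : f s < f t by apply: (hk s hs); rewrite distrC st0 ek.
  by have := lt_trans h1 h2; rewrite ltxx.
rewrite -[ltRHS]mul1r ltr_pdivlMr// -[X in _ * X]ger0_norm// -normrM mulrBl.
rewrite ek in ef.
have := floor_le (t * (k t).+1%:R); have := floorD1_gt (t * (k t).+1%:R).
have := floor_le (s * (k t).+1%:R); have := floorD1_gt (s * (k t).+1%:R).
rewrite ef !intrD /= ltr_norml; lra.
Qed.

Lemma dfn1_const_right0_seq (l : seq (R -> Prop)) :
  (forall D, List.In D l -> dfn1 D) -> exists2 eps : R, 0 < eps &
  forall D, List.In D l ->
    (forall t, 0 < t < eps -> D t) \/ (forall t, 0 < t < eps -> ~ D t).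
Proof.
elim: l => [|D l ih] h; first by exists 1.
have [e1 e10 h1] := ih (fun D' hD' => h D' (or_intror hD')).
have [e2 e20 h2] := dfn1_const_right0 (h D (or_introl erefl)).
exists (Num.min e1 e2); first by rewrite lt_min e10.
move=> D' /= [<-|hD'].
- by case: h2 => h2; [left|right] => t /andP[t0]; rewrite lt_min => /andP[_ te]; apply: h2; rewrite t0.
- by case: (h1 D' hD') => h1'; [left|right] => t /andP[t0]; rewrite lt_min => /andP[te _]; apply: h1'; rewrite t0.
Qed.

(** The bounds on [s] are separate implications because [dfn_tac] treats single inequalities only,
    not boolean conjunctions. *)
Definition right_germ (r : R -> R -> Prop) f t :=
  exists d : R, 0 < d /\ forall s, t < s -> s < t + d -> r (f t) (f s).
Definition left_germ (r : R -> R -> Prop) f t :=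
  exists d : R, 0 < d /\ forall s, t - d < s -> s < t -> r (f t) (f s).

Let lt_ x y : Prop := x < y :> R.
Let gt_ x y : Prop := y < x :> R.
Let eq_ x y : Prop := x = y :> R.

Lemma right_germ_cases f t : dff1 f ->
  [\/ right_germ lt_ f t, right_germ eq_ f t | right_germ gt_ f t].
Proof.
move=> hf.
have [e1 e10 [h1|h1]] : exists2 eps : R, 0 < eps & (forall s, t < s < t + eps -> f t < f s) \/ (forall s, t < s < t + eps -> ~ f t < f s).
- by apply: (@dfn1_const_right _ (fun s => f t < f s)); dfn_tac.
- by constructor 1; exists e1; split => // s ts st; apply: h1; rewrite ts.
have [e2 e20 [h2|h2]] : exists2 eps : R, 0 < eps & (forall s, t < s < t + eps -> f s < f t) \/ (forall s, t < s < t + eps -> ~ f s < f t).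
- by apply: (@dfn1_const_right _ (fun s => f s < f t)); dfn_tac.
- by constructor 3; exists e2; split => // s ts st; apply: h2; rewrite ts.
constructor 2; exists (Num.min e1 e2); split; first by rewrite lt_min e10.
move=> s ts; rewrite -ltrBlDl lt_min !ltrBlDl => /andP[s1 s2].
have := h1 s; have := h2 s; rewrite ts s1 s2 => /(_ isT)/negP + /(_ isT)/negP.
by rewrite -!leNgt => ? ?; apply/eqP; rewrite eq_le; apply/andP.
Qed.

Lemma left_germ_cases f t : dff1 f ->
  [\/ left_germ lt_ f t, left_germ eq_ f t | left_germ gt_ f t].
Proof.
move=> hf.
have [e1 e10 [h1|h1]] : exists2 eps : R, 0 < eps & (forall s, t - eps < s < t -> f t < f s) \/ (forall s, t - eps < s < t -> ~ f t < f s).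
- by apply: (@dfn1_const_left _ (fun s => f t < f s)); dfn_tac.
- by constructor 1; exists e1; split => // s ts st; apply: h1; rewrite ts.
have [e2 e20 [h2|h2]] : exists2 eps : R, 0 < eps & (forall s, t - eps < s < t -> f s < f t) \/ (forall s, t - eps < s < t -> ~ f s < f t).
- by apply: (@dfn1_const_left _ (fun s => f s < f t)); dfn_tac.
- by constructor 3; exists e2; split => // s ts st; apply: h2; rewrite ts.
constructor 2; exists (Num.min e1 e2); split; first by rewrite lt_min e10.
move=> s; rewrite ltrBlDl -ltrBlDr lt_min !ltrBlDr -!ltrBlDl => /andP[s1 s2] st.
have := h1 s; have := h2 s; rewrite st s1 s2 => /(_ isT)/negP + /(_ isT)/negP.
by rewrite -!leNgt => ? ?; apply/eqP; rewrite eq_le; apply/andP.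
Qed.

(** Each of the six one-sided germs is definable in the base point, hence holds at all small points
    or at none. Strict local minima or maxima everywhere are impossible, and a germ that is constant
    on one side at every point is constant on both, so only the monotone combinations survive. *)
Lemma dff1_locally_monotone f : dff1 f -> exists (eps : R) (sg : bool), 0 < eps /\
  forall t, 0 < t < eps -> exists2 d : R, 0 < d & forall s, 0 < s < eps ->
     (t < s < t + d -> (-1) ^+ sg * f t <= (-1) ^+ sg * f s) /\
     (t - d < s < t -> (-1) ^+ sg * f s <= (-1) ^+ sg * f t).
Proof.
move=> hf.
have dR r : dfn (fun e => r (e 0%N) (e 1%N)) -> dfn1 (right_germ r f).
  move=> hr; rewrite /right_germ; dfn_tac.
  by apply: (@dff_rel _ (fun e => f (e 2%N)) (fun e => f (e 0%N)) r) => //; dfn_tac.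
have dL r : dfn (fun e => r (e 0%N) (e 1%N)) -> dfn1 (left_germ r f).
  move=> hr; rewrite /left_germ; dfn_tac.
  by apply: (@dff_rel _ (fun e => f (e 2%N)) (fun e => f (e 0%N)) r) => //; dfn_tac.
have dlt : dfn (fun e => lt_ (e 0%N) (e 1%N)) by rewrite /lt_; dfn_tac.
have dgt : dfn (fun e => gt_ (e 0%N) (e 1%N)) by rewrite /gt_; dfn_tac.
have deq : dfn (fun e => eq_ (e 0%N) (e 1%N)) by rewrite /eq_; dfn_tac.
have [eps e0 h] : exists2 eps : R, 0 < eps & forall D,
    List.In D [:: right_germ lt_ f; right_germ eq_ f; right_germ gt_ f;
                  left_germ lt_ f; left_germ eq_ f; left_germ gt_ f] ->
    (forall t, 0 < t < eps -> D t) \/ (forall t, 0 < t < eps -> ~ D t).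
  apply: dfn1_const_right0_seq => D /=.
  by move=> [<-|[<-|[<-|[<-|[<-|[<-|[]]]]]]]; [exact: dR|exact: dR|exact: dR|exact: dL|exact: dL|exact: dL].
have sp D : List.In D [:: right_germ lt_ f; right_germ eq_ f; right_germ gt_ f;
                  left_germ lt_ f; left_germ eq_ f; left_germ gt_ f] ->
    forall t, 0 < t < eps -> D t -> forall s, 0 < s < eps -> D s.
  by move=> /h [//|hn] t ht Dt; case: (hn t ht).
have Rsp r : List.In (right_germ r f) [:: right_germ lt_ f; right_germ eq_ f; right_germ gt_ f;
                  left_germ lt_ f; left_germ eq_ f; left_germ gt_ f] -> forall t, 0 < t < eps -> right_germ r f t -> forall s, 0 < s < eps -> right_germ r f s by exact: sp.
set t0 := eps / 2; have ht0 : 0 < t0 < eps by rewrite /t0; lra.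
have conflict (r1 r2 : R -> R -> Prop) t : (forall x y, r1 x y -> r2 x y -> False) ->
    right_germ r1 f t -> right_germ r2 f t -> False.
  move=> hr [d1 [d10 h1]] [d2 [d20 h2]].
  have dm : 0 < Num.min d1 d2 by rewrite lt_min d10.
  have d1m : Num.min d1 d2 <= d1 by rewrite ge_min lexx.
  have d2m : Num.min d1 d2 <= d2 by rewrite ge_min lexx orbT.
  by apply: (hr _ _ (h1 (t + Num.min d1 d2 / 2) _ _) (h2 (t + Num.min d1 d2 / 2) _ _)); lra.
have conflictL (r1 r2 : R -> R -> Prop) t : (forall x y, r1 x y -> r2 x y -> False) ->
    left_germ r1 f t -> left_germ r2 f t -> False.
  move=> hr [d1 [d10 h1]] [d2 [d20 h2]].
  have dm : 0 < Num.min d1 d2 by rewrite lt_min d10.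
  have d1m : Num.min d1 d2 <= d1 by rewrite ge_min lexx.
  have d2m : Num.min d1 d2 <= d2 by rewrite ge_min lexx orbT.
  by apply: (hr _ _ (h1 (t - Num.min d1 d2 / 2) _ _) (h2 (t - Num.min d1 d2 / 2) _ _)); lra.
have lteq x y : lt_ x y -> eq_ x y -> False by move=> + E; rewrite /lt_ (E : x = y) ltxx.
have gteq x y : gt_ x y -> eq_ x y -> False by move=> + E; rewrite /gt_ (E : x = y) ltxx.
have RLeq t : 0 < t < eps -> right_germ eq_ f t ->
    exists s : R, 0 < s < eps /\ left_germ eq_ f s.
  move=> /andP[tp te] [d [d0 hd]].
  have dm : 0 < Num.min d (eps - t) by rewrite lt_min d0 subr_gt0.
  have d1m : Num.min d (eps - t) <= d by rewrite ge_min lexx.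
  have d2m : Num.min d (eps - t) <= eps - t by rewrite ge_min lexx orbT.
  set m := Num.min _ _ in dm d1m d2m.
  exists (t + m / 2); split; first by apply/andP; split; lra.
  exists (m / 2); split; first by lra.
  by move=> s s1 s2; rewrite /eq_ -(hd (t + m / 2)) ?(hd s)//; lra.
have LReq t : 0 < t < eps -> left_germ eq_ f t ->
    exists s : R, 0 < s < eps /\ right_germ eq_ f s.
  move=> /andP[tp te] [d [d0 hd]].
  have dm : 0 < Num.min d t by rewrite lt_min d0.
  have d1m : Num.min d t <= d by rewrite ge_min lexx.
  have d2m : Num.min d t <= t by rewrite ge_min lexx orbT.
  set m := Num.min _ _ in dm d1m d2m.
  exists (t - m / 2); split; first by apply/andP; split; lra.
  exists (m / 2); split; first by lra.
  by move=> s s1 s2; rewrite /eq_ -(hd (t - m / 2)) ?(hd s)//; lra.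
have fin (sg : bool) (r1 r2 : R -> R -> Prop) :
    (forall x y, r1 x y -> (-1) ^+ sg * x <= (-1) ^+ sg * y) ->
    (forall x y, r2 x y -> (-1) ^+ sg * y <= (-1) ^+ sg * x) ->
    (forall t, 0 < t < eps -> right_germ r1 f t) ->
    (forall t, 0 < t < eps -> left_germ r2 f t) ->
  exists (eps : R) (sg : bool), 0 < eps /\
  forall t, 0 < t < eps -> exists2 d : R, 0 < d & forall s, 0 < s < eps ->
     (t < s < t + d -> (-1) ^+ sg * f t <= (-1) ^+ sg * f s) /\
     (t - d < s < t -> (-1) ^+ sg * f s <= (-1) ^+ sg * f t).
  move=> k1 k2 h1 h2; exists eps, sg; split=> // t ht.
  have [d1 [d10 hd1]] := h1 t ht; have [d2 [d20 hd2]] := h2 t ht.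
  exists (Num.min d1 d2); first by rewrite lt_min d10.
  have d1m : Num.min d1 d2 <= d1 by rewrite ge_min lexx.
  have d2m : Num.min d1 d2 <= d2 by rewrite ge_min lexx orbT.
  by move=> s _; split => /andP[a1 a2]; [apply/k1/hd1|apply/k2/hd2]; lra.
case: (right_germ_cases t0 hf) => hR.
- have {}hR : forall t, 0 < t < eps -> right_germ lt_ f t by apply: (sp _ _ t0) => //=; tauto.
  case: (left_germ_cases t0 hf) => hL.
  + have {}hL : forall t, 0 < t < eps -> left_germ lt_ f t by apply: (sp _ _ t0) => //=; tauto.
    exfalso; apply: (@no_strict_local_min f 0 eps e0) => t ht.
    have [d1 [d10 h1]] := hR t ht; have [d2 [d20 h2]] := hL t ht.
    exists (Num.min d1 d2); first by rewrite lt_min d10.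
    move=> s; rewrite lt_min normr_gt0 subr_eq0 => /and3P[st].
    rewrite !ltr_norml => /andP[? ?] /andP[? ?].
    by case/orP: (lt_total st) => ?; [apply: h2|apply: h1]; lra.
  + have [s [hs1 hs2]] := LReq t0 ht0 hL.
    by case: (conflict _ _ s lteq (hR s hs1) hs2).
  + apply: (fin false lt_ gt_) => //.
    * by move=> x y /ltW; rewrite !mul1r.
    * by move=> x y /ltW; rewrite !mul1r.
    * by apply: (sp _ _ t0) => //=; tauto.
- have [s [hs1 hs2]] := RLeq t0 ht0 hR.
  apply: (fin false eq_ eq_) => //.
  + by move=> x y ->.
  + by move=> x y ->.
  + by apply: (sp _ _ t0) => //=; tauto.
  + by apply: (sp _ _ s) => //=; tauto.
- have {}hR : forall t, 0 < t < eps -> right_germ gt_ f t by apply: (sp _ _ t0) => //=; tauto.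
  case: (left_germ_cases t0 hf) => hL.
  + apply: (fin true gt_ lt_) => //.
    * by move=> x y /ltW; rewrite !mulN1r lerN2.
    * by move=> x y /ltW; rewrite !mulN1r lerN2.
    * by apply: (sp _ _ t0) => //=; tauto.
  + have [s [hs1 hs2]] := LReq t0 ht0 hL.
    by case: (conflict _ _ s gteq (hR s hs1) hs2).
  + have {}hL : forall t, 0 < t < eps -> left_germ gt_ f t by apply: (sp _ _ t0) => //=; tauto.
    exfalso; apply: (@no_strict_local_min (fun x => - f x) 0 eps e0) => t ht.
    have [d1 [d10 h1]] := hR t ht; have [d2 [d20 h2]] := hL t ht.
    exists (Num.min d1 d2); first by rewrite lt_min d10.
    move=> s; rewrite lt_min normr_gt0 subr_eq0 => /and3P[st].
    rewrite !ltr_norml ltrN2 => /andP[? ?] /andP[? ?].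
    by case/orP: (lt_total st) => ?; [apply: h2|apply: h1]; lra.
Qed.

Definition contpt f t :=
  forall eta : R, 0 < eta -> exists d : R, 0 < d /\ forall s, `|s - t| < d -> `|f s - f t| < eta.

(* A monotone function that jumps everywhere has an image without interior to
   the left of each of its left limits, which o-minimality forbids. *)
Lemma nondecreasing_dff1_contpt f eps : dff1 f -> 0 < eps ->
  (forall s t, 0 < s -> s <= t -> t < eps -> f s <= f t) ->
  exists2 eps' : R, 0 < eps' <= eps & forall t, 0 < t < eps' -> contpt f t.
Proof.
move=> hf e0 mono.
have dc : dfn1 (contpt f) by rewrite /contpt; dfn_tac.
have [e1 e10 hc] := dfn1_const_right0 dc.
pose e2 := Num.min e1 eps.
have e20 : 0 < e2 by rewrite lt_min e10.
have e21 : e2 <= e1 by rewrite ge_min lexx.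
have e2e : e2 <= eps by rewrite ge_min lexx orbT.
exists e2; first by rewrite e20.
case: hc => [hc t ht|hc]; first by apply: hc; lra.
exfalso.
set t1 := e2 / 2; have ht1 : 0 < t1 < e2 by rewrite /t1; lra.
pose E := [set y | exists2 s, 0 < s < t1 & f s = y].
have E0 : E !=set0 by exists (f (t1 / 2)), (t1 / 2) => //; lra.
have hE : has_sup E.
  by split=> //; exists (f t1) => _ [s hs <-]; apply: mono; lra.
set y := sup E.
have lty s : 0 < s < t1 -> f s < y.
  move=> hs; have fsy : f s <= y by apply: ub_le_sup; [case: hE|exists s].
  rewrite lt_neqAle fsy andbT; apply/eqP => fsE.
  (* If the supremum were attained at [s], [f] would be constant on [[s, t1[] and therefore
     continuous at the midpoint. *)
  apply: (hc ((s + t1) / 2)); first lra.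
  move=> eta eta0; exists ((t1 - s) / 2); split; first lra.
  have cst u : s <= u < t1 -> f u = y.
    move=> /andP[su ut]; apply/eqP; rewrite eq_le -[y in X in _ && X]fsE mono//; [|lra|lra].
    by rewrite andbT; apply: ub_le_sup; [case: hE|exists u => //; lra].
  by move=> u; rewrite ltr_norml => hu; rewrite !cst ?subrr ?normr0//; lra.
have dI : dfn1 (fun z => exists s : R, 0 < s /\ s < e2 /\ f s = z) by dfn_tac.
(* The image is definable, so just below [y] it contains everything or nothing. Nothing contradicts
   the supremum; everything leaves no room for a jump at [s0]. *)
have [d d0 hd] := dfn1_const_left y dI.
have [_ [s0 hs0 <-] ys0] := sup_adherent (eps := d) d0 hE.
have ys0' := lty s0 hs0; rewrite -/y in ys0.
case: hd => hd; last by apply: (hd (f s0)); [rewrite ys0|exists s0; split; lra].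
apply: (hc s0); first lra.
have mlt u v : 0 < u < e2 -> 0 < v < e2 -> f u < f v -> u < v.
  by move=> hu hv; apply: contraTT; rewrite -!leNgt => vu; apply: mono; lra.
move=> eta eta0.
have m1 : 0 < Num.min eta (f s0 - (y - d)) by rewrite lt_min eta0 subr_gt0.
have m2 : 0 < Num.min eta (y - f s0) by rewrite lt_min eta0 subr_gt0.
have m1a : Num.min eta (f s0 - (y - d)) <= eta by rewrite ge_min lexx.
have m1b : Num.min eta (f s0 - (y - d)) <= f s0 - (y - d) by rewrite ge_min lexx orbT.
have m2a : Num.min eta (y - f s0) <= eta by rewrite ge_min lexx.
have m2b : Num.min eta (y - f s0) <= y - f s0 by rewrite ge_min lexx orbT.
set k1 := Num.min _ _ in m1 m1a m1b; set k2 := Num.min _ _ in m2 m2a m2b.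
have [s1 [s10 [s1e s1E]]] : exists s : R, 0 < s /\ s < e2 /\ f s = f s0 - k1 / 2 by apply: hd; lra.
have [s2 [s20 [s2e s2E]]] : exists s : R, 0 < s /\ s < e2 /\ f s = f s0 + k2 / 2 by apply: hd; lra.
have s10' : s1 < s0 by apply: mlt; lra.
have s20' : s0 < s2 by apply: mlt; lra.
exists (Num.min (s0 - s1) (s2 - s0)); split; first by rewrite lt_min; lra.
move=> u; rewrite lt_min !ltr_norml => /andP[hu1 hu2].
have : f s1 <= f u by apply: mono; lra.
have : f u <= f s2 by apply: mono; lra.
by lra.
Qed.

Lemma dff1_monotone f : dff1 f -> exists (eps : R) (sg : bool), [/\ 0 < eps,
  (forall s t, 0 < s -> s <= t -> t < eps -> (-1) ^+ sg * f s <= (-1) ^+ sg * f t) &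
  (forall t, 0 < t < eps -> contpt f t)].
Proof.
move=> hf; have [e [sg [e0 h]]] := dff1_locally_monotone hf.
have mono := loc_nondecreasing h.
have hg : dff1 (fun t => (-1) ^+ sg * f t).
  case: (sg); last by under [X in dff1 X]eq_fun do rewrite mul1r.
  by under [X in dff1 X]eq_fun do rewrite mulN1r -sub0r; rewrite /dff1; dfn_tac.
have [e' /andP[e'0 e'e] hc] := nondecreasing_dff1_contpt hg e0 mono.
exists e', sg; split => //.
  by move=> s t s0 st te; apply: mono => //; exact: lt_le_trans e'e.
move=> t ht eta eta0; have [d [d0 hd]] := hc t ht eta eta0.
exists d; split=> // s /hd; rewrite -mulrBr normrM normrX normrN1 expr1n mul1r//.
Qed.

End Monotonicity.

(** * Vector variables and Taylor expansion of polynomials *)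

Section VectorEnv.
Variable R : realType.
Local Notation env := (nat -> R).

Lemma dfn_exblock (P : env -> Prop) m : dfn P ->
  dfn (fun e => exists x : env, P (fun i => if (i < m)%N then x i else e (i - m)%N)).
Proof.
elim: m P => [|m ih] P hP.
  apply: dfn_ext hP _ => e.
  have E (x : env) : (fun i : nat => if (i < 0)%N then x i else e (i - 0)%N) = e.
    by apply/funext => i; rewrite ltn0 subn0.
  by split => [h|[x]]; [exists e|]; rewrite E.
apply: dfn_ext (dfn_ex (ih _ hP)) _ => e; split.
- move=> [a [x hx]]; exists (fun i => if (i < m)%N then x i else a).
  rewrite (_ : (fun _ => _) = (fun i => if (i < m)%N then x i else scons a e (i - m)%N))//.
  apply/funext => i; rewrite ltnS; case: (ltngtP i m) => [im|im|->].
  - by [].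
  - by rewrite -(subnSK im).
  - by rewrite subnn.
- move=> [x hx]; exists (x m), x.
  rewrite (_ : (fun _ => _) = (fun i => if (i < m.+1)%N then x i else e (i - m.+1)%N))//.
  apply/funext => i; rewrite ltnS; case: (ltngtP i m) => [im|im|->].
  - by [].
  - by rewrite -(subnSK im).
  - by rewrite subnn.
Qed.

Definition venv m (x : 'rV[R]_m) : env :=
  fun i => if insub i is Some j then x 0 j else 0.

Lemma venvE m (x : 'rV[R]_m) (j : 'I_m) : venv x j = x 0 j.
Proof. by rewrite /venv valK. Qed.

Lemma venv_row m (e : env) i :
  venv (\row_(j < m) e j) i = if (i < m)%N then e i else 0.
Proof.
rewrite /venv; case: insubP => [j lt_im <-|/negbTE->//].
by rewrite mxE ltn_ord.
Qed.

Lemma dfn_exV m (Q : env -> 'rV[R]_m -> Prop) :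
  dfn (fun e => Q (fun i => e (i + m)%N) (\row_(i < m) e i)) -> dfn (fun e => exists v, Q e v).
Proof.
move=> h; apply: dfn_ext (dfn_exblock m h) _ => e; split.
- move=> [x]; rewrite (_ : (fun i => _) = e); last first.
    by apply/funext => i; rewrite ltnNge leq_addl addnK.
  by move=> hx; eexists; exact: hx.
- move=> [v hv]; exists (venv v).
  rewrite (_ : (fun i => _) = e); last first.
    by apply/funext => i; rewrite ltnNge leq_addl addnK.
  rewrite (_ : \row_i _ = v)//; apply/rowP => i; rewrite mxE ltn_ord.
  exact: venvE.
Qed.

Lemma dfn_allV m (Q : env -> 'rV[R]_m -> Prop) :
  dfn (fun e => Q (fun i => e (i + m)%N) (\row_(i < m) e i)) -> dfn (fun e => forall v, Q e v).
Proof.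
move=> h; apply: dfn_ext (dfn_not (dfn_exV (Q := fun e v => ~ Q e v) (dfn_not h))) _ => e.
by split => [/forallNP g v|g [v]]; [apply: contrapT|apply].
Qed.

Lemma polyf_venv_row m p (s : nat -> nat) : polyf p ->
  polyf (fun e : env => p (venv (\row_(j < m) e (s j)))).
Proof.
move=> hp; apply: (polyf_subst (s := fun i e => venv (\row_(j < m) e (s j)) i) hp) => i.
have [im|im] := ltnP i m.
  rewrite (_ : (fun _ => _) = fun e : env => e (s i)); first exact: polyf_var.
  by apply/funext => e; rewrite (venv_row m (fun j => e (s j))) im.
rewrite (_ : (fun _ => _) = fun e : env => 0); first exact: polyf_cst.
by apply/funext => e; rewrite (venv_row m (fun j => e (s j))) ltnNge im.
Qed.

Lemma mx_norm_le m k (x : 'M[R]_(m, k)) (r : R) : 0 <= r ->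
  (`|x| <= r) <-> (forall i j, `|x i j| <= r).
Proof.
move=> r0; rewrite /Num.norm /= mx_normrE; split.
- by move=> /bigmax_leP[_ h] i j; exact: (h (i, j)).
- by move=> h; apply/bigmax_leP; split => // -[i j] _; exact: h.
Qed.

Lemma mx_entry_le m k (x : 'M[R]_(m, k)) i j : `|x i j| <= `|x|.
Proof. by have /mx_norm_le := lexx `|x|; apply. Qed.

Lemma polyf_bounded m p (rho : R) : polyf p ->
  exists2 M : R, 0 < M & forall x : 'rV[R]_m, `|x| <= rho -> `|p (venv x)| <= M.
Proof.
elim=> [c|i|p1 p2 _ [M1 M10 h1] _ [M2 M20 h2]|p1 p2 _ [M1 M10 h1] _ [M2 M20 h2]].
- by exists (`|c| + 1) => [|x _]; rewrite ?ltr_wpDl// lerDl.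
- exists (`|rho| + 1) => [|x hx]; first by rewrite ltr_wpDl.
  have {hx} : `|x| <= `|rho| + 1 by rewrite (le_trans hx)// (le_trans (ler_norm _))// lerDl.
  apply: le_trans; rewrite /venv; case: insub => [j|]; last by rewrite normr0.
  exact: mx_entry_le.
- exists (M1 + M2); first by rewrite addr_gt0.
  by move=> x hx; rewrite (le_trans (ler_normD _ _))// lerD ?h1 ?h2.
- exists (M1 * M2); first by rewrite mulr_gt0.
  by move=> x hx; rewrite normrM ler_pM ?h1 ?h2.
Qed.

Lemma polyf_continuous m p : polyf p -> continuous (fun x : 'rV[R]_m => p (venv x)).
Proof.
elim=> [c|i|p1 p2 _ h1 _ h2|p1 p2 _ h1 _ h2] x.
- exact: cst_continuous.
- rewrite /venv; case: insub => [j|]; last exact: cst_continuous.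
  exact: coord_continuous.
- by apply: continuousD; [exact: h1|exact: h2].
- by apply: continuousM; [exact: h1|exact: h2].
Qed.

Lemma grad_bounded m (G : 'I_m -> env -> R) (rho : R) : (forall i, polyf (G i)) ->
  exists2 M : R, 0 < M & forall x u : 'rV[R]_m, `|x| <= rho ->
    `|\sum_i G i (venv x) * u 0 i| <= M * `|u|.
Proof.
move=> hG.
have /choice[B hB] : forall i, exists M : R, 0 < M /\ forall x : 'rV[R]_m, `|x| <= rho -> `|G i (venv x)| <= M.
  by move=> i; have [M M0 h] := polyf_bounded m rho (hG i); exists M.
exists (\sum_i B i + 1); first by rewrite ltr_wpDl// sumr_ge0// => i _; case: (hB i) => /ltW.
move=> x u hx; rewrite (le_trans (ler_norm_sum _ _ _))//.
rewrite mulrDl mul1r ler_wpDr// mulr_suml ler_sum// => i _.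
by rewrite normrM ler_pM//; [exact: (hB i).2|exact: mx_entry_le].
Qed.

(** The gradient is built by induction on the polynomial together with a quadratic remainder bound,
    uniform on balls; this bound stands in for differentiation throughout. *)
Lemma polyf_taylor m p : polyf p -> exists G : 'I_m -> env -> R,
  (forall i, polyf (G i)) /\
  forall rho : R, exists2 M : R, 0 < M & forall x u : 'rV[R]_m, `|x| <= rho -> `|u| <= rho ->
    `|p (venv (x + u)) - p (venv x) - \sum_i G i (venv x) * u 0 i| <= M * `|u| ^+ 2.
Proof.
elim=> [c|i|p1 p2 hp1 [G1 [G1p h1]] hp2 [G2 [G2p h2]]|p1 p2 hp1 [G1 [G1p h1]] hp2 [G2 [G2p h2]]].
- exists (fun i e => 0); split=> [i|rho]; first exact: polyf_cst.
  exists 1 => // x u _ _; rewrite subrr sub0r normrN big1 ?normr0 ?mul1r ?sqr_ge0// => i _.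
  by rewrite mul0r.
- exists (fun (j : 'I_m) e => (i == j :> nat)%:R); split => [j|rho]; first exact: polyf_cst.
  exists 1 => // x u _ _; rewrite /venv; case: insubP => [j ltim <-|/negbTE im].
    rewrite (bigD1 j)//= eqxx mul1r mxE big1 ?addr0; last first.
      by move=> k /negbTE kj; rewrite (inj_eq val_inj) eq_sym kj mul0r.
    by rewrite [x 0 j + _]addrC addrK mul1r subrr normr0 sqr_ge0.
  rewrite subrr sub0r normrN big1 ?normr0 ?mul1r ?sqr_ge0// => k _.
  by case: eqP => [ik|]; [move: im; rewrite ik ltn_ord|rewrite mul0r].
- exists (fun i e => G1 i e + G2 i e); split => [i|rho]; first exact: polyf_add.
  have [M1 M10 {}h1] := h1 rho; have [M2 M20 {}h2] := h2 rho.
  exists (M1 + M2); first by rewrite addr_gt0.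
  move=> x u hx hu; rewrite mulrDl.
  apply: le_trans (lerD (h1 x u hx hu) (h2 x u hx hu)).
  apply: le_trans (ler_normD _ _); rewrite le_eqVlt; apply/orP; left; apply/eqP; congr (`|_|).
  under eq_bigr do rewrite mulrDl.
  rewrite big_split /=; ring.
- exists (fun i e => G1 i e * p2 e + p1 e * G2 i e); split => [i|rho].
    by apply: polyf_add; apply: polyf_mul.
  have [M1 M10 {}h1] := h1 rho; have [M2 M20 {}h2] := h2 rho.
  have [B1 B10 b1] := polyf_bounded m rho hp1.
  have [B2 B20 b2] := polyf_bounded m (rho + rho) hp2.
  have [C1 C10 c1] := grad_bounded rho G1p.
  have [C2 C20 c2] := grad_bounded rho G2p.
  exists (M1 * B2 + (B1 + C1 * `|rho|) * M2 + C1 * C2).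
    have h : 0 <= C1 * `|rho| by apply: mulr_ge0 => //; exact: ltW.
    by rewrite !addr_gt0 ?mulr_gt0 ?ltr_wpDr.
  move=> x u hx hu.
  set P := p1 (venv (x + u)); set Q := p2 (venv (x + u)).
  set p0 := p1 (venv x); set q := p2 (venv x).
  have -> : \sum_i (G1 i (venv x) * p2 (venv x) + p1 (venv x) * G2 i (venv x)) * u 0 i =
    (\sum_i G1 i (venv x) * u 0 i) * q + p0 * \sum_i G2 i (venv x) * u 0 i.
    rewrite mulr_suml mulr_sumr -big_split /=; apply: eq_bigr => i _.
    rewrite /p0 /q; ring.
  move: (h1 x u hx hu) (h2 x u hx hu) (c1 x u hx) (c2 x u hx).
  set a := \sum_i _; set b := \sum_i _; rewrite -/P -/Q -/p0 -/q => e1 e2 e3 e4.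
  (* The remainder of a product consists of the remainders of the two factors and the product of the
     linear terms, which is quadratic in [u]. *)
  have -> : P * Q - p0 * q - (a * q + p0 * b) = (P - p0 - a) * Q + (p0 + a) * (Q - q - b) + a * b by ring.
  have EQ : `|Q| <= B2 by apply: b2; rewrite (le_trans (ler_normD _ _))// lerD.
  have Epa : `|p0 + a| <= B1 + C1 * `|rho|.
    rewrite (le_trans (ler_normD _ _))// lerD//; first exact: b1.
    by rewrite (le_trans e3)// ler_wpM2l ?(ltW C10)// (le_trans hu)// ler_norm.
  rewrite [leRHS]mulrDl [X in _ <= X + _]mulrDl.
  apply: (le_trans (ler_normD _ _)); apply: lerD.
    apply: (le_trans (ler_normD _ _)); apply: lerD.
      by rewrite normrM mulrAC ler_pM.
    by rewrite normrM -mulrA ler_pM.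
  by rewrite normrM expr2 mulrACA ler_pM.
Qed.

End VectorEnv.

(** * Definable choice and the gradient inequality *)

Section DefinableChoice.
Variables (R : realType) (m : nat) (Q : R -> set 'rV[R]_m).
Local Notation env := (nat -> R).
Hypothesis dQ : dfn (fun e => Q (e m) (\row_(i < m) e i)).
Hypothesis cQ : forall t, compact (Q t).

Fixpoint lexmin k (t : R) : set 'rV[R]_m :=
  if k is k'.+1 then
    [set x | lexmin k' t x /\ forall y, lexmin k' t y -> venv x k' <= venv y k']
  else Q t.

Lemma dfn_lexmin k : dfn (fun e => lexmin k (e m) (\row_(i < m) e i)).
Proof.
elim: k => [//|k ih] /=; apply: dfn_and; first exact: ih.
apply: dfn_allV; apply: dfn_imp.
  pose s i (e : env) := if (i < m)%N then e i else e (i + m)%N.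
  have hs i : polyf (s i) by rewrite /s; case: (_ < _)%N; exact: polyf_var.
  apply: dfn_ext (dfn_subst ih hs) _ => e; rewrite /s ltnn.
  by rewrite (_ : \row_i _ = \row_i e i)//; apply/rowP => i; rewrite !mxE ltn_ord.
by apply: dfn_le; [apply: (polyf_venv_row m (fun i => i + m)%N (polyf_var R k))
                  |apply: (polyf_venv_row m id (polyf_var R k))].
Qed.

Lemma lexmin_compact k t : compact (lexmin k t) /\ (Q t !=set0 -> lexmin k t !=set0).
Proof.
elim: k => [|k [ic ih]]; first by split => //; exact: cQ.
have [k0|/set0P[x0 hx0]] := eqVneq (lexmin k t) set0.
  have -> : lexmin k.+1 t = set0 by apply/seteqP; split => // x [h _]; rewrite -k0.
  by split; [exact: compact0|move=> /ih; rewrite k0 => -[]].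
have [x xk xmin] := compact_EVT_min (ex_intro _ x0 hx0) ic
  (continuous_subspaceT (polyf_continuous (m := m) (polyf_var R k))).
rewrite inE in xk.
have {}xmin y : lexmin k t y -> venv x k <= venv y k by move=> /mem_set /xmin.
split; last by exists x.
rewrite (_ : lexmin k.+1 t = lexmin k t `&` [set y | venv y k <= venv x k]); last first.
  apply/seteqP; split => y [hy1 hy2]; split => //; first exact: hy2.
  by move=> z /xmin; exact: le_trans.
apply: compact_closedI => //.
apply: (@closed_comp _ _ (fun y : 'rV[R]_m => venv y k) [set z | z <= venv x k]).
  by move=> y _; exact: (polyf_continuous (polyf_var R k)).
exact: closed_le.
Qed.

Lemma lexmin_unique t x y : lexmin m t x -> lexmin m t y -> x = y.
Proof.
have sub j k : lexmin (j + k) t `<=` lexmin k t.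
  by elim: j => [//|j ih] z /= [/ih].
move=> hx hy; apply/rowP => i; rewrite -!venvE.
have lti : (i.+1 + (m - i.+1) = m)%N by rewrite subnKC.
have [hx1 hx2] : lexmin i.+1 t x by apply: (sub (m - i.+1)%N); rewrite addnC lti.
have [hy1 hy2] : lexmin i.+1 t y by apply: (sub (m - i.+1)%N); rewrite addnC lti.
by apply/eqP; rewrite eq_le hx2// hy2.
Qed.

(** The lexicographically least point of a compact fibre is unique and described by a formula, so
    taking it is a definable choice. Over an empty fibre the value is [0]. *)
Lemma definable_selection : exists X : R -> 'rV[R]_m,
  (forall t, Q t !=set0 -> Q t (X t)) /\ forall i, dff1 (fun t => X t 0 i).
Proof.
exists (fun t => xget 0 (lexmin m t)); split.
  move=> t /(lexmin_compact m t).2[x hx].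
  have : lexmin m t (xget 0 (lexmin m t)) by exact: (xgetPex 0 (ex_intro _ x hx)).
  have sub k y : lexmin k t y -> Q t y by elim: k => [//|k ih] [/ih].
  exact: sub.
move=> i; rewrite /dff1 /dff.
have ds (e1 : nat) : dfn (fun e : env => lexmin m (e (e1 + m)%N) (\row_(i < m) e i)).
  pose s i (e : env) := if (i < m)%N then e i else e (e1 + m)%N.
  have hs j : polyf (s j) by rewrite /s; case: (_ < _)%N; exact: polyf_var.
  apply: dfn_ext (dfn_subst (dfn_lexmin m) hs) _ => e; rewrite /s ltnn.
  by rewrite (_ : \row_i _ = \row_i e i)//; apply/rowP => j; rewrite !mxE ltn_ord.
have h : dfn (fun e : env => (exists x, lexmin m (e 1%N) x /\ x 0 i = e 0%N) \/
     (~ (exists x, lexmin m (e 1%N) x) /\ 0 = e 0%N)).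
  apply: dfn_or; first (apply: dfn_exV; apply: dfn_and; first exact: ds).
    under [X in dfn X]eq_fun do rewrite mxE.
    by apply: dfn_eq; exact: polyf_var.
  apply: dfn_and; first by apply: dfn_not; apply: dfn_exV; exact: ds.
  by apply: dfn_eq; [exact: polyf_cst|exact: polyf_var].
apply: dfn_ext h _ => e; split.
- move=> [[x [hx <-]]|[h0 <-]].
    by rewrite (lexmin_unique (xgetPex 0 (ex_intro _ x hx)) hx).
  by rewrite xgetPN ?mxE// => x hx; apply: h0; exists x.
- move=> <-; have [[x hx]|h0] := pselect (exists x, lexmin m (e 1%N) x).
    by left; exists (xget 0 (lexmin m (e 1%N))); split => //; exact: (xgetPex 0 (ex_intro _ x hx)).
  by right; split=> //; rewrite xgetPN ?mxE// => x hx; apply: h0; exists x.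
Qed.

End DefinableChoice.

Lemma finite_common_radius (R : realType) (I : finType) (P : I -> R -> Prop) :
  (forall i, exists2 e : R, 0 < e & P i e) ->
  (forall i e e', 0 < e' -> e' <= e -> P i e -> P i e') ->
  exists2 e : R, 0 < e & forall i, P i e.
Proof.
move=> h mono.
have /choice[r hr] : forall i, exists e : R, 0 < e /\ P i e.
  by move=> i; have [e e0 he] := h i; exists e.
exists (\big[Num.min/1]_i r i).
  by apply: lt_bigmin => // i _; case: (hr i).
move=> i; apply: (mono i (r i)); last by case: (hr i).
  by apply: lt_bigmin => // j _; case: (hr j).
exact: bigmin_le.
Qed.

Section GradientInequality.
Variables (R : realType) (m : nat) (f : (nat -> R) -> R) (G : 'I_m -> (nat -> R) -> R).
Local Notation env := (nat -> R).
Hypothesis pf : polyf f.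
Hypothesis pG : forall i, polyf (G i).
Hypothesis tay : forall rho : R, exists2 M : R, 0 < M & forall x u : 'rV[R]_m,
  `|x| <= rho -> `|u| <= rho ->
  `|f (venv (x + u)) - f (venv x) - \sum_i G i (venv x) * u 0 i| <= M * `|u| ^+ 2.
Let g2 (e : env) := \sum_i G i e ^+ 2.

Let pg2 : polyf g2.
Proof. by apply: polyf_sum => i; exact: polyf_exp. Qed.

(** For positive [w] and [t], the points of level [t] where the gradient has length at most [t / w],
    squared to stay polynomial. The radius makes the fibres compact, as the selection demands. *)
Let slow (rho w t : R) : set 'rV[R]_m :=
  [set x | [/\ `|x| <= rho, f (venv x) = t & w ^+ 2 * g2 (venv x) <= t ^+ 2]].

Lemma slow_compact rho w t : compact (slow rho w t).
Proof.
apply: bounded_closed_compact.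
  by exists rho; split; [rewrite realE; exact: le_total|move=> M rM x [hx _ _]; apply: (le_trans hx); exact: ltW].
rewrite (_ : slow rho w t = [set x | `|x| <= rho] `&`
  ((fun x => f (venv x)) @^-1` [set t] `&` (fun x => w ^+ 2 * g2 (venv x)) @^-1` [set s | s <= t ^+ 2])); last first.
  apply/seteqP; split => x; first by move=> [].
  by move=> [h1 [h2 h3]]; split.
apply: closedI.
  apply: (@closed_comp _ _ (fun x : 'rV[R]_m => `|x|) [set s | s <= rho]); last exact: closed_le.
  by move=> x _; exact: norm_continuous.
apply: closedI.
  apply: closed_comp; last exact: closed_eq.
  by move=> x _; exact: polyf_continuous.
apply: closed_comp; last exact: closed_le.
by move=> x _; exact: (polyf_continuous (polyf_mul (polyf_cst (w ^+ 2)) pg2)).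
Qed.

(* Along a selection [X t] with [f (X t) = t] and [|grad f| <= t / w] the
   function [ln t] would have finite total variation near [0], because each
   coordinate of [X] is monotone and bounded. *)
Lemma no_slow_family (rho w T : R) : 0 < w -> 0 < T -> 0 <= rho ->
  (forall t : R, 0 < t < T -> slow rho w t !=set0) -> False.
Proof.
move=> w0 T0 rho0 hT.
have dS : dfn (fun e => slow rho w (e m) (\row_(i < m) e i)).
  apply: (@dfn_ext _ (fun e => (forall i : 'I_m, `|e i| <= rho) /\
    (f (venv (\row_(i < m) e i)) = e m /\ w ^+ 2 * g2 (venv (\row_(i < m) e i)) <= e m ^+ 2))).
    apply: dfn_and.
      apply: dfn_allI => i; apply: dff_le; last exact: dff_cst.
      by apply: dff_norm; exact: dff_var.
    apply: dfn_and.
      apply: dfn_eq; last exact: polyf_var.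
      exact: (polyf_venv_row m id).
    apply: dfn_le; last by apply: polyf_exp; exact: polyf_var.
    by apply: polyf_mul; [exact: polyf_cst|exact: (polyf_venv_row m id)].
  move=> e; split.
  - move=> [h1 [h2 h3]]; split=> //; apply/mx_norm_le => // i j.
    by rewrite ord1 mxE.
  - move=> [/mx_norm_le h1 h2 h3]; split => // i.
    by have := h1 rho0 0 i; rewrite mxE.
have [X [hX dX]] := definable_selection dS (@slow_compact rho w).
have {}hX t : 0 < t < T -> slow rho w t (X t) by move=> /hT; exact: hX.
have hmono : forall i : 'I_m, exists2 eps : R, 0 < eps & exists sg : bool,
    (forall s t, 0 < s -> s <= t -> t < eps -> (-1) ^+ sg * X s 0 i <= (-1) ^+ sg * X t 0 i) /\
    (forall t, 0 < t < eps -> contpt (fun t => X t 0 i) t).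
  by move=> i; have [e [sg [e0 h1 h2]]] := dff1_monotone (dX i); exists e => //; exists sg.
have [e1 e10 he1] : exists2 eps : R, 0 < eps & forall i : 'I_m, exists sg : bool,
    (forall s t, 0 < s -> s <= t -> t < eps -> (-1) ^+ sg * X s 0 i <= (-1) ^+ sg * X t 0 i) /\
    (forall t, 0 < t < eps -> contpt (fun t => X t 0 i) t).
  apply: finite_common_radius hmono _ => i e e' e'0 ee [sg [h1 h2]].
  exists sg; split => [s t s0 st te|t /andP[t0 te]]; first by apply: h1 => //; exact: lt_le_trans ee.
  by apply: h2; rewrite t0 (lt_le_trans te).
have {hmono he1}/choice[sg hsg] := he1.
pose e2 := Num.min e1 T.
have e20 : 0 < e2 by rewrite lt_min e10.
have e21 : e2 <= e1 by rewrite ge_min lexx.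
have e2T : e2 <= T by rewrite ge_min lexx orbT.
(* The signs make every summand nondecreasing, so [S t - S s] bounds the displacement of [X] between
   [s] and [t]. *)
pose S t := \sum_i (-1) ^+ (sg i) * X t 0 i.
have XT t : 0 < t < e2 -> slow rho w t (X t).
  by move=> /andP[t0 te]; apply: hX; rewrite t0 (lt_le_trans te).
have Sdiff s t : 0 < s -> s <= t -> t < e2 -> `|X t - X s| <= S t - S s.
  move=> s0 st te; have te1 := lt_le_trans te e21.
  have pos i : 0 <= (-1) ^+ (sg i) * X t 0 i - (-1) ^+ (sg i) * X s 0 i.
    by rewrite subr_ge0; apply: (hsg i).1.
  rewrite -sumrB; apply/mx_norm_le; first exact: sumr_ge0.
  move=> k i; rewrite ord1 (bigD1 i)//= !mxE -[leLHS]addr0 lerD ?sumr_ge0//.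
  rewrite -[leRHS]ger0_norm// -mulrBr [leRHS]normrM normrX normrN1 expr1n mul1r//.
have [M M0 hM] := tay (rho + rho).
(* In the Taylor expansion along [u], the linear term contributes at most [m * (t / w)] times the
   norm of [u], and the remainder at most [t / w] times it once that norm is below [t / (w * M)]. *)
pose C1 : R := (m%:R + 1) / w.
have C10 : 0 < C1 by rewrite divr_gt0// ltr_wpDl.
have key t : 0 < t < e2 -> exists2 d : R, 0 < d & forall t', 0 < t' < e2 -> `|t' - t| < d ->
    `|t' - t| <= C1 * t * `|X t' - X t|.
  move=> ht; have t0 : 0 < t by case/andP: ht.
  pose eta := t / (w * M); have eta0 : 0 < eta by rewrite divr_gt0// mulr_gt0.
  have [d d0 hd] : exists2 d : R, 0 < d & forall i : 'I_m, forall s, `|s - t| < d -> `|X s 0 i - X t 0 i| < eta.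
    apply: finite_common_radius.
      move=> i; have [|d [d0 hd]] := (hsg i).2 t _ eta eta0; last by exists d.
      by case/andP: ht => -> te; rewrite (lt_le_trans te).
    by move=> i e e' _ ee h s se; apply: h; exact: lt_le_trans ee.
  exists d => // t' ht' tt'.
  have [xr xf xg] := XT t ht; have [xr' xf' _] := XT t' ht'.
  set u := X t' - X t.
  have ueta : `|u| <= eta.
    apply/mx_norm_le; first exact: ltW.
    by move=> k i; rewrite ord1 !mxE ltW// hd.
  have := hM (X t) u; rewrite {1}/u subrKC xf xf' => /(_ _ _)/wrap[].
    by rewrite (le_trans xr)// lerDl.
    by rewrite /u (le_trans (ler_normB _ _))// lerD.
  move=> htay.
  have gi i : `|G i (venv (X t))| <= t / w.
    rewrite ler_pdivlMr// mulrC.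
    rewrite -(@ler_pXn2r _ 2)// ?nnegrE ?mulr_ge0 ?(ltW w0) ?(ltW t0)//.
    apply: le_trans xg; rewrite exprMn ler_wpM2l ?sqr_ge0//.
    by rewrite real_normK ?num_real// /g2 (bigD1 i)//= lerDl sumr_ge0// => j _; exact: sqr_ge0.
  have hG : `|\sum_i G i (venv (X t)) * u 0 i| <= m%:R * (t / w * `|u|).
    rewrite (le_trans (ler_norm_sum _ _ _))//.
    apply: (@le_trans _ _ (\sum_(i < m) (t / w * `|u|))).
      by apply: ler_sum => i _; rewrite normrM ler_pM ?mx_entry_le.
    by rewrite sumr_const card_ord mulr_natl.
  have hMu : M * `|u| ^+ 2 <= t / w * `|u|.
    rewrite expr2 mulrA ler_wpM2r//.
    apply: (le_trans (ler_wpM2l (ltW M0) ueta)).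
    rewrite /eta le_eqVlt; apply/orP; left; apply/eqP; field.
    by rewrite !lt0r_neq0.
  have -> : t' - t = (t' - t - \sum_i G i (venv (X t)) * u 0 i) + \sum_i G i (venv (X t)) * u 0 i by rewrite subrK.
  rewrite (le_trans (ler_normD _ _))//.
  apply: (le_trans (lerD (le_trans htay hMu) hG)).
  rewrite /C1 le_eqVlt; apply/orP; left; apply/eqP; field.
  by rewrite lt0r_neq0.
have lnle (a c : R) : 0 < a -> 0 < c -> ln c - ln a <= (c - a) / a.
  move=> a0 c0; rewrite -ln_div ?posrE//.
  have -> : c / a = 1 + (c - a) / a by field; rewrite lt0r_neq0.
  apply: le_ln1Dx; rewrite mulrBl divff ?lt0r_neq0//.
  by rewrite ltrBrDl subrr divr_gt0.
(* Monotonicity of [F] expresses that [S] dominates the variation of [ln]. The factor [2] pays for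
   dividing by a point [s >= t / 2] on the left of [t]. *)
pose F t := 2 * C1 * S t - ln t.
have Fmono : forall s t, 0 < s -> s <= t -> t < e2 -> F s <= F t.
  apply: loc_nondecreasing => t ht; have [d d0 hd] := key t ht.
  have t0 : 0 < t by case/andP: ht.
  have te : t < e2 by case/andP: ht.
  exists (Num.min d (t / 2)); first by rewrite lt_min d0 divr_gt0.
  move=> s hs; have s0 : 0 < s by case/andP: hs.
  have se : s < e2 by case/andP: hs.
  have md : Num.min d (t / 2) <= d by rewrite ge_min lexx.
  have mt : Num.min d (t / 2) <= t / 2 by rewrite ge_min lexx orbT.
  split => /andP[h1 h2].
  - have hS := Sdiff t s t0 (ltW h1) se.
    have hk : `|s - t| <= C1 * t * `|X s - X t| by apply: hd => //; rewrite ltr_norml; apply/andP; split; lra.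
    have hl := lnle t s t0 s0.
    have : (s - t) / t <= C1 * (S s - S t).
      rewrite ler_pdivrMr// mulrAC (le_trans (ler_norm _))//.
      by rewrite (le_trans hk)// ler_wpM2l// mulr_ge0 ?ltW.
    have : 0 <= C1 * (S s - S t) by rewrite mulr_ge0 ?(ltW C10)// (le_trans _ hS).
    rewrite /F; lra.
  - have hS := Sdiff s t s0 (ltW h2) te.
    have hk : `|s - t| <= C1 * t * `|X s - X t| by apply: hd => //; rewrite ltr_norml; apply/andP; split; lra.
    have hl := lnle s t s0 t0.
    have : (t - s) / s <= 2 * C1 * (S t - S s).
      rewrite ler_pdivrMr// (le_trans (ler_norm _))// distrC (le_trans hk)//.
      have -> : 2 * C1 * (S t - S s) * s = C1 * (2 * s) * (S t - S s) by ring.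
      apply: ler_pM => //; last by rewrite distrC.
        by apply: mulr_ge0; exact: ltW.
      by apply: ler_wpM2l; [exact: ltW|lra].
    rewrite /F; lra.
pose b := e2 / 2; have hb : 0 < b < e2 by rewrite /b; apply/andP; split; lra.
have Sbd t : 0 < t < e2 -> `|S t| <= m%:R * rho.
  move=> ht; have [xr _ _] := XT t ht.
  rewrite (le_trans (ler_norm_sum _ _ _))//.
  apply: (@le_trans _ _ (\sum_(i < m) rho)); last by rewrite sumr_const card_ord mulr_natl.
  apply: ler_sum => i _; rewrite normrM normrX normrN1 expr1n mul1r.
  by rewrite (le_trans _ xr)// mx_entry_le.
pose B := 2 * C1 * (m%:R * rho + m%:R * rho) - ln b.
(* Small enough that [- ln a] exceeds the bound [B] which [F a <= F b] imposes on it. *)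
pose a := Num.min b (expR (- (B + 1))).
have a0 : 0 < a by rewrite lt_min expR_gt0; case/andP: hb => ->.
have ab : a <= b by rewrite ge_min lexx.
have ha : 0 < a < e2 by rewrite a0 (le_lt_trans ab)//; case/andP: hb.
have lna : ln a <= - (B + 1).
  by rewrite -[leRHS]expRK ler_ln ?posrE ?expR_gt0// ge_min lexx orbT.
have : F a <= F b by apply: Fmono => //; case/andP: hb.
have h1 := Sbd a ha; have h2 := Sbd b hb.
have : 2 * C1 * (S b - S a) <= 2 * C1 * (m%:R * rho + m%:R * rho).
  apply: ler_wpM2l; first by apply: mulr_ge0 => //; exact: ltW.
  by apply: (le_trans (ler_norm _)); apply: (le_trans (ler_normB _ _)); exact: lerD.
by rewrite /F; move: lna; rewrite /B; lra.
Qed.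

(** On a cusp in the pair of [w] and the level, slow points exist always or never; the former, at
    one fixed [w], is the family just excluded. Taking for [w] a root of a multiple of [f] turns the
    conclusion into a Lojasiewicz gradient inequality. *)
Theorem gradient_inequality (rho : R) : 0 <= rho -> exists N (eps : R), 0 < eps <= 1 /\
  forall (w : R) (x : 'rV[R]_m), 0 < w < eps -> `|x| <= rho -> 0 < f (venv x) < w ^+ N ->
    f (venv x) ^+ 2 < w ^+ 2 * \sum_i G i (venv x) ^+ 2.
Proof.
move=> rho0.
have dP : dfn (fun e => exists x : 'rV[R]_m, (forall i, `|x 0 i| <= rho) /\
    (f (venv x) = e 1%N /\ e 0%N ^+ 2 * g2 (venv x) <= e 1%N ^+ 2)).
  apply: dfn_exV; apply: dfn_and.
    apply: dfn_allI => i; under [X in dfn X]eq_fun do rewrite mxE.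
    by apply: dff_le; [apply: dff_norm; exact: dff_var|exact: dff_cst].
  apply: dfn_and.
    by apply: dfn_eq; [exact: (polyf_venv_row m id)|exact: polyf_var].
  apply: dfn_le; last by apply: polyf_exp; exact: polyf_var.
  by apply: polyf_mul; [apply: polyf_exp; exact: polyf_var|exact: (polyf_venv_row m id)].
have [N [eps [/andP[e0 e1] h]]] := dfn_const_cusp (fun=> 0) dP.
exists N, eps; split; first by rewrite e0.
case: h => [h|h w x hw xr hf].
  exfalso; have h2 : 0 < eps / 2 < eps by apply/andP; split; lra.
  have h20 : 0 < eps / 2 by case/andP: h2.
  apply: (@no_slow_family rho (eps / 2) ((eps / 2) ^+ N)) => //; first exact: exprn_gt0.
  move=> t ht; have [x [hx [h3 h4]]] := h _ _ h2 ht.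
  by exists x; split => //; apply/mx_norm_le => // i j; rewrite ord1.
rewrite ltNge; apply/negP => hle; apply: (h w (f (venv x)) hw hf) => /=.
by exists x; split => // i; rewrite (le_trans _ xr)// mx_entry_le.
Qed.

End GradientInequality.

(** * Limits along ultrafilters and limits of matrices *)

Section Ultrafilters.

Lemma ultra_fmap (T U : Type) (f : T -> U) (F : set_system T) :
  UltraFilter F -> UltraFilter (f @ F).
Proof.
move=> uF; have pF : ProperFilter F by exact: ultra_proper.
apply: Build_UltraFilter => G pG FG; apply/seteqP; split; last exact: FG.
move=> A GA; have [//|nA] := in_ultra_setVsetC (f @^-1` A) uF.
have {}nA : G (~` A) by apply: FG.
by have : G set0 by [rewrite -(setICr A); exact: filterI]; move=> /filter_not_empty.
Qed.

Lemma ultra_nat : exists U : set_system nat, UltraFilter U /\ \oo `<=` U.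
Proof. by apply: ultraFilterLemma; exact: eventually_filter. Qed.

(** Along an ultrafilter every family in a compact set converges, so many limits exist at once
    without passing to subsequences. *)
Lemma ultra_lim (I : Type) (T : topologicalType) (U : set_system I) (u : I -> T) (A : set T) :
  UltraFilter U -> compact A -> U [set i | A (u i)] -> exists2 p, A p & u @ U --> p.
Proof.
move=> uU; rewrite compact_ultra => /(_ (u @ U)) h hA.
by have [p [Ap up]] := h (ultra_fmap _ uU) hA; exists p.
Qed.

End Ultrafilters.

Section MatrixLimits.
Variables (R : realType) (T : Type) (F : set_system T).
Context {FF : Filter F}.

Lemma cvg_mx m n (f : T -> 'M[R]_(m, n)) (M : 'M[R]_(m, n)) :
  (forall i j, (fun x => f x i j) @ F --> M i j) -> f @ F --> M.
Proof.
move=> h A [P hP PA]; rewrite /fmap /=.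
apply: (@filterS _ _ _ [set x | forall i j, P i j (f x i j)]).
  by move=> x hx; apply: PA.
apply: filter_forall => i; apply: filter_forall => j.
exact: (h i j (P i j) (hP i j)).
Qed.

Lemma cvg_coord m n (f : T -> 'M[R]_(m, n)) (M : 'M[R]_(m, n)) i j :
  f @ F --> M -> (fun x => f x i j) @ F --> M i j.
Proof.
move=> h; apply: (@cvg_comp _ _ _ f (fun M : 'M[R]_(m, n) => M i j) F (nbhs M)) => //.
exact: coord_continuous.
Qed.

Lemma cvgmxD m n (f g : T -> 'M[R]_(m, n)) (a b : 'M[R]_(m, n)) :
  f @ F --> a -> g @ F --> b -> (fun x => f x + g x) @ F --> a + b.
Proof. by move=> fa gb; exact: cvgD. Qed.

Lemma cvgmxB m n (f g : T -> 'M[R]_(m, n)) (a b : 'M[R]_(m, n)) :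
  f @ F --> a -> g @ F --> b -> (fun x => f x - g x) @ F --> a - b.
Proof. by move=> fa gb; exact: cvgB. Qed.

Lemma cvgmxZ m n (c : T -> R) (f : T -> 'M[R]_(m, n)) (k : R) (a : 'M[R]_(m, n)) :
  c @ F --> k -> f @ F --> a -> (fun x => c x *: f x) @ F --> k *: a.
Proof. by move=> ck fa; exact: cvgZ. Qed.

Lemma cvgmx_sum m n (I : Type) (r : seq I) (f : I -> T -> 'M[R]_(m, n)) (a : I -> 'M[R]_(m, n)) :
  (forall i, f i @ F --> a i) -> (fun x => \sum_(i <- r) f i x) @ F --> \sum_(i <- r) a i.
Proof.
move=> fa; elim: r => [|i r ih].
  by rewrite big_nil; under [X in X @ _ --> _]eq_fun do rewrite big_nil; exact: cvg_cst.
by rewrite big_cons; under [X in X @ _ --> _]eq_fun do rewrite big_cons; exact: cvgmxD.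
Qed.

Lemma cvgr_sum (I : Type) (r : seq I) (f : I -> T -> R) (a : I -> R) :
  (forall i, f i @ F --> a i) -> (fun x => \sum_(i <- r) f i x) @ F --> \sum_(i <- r) a i.
Proof.
move=> fa; elim: r => [|i r ih].
  by rewrite big_nil; under [X in X @ _ --> _]eq_fun do rewrite big_nil; exact: cvg_cst.
by rewrite big_cons; under [X in X @ _ --> _]eq_fun do rewrite big_cons; apply: cvgD.
Qed.

Lemma cvgmxM m n p (f : T -> 'M[R]_(m, n)) (g : T -> 'M[R]_(n, p)) (a : 'M[R]_(m, n)) (b : 'M[R]_(n, p)) :
  f @ F --> a -> g @ F --> b -> (fun x => f x *m g x) @ F --> a *m b.
Proof.
move=> fa gb; apply: cvg_mx => i j; rewrite mxE.
under [X in X @ _ --> _]eq_fun do rewrite mxE.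
by apply: cvgr_sum => k; apply: cvgM; exact: cvg_coord.
Qed.

Lemma cvgmxT m n (f : T -> 'M[R]_(m, n)) (a : 'M[R]_(m, n)) : f @ F --> a -> (fun x => (f x)^T) @ F --> a^T.
Proof.
move=> fa; apply: cvg_mx => i j; rewrite mxE.
by under [X in X @ _ --> _]eq_fun do rewrite mxE; exact: cvg_coord.
Qed.

Lemma cvgmx_tr n (f : T -> 'M[R]_n) (a : 'M[R]_n) : f @ F --> a -> (fun x => \tr (f x)) @ F --> \tr a.
Proof. by move=> fa; apply: cvgr_sum => i; exact: cvg_coord. Qed.

End MatrixLimits.

(** * Gradient descent onto the zero set of a nonnegative polynomial *)

Section Descent.
Variables (R : realType) (m : nat) (f : (nat -> R) -> R).
Hypothesis pf : polyf f.
Hypothesis f_ge0 : forall x : 'rV[R]_m, 0 <= f (venv x).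

Lemma root_exists N : exists rt : R -> R,
  forall y, 0 <= y -> 0 <= rt y /\ rt y ^+ N.+1 = y.
Proof.
exists (fun y => y `^ N.+1%:R^-1) => y y0; split; first exact: powR_ge0.
by rewrite -powR_mulrn ?powR_ge0// -powRrM mulVf ?powRr1.
Qed.

(* Gradient descent with a small constant step: the gradient inequality makes
   the length of each step at most a constant times the decrease of the root
   [w] with [w ^+ N.+1 = 2 * f], so that all trajectories converge uniformly. *)
Theorem zero_set_retract (rho0 : R) : exists2 tau : R, 0 < tau &
  exists D : 'rV[R]_m -> 'rV[R]_m, forall x, `|x| < rho0 -> f (venv x) < tau ->
    [/\ f (venv (D x)) = 0, f (venv x) = 0 -> D x = x & {for x, continuous D}].
Proof.
have [rho00|rho00] := ltP 0 rho0; last first.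
  exists 1 => //; exists id => x xr.
  by have := le_lt_trans (normr_ge0 x) (lt_le_trans xr rho00); rewrite ltxx.
have [G [pG tay]] := polyf_taylor m pf.
(* Trajectories from the ball of radius [rho0] move by at most [1] in total, so they stay where the
   estimates hold. *)
pose rho := rho0 + 2; have rho_ge0 : 0 <= rho by rewrite /rho; lra.
have [N0 [eps [/andP[e0 e1] hN0]]] := gradient_inequality pf pG tay rho_ge0.
(* Raising the exponent by one makes it positive, as taking the root requires, and keeps the
   inequality because [w < eps <= 1]. *)
pose N := N0.+1.
have hN (w : R) (x : 'rV[R]_m) : 0 < w < eps -> `|x| <= rho -> 0 < f (venv x) < w ^+ N ->
    f (venv x) ^+ 2 < w ^+ 2 * \sum_i G i (venv x) ^+ 2.
  move=> /andP[w0 we] xr /andP[f0 fw]; apply: hN0 => //; first by rewrite w0.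
  rewrite f0 (lt_le_trans fw)// ler_wiXn2l ?leqnSn ?(ltW w0)//.
  by rewrite (le_trans (ltW we)).
have [rt hrt] := root_exists N0.
pose w (x : 'rV[R]_m) := rt (2 * f (venv x)).
have w_ge0 x : 0 <= w x by apply: (hrt _ _).1; rewrite mulr_ge0.
have wN x : w x ^+ N = 2 * f (venv x) by apply: (hrt _ _).2; rewrite mulr_ge0.
(* The ratio of step length to decrease of [w]: [N] comes from factoring a difference of [N]-th
   powers, [2] from [w ^+ N = 2 * f]. *)
pose nn : R := 2 * N%:R; have nn0 : 0 < nn by rewrite mulr_gt0.
(* For [w] below [nn^-1] the total displacement, at most [nn * w], does not exceed [1]. *)
pose eps' := Num.min eps nn^-1.
have e'0 : 0 < eps' by rewrite lt_min e0 invr_gt0.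
pose tau := eps' ^+ N / 2.
have tau0 : 0 < tau by rewrite divr_gt0// exprn_gt0.
have w_lt x : f (venv x) < tau -> w x < eps'.
  move=> fx; rewrite -(@ltr_pXn2r _ N)// ?nnegrE ?(ltW e'0)// wN.
  by move: fx; rewrite /tau ltr_pdivlMr// mulrC.
have [M M0 hM] := tay rho.
have [B B0 hB] : exists2 B : R, 0 < B & forall (x : 'rV[R]_m) i, `|x| <= rho -> `|G i (venv x)| <= B.
  have /choice[b hb] : forall i, exists B : R, 0 < B /\ forall x : 'rV[R]_m, `|x| <= rho -> `|G i (venv x)| <= B.
    by move=> i; have [B B0 h] := polyf_bounded m rho (pG i); exists B.
  exists (1 + \sum_i b i); first by rewrite ltr_wpDr// sumr_ge0// => i _; case: (hb i) => /ltW.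
  move=> x i xr; apply: (le_trans ((hb i).2 x xr)).
  rewrite (bigD1 i)//= addrCA lerDl addr_ge0// sumr_ge0// => j _; by case: (hb j) => /ltW.
(* The first bound lets a step decrease [f] by [eta / 2] times the squared gradient; the second
   keeps the length of a step at most [1]. *)
pose eta := Num.min (2 * M)^-1 (B^-1).
have eta0 : 0 < eta by rewrite lt_min !invr_gt0 B0 mulr_gt0.
have etaM : M * eta <= 2^-1.
  have : eta <= (2 * M)^-1 by rewrite ge_min lexx.
  move=> /(ler_wpM2l (ltW M0)); rewrite invfM mulrCA divff ?lt0r_neq0// mulr1; exact.
have etaB : eta * B <= 1.
  have : eta <= B^-1 by rewrite ge_min lexx orbT.
  by move=> /(ler_wpM2r (ltW B0)); rewrite mulVf ?lt0r_neq0.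
pose g2 (x : 'rV[R]_m) := \sum_i G i (venv x) ^+ 2.
have g2_ge0 x : 0 <= g2 x by apply: sumr_ge0 => i _; exact: sqr_ge0.
pose grad (x : 'rV[R]_m) : 'rV[R]_m := \row_i G i (venv x).
pose step (x : 'rV[R]_m) := x - eta *: grad x.
have grad_le x : `|grad x| <= Num.sqrt (g2 x).
  apply/mx_norm_le; first exact: sqrtr_ge0.
  move=> i j; rewrite ord1 mxE -sqrtr_sqr ler_wsqrtr// /g2 (bigD1 j)//= lerDl.
  by apply: sumr_ge0 => k _; exact: sqr_ge0.
have step_f x : `|x| <= rho -> f (venv (step x)) <= f (venv x) - eta / 2 * g2 x.
  move=> xr; set u := - (eta *: grad x).
  have ur : `|u| <= rho.
    rewrite normrN normrZ gtr0_norm//; apply: (@le_trans _ _ (eta * B)).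
      rewrite ler_wpM2l ?(ltW eta0)//; apply/mx_norm_le; first exact: ltW.
      by move=> i j; rewrite ord1 mxE; exact: hB.
    by apply: (le_trans etaB); rewrite /rho; lra.
  have := hM x u xr ur.
  have -> : \sum_i G i (venv x) * u 0 i = - (eta * g2 x).
    rewrite /g2 mulr_sumr -sumrN; apply: eq_bigr => i _; rewrite !mxE; ring.
  have -> : x + u = step x by [].
  rewrite ler_norml opprK => /andP[_].
  have : M * `|u| ^+ 2 <= eta / 2 * g2 x.
    rewrite normrN normrZ gtr0_norm// exprMn.
    have -> : M * (eta ^+ 2 * `|grad x| ^+ 2) = eta * (M * eta) * `|grad x| ^+ 2 by ring.
    apply: ler_pM; rewrite ?mulr_ge0 ?sqr_ge0 ?(ltW eta0) ?(ltW M0)//.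
      by rewrite ler_wpM2l ?(ltW eta0).
    rewrite -(@sqr_sqrtr _ (g2 x))// ler_pXn2r ?nnegrE ?sqrtr_ge0//.
  lra.
have step_w x : `|x| <= rho -> f (venv x) < tau -> `|step x - x| <= nn * (w x - w (step x)).
  move=> xr ft; have sf := step_f x xr.
  have s_le : `|step x - x| <= eta * Num.sqrt (g2 x).
    rewrite /step addrC addKr normrN normrZ gtr0_norm//.
    by apply: ler_wpM2l; [exact: ltW|exact: grad_le].
  apply: (le_trans s_le).
  have [fx0|fx0] := eqVneq (f (venv x)) 0.
    (* A nonzero gradient at a zero of [f] would let a step make [f] negative. *)
    have g0 : g2 x = 0.
      apply/eqP; rewrite eq_le g2_ge0 andbT.
      have := f_ge0 (step x); move: sf; rewrite fx0 => h1 h2.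
      have : eta / 2 * g2 x <= 0 by lra.
      by rewrite pmulr_rle0// divr_gt0.
    have -> : step x = x.
      have : `|grad x| <= 0 by rewrite (le_trans (grad_le x))// g0 sqrtr0.
      by rewrite normr_le0 /step => /eqP ->; rewrite scaler0 subr0.
    by rewrite subrr mulr0 g0 sqrtr0 mulr0.
  have fxp : 0 < f (venv x) by rewrite lt_neqAle eq_sym fx0 f_ge0.
  have wx0 : 0 < w x.
    rewrite lt_neqAle w_ge0 andbT eq_sym; apply/eqP => w0; have := wN x.
    by rewrite w0 expr0n /= => h; move: fxp; lra.
  have wxe : w x < eps by rewrite (lt_le_trans (w_lt x ft))// ge_min lexx.
  have hg : f (venv x) ^+ 2 < w x ^+ 2 * g2 x.
    by apply: hN => //; [rewrite wx0|rewrite fxp wN; lra].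
  set s := Num.sqrt (g2 x).
  have s2 : s ^+ 2 = g2 x by rewrite sqr_sqrtr.
  have hws : f (venv x) < w x * s.
    rewrite -(@ltr_pXn2r _ 2)// ?nnegrE ?mulr_ge0 ?sqrtr_ge0//.
    by rewrite exprMn s2.
  have s0 : 0 < s.
    by have := lt_trans fxp hws; rewrite pmulr_rgt0.
  have ws : w x ^+ N0 < 2 * s.
    have : 2 * f (venv x) < 2 * (w x * s) by lra.
    by rewrite -wN exprS mulrCA ltr_pM2l.
  have fw : eta * g2 x <= w x ^+ N - w (step x) ^+ N by rewrite !wN; lra.
  have wle : w (step x) <= w x.
    rewrite -(@ler_pXn2r _ N)// ?nnegrE// -subr_ge0 (le_trans _ fw)//.
    by rewrite mulr_ge0 ?(ltW eta0).
  have h1 : w x ^+ N - w (step x) ^+ N <= (w x - w (step x)) * (N%:R * w x ^+ N0).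
    rewrite subrXX; apply: ler_wpM2l; first by rewrite subr_ge0.
    apply: (@le_trans _ _ (\sum_(i < N) w x ^+ N0)); last by rewrite sumr_const card_ord mulr_natl.
    apply: ler_sum => i _.
    have -> : w x ^+ N0 = w x ^+ (N0 - i) * w x ^+ i by rewrite -exprD subnK// -ltnS.
    rewrite ler_wpM2l ?exprn_ge0//.
    by case: (val i) => [//|k]; rewrite ler_pXn2r ?nnegrE.
  have h2 : (w x - w (step x)) * (N%:R * w x ^+ N0) <= (w x - w (step x)) * (N%:R * (2 * s)).
    by rewrite ler_wpM2l ?subr_ge0// ler_wpM2l// ltW.
  have h3 : (eta * s) * s <= (nn * (w x - w (step x))) * s.
    rewrite -mulrA -expr2 s2 (le_trans fw)// (le_trans h1)// (le_trans h2)//.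
    by rewrite le_eqVlt; apply/orP; left; apply/eqP; rewrite /nn; ring.
  by rewrite -(ler_pM2r s0).
have inv k x : `|x| < rho0 -> f (venv x) < tau ->
   [/\ `|iter k step x| <= rho, f (venv (iter k step x)) <= f (venv x) &
       `|iter k step x - x| <= nn * (w x - w (iter k step x))].
  move=> xr ft; elim: k => [|k [ih1 ih2 ih3]] /=.
    by rewrite !subrr mulr0 normr0; split => //; rewrite (le_trans (ltW xr))// /rho; lra.
  set y := iter k step x in ih1 ih2 ih3 *.
  have fy := le_lt_trans ih2 ft.
  have sw := step_w y ih1 fy.
  have sf : f (venv (step y)) <= f (venv x).
    apply: le_trans ih2; apply: (le_trans (step_f y ih1)).
    by rewrite gerBl mulr_ge0// divr_ge0// ltW.
  have dist : `|step y - x| <= nn * (w x - w (step y)).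
    have -> : step y - x = (step y - y) + (y - x) by rewrite addrA subrK.
    rewrite (le_trans (ler_normD _ _))// (le_trans (lerD sw ih3))//.
    by rewrite le_eqVlt; apply/orP; left; apply/eqP; ring.
  split => //.
  have : nn * (w x - w (step y)) <= 1.
    apply: (@le_trans _ _ (nn * nn^-1)); last by rewrite divff ?lt0r_neq0.
    rewrite ler_wpM2l ?(ltW nn0)//; apply: (@le_trans _ _ (w x)); first by rewrite gerBl.
    by rewrite (le_trans (ltW (w_lt x ft)))// ge_min lexx orbT.
  move=> hn; have -> : step y = (step y - x) + x by rewrite subrK.
  rewrite (le_trans (ler_normD _ _))//; move: dist xr hn; rewrite /rho; lra.
(* As long as [f > a], the gradient inequality with [w < 1] bounds the squared gradient below by
   [a ^+ 2]. Each step then lowers [f] by at least [c], which can happen at most [tau / c] times,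
   whatever the starting point. *)
have unif (e : R) : 0 < e -> exists k, forall x, `|x| < rho0 -> f (venv x) < tau ->
    nn * w (iter k step x) <= e.
  move=> ep; pose a := (e / nn) ^+ N / 2.
  have a0 : 0 < a by rewrite divr_gt0// exprn_gt0// divr_gt0.
  pose c := eta / 2 * a ^+ 2; have c0 : 0 < c by rewrite mulr_gt0 ?exprn_gt0// divr_gt0.
  pose k := (Num.truncn (tau / c)).+1.
  exists k => x xr ft.
  suff fk : f (venv (iter k step x)) <= a.
    rewrite mulrC -ler_pdivlMr// -(@ler_pXn2r _ N)// ?nnegrE ?divr_ge0 ?(ltW ep) ?(ltW nn0)//.
    by rewrite wN mulrC -ler_pdivlMr.
  rewrite leNgt; apply/negP => fk.
  have mono j : f (venv (iter j.+1 step x)) <= f (venv (iter j step x)) - eta / 2 * g2 (iter j step x).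
    by have [h _ _] := inv j x xr ft; exact: step_f.
  have above j : (j <= k)%N -> a < f (venv (iter j step x)).
    move=> jk; apply: (lt_le_trans fk); rewrite -(subnK jk); elim: (k - j)%N => [//|i ih].
    by rewrite addSn (le_trans (mono _))// (le_trans _ ih)// gerBl mulr_ge0// divr_ge0// ltW.
  have dec j : (j <= k)%N -> f (venv (iter j step x)) <= tau - j%:R * c.
    elim: j => [|j ih] jk; first by rewrite mul0r subr0 ltW.
    have fj := ih (ltnW jk).
    apply: (le_trans (mono j)).
    suff : c <= eta / 2 * g2 (iter j step x) by rewrite mulrS; lra.
    rewrite /c ler_wpM2l ?divr_ge0 ?(ltW eta0)//.
    have ay := above j (ltnW jk).
    have [yr yf _] := inv j x xr ft; set y := iter j step x in fj yr yf ay *.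
    have fy0 := lt_trans a0 ay.
    have wy := w_lt y (le_lt_trans yf ft).
    have wy0 : 0 < w y.
      rewrite lt_neqAle w_ge0 andbT eq_sym; apply/eqP => w0; have := wN y.
      by rewrite w0 expr0n /= => h; move: fy0; lra.
    have wye : w y < eps by rewrite (lt_le_trans wy)// ge_min lexx.
    have : f (venv y) ^+ 2 < w y ^+ 2 * g2 y.
      by apply: hN => //; [rewrite wy0|rewrite fy0 wN; lra].
    have : w y ^+ 2 * g2 y <= g2 y.
      by rewrite ler_piMl// expr_le1// (le_trans (ltW wye)).
    have : a ^+ 2 <= f (venv y) ^+ 2 by rewrite ler_pXn2r ?nnegrE ?(ltW a0) ?(ltW fy0)// ltW.
    lra.
  have h1 := dec k (leqnn k).
  have : tau / c < k%:R by exact: truncnS_gt.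
  rewrite ltr_pdivrMr//; lra.
have [U [uU ooU]] := ultra_nat; have pU : ProperFilter U by exact: ultra_proper.
have ballC : compact [set x : 'rV[R]_m | `|x| <= rho].
  apply: bounded_closed_compact.
    exists rho; split; first by rewrite realE rho_ge0.
    by move=> b rb x xr; exact: (le_trans xr (ltW rb)).
  apply: (@closed_comp _ _ (fun x : 'rV[R]_m => `|x|) [set s | s <= rho]); last exact: closed_le.
  by move=> x _; exact: norm_continuous.
have /choice[D hD] : forall x : 'rV[R]_m, exists y : 'rV[R]_m, `|x| < rho0 -> f (venv x) < tau ->
    (fun k => iter k step x) @ U --> y.
  move=> x; have [xr|] := boolP (`|x| < rho0); last by exists 0.
  have [ft|] := boolP (f (venv x) < tau); last by exists 0.
  have [y _ hy] : exists2 y, [set x : 'rV[R]_m | `|x| <= rho] y & (fun k => iter k step x) @ U --> y.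
    apply: ultra_lim => //; apply: filterS (filterT : U setT) => k _ /=.
    by have [] := inv k x xr ft.
  by exists y.
have tail k x : `|x| < rho0 -> f (venv x) < tau -> `|D x - iter k step x| <= nn * w (iter k step x).
  move=> xr ft; set y := iter k step x; set e := nn * w y.
  have hc : (fun j => `|iter j step x - y|) @ U --> `|D x - y|.
    apply: cvg_norm; apply: cvgB; [exact: hD|exact: cvg_cst].
  apply: (@closed_cvg _ _ U _ (fun j => `|iter j step x - y|) [set s | s <= e] (@closed_le _ e) _ _ hc).
  apply: ooU; exists k => // j /= kj.
  rewrite -(subnK kj) addnC iterD -/y.
  have tr i : `|iter i step y - y| <= nn * (w y - w (iter i step y)).
    elim: i => [|i ih] /=; first by rewrite !subrr normr0 mulr0.
    have Ey : iter i step y = iter (i + k) step x by rewrite iterD.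
    have [zr zf _] := inv (i + k)%N x xr ft; rewrite -Ey in zr zf.
    have sw := step_w _ zr (le_lt_trans zf ft).
    have -> : step (iter i step y) - y = (step (iter i step y) - iter i step y) + (iter i step y - y) by rewrite addrA subrK.
    rewrite (le_trans (ler_normD _ _))// (le_trans (lerD sw ih))//.
    by rewrite le_eqVlt; apply/orP; left; apply/eqP; ring.
  rewrite -iterD addnC iterD -/y; apply: (le_trans (tr _)).
  by rewrite /e ler_wpM2l ?(ltW nn0)// gerBl.
have Dk (e : R) : 0 < e -> exists k, forall x, `|x| < rho0 -> f (venv x) < tau ->
    `|D x - iter k step x| <= e.
  move=> /unif[k hk]; exists k => x xr ft; exact: (le_trans (tail k x xr ft) (hk x xr ft)).
exists tau => //; exists D => x xr ft; split.
- have hc : (fun k => f (venv (iter k step x))) @ U --> f (venv (D x)).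
    apply: (@cvg_comp _ _ _ (fun k => iter k step x) (fun y => f (venv y)) U (nbhs (D x))) => //.
      exact: hD.
    exact: polyf_continuous.
  apply/eqP; rewrite eq_le f_ge0 andbT leNgt; apply/negP => fD.
  have [r0 rN] := hrt _ (ltW fD).
  have r_gt0 : 0 < rt (f (venv (D x))).
    rewrite lt_neqAle r0 andbT eq_sym; apply/eqP => h0.
    by move: rN fD; rewrite h0 expr0n /= => <-; rewrite ltxx.
  have [k hk] := unif (nn * rt (f (venv (D x)))) (mulr_gt0 nn0 r_gt0).
  have {}hk := hk x xr ft; rewrite ler_pM2l// in hk.
  have fk : 2 * f (venv (iter k step x)) <= f (venv (D x)).
    by rewrite -wN -rN ler_pXn2r ?nnegrE.
  have : f (venv (D x)) <= f (venv (iter k step x)).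
    apply: (@closed_cvg _ _ U _ _ [set s | s <= _] (@closed_le _ _) _ _ hc).
    apply: ooU; exists k => // j /= kj.
    rewrite -(subnK kj); elim: (j - k)%N => [//|i ih].
    rewrite addSn; apply: le_trans ih; rewrite iterS.
    have [yr _ _] := inv (i + k)%N x xr ft.
    by apply: (le_trans (step_f _ yr)); rewrite gerBl mulr_ge0// divr_ge0// ltW.
  by lra.
- move=> fx0; have := tail 0%N x xr ft; rewrite /= (_ : w x = 0).
    by rewrite mulr0 normr_le0 subr_eq0 => /eqP.
  by apply/eqP; have /eqP := wN x; rewrite fx0 mulr0 expf_eq0.
- have stepc : continuous step.
    move=> y; apply: (@cvgmxB _ _ (nbhs y) _ _ _ (fun x => x)); first exact: cvg_id.
    apply: (@cvgmxZ _ _ (nbhs y) _ _ _ (fun=> eta) grad); first exact: cvg_cst.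
    apply: (@cvg_mx _ _ (nbhs y)) => i j.
    rewrite mxE (_ : (fun x => _) = fun x : 'rV[R]_m => G j (venv x)).
      exact: polyf_continuous.
    by apply/funext => x'; rewrite mxE.
  have itc k : continuous (iter k step).
    elim: k => [|k ih] y /=; first exact: cvg_id.
    exact: (continuous_comp (ih y) (stepc _)).
  apply/(@cvgrPdist_le R 'rV[R]_m 'rV[R]_m (nbhs x) _ D (D x)) => e ep.
  have e3 : 0 < e / 3 by rewrite divr_gt0.
  have [k hk] := Dk (e / 3) e3.
  have nx : \forall y \near x, `|y| < rho0.
    by apply: (@cvgr_lt R _ (nbhs x) _ (fun y : 'rV[R]_m => `|y|) `|x|) => //; exact: norm_continuous.
  have nf : \forall y \near x, f (venv y) < tau.
    by apply: (@cvgr_lt R _ (nbhs x) _ (fun y : 'rV[R]_m => f (venv y)) (f (venv x))) => //; exact: polyf_continuous.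
  have nk : \forall y \near x, `|iter k step x - iter k step y| <= e / 3.
    by have /(@cvgrPdist_le R 'rV[R]_m 'rV[R]_m (nbhs x) _ (iter k step) (iter k step x)) := itc k x; apply.
  near=> y.
  have yr : `|y| < rho0 by near: y.
  have fy : f (venv y) < tau by near: y.
  have yk : `|iter k step x - iter k step y| <= e / 3 by near: y.
  have hx := hk x xr ft; have hy := hk y yr fy.
  have -> : D x - D y = (D x - iter k step x) + (iter k step x - iter k step y) - (D y - iter k step y).
    by rewrite addrA subrK opprB addrA subrK.
  rewrite (le_trans (ler_normB _ _))// (le_trans (lerD (ler_normD _ _) (lexx _)))//.
  by rewrite (le_trans (lerD (lerD hx yk) hy))//; lra.
Unshelve. all: by end_near. Qed.

End Descent.

(** * Cells: equations and strict inequalities *)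

Section Cells.
Variable R : realType.
Local Notation env := (nat -> R).
Local Notation cell := ((env -> R) * seq (env -> R))%type.

Definition in_cell (c : cell) (e : env) : Prop :=
  c.1 e = 0 /\ forall q, List.In q c.2 -> 0 < q e.
Definition poly_cell (c : cell) : Prop := polyf c.1 /\ forall q, List.In q c.2 -> polyf q.

(** Disjunctive normal form with a single equation per cell: several equations merge into a sum of
    squares. *)
Definition cells_of (P : env -> Prop) := exists cs : seq cell,
  (forall c, List.In c cs -> poly_cell c) /\
  forall e, P e <-> exists c, List.In c cs /\ in_cell c e.

Lemma cells_or P Q : cells_of P -> cells_of Q -> cells_of (fun e => P e \/ Q e).
Proof.
move=> [c1 [p1 h1]] [c2 [p2 h2]]; exists (c1 ++ c2); split.
  by move=> c /List.in_app_iff[/p1|/p2].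
move=> e; split.
  by move=> [/h1[c [? ?]]|/h2[c [? ?]]]; exists c; split=> //; apply/List.in_app_iff; [left|right].
by move=> [c [/List.in_app_iff[?|?] ?]]; [left; apply/h1|right; apply/h2]; exists c.
Qed.

Lemma cells_and1 (c : cell) (cs : seq cell) : poly_cell c -> (forall c, List.In c cs -> poly_cell c) ->
  cells_of (fun e => in_cell c e /\ exists c', List.In c' cs /\ in_cell c' e).
Proof.
move=> [pc1 pc2] pcs.
exists (List.map (fun c' : cell => ((fun e => c.1 e ^+ 2 + c'.1 e ^+ 2), c.2 ++ c'.2)) cs); split.
  move=> _ /List.in_map_iff[c' [<- /pcs[p1 p2]]]; split => /=.
    by apply: polyf_add; exact: polyf_exp.
  by move=> q /List.in_app_iff[/pc2|/p2].
move=> e; split.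
  move=> [[h1 h2] [c' [cin [h1' h2']]]].
  exists (fun e => c.1 e ^+ 2 + c'.1 e ^+ 2, c.2 ++ c'.2); split.
    by apply/List.in_map_iff; exists c'.
  split => /=; first by rewrite h1 h1' !expr0n addr0.
  by move=> q /List.in_app_iff[/h2|/h2'].
move=> [_ [/List.in_map_iff[c' [<- cin]] [/= h1 h2]]].
have := h1; move=> /eqP; rewrite paddr_eq0 ?sqr_ge0// !sqrf_eq0 => /andP[/eqP k1 /eqP k2].
split; first by split => // q hq; apply: h2; apply/List.in_app_iff; left.
by exists c'; split => //; split => // q hq; apply: h2; apply/List.in_app_iff; right.
Qed.

Lemma cells_ext P Q : cells_of P -> (forall e, P e <-> Q e) -> cells_of Q.
Proof.
by move=> h PQ; rewrite (_ : Q = P)//; apply/funext => e; apply/propext; split => /PQ.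
Qed.

Lemma cells_false : cells_of (fun=> False).
Proof. by exists [::]; split => // e; split => // -[c []]. Qed.

Lemma cells_and P Q : cells_of P -> cells_of Q -> cells_of (fun e => P e /\ Q e).
Proof.
move=> [c1 [p1 h1]] [c2 [p2 h2]].
apply: (@cells_ext (fun e => (exists c, List.In c c1 /\ in_cell c e) /\ exists c, List.In c c2 /\ in_cell c e)); last first.
  by move=> e; split => -[/h1 ? /h2 ?].
elim: c1 p1 {h1} => [_|c c1 ih p1].
  by apply: cells_ext cells_false _ => e; split => // -[[? []]].
have ih' := ih (fun c' hc => p1 c' (or_intror hc)).
apply: cells_ext (cells_or (cells_and1 (p1 c (or_introl erefl)) p2) ih') _ => e; split.
  move=> [[a b]|[[c' [a b]] d]]; first by split => //; exists c; split => //; left.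
  by split => //; exists c'; split => //; right.
move=> [[c' [[<-|a] b]] d]; [by left|].
by right; split => //; exists c'.
Qed.

Lemma qf_cells P : qf P -> cells_of P /\ cells_of (fun e => ~ P e).
Proof.
elim=> [p hp|P1 P2 _ [h1 n1] _ [h2 n2]|P1 _ [h1 n1]].
- split.
    exists [:: ((fun=> 0), [:: p])]; split.
      by move=> c /= [<-|//]; split => [|q /= [<-|]//]; exact: polyf_cst.
    move=> e; split; last by move=> [c [/= [<-|//] [_ /=]]]; apply; left.
    move=> pe; exists ((fun=> 0), [:: p]); split; first by left.
    by split => // q /= [<-|].
  exists [:: (p, [::]); ((fun=> 0), [:: (fun e => - p e)])]; split.
    move=> c /= [<-|[<-|//]]; split => //=; first exact: polyf_cst.
    by move=> q [<-|//]; exact: polyf_opp.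
  move=> e; split.
    move=> /negP; rewrite -leNgt le_eqVlt => /predU1P[pe|pe].
      by exists (p, [::]); split => //; left.
    exists ((fun=> 0), [:: (fun e => - p e)]); split; first by right; left.
    by split=> //= q [<-|//]; rewrite oppr_gt0.
  move=> [c [/= [<-|[<-|//]] [/= h1 h2]]]; first by rewrite h1 ltxx.
  have := h2 _ (or_introl erefl); rewrite oppr_gt0 => h3 h4.
  by have := lt_trans h3 h4; rewrite ltxx.
- split; first exact: cells_and.
  apply: cells_ext (cells_or n1 n2) _ => e; split; first by move=> [h|h] [].
  by move=> /not_andP.
- split => //; apply: cells_ext h1 _ => e; split; first by move=> ? /(_ _).
  exact: contrapT.
Qed.

End Cells.

Section MaxLimits.
Variables (R : realType) (T : Type) (F : set_system T).
Context {FF : Filter F}.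

Lemma cvg_maxr (f g : T -> R) (a b : R) : f @ F --> a -> g @ F --> b ->
  (fun x => Num.max (f x) (g x)) @ F --> Num.max a b.
Proof.
move=> fa gb; rewrite maxr_absE; under [X in X @ _ --> _]eq_fun do rewrite maxr_absE.
by apply: cvgM; [apply: cvgD; [exact: cvgD|apply: cvg_norm; exact: cvgB]|exact: cvg_cst].
Qed.

Lemma cvg_minr (f g : T -> R) (a b : R) : f @ F --> a -> g @ F --> b ->
  (fun x => Num.min (f x) (g x)) @ F --> Num.min a b.
Proof.
move=> fa gb; rewrite minr_absE; under [X in X @ _ --> _]eq_fun do rewrite minr_absE.
by apply: cvgM; [apply: cvgB; [exact: cvgD|apply: cvg_norm; exact: cvgB]|exact: cvg_cst].
Qed.

End MaxLimits.

(** * Compact definable sets are neighbourhood retracts *)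

Section NeighbourhoodRetract.
Variable R : realType.
Local Notation env := (nat -> R).

Definition nbhd_retract (V : topologicalType) (S : set V) :=
  exists (U : set V) (r : V -> V), [/\ open U, S `<=` U,
    (forall x, U x -> {for x, continuous r}), (forall x, U x -> S (r x)) &
    (forall x, S x -> r x = x)].

Variables (m : nat) (S : set 'rV[R]_m).
Hypothesis cS : compact S.
Hypothesis dS : dfn (fun e => S (\row_(i < m) e i)).

Lemma row_venv (x : 'rV[R]_m) : \row_(i < m) venv x i = x.
Proof. by apply/rowP => i; rewrite mxE venvE. Qed.

Lemma polyf_closed_ge (p : env -> R) (c : R) : polyf p -> closed [set x : 'rV[R]_m | c <= p (venv x)].
Proof.
move=> hp; apply: (@closed_comp _ _ (fun x : 'rV[R]_m => p (venv x)) [set y | c <= y]); last exact: closed_ge.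
by move=> x _; exact: polyf_continuous.
Qed.

(* A cell of the complement of [S], thickened by a Lojasiewicz inequality
   between its equation and the product of its inequalities, still misses [S]. *)
Lemma cell_lojasiewicz (p : env -> R) (qs : seq (env -> R)) : poly_cell (p, qs) ->
  (forall x : 'rV[R]_m, in_cell (p, qs) (venv x) -> ~ S x) ->
  exists (M : R) N, 0 < M /\ forall x, S x -> (forall q, List.In q qs -> 0 < q (venv x)) ->
    (\prod_(q <- qs) q (venv x)) ^+ N <= M * p (venv x) ^+ 2.
Proof.
move=> [/= hp hqs] dis.
pose Pi (e : env) := \prod_(q <- qs) q e.
have hPi : polyf Pi.
  rewrite /Pi; elim: qs hqs {dis Pi} => [_|q l ih h].
    by under [X in polyf X]eq_fun do rewrite big_nil; exact: polyf_cst.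
  under [X in polyf X]eq_fun do rewrite big_cons.
  by apply: polyf_mul; [apply: h; left|apply: ih => q' hq'; apply: h; right].
have Pi_pos e : (forall q, List.In q qs -> 0 < q e) -> 0 < Pi e.
  rewrite /Pi; elim: (qs) => [_|q l ih h]; first by rewrite big_nil.
  by rewrite big_cons mulr_gt0//; [apply: h; left|apply: ih => q' hq'; apply: h; right].
have Pi_pos' e : (forall q, List.In q qs -> 0 <= q e) -> 0 < Pi e -> forall q, List.In q qs -> 0 < q e.
  rewrite /Pi; elim: (qs) => [//|q l ih h]; rewrite big_cons => hq q' /= qin.
  have q0 : q e != 0 by apply: contraTneq hq => ->; rewrite mul0r ltxx.
  have qp : 0 < q e by rewrite lt_neqAle eq_sym q0 h//; left.
  case: qin => [<-//|]; apply: ih; first by move=> q'' hq''; apply: h; right.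
  by rewrite -(pmulr_rgt0 _ qp).
have low (t : R) : 0 < t -> exists2 c : R, 0 < c & forall x, S x -> (forall q, List.In q qs -> 0 < q (venv x)) ->
     t <= Pi (venv x) -> c <= p (venv x) ^+ 2.
  move=> t0; pose A := S `&` ([set x : 'rV[R]_m | forall q, List.In q qs -> 0 <= q (venv x)] `&` [set x : 'rV[R]_m | t <= Pi (venv x)]).
  have cA : compact A.
    apply: compact_closedI => //; apply: closedI; last exact: polyf_closed_ge.
    elim: (qs) hqs => [_|q l ih h].
      rewrite (_ : mkset _ = setT); first exact: closedT.
      by apply/seteqP; split => // x _ q [].
    rewrite (_ : mkset _ = [set x : 'rV[R]_m | 0 <= q (venv x)] `&` [set x : 'rV[R]_m | forall q, List.In q l -> 0 <= q (venv x)]).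
      apply: closedI; first by apply: polyf_closed_ge; apply: h; left.
      by apply: ih => q' hq'; apply: h; right.
    apply/seteqP; split => x /= hx.
      by split; [apply: hx; left|move=> q' hq'; apply: hx; right].
    by move=> q' [<-|]; [case: hx|apply: hx.2].
  have [A0|/set0P A0] := eqVneq A set0.
    exists 1 => // x Sx hx tx; have : A x by split=> //; split => // q /hx /ltW.
    by rewrite A0.
  have cp : continuous (fun x : 'rV[R]_m => p (venv x) ^+ 2).
    by apply: (@polyf_continuous _ _ (fun e => p e ^+ 2)); exact: polyf_exp.
  have [x] := compact_EVT_min A0 cA (continuous_subspaceT cp).
  rewrite inE => -[Sx [hx tx]] xmin.
  exists (p (venv x) ^+ 2); last first.
    by move=> y Sy hy ty; apply: xmin; rewrite inE; split => //; split => // q /hy /ltW.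
  rewrite lt_neqAle sqr_ge0 andbT eq_sym sqrf_eq0; apply/eqP => px0.
  apply: (dis x) => //; split => //=.
  by apply: Pi_pos' => //; exact: lt_le_trans tx.
have dP : dfn (fun e => exists x : 'rV[R]_m, S x /\ ((forall i : 'I_(size qs), 0 < nth (fun=> 0) qs i (venv x)) /\
    (e 0%N <= Pi (venv x) /\ p (venv x) ^+ 2 <= e 1%N))).
  have hn i : polyf (nth (fun=> 0) qs i).
    elim: (qs) hqs i => [_ i|q l ih h [|i]] /=; first by rewrite nth_nil; exact: polyf_cst.
      by apply: h; left.
    by apply: ih => q' hq'; apply: h; right.
  apply: dfn_exV; apply: dfn_and; first exact: dS.
  apply: dfn_and.
    by apply: dfn_allI => i; apply: dfn_lt; [exact: polyf_cst|exact: (polyf_venv_row m id)].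
  apply: dfn_and; first by apply: dfn_le; [exact: polyf_var|exact: (polyf_venv_row m id)].
  apply: dfn_le; last exact: polyf_var.
  by apply: polyf_exp; exact: (polyf_venv_row m id).
have nthP (x : 'rV[R]_m) : (forall q, List.In q qs -> 0 < q (venv x)) <->
    (forall i : 'I_(size qs), 0 < nth (fun=> 0) qs i (venv x)).
  split.
    move=> h i; apply: h; case: i => i /=; elim: (qs) i => [//|q l ih [|i]] /= hi; first by left.
    by right; apply: ih.
  elim: (qs) => [//|q l ih] h q' /= [<-|]; first exact: (h ord0).
  by apply: ih => i; exact: (h (lift ord0 i)).
have [N [eps [/andP[e0 e1] hcusp]]] := dfn_const_cusp (fun=> 0) dP.
have {}hcusp t s : 0 < t < eps -> 0 < s < t ^+ N ->
  ~ exists x : 'rV[R]_m, S x /\ ((forall i : 'I_(size qs), 0 < nth (fun=> 0) qs i (venv x)) /\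
    (t <= Pi (venv x) /\ p (venv x) ^+ 2 <= s)).
  case: hcusp => [h|]; last by move=> h ht hs; exact: (h t s ht hs).
  exfalso; have [c c0 hc] := low (eps / 2) (divr_gt0 e0 (ltr0n _ 2)).
  have t0 : 0 < eps / 2 < eps by apply/andP; split; lra.
  have tN : 0 < (eps / 2) ^+ N by apply: exprn_gt0; case/andP: t0.
  have mm : 0 < Num.min c ((eps / 2) ^+ N) by rewrite lt_min c0.
  have m1 : Num.min c ((eps / 2) ^+ N) <= c by rewrite ge_min lexx.
  have m2 : Num.min c ((eps / 2) ^+ N) <= (eps / 2) ^+ N by rewrite ge_min lexx orbT.
  have [|x [Sx [/nthP hq [h1 h2]]]] := h (eps / 2) (Num.min c ((eps / 2) ^+ N) / 2) t0.
    by apply/andP; split; lra.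
  have := hc x Sx hq h1; move: h2 => /=; lra.
have [c c0 hc] := low (eps / 2) (divr_gt0 e0 (ltr0n _ 2)).
have [Bd Bd0 hBd] : exists2 B : R, 0 < B & forall x, S x -> Pi (venv x) <= B.
  have [S0|/set0P S0] := eqVneq S set0; first by exists 1 => // x; rewrite S0.
  have [x _ xmax] := compact_EVT_max S0 cS (continuous_subspaceT (polyf_continuous hPi)).
  exists (`|Pi (venv x)| + 1); first by rewrite ltr_wpDl.
  move=> y Sy; rewrite (le_trans (xmax y _)) ?inE// (le_trans (ler_norm _))// lerDl//.
(* The summand [1] serves the cusp, where [Pi < eps]; the other one serves [Pi >= eps], where
   [p ^+ 2] is at least [c]. *)
exists (1 + Bd ^+ N / c), N; split.
  by rewrite addr_gt0// divr_gt0// exprn_gt0.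
move=> x Sx hx; rewrite -/(Pi _).
have Pp := Pi_pos _ hx.
have BNc : 0 <= Bd ^+ N / c by rewrite divr_ge0 ?exprn_ge0// ltW.
have [tl|tl] := ltP (Pi (venv x)) eps.
  apply: (@le_trans _ _ (p (venv x) ^+ 2)); last by rewrite mulrDl mul1r lerDl mulr_ge0 ?sqr_ge0.
  rewrite leNgt; apply/negP => plt.
  set T := Pi (venv x) ^+ N in plt.
  have T0 : 0 < T by rewrite exprn_gt0.
  apply: (hcusp (Pi (venv x)) (Num.max (p (venv x) ^+ 2) (T / 2))).
  - by rewrite Pp.
  - rewrite lt_max gt_max plt -/T; apply/andP; split; first by apply/orP; right; lra.
    by rewrite /=; lra.
  - by exists x; split => //; split; [exact/nthP|split => //; rewrite le_max lexx].
have h1 : c <= p (venv x) ^+ 2 by apply: hc => //; lra.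
apply: (@le_trans _ _ (Bd ^+ N)).
  have hB := hBd x Sx; case: (N) => [//|k].
  by rewrite ler_pXn2r ?nnegrE ?(ltW Pp) ?(ltW Bd0).
rewrite mulrDl; apply: ler_wpDl; first by rewrite mul1r sqr_ge0.
by rewrite mulrAC ler_pdivlMr// ler_wpM2l// exprn_ge0// ltW.
Qed.

(** The complement of [S] is a finite union of cells. Each cell, thickened to the open set where its
    [q] are positive and [M * p ^+ 2] is less than the [N]-th power of their product, still misses
    [S], and the complement of a thickened cell is a finite union of conditions [0 <= g]. *)
Lemma closed_description : exists Ls : seq (seq (env -> R)),
  (forall L, List.In L Ls -> forall g, List.In g L -> polyf g) /\
  forall x : 'rV[R]_m, S x <-> forall L, List.In L Ls -> exists g, List.In g L /\ 0 <= g (venv x).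
Proof.
have [_ [cs [pcs hcs]]] := qf_cells (dfn_qf dS).
have /choice[L hL] : forall c, exists L : seq (env -> R), List.In c cs ->
    (forall g, List.In g L -> polyf g) /\
    forall x : 'rV[R]_m, (S x -> exists g, List.In g L /\ 0 <= g (venv x)) /\
       (in_cell c (venv x) -> ~ exists g, List.In g L /\ 0 <= g (venv x)).
  move=> [p qs]; have [hin|hin] := pselect (List.In (p, qs) cs); last by exists [::].
  have pc := pcs _ hin.
  have dis (x : 'rV[R]_m) : in_cell (p, qs) (venv x) -> ~ S x.
    by move=> hx; rewrite -[X in S X]row_venv; apply/hcs; exists (p, qs).
  have [M [N [M0 hM]]] := cell_lojasiewicz pc dis.
  pose g0 (e : env) := M * p e ^+ 2 - (\prod_(q <- qs) q e) ^+ N.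
  exists (g0 :: List.map (fun q e => - q e) qs) => _; split.
    move=> g /= [<-|/List.in_map_iff[q [<- hq]]]; last by apply: polyf_opp; exact: pc.2.
    apply: polyf_sub; first by apply: polyf_mul; [exact: polyf_cst|apply: polyf_exp; exact: pc.1].
    apply: polyf_exp; elim: (qs) (pc.2 : forall q, List.In q qs -> polyf q) => [_|q l ih h].
      by under [X in polyf X]eq_fun do rewrite big_nil; exact: polyf_cst.
    under [X in polyf X]eq_fun do rewrite big_cons.
    by apply: polyf_mul; [apply: h; left|apply: ih => q' hq'; apply: h; right].
  move=> x; split.
    move=> Sx; have [h|] := pselect (forall q, List.In q qs -> 0 < q (venv x)).
      exists g0; split; first by left.
      by rewrite /g0 subr_ge0; exact: hM.
    move=> /existsNP[q /not_implyP[hq /negP]]; rewrite -leNgt => qx.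
    exists (fun e => - q e); split; last by rewrite oppr_ge0.
    by right; apply/List.in_map_iff; exists q.
  move=> [/= p0 hq] [g [[<-|/List.in_map_iff[q [<- qin]]]]].
    rewrite /g0 p0 expr0n mulr0 sub0r oppr_ge0 leNgt exprn_gt0//.
    elim: (qs) hq => [_|q l ih h]; first by rewrite big_nil.
    by rewrite big_cons mulr_gt0//; [apply: h; left|apply: ih => q' hq'; apply: h; right].
  by rewrite oppr_ge0 leNgt hq.
exists (List.map L cs); split.
  by move=> _ /List.in_map_iff[c [<- hc]]; exact: (hL c hc).1.
move=> x; split.
  by move=> Sx _ /List.in_map_iff[c [<- hc]]; exact: ((hL c hc).2 x).1.
move=> h; apply: contrapT; rewrite -[X in S X]row_venv => /hcs[c [hc hx]].
apply: (((hL c hc).2 x).2 hx); apply: h.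
by apply/List.in_map_iff; exists c.
Qed.

(** One slack variable per list [L c]: the product of the squared differences between the [g] in
    [L c] and the square of the slack variable vanishes exactly when some [g] equals that square.
    The square root of the largest [g] gives a continuous map [sg] that sends [S] into the zero set,
    so descent can be started at [sg x] for [x] near [S]. *)
Theorem compact_definable_nbhd_retract : nbhd_retract S.
Proof.
have [Ls [pLs hLs]] := closed_description.
pose k := size Ls; pose L (c : 'I_k) := nth [::] Ls c.
have Lin (c : 'I_k) : List.In (L c) Ls.
  rewrite /L; case: c => i; rewrite /k; elim: (Ls) i => [//|l s' ih [|i]] /= hi; first by left.
  by right; exact: ih.
have inL l : List.In l Ls -> exists c : 'I_k, l = L c.
  rewrite /L /k; elim: (Ls) => [//|l' s' ih] /= [<-|/ih[c ->]]; first by exists ord0.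
  by exists (lift ord0 c).
have pL c g : List.In g (L c) -> polyf g by move=> hg; exact: (pLs _ (Lin c)).
have {}hLs x : S x <-> forall c, exists g, List.In g (L c) /\ 0 <= g (venv x).
  rewrite hLs; split => [h c|h l /inL[c ->]//]; exact: h.
(* A [g] may mention indices beyond the first [m]. They vanish under [venv] in dimension [m] but
   hold slack variables in dimension [m + k], so [restr] resets them to [0]. *)
pose restr (e : env) : env := fun i => if (i < m)%N then e i else 0.
have prestr p : polyf p -> polyf (fun e => p (restr e)).
  move=> hp; apply: (polyf_subst (s := fun i e => restr e i) hp) => i; rewrite /restr.
  by case: (i < m)%N; [exact: polyf_var|exact: polyf_cst].
pose fac (c : 'I_k) (g : env -> R) (e : env) := (g (restr e) - e (m + c)%N ^+ 2) ^+ 2.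
pose f (e : env) := \sum_c \prod_(g <- L c) fac c g e.
have pf : polyf f.
  apply: polyf_sum => c; elim: (L c) (pL c) => [_|g l ih h].
    by under [X in polyf X]eq_fun do rewrite big_nil; exact: polyf_cst.
  under [X in polyf X]eq_fun do rewrite big_cons.
  apply: polyf_mul; last by apply: ih => g' hg'; apply: h; right.
  apply: polyf_exp; apply: polyf_sub; first by apply: prestr; apply: h; left.
  by apply: polyf_exp; exact: polyf_var.
have prod_ge0 c e : 0 <= \prod_(g <- L c) fac c g e by apply: prodr_ge0 => g _; exact: sqr_ge0.
have f_ge0 (z : 'rV[R]_(m + k)) : 0 <= f (venv z) by apply: sumr_ge0.
have prod0 c e (l : seq (env -> R)) : \prod_(g <- l) fac c g e = 0 <-> exists g, List.In g l /\ fac c g e = 0.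
  elim: l => [|g l ih].
    by rewrite big_nil; split => [/eqP|[g []//]]; rewrite oner_eq0.
  rewrite big_cons; split.
    move=> /eqP; rewrite mulf_eq0 => /orP[/eqP h|/eqP/ih[g' [h1 h2]]].
      by exists g; split => //; left.
    by exists g'; split => //; right.
  move=> [g' [[<-|h1] h2]]; first by rewrite h2 mul0r.
  by rewrite (ih.2 _) ?mulr0//; exists g'.
have restrE (z : 'rV[R]_(m + k)) : restr (venv z) = venv (lsubmx z).
  apply/funext => i; rewrite /restr; case: ltnP => im; last first.
    by rewrite /venv insubF// ltnNge im.
  have -> : i = Ordinal im by [].
  rewrite [RHS]venvE mxE; exact: (venvE z (lshift k (Ordinal im))).
have yE (z : 'rV[R]_(m + k)) (c : 'I_k) : venv z (m + c)%N = rsubmx z 0 c.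
  by rewrite mxE; exact: (venvE z (rshift m c)).
(* The base value [-1] is never the maximum when some [g] is nonnegative, and it covers an empty
   list. *)
pose h (c : 'I_k) (x : 'rV[R]_m) := foldr (fun g a => Num.max (g (venv x)) a) (-1) (L c).
have hc c : continuous (h c).
  rewrite /h; elim: (L c) (pL c) => [_|g l ih hl] x /=; first exact: cst_continuous.
  have g1 : (fun x : 'rV[R]_m => g (venv x)) @ nbhs x --> g (venv x).
    by apply: polyf_continuous; apply: hl; left.
  have g2 : (fun x : 'rV[R]_m => foldr (fun g a => Num.max (g (venv x)) a) (-1) l) @ nbhs x -->
      foldr (fun g a => Num.max (g (venv x)) a) (-1) l.
    by apply: ih => g' hg'; apply: hl; right.
  exact: (@cvg_maxr _ _ (nbhs x) _ _ _ _ _ g1 g2).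
have h_ge0 c x : (exists g, List.In g (L c) /\ 0 <= g (venv x)) ->
    0 <= h c x /\ exists g, List.In g (L c) /\ g (venv x) = h c x.
  have aux (l : seq (env -> R)) : let H := foldr (fun g a => Num.max (g (venv x)) a) (-1) l in
      (H = -1 \/ exists g, List.In g l /\ g (venv x) = H) /\ (forall g, List.In g l -> g (venv x) <= H).
    elim: l => [|g l [ih1 ih2]] /=; first by split => //; left.
    set H := foldr _ _ l in ih1 ih2 *.
    split; last first.
      by move=> g' [<-|/ih2 hg]; rewrite le_max ?lexx ?hg ?orbT.
    have [gH|gH] := leP (g (venv x)) H.
      case: ih1 => [ih1|[g' [i1 i2]]]; first by left.
      by right; exists g'; split => //; right.
    by right; exists g; split => //; left.
  move=> [g [hg g0]]; have [h1 h2] := aux (L c).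
  have H0 : 0 <= h c x by apply: (le_trans g0); exact: h2.
  split => //; case: h1 => // hN; exfalso; move: H0; rewrite /h hN; lra.
pose sg (x : 'rV[R]_m) : 'rV[R]_(m + k) := row_mx x (\row_c Num.sqrt (h c x)).
have sgc : continuous sg.
  move=> x; apply: (@cvg_mx _ _ (nbhs x)) => i j; rewrite /sg.
  case: (split_ordP j) => j' ->.
    rewrite row_mxEl; under [X in X @ _ --> _]eq_fun do rewrite row_mxEl.
    exact: coord_continuous.
  rewrite row_mxEr mxE; under [X in X @ _ --> _]eq_fun do rewrite row_mxEr mxE.
  apply: (@cvg_comp _ _ _ (h j') Num.sqrt (nbhs x) (nbhs (h j' x))); first exact: hc.
  exact: sqrt_continuous.
have fsg x : S x -> f (venv (sg x)) = 0.
  move=> /hLs Sx; apply: big1 => c _; apply/prod0.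
  have [H0 [g [hg gH]]] := h_ge0 c x (Sx c).
  exists g; split => //; rewrite /fac restrE yE row_mxKl row_mxKr mxE gH.
  by rewrite sqr_sqrtr// subrr expr0n.
have f0S (z : 'rV[R]_(m + k)) : f (venv z) = 0 -> S (lsubmx z).
  move=> /eqP; rewrite psumr_eq0// => /allP fz; apply/hLs => c.
  have /eqP/prod0[g [hg]] := fz c (mem_index_enum c).
  rewrite /fac => /eqP; rewrite sqrf_eq0 subr_eq0 restrE => /eqP gz.
  by exists g; split => //; rewrite gz sqr_ge0.
have [rho hrho] : exists rho : R, forall x, S x -> `|sg x| < rho.
  have : compact (sg @` S) by apply: continuous_compact => //; exact: continuous_subspaceT.
  move=> /compact_bounded[M [_ hM]]; exists (M + 2) => x Sx.
  have := hM (M + 1) _ (sg x); rewrite ltrDl ltr01 => /(_ isT) hs.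
  apply: le_lt_trans (_ : M + 1 < M + 2); last by rewrite ltrD2l ltr1n.
  by apply: hs; exists x.
have [tau tau0 [D hD]] := zero_set_retract pf f_ge0 rho.
exists [set x | `|sg x| < rho /\ f (venv (sg x)) < tau], (fun x => lsubmx (D (sg x))); split.
- rewrite (_ : mkset _ = (fun x => `|sg x|) @^-1` [set y | y < rho] `&`
     (fun x => f (venv (sg x))) @^-1` [set y | y < tau])//.
  apply: openI; apply: open_comp; try exact: open_lt.
    move=> x _; apply: (@cvg_comp _ _ _ sg (fun z => `|z|) (nbhs x) (nbhs (sg x))); first exact: sgc.
    exact: norm_continuous.
  move=> x _; apply: (@cvg_comp _ _ _ sg (fun z => f (venv z)) (nbhs x) (nbhs (sg x))); first exact: sgc.
  exact: polyf_continuous.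
- by move=> x Sx; split; [exact: hrho|rewrite fsg].
- move=> x [h1 h2]; have [_ _ cD] := hD (sg x) h1 h2.
  have cDs : (fun x => D (sg x)) @ nbhs x --> D (sg x).
    apply: (@cvg_comp _ _ _ sg D (nbhs x) (nbhs (sg x))); first exact: sgc.
    exact: cD.
  apply: (@cvg_mx _ _ (nbhs x)) => i j; rewrite mxE.
  under [X in X @ _ --> _]eq_fun do rewrite mxE.
  exact: cvg_coord.
- by move=> x [h1 h2]; have [fD _ _] := hD (sg x) h1 h2; exact: f0S.
- move=> x Sx; have [_ DE _] := hD (sg x) (hrho x Sx) (eq_ind_r (fun y => y < tau) tau0 (fsg x Sx)).
  by rewrite DE ?fsg// row_mxKl.
Qed.

End NeighbourhoodRetract.

(** * From approximate deformations to strong deformation retractions *)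

Section Distance.
Variables (R : realType) (V : normedModType R).
Implicit Types (S : set V) (x y : V).

Definition dist S x : R := inf [set `|x - y| | y in S].

Lemma dist_has_inf S x : S !=set0 -> has_inf [set `|x - y| | y in S].
Proof.
by move=> [y Sy]; split; [exists `|x - y|, y|exists 0 => _ [z _ <-]].
Qed.

Lemma dist_le S x y : S y -> dist S x <= `|x - y|.
Proof. by move=> Sy; apply: ge_inf; [exists 0 => _ [z _ <-]|exists y]. Qed.

Lemma dist_ge0 S x : 0 <= dist S x.
Proof.
have [->|/set0P S0] := eqVneq S set0; first by rewrite /dist image_set0 inf0.
apply: lb_le_inf; first by have [] := dist_has_inf x S0.
by move=> _ [z _ <-].
Qed.

Lemma dist_lt S x (d : R) : S !=set0 -> dist S x < d -> exists2 y, S y & `|x - y| < d.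
Proof.
move=> S0 xd; have := inf_adherent (eps := d - dist S x) _ (dist_has_inf x S0).
rewrite subr_gt0 => /(_ xd)[_ [y Sy <-]]; rewrite -/(dist S x) subrKC => h.
by exists y.
Qed.

Lemma dist0 S x : S x -> dist S x = 0.
Proof.
by move=> Sx; apply/eqP; rewrite eq_le dist_ge0 (le_trans (dist_le _ Sx))// subrr normr0.
Qed.

Lemma dist_lipschitz S x y : S !=set0 -> dist S x <= dist S y + `|x - y|.
Proof.
move=> S0; rewrite -lerBlDr; apply: lb_le_inf; first by have [] := dist_has_inf y S0.
move=> _ [z Sz <-]; rewrite lerBlDr; apply: (le_trans (dist_le x Sz)).
by rewrite [leRHS]addrC -[x - z](subrKA y) ler_normD.
Qed.

Lemma dist_continuous S : continuous (dist S).
Proof.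
have [->|/set0P S0] := eqVneq S set0.
  rewrite (_ : dist set0 = fun=> 0); first exact: cst_continuous.
  by apply/funext => x; rewrite /dist image_set0 inf0.
move=> x; apply/cvgrPdist_le => e e0; near=> y.
have xy : `|x - y| <= e by near: y; apply: cvgr_dist_le.
have h1 := dist_lipschitz x y S0; have h2 := dist_lipschitz y x S0.
rewrite distrC in h2; rewrite ler_norml; apply/andP; split; lra.
Unshelve. all: by end_near. Qed.

Lemma compact_open_uniform (K U : set V) : compact K -> open U -> K `<=` U ->
  exists2 d : R, 0 < d & forall x y, K x -> `|x - y| < d -> U y.
Proof.
move=> cK oU KU; apply: contrapT => hn.
have /choice[s hs] : forall j : nat, exists p : V * V, [/\ K p.1, `|p.1 - p.2| < j.+1%:R^-1 & ~ U p.2].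
  move=> j; apply: contrapT => hj; apply: hn; exists j.+1%:R^-1; first by rewrite invr_gt0.
  by move=> x y Kx xy; apply: contrapT => nU; apply: hj; exists (x, y).
have [W [uW ooW]] := ultra_nat; have pW : ProperFilter W by exact: ultra_proper.
have [p Kp hp] : exists2 p, K p & (fun j => (s j).1) @ W --> p.
  by apply: ultra_lim => //; apply: filterS (filterT : W setT) => j _; have [] := hs j.
have : W [set j | U (s j).2].
  have : nbhs p U by apply: open_nbhs_nbhs; split => //; exact: KU.
  move=> /nbhs_ballP[e /= e0 he].
  have h1 : W [set j | `|p - (s j).1| < e / 2].
    by have /cvgrPdist_lt := hp; apply; rewrite divr_gt0.
  have h2 : W [set j | j.+1%:R^-1 < e / 2].
    apply: ooW; near=> j => /=; near: j; exact: near_infty_natSinv_lt (PosNum (divr_gt0 e0 (ltr0n _ 2))).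
  apply: filterS2 h1 h2 => j /= h1 h2; apply: he; rewrite -ball_normE /=.
  have [_ h3 _] := hs j; rewrite -[p - _](subrKA (s j).1) (le_lt_trans (ler_normD _ _))//.
  by rewrite [ltRHS]splitr ltrD// (lt_trans h3).
move=> hU; have : W set0 by apply: filterS hU => j hj; have [_ _] := hs j.
exact: filter_not_empty.
Unshelve. all: by end_near. Qed.

End Distance.

Section StrongDeformation.
Variables (R : realType) (n : nat).
Local Notation mat := 'M[R]_n.
Implicit Types (X Y Z : set mat).

Definition cont_on (T U : topologicalType) (A : set T) (f : T -> U) :=
  forall x, A x -> f @ within A (nbhs x) --> f x.

Lemma within_snd (A : set R) X (p : R * mat) :
  (fun q : R * mat => q.2) @ within (A `*` X) (nbhs p) --> within X (nbhs p.2).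
Proof.
case: p => t x P; rewrite /within /= => hP.
have h : nbhs (t, x) [set q : R * mat | X q.2 -> P q.2].
  exact: (@cvg_snd R mat (nbhs t) (nbhs x) _ [set y | X y -> P y] hP).
by apply: filterS h => q h [_ /h].
Qed.

Lemma within_fst (D : set (R * mat)) (p : R * mat) :
  (fun q : R * mat => q.1) @ within D (nbhs p) --> p.1.
Proof.
case: p => t x P hP; rewrite /within /fmap /=.
have h : nbhs (t, x) [set q : R * mat | P q.1].
  exact: (@cvg_fst R mat (nbhs t) (nbhs x) _ P hP).
by apply: filterS h.
Qed.

Lemma segment_cvg (T : Type) (F : set_system T) {FF : Filter F} (a : T -> R) (u v : T -> mat)
    (a0 : R) (u0 v0 : mat) : a @ F --> a0 -> u @ F --> u0 -> v @ F --> v0 ->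
  (fun x => (1 - a x) *: u x + a x *: v x) @ F --> (1 - a0) *: u0 + a0 *: v0.
Proof.
move=> ha hu hv; apply: cvgmxD; apply: cvgmxZ => //.
by apply: cvgB => //; exact: cvg_cst.
Qed.

Lemma segment_dist (a : R) (u v x y : mat) (d : R) : 0 <= a <= 1 -> `|x - u| < d -> `|y - v| < d ->
  `|((1 - a) *: x + a *: y) - ((1 - a) *: u + a *: v)| < d.
Proof.
move=> /andP[a0 a1] xu yv.
have -> : ((1 - a) *: x + a *: y) - ((1 - a) *: u + a *: v) = (1 - a) *: (x - u) + a *: (y - v).
  by rewrite !scalerBr opprD addrACA.
rewrite (le_lt_trans (ler_normD _ _))// !normrZ !ger0_norm ?subr_ge0//.
have [->|an0] := eqVneq a 0; first by rewrite subr0 mul1r mul0r addr0.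
have ap : 0 < a by rewrite lt_neqAle eq_sym an0.
apply: (@le_lt_trans _ _ ((1 - a) * d + a * `|y - v|)).
  by rewrite lerD2r ler_wpM2l ?subr_ge0// ltW.
have : a * `|y - v| < a * d by rewrite ltr_pM2l.
lra.
Qed.

(* If [A |-> g A] moves [X] into a small neighbourhood of [Y] along segments
   that stay near [X], and near [Y] when they start in [Y], then slowing the
   motion down near [Y] and correcting with the two neighbourhood retractions
   produces a strong deformation retraction. *)
Lemma sdr_of_approx X Y : compact X -> compact Y -> Y `<=` X ->
  nbhd_retract X -> nbhd_retract Y ->
  (forall UX UY, open UX -> open UY -> X `<=` UX -> Y `<=` UY ->
    exists g : mat -> mat, [/\ cont_on X g,
      (forall A t, X A -> 0 <= t <= 1 -> UX ((1 - t) *: A + t *: g A)),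
      (forall A, X A -> UY (g A)) &
      (forall A t, Y A -> 0 <= t <= 1 -> UY ((1 - t) *: A + t *: g A))]) ->
  strong_def_retract Y X.
Proof.
move=> cX cY YX [UX [rX [oUX XUX rXc rXX rXid]]] [UY0 [rY [oUY0 YUY0 rYc rYY rYid]]] happ.
(* Here a point can be carried into [Y] by [rY] along a segment that stays in [UX]; taking the
   interior makes the condition open. *)
pose UY := [set z | UY0 z /\ forall t, 0 <= t <= 1 -> UX ((1 - t) *: z + t *: rY z)]^°.
have oUY : open UY by exact: open_interior.
have UYs z : UY z -> UY0 z /\ forall t, 0 <= t <= 1 -> UX ((1 - t) *: z + t *: rY z).
  exact: interior_subset.
have YUY : Y `<=` UY.
  move=> y Yy; rewrite /UY /interior.
  have : nbhs y UX by apply: open_nbhs_nbhs; split => //; exact/XUX/YX.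
  move=> /nbhs_ballP[d /= d0 hd].
  have n1 : nbhs y UY0 by apply: open_nbhs_nbhs; split => //; exact: YUY0.
  have n2 : nbhs y [set z | `|z - y| < d].
    have /(@cvgrPdist_lt R mat mat (nbhs y) _ id y) : (id : mat -> mat) @ nbhs y --> y by exact: cvg_id.
    by move=> /(_ d d0); apply: filterS => z /=; rewrite distrC.
  have n3 : nbhs y [set z | `|rY z - y| < d].
    have /(@cvgrPdist_lt R mat mat (nbhs y) _ rY (rY y)) := rYc y (YUY0 _ Yy).
    by move=> /(_ d d0); apply: filterS => z /=; rewrite rYid// distrC.
  apply: filterS2 n1 (filterI n2 n3) => z h1 [/= h2 h3]; split => // t ht; apply: hd.
  rewrite -ball_normE /= distrC.
  by have := segment_dist ht h2 h3; rewrite -scalerDl subrK scale1r.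
have [g [gc gX gY gYY]] := happ UX UY oUX oUY XUX YUY.
split => //.
have [Y0|/set0P Y0] := eqVneq Y set0.
  have X0 x : X x -> False by move=> /gY /UYs[/rYY]; rewrite Y0.
  exists (fun _ x => x); split; [|by []|by []|by move=> x /X0|by []].
  by apply/subspace_continuousP => -[t x] [_ /X0].
(* Near [Y] the whole segment to [g x] lies in [UY], so the motion may be stopped there at any
   intermediate point. *)
have [N [oN YN hN]] : exists N : set mat, [/\ open N, Y `<=` N &
    forall x, X x -> N x -> forall t, 0 <= t <= 1 -> UY ((1 - t) *: x + t *: g x)].
  exists [set x | X x -> forall t, 0 <= t <= 1 -> UY ((1 - t) *: x + t *: g x)]^°.
  split; [exact: open_interior| |by move=> x Xx /interior_subset; exact].
  move=> y Yy; rewrite /interior.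
  pose seg : set mat := (fun t : R => (1 - t) *: y + t *: g y) @` `[0, 1]%classic.
  have cseg : compact seg.
    apply: continuous_compact; last exact: segment_compact.
    apply: continuous_subspaceT => t; apply: (@segment_cvg _ (nbhs t) _ id); first exact: cvg_id.
      exact: cvg_cst.
    exact: cvg_cst.
  have [|d d0 hd] := compact_open_uniform cseg oUY.
    by move=> _ [t ht <-]; apply: gYY => //; move: ht; rewrite /= in_itv.
  have n2 : nbhs y [set z | `|z - y| < d].
    have /(@cvgrPdist_lt R mat mat (nbhs y) _ id y) : (id : mat -> mat) @ nbhs y --> y by exact: cvg_id.
    by move=> /(_ d d0); apply: filterS => z /=; rewrite distrC.
  have n3 : nbhs y [set z | X z -> `|g z - g y| < d].
    have /(@cvgrPdist_lt R mat mat (within X (nbhs y)) _ g (g y)) := gc y (YX _ Yy).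
    by move=> /(_ d d0); apply: filterS => z /=; rewrite distrC.
  apply: filterS2 n2 n3 => z h1 h2 Xz t ht.
  apply: (hd ((1 - t) *: y + t *: g y)); first by exists t => //; rewrite /= in_itv.
  by rewrite distrC; exact: segment_dist ht h1 (h2 Xz).
have [d d0 hd] := compact_open_uniform cY oN YN.
(* The fraction of the segment that is travelled: [0] on [Y], whose points must not move, and [1]
   from distance [d] on, where only the endpoint [g x] is known to lie in [UY]. *)
pose u x := Num.min 1 (dist Y x / d).
have u01 x : 0 <= u x <= 1.
  by rewrite le_min ler01 divr_ge0 ?dist_ge0 ?(ltW d0)//= ge_min lexx.
have uY y : Y y -> u y = 0 by move=> Yy; rewrite /u dist0// mul0r min_r.
pose z s x : mat := (1 - s * u x) *: x + (s * u x) *: g x.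
have zUX s x : 0 <= s <= 1 -> X x -> UX (z s x).
  move=> /andP[s0 s1] Xx; apply: gX => //; have /andP[? ?] := u01 x.
  by rewrite mulr_ge0//= mulr_ile1.
have zUY x : X x -> UY (z 1 x).
  move=> Xx; rewrite /z mul1r; have [ux|ux] := ltP (dist Y x) d.
    have [y Yy xy] := dist_lt Y0 ux.
    by apply: hN => //; apply: (hd y) => //; rewrite distrC.
  have -> : u x = 1 by rewrite /u min_l// ler_pdivlMr// mul1r.
  by rewrite subrr scale0r add0r scale1r; exact: gY.
(* Up to time [1/2] the motion goes towards [g x], afterwards towards [rY (z 1 x)]. The clamped
   parameters put both stages into one continuous formula. *)
pose sf (t : R) := Num.min 1 (2 * t); pose tf (t : R) := Num.max 0 (2 * t - 1).
have sf01 t : 0 <= t <= 1 -> 0 <= sf t <= 1.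
  by move=> /andP[t0 t1]; rewrite le_min ler01 mulr_ge0//= ge_min lexx.
have tf01 t : 0 <= t <= 1 -> 0 <= tf t <= 1.
  by move=> /andP[t0 t1]; rewrite le_max lexx//= ge_max ler01 /=; lra.
pose w t x := (1 - tf t) *: z (sf t) x + tf t *: rY (z 1 x).
have wUX t x : 0 <= t <= 1 -> X x -> UX (w t x).
  move=> ht Xx; rewrite /w; have [t2|t2] := leP (2 * t - 1) 0.
    have -> : tf t = 0 by rewrite /tf max_l.
    by rewrite subr0 scale1r scale0r addr0; apply: zUX => //; exact: sf01.
  have -> : sf t = 1 by rewrite /sf min_l//; lra.
  by apply: (UYs _ (zUY x Xx)).2; exact: tf01.
have wY t y : Y y -> w t y = y.
  move=> Yy; have zy s : z s y = y by rewrite /z uY// mulr0 subr0 scale1r scale0r addr0.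
  by rewrite /w !zy rYid// -scalerDl subrK scale1r.
exists (fun t x => rX (w t x)); split.
- apply/subspace_continuousP => -[t x] [/= + Xx]; rewrite in_itv /= => ht.
  set F := within _ _.
  have FF : Filter F by exact: within_filter.
  have sndF : (fun q : R * mat => q.2) @ F --> within X (nbhs x) by exact: within_snd.
  have snd0 : (fun q : R * mat => q.2) @ F --> x.
    by apply: cvg_trans sndF _; exact: cvg_within.
  have fst0 : (fun q : R * mat => q.1) @ F --> t by exact: within_fst.
  have gF : (fun q : R * mat => g q.2) @ F --> g x.
    by apply: (@cvg_comp _ _ _ (fun q : R * mat => q.2) g F _ _ sndF); exact: gc.
  have uF : (fun q : R * mat => u q.2) @ F --> u x.
    apply: cvg_minr; first exact: cvg_cst.
    apply: cvgM; last exact: cvg_cst.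
    by apply: (@cvg_comp _ _ _ (fun q : R * mat => q.2) (dist Y) F _ _ snd0); exact: dist_continuous.
  have sF : (fun q : R * mat => sf q.1) @ F --> sf t.
    by apply: cvg_minr; [exact: cvg_cst|apply: cvgM; [exact: cvg_cst|]].
  have tF : (fun q : R * mat => tf q.1) @ F --> tf t.
    apply: cvg_maxr; first exact: cvg_cst.
    by apply: cvgB; [apply: cvgM; [exact: cvg_cst|]|exact: cvg_cst].
  have zF (a : R * mat -> R) (a0 : R) : a @ F --> a0 -> (fun q => z (a q) q.2) @ F --> z a0 x.
    by move=> ha; apply: segment_cvg => //; exact: cvgM.
  have rYF : (fun q : R * mat => rY (z 1 q.2)) @ F --> rY (z 1 x).
    have z1F := zF (fun=> 1) 1 (cvg_cst _).
    apply: (@cvg_comp _ _ _ (fun q : R * mat => z 1 q.2) rY F (nbhs (z 1 x)) (nbhs (rY (z 1 x)))); first exact: z1F.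
    by apply: rYc; exact: (UYs _ (zUY x Xx)).1.
  have wF : (fun q : R * mat => w q.1 q.2) @ F --> w t x.
    by apply: segment_cvg => //; exact: zF.
  apply: (@cvg_comp _ _ _ (fun q : R * mat => w q.1 q.2) rX F (nbhs (w t x)) (nbhs (rX (w t x)))) => //.
  by apply: rXc; exact: wUX.
- by move=> t x ht Xx; apply: rXX; exact: wUX.
- move=> x Xx; rewrite (_ : w 0 x = x) ?rXid//.
  have -> : w 0 x = z 0 x.
    rewrite /w /tf /sf mulr0 sub0r max_l ?oppr_le0// min_r//.
    by rewrite subr0 scale1r scale0r addr0.
  by rewrite /z mul0r subr0 scale1r scale0r addr0.
- move=> x Xx; have -> : w 1 x = rY (z 1 x).
    have tf1 : tf 1 = 1 by rewrite /tf max_r; lra.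
    by rewrite /w tf1 subrr scale0r add0r scale1r.
  have Yr : Y (rY (z 1 x)) by apply: rYY; exact: (UYs _ (zUY x Xx)).1.
  by rewrite rXid//; exact: YX.
- by move=> t y ht Yy; rewrite wY// rXid//; exact: YX.
Qed.

Lemma sdr_trans X Y Z : strong_def_retract Y X -> strong_def_retract Z Y ->
  strong_def_retract Z X.
Proof.
move=> [YX [G [Gc GX G0 G1 GY]]] [ZY [H [Hc HY H0 H1 HZ]]]; split; first exact: subset_trans YX.
pose sf (t : R) := Num.min 1 (2 * t); pose tf (t : R) := Num.max 0 (2 * t - 1).
have sf01 t : 0 <= t <= 1 -> 0 <= sf t <= 1.
  by move=> /andP[t0 t1]; rewrite le_min ler01 mulr_ge0//= ge_min lexx.
have tf01 t : 0 <= t <= 1 -> 0 <= tf t <= 1.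
  by move=> /andP[t0 t1]; rewrite le_max lexx//= ge_max ler01 /=; lra.
have split01 t : tf t = 0 \/ sf t = 1.
  have [t2|t2] := leP (2 * t - 1) 0; [left; rewrite /tf max_l//|right; rewrite /sf min_l//; lra].
(* no pasting: the correction term vanishes as soon as the second stage starts *)
pose K t x := H (tf t) (G 1 x) + (G (sf t) x - G 1 x).
have KE t x : X x -> (tf t = 0 /\ K t x = G (sf t) x) \/ (sf t = 1 /\ K t x = H (tf t) (G 1 x)).
  move=> Xx; rewrite /K; case: (split01 t) => E; [left|right]; split => //; rewrite E.
    by rewrite H0 ?subrKC//; exact: G1.
  by rewrite subrr addr0.
exists K; split.
- apply/subspace_continuousP => -[t x] [/= + Xx]; rewrite in_itv /= => ht.
  set F := within _ _; have FF : Filter F by exact: within_filter.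
  have sndF : (fun q : R * mat => q.2) @ F --> within X (nbhs x) by exact: within_snd.
  have snd0 : (fun q : R * mat => q.2) @ F --> x.
    by apply: cvg_trans sndF _; exact: cvg_within.
  have fst0 : (fun q : R * mat => q.1) @ F --> t by exact: within_fst.
  have inF : F [set q | 0 <= q.1 <= 1 /\ X q.2].
    rewrite /F /within /=; apply: filterE => q [/= + Xq]; by rewrite in_itv.
  have sF : (fun q : R * mat => sf q.1) @ F --> sf t.
    by apply: cvg_minr; [exact: cvg_cst|apply: cvgM; [exact: cvg_cst|]].
  have tF : (fun q : R * mat => tf q.1) @ F --> tf t.
    apply: cvg_maxr; first exact: cvg_cst.
    by apply: cvgB; [apply: cvgM; [exact: cvg_cst|]|exact: cvg_cst].
  have comp (W : set mat) (L : R -> mat -> mat) (a : R * mat -> R) (b : R * mat -> mat) (a0 : R) (b0 : mat) :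
     {within `[0, 1]%classic `*` W, continuous (fun p : R * mat => L p.1 p.2)} ->
     (`[0, 1]%classic `*` W) (a0, b0) -> a @ F --> a0 -> b @ F --> b0 ->
     F [set q | 0 <= a q <= 1 /\ W (b q)] -> (fun q => L (a q) (b q)) @ F --> L a0 b0.
    move=> /subspace_continuousP/(_ (a0, b0)) Lc W0 ha hb hin.
    apply: (@cvg_comp _ _ _ (fun q => (a q, b q)) (fun p : R * mat => L p.1 p.2) F _ _ _ (Lc W0)).
    move=> P; rewrite /within /fmap /= => hP.
    have h : F [set q | (`[0, 1]%classic `*` W) (a q, b q) -> P (a q, b q)].
      exact: (cvg_pair ha hb hP).
    apply: filterS2 hin h => q [h1 h2] h; apply: h; split => //=; by rewrite in_itv.
  have g1 : (fun q : R * mat => G 1 q.2) @ F --> G 1 x.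
    apply: (comp X G (fun=> 1)) => //; first by split => //=; rewrite in_itv /= ler01 lexx.
      exact: cvg_cst.
    by apply: filterS inF => q [_ h]; rewrite ler01 lexx.
  apply: cvgmxD; last apply: cvgmxB => //.
    apply: (comp Y H (fun q => tf q.1) (fun q => G 1 q.2)) => //.
      by split => /=; [rewrite in_itv /=; exact: tf01|exact: G1].
    by apply: filterS inF => q [h1 h2]; split; [exact: tf01|exact: G1].
  apply: (comp X G (fun q => sf q.1) (fun q => q.2)) => //.
    by split => //=; rewrite in_itv /=; exact: sf01.
  by apply: filterS inF => q [h1 h2]; split => //; exact: sf01.
- move=> t x ht Xx; case: (KE t x Xx) => -[_ ->]; first by apply: GX => //; exact: sf01.
  by apply: YX; apply: HY; [exact: tf01|exact: G1].
- move=> x Xx; have tf0 : tf 0 = 0 by rewrite /tf mulr0 sub0r max_l// oppr_le0.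
  have sf0 : sf 0 = 0 by rewrite /sf mulr0 min_r.
  case: (KE 0 x Xx) => -[E ->]; first by rewrite sf0 G0.
  by move: E; rewrite sf0 => /eqP; rewrite eq_sym oner_eq0.
- move=> x Xx; have tf1 : tf 1 = 1 by rewrite /tf max_r; lra.
  case: (KE 1 x Xx) => -[E ->]; last by rewrite tf1; apply: H1; exact: G1.
  by move: E; rewrite tf1 => /eqP; rewrite oner_eq0.
- move=> t y ht Zy; have Yy := ZY _ Zy; have Xy := YX _ Yy.
  case: (KE t y Xy) => -[E ->]; first by apply: GY => //; exact: sf01.
  by rewrite GY ?ler01 ?lexx// HZ//; exact: tf01.
Qed.

End StrongDeformation.

(** * Orthonormal frames, projections and spectral decomposition *)

Section OrthonormalFrames.
Variables (R : realType) (n : nat).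
Local Notation vec := 'rV[R]_n.
Local Notation mat := 'M[R]_n.
Implicit Types (x y z : vec) (P A B : mat).

Lemma QfE x y : Qf x y = \sum_i x 0 i * y 0 i.
Proof. by rewrite /Qf mxE; apply: eq_bigr => i _; rewrite mxE. Qed.

Lemma QfC x y : Qf x y = Qf y x.
Proof. by rewrite !QfE; apply: eq_bigr => i _; rewrite mulrC. Qed.

Lemma QfDl x y z : Qf (x + y) z = Qf x z + Qf y z.
Proof. by rewrite /Qf mulmxDl mxE. Qed.
Lemma QfZl a x z : Qf (a *: x) z = a * Qf x z.
Proof. by rewrite /Qf -scalemxAl mxE. Qed.
Lemma QfDr x y z : Qf z (x + y) = Qf z x + Qf z y.
Proof. by rewrite QfC QfDl !(QfC z). Qed.
Lemma QfZr a x z : Qf z (a *: x) = a * Qf z x.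
Proof. by rewrite QfC QfZl QfC. Qed.
Lemma Qf0l x : Qf 0 x = 0. Proof. by rewrite -(scale0r (0 : vec)) QfZl mul0r. Qed.
Lemma QfNl x z : Qf (- x) z = - Qf x z.
Proof. by rewrite -scaleN1r QfZl mulN1r. Qed.
Lemma QfBl x y z : Qf (x - y) z = Qf x z - Qf y z.
Proof. by rewrite QfDl QfNl. Qed.

Lemma Qf_mulmx x y A : Qf (x *m A) y = Qf x (y *m A^T).
Proof. by rewrite /Qf trmx_mul trmxK mulmxA. Qed.

Lemma Qf_ge0 x : 0 <= Qf x x.
Proof. by rewrite QfE sumr_ge0// => i _; rewrite -expr2 sqr_ge0. Qed.

Lemma Qf_eq0 x : (Qf x x == 0) = (x == 0).
Proof.
apply/idP/eqP => [|->]; last by rewrite Qf0l.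
rewrite QfE psumr_eq0; last by move=> i _; rewrite -expr2 sqr_ge0.
move=> /allP h; apply/rowP => i; have := h i (mem_index_enum i).
by rewrite /= -expr2 sqrf_eq0 mxE => /eqP.
Qed.

Lemma Qf_gt0 x : x != 0 -> 0 < Qf x x.
Proof. by move=> x0; rewrite lt_neqAle Qf_ge0 eq_sym Qf_eq0 x0. Qed.

Lemma frame_rank k (U : 'M[R]_(k, n)) : U *m U^T = 1%:M -> \rank U = k.
Proof.
move=> UU; apply/eqP; rewrite eqn_leq rank_leq_row /=.
by rewrite -{1}(mxrank1 R k) -UU mxrankM_maxl.
Qed.

Lemma frame_extend k (U : 'M[R]_(k, n)) y : U *m U^T = 1%:M -> y *m U^T = 0 -> y != 0 ->
  exists2 a : R, a != 0 & col_mx U (a *: y) *m (col_mx U (a *: y))^T = 1%:M.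
Proof.
move=> UU yU y0; have q0 := Qf_gt0 y0.
exists (Num.sqrt (Qf y y))^-1; first by rewrite invr_eq0 gt_eqF// sqrtr_gt0.
set a := (_)^-1; rewrite tr_col_mx mul_col_row UU.
have Uy : U *m (a *: y)^T = 0.
  by rewrite linearZ /= -scalemxAr -[U]trmxK -trmx_mul yU trmx0 scaler0.
have -> : a *: y *m U^T = 0 by rewrite -scalemxAl yU scaler0.
rewrite Uy (_ : a *: y *m (a *: y)^T = 1%:M) -?scalar_mx_block//.
rewrite [LHS]mx11_scalar; congr (_%:M).
rewrite -/(Qf (a *: y) (a *: y)) QfZl QfZr mulrA -expr2 /a exprVn sqr_sqrtr ?ltW//.
by rewrite mulVf// gt_eqF.
Qed.

(** An orthonormal frame has at most [n] rows, so a maximal one exists. As [W] is arbitrary, the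
    same lemma yields orthonormal bases of subspaces and of eigenvectors. *)
Lemma max_frame (W : forall k, 'M[R]_(k, n) -> Prop) : W 0%N 0 ->
  exists k (U : 'M[R]_(k, n)), [/\ U *m U^T = 1%:M, W k U &
    forall (U' : 'M[R]_(k + 1, n)), U' *m U'^T = 1%:M -> ~ W (k + 1)%N U'].
Proof.
move=> W0; pose Pk k := `[< exists U : 'M[R]_(k, n), U *m U^T = 1%:M /\ W k U >].
have ex0 : exists k, Pk k.
  exists 0%N; apply/asboolP; exists 0; split => //.
  by apply/matrixP => -[].
have bd k : Pk k -> (k <= n)%N.
  by move=> /asboolP[U [/frame_rank rU _]]; rewrite -{1}rU; exact: rank_leq_col.
case: (ex_maxnP ex0 bd) => k /asboolP[U [UU WU]] kmax.
exists k, U; split => // U' UU' WU'.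
have : Pk (k + 1)%N by apply/asboolP; exists U'.
by move=> /kmax; rewrite addn1 ltnn.
Qed.

Lemma proj_of_frame k (U : 'M[R]_(k, n)) : U *m U^T = 1%:M -> is_proj (U^T *m U).
Proof.
move=> UU; split; first by rewrite trmx_mul trmxK.
by rewrite mulmxA -(mulmxA U^T) UU mulmx1.
Qed.

(** The bridge from subspaces given by a predicate, such as joins and preimages, to projection
    matrices. A vector outside the span of a maximal frame in [W] would, once projected off it,
    extend the frame. *)
Lemma proj_of_subspace (W : vec -> Prop) : W 0 ->
  (forall a x y, W x -> W y -> W (a *: x + y)) ->
  exists k (U : 'M[R]_(k, n)), U *m U^T = 1%:M /\ forall x, inS (U^T *m U) x <-> W x.
Proof.
move=> W0 WL.
have [|k [U [UU WU kmax]]] := @max_frame (fun k U => forall i, W (row i U)).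
  by case.
exists k, U; split => //.
have WZ a x : W x -> W (a *: x) by move=> Wx; rewrite -[_ *: _]addr0; exact: WL.
have WD x y : W x -> W y -> W (x + y) by move=> Wx Wy; rewrite -[x]scale1r; exact: WL.
have Wsum (c : 'rV[R]_k) : W (c *m U).
  by rewrite mulmx_sum_row; apply: (big_ind W) => // i _; exact: WZ.
move=> x; split; first by move=> <-; rewrite mulmxA.
move=> Wx; apply: contrapT => nx.
pose y := x - x *m (U^T *m U).
have y0 : y != 0 by rewrite subr_eq0; apply/eqP => E; apply: nx.
have yU : y *m U^T = 0.
  by rewrite mulmxBl -!mulmxA UU mulmx1 subrr.
have [a a0 UU'] := frame_extend UU yU y0.
apply: (kmax _ UU') => i; case: (split_ordP i) => j ->.
  by rewrite rowKu.
rewrite rowKd rowE ord1 (_ : delta_mx 0 0 = 1%:M) ?mul1mx; last first.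
  by apply/matrixP => r c; rewrite !ord1 !mxE.
by apply: (WZ a); apply: WD => //; rewrite mulmxA -scaleN1r; apply: (WZ (-1)); exact: Wsum.
Qed.

Lemma inS_sub P Q : is_proj P -> subS P Q -> P *m Q = P.
Proof.
move=> [_ PP] h; apply/row_matrixP => i; rewrite row_mul.
by apply: h; rewrite /inS -row_mul PP.
Qed.

Lemma sub_inS P Q : P *m Q = P -> subS P Q.
Proof. by move=> PQ x; rewrite /inS => h; rewrite -{1}h -mulmxA PQ h. Qed.

Lemma inS_sub' P Q : is_proj P -> is_proj Q -> subS P Q -> Q *m P = P.
Proof. by move=> pP [QT _] h; have := congr1 trmx (inS_sub pP h); rewrite trmx_mul QT pP.1. Qed.

Lemma subS_anti P Q : is_proj P -> is_proj Q -> subS P Q -> subS Q P -> P = Q.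
Proof.
by move=> pP pQ PQ QP; rewrite -(inS_sub pP PQ) (inS_sub' pQ pP QP).
Qed.

Lemma proj_frame P : is_proj P -> exists U : 'M[R]_(\rank P, n), U *m U^T = 1%:M /\ P = U^T *m U.
Proof.
move=> pP; have [||k [U [UU hU]]] := proj_of_subspace (W := inS P).
- by rewrite /inS mul0mx.
- by move=> a x y; rewrite /inS => hx hy; rewrite mulmxDl -scalemxAl hx hy.
have PE : P = U^T *m U.
  by apply: subS_anti => //; [exact: proj_of_frame|move=> x /hU|move=> x /hU].
have rP : \rank P = k.
  apply/eqP; rewrite eqn_leq; apply/andP; split.
    by rewrite PE (leq_trans (mxrankM_maxr _ _))// rank_leq_row.
  by rewrite -{1}(frame_rank UU) -[U in \rank U]mul1mx -UU -mulmxA -PE mxrankM_maxr.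
by rewrite rP; exists U.
Qed.

Lemma proj_trace P : is_proj P -> \tr P = (\rank P)%:R.
Proof.
by move=> /proj_frame[U [UU {1}->]]; rewrite mxtrace_mulC UU mxtrace1.
Qed.

Lemma tr_mulT_ge0 m (A : 'M[R]_(m, n)) : 0 <= \tr (A *m A^T).
Proof.
by apply: sumr_ge0 => i _; rewrite mxE; apply: sumr_ge0 => j _; rewrite mxE -expr2 sqr_ge0.
Qed.

Lemma tr_mulT_eq0 m (A : 'M[R]_(m, n)) : \tr (A *m A^T) = 0 -> A = 0.
Proof.
have pos i : 0 <= (A *m A^T) i i by rewrite mxE; apply: sumr_ge0 => j _; rewrite mxE -expr2 sqr_ge0.
move=> /eqP; rewrite psumr_eq0// => /allP h; apply/matrixP => i j.
have := h i (mem_index_enum i); rewrite /= mxE psumr_eq0; last by move=> k _; rewrite mxE -expr2 sqr_ge0.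
by move=> /allP/(_ j (mem_index_enum j)); rewrite /= mxE -expr2 sqrf_eq0 mxE => /eqP.
Qed.

Lemma proj_tr_eq0 P : is_proj P -> \tr P = 0 -> P = 0.
Proof. by move=> [PT PP] P0; apply: tr_mulT_eq0; rewrite PT PP. Qed.

Lemma proj_subB P Q : is_proj P -> is_proj Q -> subS P Q -> is_proj (Q - P).
Proof.
move=> pP pQ PQ; split; first by rewrite linearB /= pP.1 pQ.1.
by rewrite mulmxBl !mulmxBr pP.2 pQ.2 (inS_sub pP PQ) (inS_sub' pP pQ PQ) subrr subr0.
Qed.

Lemma proj1 : is_proj (1%:M : mat). Proof. by split; [rewrite trmx1|rewrite mulmx1]. Qed.

Lemma subS1 P : subS P 1%:M. Proof. by move=> x _; rewrite /inS mulmx1. Qed.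

Lemma subS_rank P Q : is_proj P -> is_proj Q -> subS P Q -> (\rank P <= \rank Q)%N.
Proof. by move=> pP pQ /(inS_sub pP) <-; exact: mxrankM_maxr. Qed.

Lemma subS_rank_eq P Q : is_proj P -> is_proj Q -> subS P Q -> \rank P = \rank Q -> P = Q.
Proof.
move=> pP pQ PQ rPQ; apply/eqP; rewrite eq_sym -subr_eq0; apply/eqP.
apply: proj_tr_eq0; first exact: proj_subB.
by rewrite linearB /= !proj_trace// rPQ subrr.
Qed.

Lemma psubS_rank P Q : is_proj P -> is_proj Q -> psubS P Q -> (\rank P < \rank Q)%N.
Proof.
move=> pP pQ [PQ nPQ]; rewrite ltn_neqAle subS_rank// andbT.
by apply/eqP => /(subS_rank_eq pP pQ PQ).
Qed.

(** [P i i] is the squared length of row [i] of [P]; the same fact for [1%:M - P] gives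
    [P i i <= 1]. *)
Lemma proj_norm_le1 P : is_proj P -> `|P| <= 1.
Proof.
move=> pP; have := proj_subB pP proj1 (subS1 (P := P)); rewrite -[X in _ <= X]/(1 : R) => p1.
apply/mx_norm_le => // i j.
have sq (Q : mat) (k : 'I_n) : is_proj Q -> Q k k = \sum_l Q k l ^+ 2.
  by move=> [QT QQ]; rewrite -{1}QQ mxE; apply: eq_bigr => l _; rewrite -{2}QT mxE expr2.
have d1 : P i i <= 1.
  have := sq _ i p1; rewrite !mxE eqxx => E.
  by rewrite -subr_ge0 -[X in _ - X]/(P i i) (_ : 1 - P i i = 1%:R - P i i)// E sumr_ge0// => l _; exact: sqr_ge0.
rewrite -(@ler_pXn2r _ 2)// ?nnegrE// expr1n real_normK ?num_real//.
apply: le_trans d1; rewrite (sq P i pP) (bigD1 j)//= lerDl sumr_ge0// => l _; exact: sqr_ge0.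
Qed.

End OrthonormalFrames.

Section MatrixCompactness.
Variable R : realType.

Lemma vec_mx_continuous m n : continuous (@vec_mx R m n : 'rV[R]_(m * n) -> 'M[R]_(m, n)).
Proof.
move=> x; apply: (@cvg_mx _ _ (nbhs x)) => i j; rewrite mxE.
under [X in X @ _ --> _]eq_fun do rewrite mxE.
exact: coord_continuous.
Qed.

Lemma mxvec_continuous m n : continuous (@mxvec R m n : 'M[R]_(m, n) -> 'rV[R]_(m * n)).
Proof.
move=> x; apply: (@cvg_mx _ _ (nbhs x)) => i j; rewrite ord1.
case/mxvec_indexP: j => j1 j2; rewrite mxvecE.
under [X in X @ _ --> _]eq_fun do rewrite mxvecE.
exact: coord_continuous.
Qed.

Lemma mx_ball_compact m n (rho : R) : compact [set M : 'M[R]_(m, n) | `|M| <= rho].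
Proof.
have [r0|r0] := leP 0 rho; last first.
  rewrite (_ : mkset _ = set0); first exact: compact0.
  apply/seteqP; split => // M /= h.
  by have := le_lt_trans (le_trans (normr_ge0 M) h) r0; rewrite ltxx.
have -> : [set M : 'M[R]_(m, n) | `|M| <= rho] = vec_mx @` [set x : 'rV[R]_(m * n) | `|x| <= rho].
  apply/seteqP; split.
    move=> M /= hM; exists (mxvec M); last by rewrite mxvecK.
    apply/mx_norm_le => // i j; rewrite ord1.
    case/mxvec_indexP: j => j1 j2; rewrite mxvecE.
    by move: hM => /mx_norm_le; exact.
  move=> _ [x /= hx <-]; apply/mx_norm_le => // i j; rewrite mxE.
  by move: hx => /mx_norm_le; exact.
apply: continuous_compact; first by apply: continuous_subspaceT; exact: vec_mx_continuous.
apply: bounded_closed_compact.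
  exists rho; split; first by rewrite realE r0.
  by move=> b rb x xr; exact: (le_trans xr (ltW rb)).
apply: (@closed_comp _ _ (fun x : 'rV[R]_(m * n) => `|x|) [set s | s <= rho]); last exact: closed_le.
by move=> x _; exact: norm_continuous.
Qed.

Variables (I : Type) (U : set_system I).
Hypothesis uU : UltraFilter U.

Lemma ultra_lim_mx m n (u : I -> 'M[R]_(m, n)) (rho : R) : U [set i | `|u i| <= rho] ->
  exists p : 'M[R]_(m, n), u @ U --> p.
Proof.
by move=> hu; have [p _ hp] := ultra_lim uU (@mx_ball_compact m n rho) hu; exists p.
Qed.

Lemma ultra_lim_itv (u : I -> R) (a b : R) : U [set i | a <= u i <= b] ->
  exists2 p : R, a <= p <= b & u @ U --> p.
Proof.
move=> hu; have [|p] := ultra_lim uU (@segment_compact R a b) (u := u).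
  by apply: filterS hu => i /=; rewrite in_itv.
by rewrite /= in_itv /= => hp up; exists p.
Qed.

Let pU : ProperFilter U. Proof. exact: ultra_proper. Qed.

Lemma cvg_mx_unique m n (u : I -> 'M[R]_(m, n)) (a b : 'M[R]_(m, n)) :
  u @ U --> a -> u @ U --> b -> a = b.
Proof. by move=> ua ub; apply: (cvg_unique _ ua ub); exact: norm_hausdorff. Qed.

Lemma cvg_mx_eq m n (u v : I -> 'M[R]_(m, n)) (a b : 'M[R]_(m, n)) :
  u @ U --> a -> v @ U --> b -> U [set i | u i = v i] -> a = b.
Proof.
move=> ua vb uv; apply: (cvg_mx_unique ua).
apply: cvg_trans vb; apply: near_eq_cvg; apply: filterS uv => i /= ->//.
Qed.

Lemma cvg_r_eq (u v : I -> R) (a b : R) :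
  u @ U --> a -> v @ U --> b -> U [set i | u i = v i] -> a = b.
Proof.
move=> ua vb uv; apply: (cvg_unique _ ua); first exact: norm_hausdorff.
apply: cvg_trans vb; apply: near_eq_cvg; apply: filterS uv => i /= ->//.
Qed.

Lemma cvg_r_le (u v : I -> R) (a b : R) :
  u @ U --> a -> v @ U --> b -> U [set i | u i <= v i] -> a <= b.
Proof.
move=> ua vb uv; rewrite -subr_ge0.
have h : (fun i => v i - u i) @ U --> b - a by exact: cvgB.
apply: (@closed_cvg _ _ U _ (fun i => v i - u i) [set s | 0 <= s] (@closed_ge _ 0) _ _ h).
by apply: filterS uv => i /=; rewrite subr_ge0.
Qed.

End MatrixCompactness.

Section Spectral.
Variables (R : realType) (n : nat).
Local Notation vec := 'rV[R]_n.
Local Notation mat := 'M[R]_n.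
Implicit Types (x y : vec) (A B : mat).

Lemma Qf_cvg (T : Type) (F : set_system T) {FF : Filter F} (f g : T -> vec) (a b : vec) :
  f @ F --> a -> g @ F --> b -> (fun t => Qf (f t) (g t)) @ F --> Qf a b.
Proof.
move=> fa gb; apply: (@cvg_coord R T F _ _ (fun t => f t *m (g t)^T)).
by apply: cvgmxM => //; exact: cvgmxT.
Qed.

(* Rayleigh quotient on the orthogonal complement of a frame of eigenvectors *)
Lemma spectral A : A^T = A -> exists (U : mat) (d : 'rV[R]_n),
  U *m U^T = 1%:M /\ U *m A = diag_mx d *m U.
Proof.
move=> AT.
have [|k [U [UU [d Ud] kmax]]] := @max_frame R n (fun k U => exists d : 'rV[R]_k, U *m A = diag_mx d *m U).
  by exists 0; apply/matrixP => -[].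
suff kn : k = n.
  by move: U d UU Ud {kmax}; rewrite kn => U d UU Ud; exists U, d.
apply/eqP; rewrite eqn_leq -{1}(frame_rank UU) rank_leq_col /= leqNgt; apply/negP => kn.
pose W x := x *m U^T = 0.
have [x0 x00 Wx0] : exists2 x0 : vec, x0 != 0 & W x0.
  have : \rank (kermx U^T) != 0%N.
    by rewrite mxrank_ker mxrank_tr (frame_rank UU) subn_eq0 -ltnNge.
  rewrite mxrank_eq0 => /eqP/matrixP h.
  have /rowV0Pn[x0 /sub_kermxP hx x00] : kermx U^T != 0 by apply/eqP => E; apply: h => i j; rewrite E.
  by exists x0.
pose S := [set x : vec | W x /\ Qf x x = 1].
have cS : compact S.
  apply: bounded_closed_compact.
    exists 1; split; first by rewrite realE ler01.
    move=> b b1 x [_ x1]; apply: (@le_trans _ _ 1); last exact: ltW.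
    apply/mx_norm_le => // i j; rewrite ord1.
    rewrite -(@ler_pXn2r _ 2)// ?nnegrE// expr1n real_normK ?num_real// -x1 QfE (bigD1 j)//= -expr2 lerDl.
    by apply: sumr_ge0 => l _; rewrite -expr2 sqr_ge0.
  have -> : S = (fun x : vec => x *m U^T) @^-1` [set 0] `&` (fun x : vec => Qf x x) @^-1` [set 1] by [].
  apply: closedI; apply: closed_comp.
  - move=> x _; apply: (@cvgmxM _ _ (nbhs x)); [exact: cvg_id|exact: cvg_cst].
  - exact: (accessible_closed_set1 (hausdorff_accessible (@norm_hausdorff _ _))).
  - by move=> x _; apply: (@Qf_cvg _ (nbhs x)); exact: cvg_id.
  - exact: closed_eq.
have WZ a x : W x -> W (a *: x) by rewrite /W -scalemxAl => ->; rewrite scaler0.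
have WD x y : W x -> W y -> W (x + y) by rewrite /W mulmxDl => -> ->; rewrite addr0.
have WA x : W x -> W (x *m A).
  rewrite /W => hx; rewrite -mulmxA -[A]AT -trmx_mul Ud trmx_mul mulmxA hx mul0mx//.
have nrm x : W x -> x != 0 -> S ((Num.sqrt (Qf x x))^-1 *: x).
  move=> Wx xn0; have q0 := Qf_gt0 xn0; split; first exact: WZ.
  by rewrite QfZl QfZr mulrA -expr2 exprVn sqr_sqrtr ?ltW// mulVf// gt_eqF.
have cq : {within S, continuous (fun x : vec => Qf (x *m A) x)}.
  apply: continuous_subspaceT => x; apply: (@Qf_cvg _ (nbhs x)); last exact: cvg_id.
  by apply: (@cvgmxM _ _ (nbhs x)); [exact: cvg_id|exact: cvg_cst].
have [x] := compact_EVT_max (ex_intro _ _ (nrm x0 Wx0 x00)) cS cq.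
rewrite inE => -[Wx x1] xmax.
set l := Qf (x *m A) x in xmax.
have hW z : W z -> Qf (z *m A) z <= l * Qf z z.
  move=> Wz; have [->|z0] := eqVneq z 0; first by rewrite mul0mx !Qf0l mulr0.
  have q0 := Qf_gt0 z0.
  have := xmax _ (mem_set (nrm z Wz z0)).
  rewrite -scalemxAl QfZl QfZr mulrA -expr2 exprVn sqr_sqrtr ?(ltW q0)//.
  by rewrite ler_pdivrMl// [leRHS]mulrC.
have [v vE] : exists v, v = x *m A - l *: x by eexists.
have Wv : W v by rewrite vE; apply: WD; [exact: WA|rewrite -scaleN1r; do 2!apply: (WZ _)].
have xv : Qf (x *m A) v - l * Qf x v = Qf v v by rewrite {3}vE QfBl QfZl.
have v0 : v = 0.
  apply/eqP; rewrite -Qf_eq0 eq_le Qf_ge0 andbT leNgt; apply/negP => qv.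
  (* Variation of the Rayleigh quotient at its maximum [x] in the direction [v]; letting [t] tend to
     [0] forces [v] to vanish. *)
  have key (t : R) : 0 < t -> 2 * Qf v v <= t * (l * Qf v v - Qf (v *m A) v).
    move=> t0; have := hW (x + t *: v) (WD _ _ Wx (WZ t _ Wv)).
    rewrite mulmxDl -scalemxAl !(QfDl, QfDr, QfZl, QfZr) x1 -/l.
    have -> : Qf (v *m A) x = Qf (x *m A) v by rewrite Qf_mulmx AT QfC.
    rewrite (QfC v x) => h; rewrite -(ler_pM2l t0) -xv; move: h; nra.
  set c := l * Qf v v - Qf (v *m A) v in key.
  have c0 : 0 < `|c| + 1 by rewrite ltr_wpDl.
  have t0 : 0 < Qf v v / (`|c| + 1) by rewrite divr_gt0.
  have := key _ t0; rewrite mulrAC ler_pdivlMr//.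
  have : c <= `|c| by exact: ler_norm.
  have := normr_ge0 c; nra.
have xA : x *m A = l *: x by apply/eqP; rewrite -subr_eq0 -vE v0.
have xn0 : x != 0 by rewrite -Qf_eq0 x1 oner_eq0.
have [a a0 UU'] := frame_extend UU Wx xn0.
apply: (kmax _ UU'); exists (row_mx d (const_mx l)).
rewrite mul_col_mx Ud -scalemxAl xA.
apply/row_matrixP => i; rewrite row_mul row_diag_mx -scalemxAl -rowE.
case: (split_ordP i) => j ->; rewrite ?row_mxEl ?row_mxEr ?rowKu ?rowKd.
  by rewrite row_mul row_diag_mx -scalemxAl -rowE.
by rewrite mxE ord1 !rowE -!scalemxAr !scalerA mulrC.
Qed.

End Spectral.

Section SpectralConsequences.
Variables (R : realType) (n : nat).
Local Notation vec := 'rV[R]_n.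
Local Notation mat := 'M[R]_n.
Implicit Types (x y : vec) (A B : mat).

Lemma frame_square (U : mat) : U *m U^T = 1%:M -> U^T *m U = 1%:M.
Proof. exact: mulmx1C. Qed.

Lemma spectral_decomp A (U : mat) (d : 'rV[R]_n) : U *m U^T = 1%:M ->
  U *m A = diag_mx d *m U -> A = U^T *m diag_mx d *m U.
Proof. by move=> UU UA; rewrite -mulmxA -UA mulmxA frame_square// mul1mx. Qed.

Lemma spectral_eigen A (U : mat) (d : 'rV[R]_n) i :
  U *m A = diag_mx d *m U -> row i U *m A = d 0 i *: row i U.
Proof. by move=> UA; rewrite -row_mul UA row_mul row_diag_mx -scalemxAl -rowE. Qed.

Lemma spectral_trace A (U : mat) (d : 'rV[R]_n) : U *m U^T = 1%:M ->
  U *m A = diag_mx d *m U -> \tr A = \sum_i d 0 i.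
Proof.
move=> UU UA; rewrite (spectral_decomp UU UA) mxtrace_mulC mulmxA UU mul1mx.
by rewrite mxtrace_diag.
Qed.

Lemma spectral_form A (U : mat) (d : 'rV[R]_n) x : U *m U^T = 1%:M ->
  U *m A = diag_mx d *m U -> Qf (x *m A) x = \sum_i d 0 i * (x *m U^T) 0 i ^+ 2.
Proof.
move=> UU UA; rewrite (spectral_decomp UU UA) !mulmxA /Qf -mulmxA.
rewrite -{2}[U]trmxK -trmx_mul mxE; apply: eq_bigr => i _.
by rewrite mul_mx_diag !mxE expr2 mulrCA mulrA.
Qed.

Lemma frame_row_neq0 (U : mat) i : U *m U^T = 1%:M -> row i U != 0.
Proof.
move=> UU; apply/eqP => U0; have /matrixP/(_ i i) := UU.
rewrite mxE big1 ?mxE ?eqxx; first by move/eqP; rewrite eq_sym oner_eq0.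
by move=> j _; have /rowP/(_ j) := U0; rewrite !mxE => ->; rewrite mul0r.
Qed.

Lemma nonneg_specP A : A^T = A -> Defs.nonneg_spec A <-> forall x, 0 <= Qf (x *m A) x.
Proof.
move=> AT; split.
  have [U [d [UU UA]]] := spectral AT => hA x; rewrite (spectral_form x UU UA).
  apply: sumr_ge0 => i _; rewrite mulr_ge0 ?sqr_ge0//.
  by apply: (hA _ (row i U)); [exact: frame_row_neq0|exact: spectral_eigen].
move=> h l v v0 hv; have := h v; rewrite hv QfZl pmulr_lge0//; exact: Qf_gt0.
Qed.

(** In an eigenframe of [A] the trace is a sum of eigenvalues of [A] times values of the form of
    [B]. *)
Lemma tr_psd_ge0 A B : A^T = A -> (forall x, 0 <= Qf (x *m A) x) ->
  (forall x, 0 <= Qf (x *m B) x) -> 0 <= \tr (A *m B).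
Proof.
move=> AT hA hB; have [U [d [UU UA]]] := spectral AT.
rewrite (spectral_decomp UU UA) -!mulmxA mxtrace_mulC -!mulmxA.
apply: sumr_ge0 => i _; rewrite mul_diag_mx mxE mulr_ge0//.
  have nA : Defs.nonneg_spec A by apply/(nonneg_specP AT).
  by apply: (nA _ (row i U)); [exact: frame_row_neq0|exact: spectral_eigen].
have := hB (row i U); rewrite /Qf -row_mul mxE => /le_trans; apply.
rewrite mulmxA mxE le_eqVlt; apply/orP; left; apply/eqP; apply: eq_bigr => j _.
by rewrite !mxE.
Qed.

Lemma proj_psd P x : is_proj P -> 0 <= Qf (x *m P) x.
Proof.
move=> [PT PP]; have -> : Qf (x *m P) x = Qf (x *m P) (x *m P); last exact: Qf_ge0.
by rewrite [RHS]Qf_mulmx PT -mulmxA PP QfC.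
Qed.

(** The trace is the squared Frobenius norm of [f *m e]. *)
Lemma tr_proj_eq0 (e f : mat) : is_proj e -> is_proj f -> \tr (f *m e) <= 0 -> f *m e = 0.
Proof.
move=> pe pf h; apply: tr_mulT_eq0.
have E : \tr (f *m e *m (f *m e)^T) = \tr (f *m e).
  rewrite trmx_mul pe.1 pf.1 mulmxA -(mulmxA f e e) pe.2 mxtrace_mulC mulmxA pf.2//.
by apply/eqP; rewrite eq_le tr_mulT_ge0 andbT E.
Qed.

Variable A : mat.

Lemma Fa_eig (a l : R) (v : vec) : l <= a -> v *m A = l *: v -> Fa A a v.
Proof.
move=> la hv; exists [:: (l, v)]; split; last by rewrite big_seq1.
by move=> p; rewrite inE => /eqP ->.
Qed.

Lemma Fa0 (a : R) : Fa A a 0.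
Proof. by exists [::]; split => //; rewrite big_nil. Qed.

Lemma Fa_add (a : R) x y : Fa A a x -> Fa A a y -> Fa A a (x + y).
Proof.
move=> [s [hs ->]] [t [ht ->]]; exists (s ++ t); rewrite big_cat; split => // p.
by rewrite mem_cat => /orP[/hs|/ht].
Qed.

Lemma Fa_opp (a : R) x : Fa A a x -> Fa A a (- x).
Proof.
move=> [s [hs ->]]; exists [seq (p.1, - p.2) | p <- s]; split.
  by move=> _ /mapP[p /hs[h1 h2] ->]; split => //=; rewrite /is_eigvec mulNmx h2 scalerN.
by rewrite big_map /= sumrN.
Qed.

Lemma Fa_le (a b : R) x : a <= b -> Fa A a x -> Fa A b x.
Proof.
by move=> ab [s [hs ->]]; exists s; split => // p /hs[h1 h2]; split => //; exact: le_trans ab.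
Qed.

Lemma Fa_ind (a : R) (W : vec -> Prop) : W 0 -> (forall x y, W x -> W y -> W (x + y)) ->
  (forall l v, l <= a -> v *m A = l *: v -> W v) -> forall x, Fa A a x -> W x.
Proof.
move=> W0 WD We x [s [hs ->]]; elim: s hs => [_|p s ih hs]; first by rewrite big_nil.
rewrite big_cons; apply: WD; first by have [] := hs p (mem_head _ _); exact: We.
by apply: ih => q qs; apply: hs; rewrite inE qs orbT.
Qed.

Variables (U : mat) (d : 'rV[R]_n).
Hypothesis UU : U *m U^T = 1%:M.
Hypothesis UA : U *m A = diag_mx d *m U.

(** Eigenvectors of a symmetric matrix for different eigenvalues are orthogonal; conversely [x] is
    expanded in the eigenframe. *)
Lemma Fa_spectral (a : R) x : Fa A a x <-> forall k, a < d 0 k -> Qf x (row k U) = 0.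
Proof.
split.
  move: x; apply: Fa_ind.
  - by move=> k _; rewrite Qf0l.
  - by move=> x y hx hy k ak; rewrite QfDl hx// hy// addr0.
  - move=> l v la hv k ak.
    have AT : A^T = A.
      by rewrite (spectral_decomp UU UA) !trmx_mul tr_diag_mx trmxK mulmxA.
    have := Qf_mulmx v (row k U) A; rewrite AT (spectral_eigen _ UA) hv QfZl QfZr => /eqP.
    rewrite -subr_eq0 -mulrBl mulf_eq0 subr_eq0 => /orP[/eqP E|/eqP//].
    by have := le_lt_trans la ak; rewrite E ltxx.
move=> h.
have -> : x = \sum_k Qf x (row k U) *: row k U.
  rewrite -[LHS]mulmx1 -(frame_square UU) mulmxA mulmx_sum_row; apply: eq_bigr => k _.
  congr (_ *: _); rewrite /Qf !mxE; apply: eq_bigr => j _; by rewrite !mxE.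
apply: (big_ind (Fa A a)) => [|x' y'|k _]; [exact: Fa0|exact: Fa_add|].
have [dk|dk] := leP (d 0 k) a; last by rewrite h// scale0r; exact: Fa0.
by apply: (Fa_eig dk); rewrite -scalemxAl (spectral_eigen _ UA) scalerA mulrC -scalerA.
Qed.

Lemma spectral_nonneg : (forall k, 0 <= d 0 k) <-> Defs.nonneg_spec A.
Proof.
have AT : A^T = A by rewrite (spectral_decomp UU UA) !trmx_mul tr_diag_mx trmxK mulmxA.
split; last by move=> h k; apply: (h _ (row k U)); [exact: frame_row_neq0|exact: spectral_eigen].
move=> dk; apply/(nonneg_specP AT) => x; rewrite (spectral_form x UU UA).
by apply: sumr_ge0 => i _; rewrite mulr_ge0 ?sqr_ge0.
Qed.

End SpectralConsequences.

(** * The bracket, subalgebras and the sets B[k] *)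

Section Bracket.
Variables (R : realType) (n : nat) (br : 'rV[R]_n -> 'rV[R]_n -> 'rV[R]_n).
Local Notation vec := 'rV[R]_n.
Local Notation mat := 'M[R]_n.
Hypothesis hbr : compact_lie_bracket br.

Lemma brDl x y z : br (x + y) z = br x z + br y z.
Proof. by case: hbr => h _ _ _ _; have := h 1 x y z; rewrite !scale1r. Qed.
Lemma brDr x y z : br z (x + y) = br z x + br z y.
Proof. by case: hbr => _ h _ _ _; have := h 1 x y z; rewrite !scale1r. Qed.
Lemma br0l z : br 0 z = 0.
Proof. by have /eqP := brDl 0 0 z; rewrite addr0 -subr_eq subrr => /eqP. Qed.
Lemma br0r z : br z 0 = 0.
Proof. by have /eqP := brDr 0 0 z; rewrite addr0 -subr_eq subrr => /eqP. Qed.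
Lemma brZl a x z : br (a *: x) z = a *: br x z.
Proof. by case: hbr => h _ _ _ _; have := h a x 0 z; rewrite !addr0 br0l addr0. Qed.
Lemma brZr a x z : br z (a *: x) = a *: br z x.
Proof. by case: hbr => _ h _ _ _; have := h a x 0 z; rewrite !addr0 br0r addr0. Qed.
Lemma brC x y : br x y = - br y x.
Proof.
case: hbr => _ _ h _ _; apply/eqP; rewrite -addr_eq0; apply/eqP.
by have := h (x + y); rewrite brDl !brDr !h add0r addr0.
Qed.
Lemma br_jacobi x y z : br (br x y) z = br x (br y z) - br y (br x z).
Proof.
case: hbr => _ _ _ h _; have /eqP := h x y z.
rewrite (brC z (br x y)) (brC z x) (_ : br y (- br x z) = - br y (br x z)); last first.
  by rewrite -scaleN1r brZr scaleN1r.
by rewrite subr_eq0 => /eqP <-.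
Qed.

Lemma br_suml (I : Type) (r : seq I) (F : I -> vec) z : br (\sum_(i <- r) F i) z = \sum_(i <- r) br (F i) z.
Proof. by elim: r => [|i r ih]; rewrite ?big_nil ?br0l// !big_cons brDl ih. Qed.
Lemma br_sumr (I : Type) (r : seq I) (F : I -> vec) z : br z (\sum_(i <- r) F i) = \sum_(i <- r) br z (F i).
Proof. by elim: r => [|i r ih]; rewrite ?big_nil ?br0r// !big_cons brDr ih. Qed.

Lemma brE x y : br x y = \sum_i \sum_j (x 0 i * y 0 j) *: br (delta_mx 0 i) (delta_mx 0 j).
Proof.
rewrite {1}(row_sum_delta x) br_suml; apply: eq_bigr => i _.
rewrite {1}(row_sum_delta y) br_sumr; apply: eq_bigr => j _.
by rewrite brZl brZr scalerA.
Qed.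

Lemma br_cvg (T : Type) (F : set_system T) {FF : Filter F} (f g : T -> vec) (a b : vec) :
  f @ F --> a -> g @ F --> b -> (fun t => br (f t) (g t)) @ F --> br a b.
Proof.
move=> fa gb; rewrite brE; under [X in X @ _ --> _]eq_fun do rewrite brE.
apply: cvgmx_sum => i; apply: cvgmx_sum => j; apply: cvgmxZ; last exact: cvg_cst.
by apply: cvgM; exact: cvg_coord.
Qed.

(** In an eigenframe, filtering is a condition on finitely many structure constants. In this form it
    is semialgebraic and, because a strict inequality between eigenvalues persists nearby, stable
    under limits. *)
Lemma filtering_spectral (A U : mat) (d : 'rV[R]_n) : U *m U^T = 1%:M ->
  U *m A = diag_mx d *m U -> filtering br A <->
  forall i j k, d 0 k <= d 0 i + d 0 j \/ Qf (br (row i U) (row j U)) (row k U) = 0.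
Proof.
move=> UU UA; split.
  move=> hA i j k; have [|dk] := leP (d 0 k) (d 0 i + d 0 j); [by left|right].
  have Fi : Fa A (d 0 i) (row i U) by apply: (Fa_eig (lexx _)); exact: spectral_eigen.
  have Fj : Fa A (d 0 j) (row j U) by apply: (Fa_eig (lexx _)); exact: spectral_eigen.
  by have /(Fa_spectral UU UA) := hA _ _ _ _ Fi Fj; exact.
move=> h a b x y /(Fa_spectral UU UA) hx /(Fa_spectral UU UA) hy.
apply/(Fa_spectral UU UA) => k abk.
have ex z : z = \sum_k Qf z (row k U) *: row k U.
  rewrite -[LHS]mulmx1 -(frame_square UU) mulmxA mulmx_sum_row; apply: eq_bigr => l _.
  congr (_ *: _); rewrite /Qf !mxE; apply: eq_bigr => j _; by rewrite !mxE.
have Qsum (F : 'I_n -> vec) z : Qf (\sum_i F i) z = \sum_i Qf (F i) z.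
  by apply: (big_morph (fun x => Qf x z)) => [x' y'|]; [exact: QfDl|exact: Qf0l].
rewrite (ex x) (ex y) br_suml Qsum; apply: big1 => i _.
rewrite brZl QfZl; have [ai|ai] := leP (d 0 i) a; last by rewrite hx// mul0r.
rewrite br_sumr Qsum big1 ?mulr0// => j _; rewrite brZr QfZl.
have [bj|bj] := leP (d 0 j) b; last by rewrite hy// mul0r.
case: (h i j k) => [hk|->]; last by rewrite mulr0.
by exfalso; have := lt_le_trans abk (le_trans hk (lerD ai bj)); rewrite ltxx.
Qed.

End Bracket.

Section Subalgebras.
Variables (R : realType) (n : nat) (br : 'rV[R]_n -> 'rV[R]_n -> 'rV[R]_n).
Variables (h : 'M[R]_n) (Aut : set 'M[R]_n).
Local Notation vec := 'rV[R]_n.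
Local Notation mat := 'M[R]_n.
Hypothesis hbr : compact_lie_bracket br.
Hypothesis hAut : is_aut_group br h Aut.
Implicit Types (k l m A : mat) (x y : vec).

Lemma proj_of_space (W : vec -> Prop) : W 0 ->
  (forall a x y, W x -> W y -> W (a *: x + y)) ->
  exists2 P : mat, is_proj P & forall x, inS P x <-> W x.
Proof.
move=> W0 WL; have [k [U [UU hU]]] := proj_of_subspace W0 WL.
by exists (U^T *m U) => //; exact: proj_of_frame.
Qed.

Lemma inS0 (P : mat) : inS P 0. Proof. by rewrite /inS mul0mx. Qed.
Lemma inSL (P : mat) a x y : inS P x -> inS P y -> inS P (a *: x + y).
Proof. by rewrite /inS => hx hy; rewrite mulmxDl -scalemxAl hx hy. Qed.
Lemma inSD (P : mat) x y : inS P x -> inS P y -> inS P (x + y).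
Proof. by rewrite -[X in inS P (X + _)]scale1r; exact: inSL. Qed.
Lemma inS_mul (P : mat) x : is_proj P -> inS P (x *m P).
Proof. by move=> pP; rewrite /inS -mulmxA pP.2. Qed.

Lemma join_exists k l : exists m, is_join_alg br k l m.
Proof.
pose W x := forall m', is_subalg br m' -> subS k m' -> subS l m' -> inS m' x.
have [||m pm hm] := @proj_of_space W.
- by move=> m' _ _ _; exact: inS0.
- by move=> a x y Wx Wy m' sm' km lm; apply: inSL; [exact: Wx|exact: Wy].
exists m; split.
- split => // x y /hm Wx /hm Wy; apply/hm => m' sm' km lm.
  by apply: sm'.2; [exact: Wx|exact: Wy].
- by move=> x kx; apply/hm => m' _ km _; exact: km.
- by move=> x kx; apply/hm => m' _ _ lm; exact: lm.
- by move=> m' sm' km lm x /hm; exact.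
Qed.

(** The preimage of [m] under [a] is a subalgebra containing [k] and [l], hence it contains [m]. *)
Lemma join_Aut_inv k l m : Aut_inv Aut k -> Aut_inv Aut l -> is_join_alg br k l m -> Aut_inv Aut m.
Proof.
move=> ak al [sm km lm mmin] a x aA.
pose W x := inS m (x *m a).
have [||m' pm' hm'] := @proj_of_space W.
- by rewrite /W mul0mx; exact: inS0.
- by move=> c y z; rewrite /W mulmxDl -scalemxAl; exact: inSL.
have [_ _ _ _ /(_ a aA)[_ abr _]] := hAut.
have sm' : is_subalg br m'.
  split => // y z /hm' hy /hm' hz; apply/hm'; rewrite /W -abr; exact: sm.2.
suff /(_ x) : subS m m' by move=> hx /hx/hm'.
by apply: mmin => // y hy; apply/hm'; [apply: km; exact: ak|apply: lm; exact: al].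
Qed.

Lemma Bk_Dset b k A : Bk br Aut b k A -> Dset br Aut k A.
Proof. by case: b => // -[]. Qed.

Lemma Bk_change b k l A : Bk br Aut b k A ->
  (forall x, inS l x -> x *m A = 0) ->
  (forall x y, inS l x -> br x y *m A = br x (y *m A)) -> Bk br Aut b l A.
Proof.
case: b => [[[sA nA tA aA _] FA]|[sA nA tA aA _]] h1 h2; last by split.
by split => //; split.
Qed.

Lemma Bk_sub b k l A : subS k l -> Bk br Aut b l A -> Bk br Aut b k A.
Proof.
move=> kl hA; have [_ _ _ _ [h1 h2]] := Bk_Dset hA.
by apply: (Bk_change hA) => [x /kl|x y /kl]; [exact: h1|exact: h2].
Qed.

Lemma Bk_gP b A : ~ Bk br Aut b (gP R n) A.
Proof.
move=> /Bk_Dset[_ _ tA _ [h1 _]].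
have A0 : A = 0.
  by apply/row_matrixP => i; rewrite rowE h1 ?row0// /inS mulmx1.
by move: tA; rewrite A0 mxtrace0 => /eqP; rewrite eq_sym oner_eq0.
Qed.

(* The vectors killed by A whose adjoint action commutes with A form a subalgebra. *)
Lemma Bk_join b k l m A : Bk br Aut b k A -> Bk br Aut b l A -> is_join_alg br k l m ->
  Bk br Aut b m A.
Proof.
move=> hk hl [sm km lm mmin].
have [_ _ _ _ [k1 k2]] := Bk_Dset hk; have [_ _ _ _ [l1 l2]] := Bk_Dset hl.
pose W x := x *m A = 0 /\ forall y, br x y *m A = br x (y *m A).
have [||m' pm' hm'] := @proj_of_space W.
- by split => [|y]; rewrite ?mul0mx// !(br0l hbr) mul0mx.
- move=> a x y [x1 x2] [y1 y2]; split; first by rewrite mulmxDl -scalemxAl x1 y1 scaler0 addr0.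
  move=> z; rewrite !(brDl hbr) !(brZl hbr) mulmxDl -scalemxAl x2 y2//.
have sm' : is_subalg br m'.
  split => // x y /hm'[x1 x2] /hm'[y1 y2]; apply/hm'; split.
    by rewrite x2 y1 (br0r hbr).
  by move=> z; rewrite !(br_jacobi hbr) mulmxBl !x2 !y2 x2.
have mm' : subS m m'.
  apply: mmin => // x hx; apply/hm'; split; [exact: k1|by move=> y; exact: k2|exact: l1|by move=> y; exact: l2].
by apply: (Bk_change hk) => [x /mm'/hm'[]//|x y /mm'/hm'[_]]; exact.
Qed.

(** Both [a] and its inverse [a^T] preserve [k]; transposing the relation for the inverse gives the
    other half of the commutation. *)
Lemma Aut_comm k a : is_proj k -> Aut_inv Aut k -> Aut a -> k *m a = a *m k.
Proof.
move=> pk ak aA; have [_ _ _ Ainv /(_ a aA)[aT _ _]] := hAut.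
have key c : Aut c -> k *m c *m k = k *m c.
  move=> cA; apply/row_matrixP => i; rewrite row_mul row_mul.
  by apply: ak => //; rewrite /inS -row_mul pk.2.
have ia : invmx a = a^T.
  have ua : a \in unitmx by case: (mulmx1_unit aT).
  by rewrite -[RHS]mul1mx -(mulVmx ua) -mulmxA aT mulmx1.
have := key _ (Ainv a aA); rewrite ia => /(congr1 trmx).
by rewrite !trmx_mul trmxK pk.1 mulmxA key.
Qed.

(** Invariance of [Q] makes the adjoint action of [k] preserve the orthogonal complement of [k]. *)
Lemma orth_br k x y : is_subalg br k -> inS k x -> y *m k = 0 -> br x y *m k = 0.
Proof.
move=> [pk sk] kx yk; apply/eqP; rewrite -Qf_eq0; apply/eqP.
have [_ _ _ _ inv] := hbr.
set w := br x y *m k.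
have kw : inS k w by exact: inS_mul.
have -> : Qf w w = Qf (br x y) w.
  by rewrite /w [LHS]Qf_mulmx pk.1 -mulmxA pk.2.
rewrite (brC hbr) QfNl inv.
have kxw : br x w *m k = br x w by exact: sk.
by rewrite -kxw QfC Qf_mulmx pk.1 yk QfC Qf0l oppr0.
Qed.

Lemma ad_proj k x y : is_subalg br k -> inS k x -> br x y *m k = br x (y *m k).
Proof.
move=> sk kx; have [pk sk2] := sk.
have z : (y - y *m k) *m k = 0 by rewrite mulmxBl -mulmxA pk.2 subrr.
rewrite -{1}[y](subrKC (y *m k)) (brDr hbr) mulmxDl (orth_br sk kx z) addr0.
by apply: sk2 => //; exact: inS_mul.
Qed.

Lemma rank_lt_gP k : is_proj k -> k <> gP R n -> (\rank k < n)%N.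
Proof.
move=> pk kg; rewrite -[X in (_ < X)%N](mxrank1 R n); apply: psubS_rank => //; first exact: proj1.
by split => //; exact: subS1.
Qed.

Lemma chibar_tr k : is_proj k -> k <> gP R n -> \tr (chibar k) = 1.
Proof.
move=> pk kg; rewrite /chibar linearZ /= linearB /= mxtrace1 (proj_trace pk).
have rk := rank_lt_gP pk kg; rewrite natrB ?(ltnW rk)// mulVf//.
by rewrite subr_eq0 eqr_nat neq_ltn rk orbT.
Qed.

Section Star.
Variables (k : mat).
Hypothesis sk : is_subalg br k.
Let pk := sk.1.

Lemma decompk x : x = x *m k + x *m (1%:M - k).
Proof. by rewrite -mulmxDr addrC subrK mulmx1. Qed.

Lemma inS_kill x : x *m (1%:M - k) = 0 <-> inS k x.
Proof.
by rewrite mulmxBr mulmx1 /inS; split => [/eqP|->]; rewrite ?subrr// subr_eq0 => /eqP.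
Qed.

(** The eigenspaces are [k], for [0], and its complement, for [c]. So [Fa] takes only the values
    zero, [k] and the whole space, and [k] is a subalgebra. *)
Lemma chibar_filtering (c : R) : 0 < c -> filtering br (c *: (1%:M - k)).
Proof.
move=> c0; set C := c *: _.
have kC x : inS k x -> x *m C = 0 *: x by move=> /inS_kill kx; rewrite -scalemxAr kx scaler0 scale0r.
have oC x : x *m k = 0 -> x *m C = c *: x.
  by move=> xk; rewrite -scalemxAr mulmxBr xk mulmx1 subr0.
have FaP a x : Fa C a x -> (x = 0) \/ (0 <= a /\ inS k x) \/ c <= a.
  have [ca|ca] := leP c a; first by right; right.
  move=> hx; suff : inS k x /\ (x = 0 \/ 0 <= a) by move=> [h1 [->|h2]]; [left|right; left].
  move: x hx; apply: Fa_ind.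
  - by split; [exact: inS0|left].
  - move=> x y [x1 x2] [y1 y2]; split; first exact: inSD.
    by case: x2 => [->|?]; [case: y2 => [->|?]; [left; rewrite addr0|right]|right].
  - move=> l v la hv.
    have v2 : v *m (1%:M - k) = 0.
      have : v *m C *m (1%:M - k) = l *: v *m (1%:M - k) by rewrite hv.
      have i1 : (1%:M - k) *m (1%:M - k) = 1%:M - k by exact: (proj_subB pk (proj1 R n) (@subS1 R n k)).2.
      rewrite -scalemxAr -!scalemxAl -mulmxA i1 => /eqP; rewrite -subr_eq0 -scalerBl scaler_eq0.
      by move=> /orP[|/eqP//]; rewrite subr_eq0 => /eqP E; move: la; rewrite leNgt -E ca.
    have kv : inS k v by apply/inS_kill.
    split => //; have : v *m C = 0 *: v by exact: kC.
    rewrite hv => /eqP; rewrite -subr_eq0 -scalerBl subr0 scaler_eq0 => /orP[/eqP l0|/eqP]; last by left.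
    by right; rewrite -l0.
have Fall a x : c <= a -> Fa C a x.
  move=> ca; rewrite (decompk x); apply: Fa_add.
    by apply: (@Fa_eig _ _ C a 0); [exact: le_trans (ltW c0) ca|apply: kC; exact: inS_mul].
  by apply: (@Fa_eig _ _ C a c) => //; apply: oC; rewrite -mulmxA mulmxBl mul1mx pk.2 subrr mulmx0.
move=> a b x y /FaP hx /FaP hy.
case: hx => [->|hx]; first by rewrite (br0l hbr); exact: Fa0.
case: hy => [->|hy]; first by rewrite (br0r hbr); exact: Fa0.
case: hx => [[a0 kx]|ca].
  case: hy => [[b0 ky]|cb]; last by apply: Fall; rewrite (le_trans cb)// lerDr.
  apply: (@Fa_eig _ _ C (a + b) 0); first by rewrite addr_ge0.
  by apply: kC; exact: sk.2.
apply: Fall; apply: (le_trans ca); rewrite lerDl.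
by case: hy => [[]//|cb]; exact: le_trans (ltW c0) cb.
Qed.

(** Brackets within [k] stay in [k]. Brackets with [k] preserve every [Fa A], because [A] commutes
    with the adjoint action of [k]. Two shifted levels [(a - c) / r] and [(b - c) / r] add up to at
    most [(a + b - c) / r], as [0 <= c]. This is what makes [Xset k] star-shaped about its
    vertex. *)
Lemma star_filtering A (r c : R) : 0 < r -> 0 <= c -> A^T = A ->
  (forall x, inS k x -> x *m A = 0) -> (forall x y, inS k x -> br x y *m A = br x (y *m A)) ->
  filtering br A -> filtering br (r *: A + c *: (1%:M - k)).
Proof.
move=> r0 c0 AT kA adA FA; set C := r *: A + _.
have rn0 : r != 0 by rewrite gt_eqF.
have kA0 : k *m A = 0 by apply/row_matrixP => i; rewrite row_mul row0 kA// /inS -row_mul pk.2.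
have Ak0 : A *m k = 0 by have := congr1 trmx kA0; rewrite trmx_mul pk.1 AT trmx0.
have kC x : inS k x -> x *m C = 0 *: x.
  move=> kx; rewrite mulmxDr -!scalemxAr kA// scaler0 add0r.
  by move: kx => /inS_kill ->; rewrite scaler0 scale0r.
(* F_a(C) splits into a part in k and a part in F_((a - c) / r)(A) *)
have FaP a x : Fa C a x -> exists x1 x2, [/\ x = x1 + x2, inS k x1, x1 = 0 \/ 0 <= a & Fa A ((a - c) / r) x2].
  move: x; apply: Fa_ind.
  - by exists 0, 0; split; [rewrite addr0|exact: inS0|left|exact: Fa0].
  - move=> x y [x1 [x2 [-> kx ax fx]]] [y1 [y2 [-> ky ay fy]]].
    exists (x1 + y1), (x2 + y2); split; [by rewrite addrACA|exact: inSD| |exact: Fa_add].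
    by case: ax => [->|?]; [case: ay => [->|?]; [left; rewrite addr0|right]|right].
  - move=> l v la hv; exists (v *m k), (v *m (1%:M - k)); split.
    + exact: decompk.
    + exact: inS_mul.
    + have : v *m C *m k = l *: v *m k by rewrite hv.
      have -> : v *m C *m k = 0.
        rewrite -mulmxA mulmxDl -!scalemxAl Ak0 scaler0 add0r mulmxBl mul1mx pk.2 subrr scaler0 mulmx0//.
      rewrite -scalemxAl => /esym/eqP; rewrite scaler_eq0 => /orP[/eqP l0|/eqP]; last by left.
      by right; rewrite -l0.
    + apply: (@Fa_eig _ _ A _ ((l - c) / r)); first by rewrite ler_pM2r ?invr_gt0// lerD2r.
      have vA : v *m (1%:M - k) *m A = v *m A by rewrite -mulmxA mulmxBl mul1mx kA0 subr0.
      have i1 : (1%:M - k) *m (1%:M - k) = 1%:M - k by exact: (proj_subB pk (proj1 R n) (@subS1 R n k)).2.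
      have E1 : C *m (1%:M - k) = r *: A + c *: (1%:M - k).
        by rewrite mulmxDl -!scalemxAl i1 mulmxBr mulmx1 Ak0 subr0.
      have : r *: (v *m A) + c *: (v *m (1%:M - k)) = l *: (v *m (1%:M - k)).
        by rewrite [RHS]scalemxAl -hv -mulmxA E1 (mulmxDr v (r *: A)) -!scalemxAr.
      move=> /eqP; rewrite eq_sym -subr_eq -scalerBl vA => /eqP E.
      by rewrite mulrC -scalerA E scalerA mulVf// scale1r.
have Fk a x : 0 <= a -> inS k x -> Fa C a x by move=> a0 kx; apply: (Fa_eig a0); exact: kC.
have FA_C a x : Fa A ((a - c) / r) x -> Fa C a x.
  move: x; apply: Fa_ind; [exact: Fa0|exact: Fa_add|move=> l v la hv].
  rewrite ler_pdivlMr// lerBrDr in la.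
  have lk : l *: (v *m k) = 0 by rewrite scalemxAl -hv -mulmxA Ak0 mulmx0.
  have v2A : v *m (1%:M - k) *m A = l *: (v *m (1%:M - k)).
    rewrite -mulmxA mulmxBl mul1mx kA0 subr0 hv.
    by rewrite {1}(decompk v) scalerDr lk add0r.
  rewrite (decompk v); apply: Fa_add.
    have [->|vk] := eqVneq (v *m k) 0; first exact: Fa0.
    apply: Fk; last exact: inS_mul.
    move/eqP: lk; rewrite scaler_eq0 (negbTE vk) orbF => /eqP l0.
    by move: la; rewrite l0 mul0r add0r; exact: le_trans.
  apply: (Fa_eig la); rewrite (mulmxDr _ (r *: A)) -!scalemxAr v2A.
  have -> : v *m (1%:M - k) *m (1%:M - k) = v *m (1%:M - k).
    by rewrite -mulmxA (proj_subB pk (proj1 R n) (@subS1 R n k)).2.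
  by rewrite scalerA -scalerDl mulrC.
have adF a x y : inS k x -> Fa A a y -> Fa A a (br x y).
  move=> kx; move: y; apply: Fa_ind.
  - by rewrite (br0r hbr); exact: Fa0.
  - by move=> y z; rewrite (brDr hbr); exact: Fa_add.
  - by move=> l v la hv; apply: (Fa_eig la); rewrite adA// hv (brZr hbr).
move=> a b x y /FaP[x1 [x2 [-> kx ax fx]]] /FaP[y1 [y2 [-> ky by_ fy]]].
rewrite (brDl hbr) !(brDr hbr).
apply: Fa_add; apply: Fa_add.
- case: ax => [->|a0]; first by rewrite (br0l hbr); exact: Fa0.
  case: by_ => [->|b0]; first by rewrite (br0r hbr); exact: Fa0.
  by apply: Fk; [exact: addr_ge0|exact: sk.2].
- case: ax => [->|a0]; first by rewrite (br0l hbr); exact: Fa0.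
  by apply: (@Fa_le _ _ C b); [rewrite lerDr|apply: FA_C; exact: adF].
- case: by_ => [->|b0]; first by rewrite (br0r hbr); exact: Fa0.
  apply: (@Fa_le _ _ C a); first by rewrite lerDl.
  by rewrite (brC hbr); apply: Fa_opp; apply: FA_C; exact: adF.
- apply: FA_C; apply: Fa_le (FA _ _ _ _ fx fy).
  by rewrite -mulrDl ler_pM2r ?invr_gt0//; lra.
Qed.

End Star.

Lemma Aut_inv_chibar k a : is_proj k -> Aut_inv Aut k -> Aut a -> chibar k *m a = a *m chibar k.
Proof.
by move=> pk ak aA; rewrite /chibar -scalemxAl -scalemxAr mulmxBl mulmxBr mul1mx mulmx1 Aut_comm.
Qed.

Lemma chibar_Bk b k : is_subalg br k -> Aut_inv Aut k -> k <> gP R n -> Bk br Aut b k (chibar k).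
Proof.
move=> sk ak kg; have pk := sk.1; have rk := rank_lt_gP pk kg.
have c0 : 0 < ((n - \rank k)%:R : R)^-1 by rewrite invr_gt0 ltr0n subn_gt0.
have p1 := proj_subB pk (proj1 R n) (@subS1 R n k).
have T : (chibar k)^T = chibar k by rewrite /chibar linearZ /= p1.1.
have N : Defs.nonneg_spec (chibar k).
  apply/(nonneg_specP T) => x; rewrite /chibar -scalemxAr QfZl mulr_ge0 ?(ltW c0)//; exact: proj_psd.
have D : Dset br Aut k (chibar k).
  split => //; first exact: chibar_tr.
    by move=> a aA; exact: Aut_inv_chibar.
  split.
    by move=> x /(inS_kill k) kx; rewrite /chibar -scalemxAr kx scaler0.
  move=> x y kx; rewrite /chibar -!scalemxAr (brZr hbr) !mulmxBr !mulmx1 (ad_proj y sk kx).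
  by rewrite (brDr hbr) -[- (y *m k)]scaleN1r (brZr hbr) scaleN1r.
case: b => //; split => //; split => //; last exact: chibar_tr.
exact: chibar_filtering.
Qed.

Lemma Bk_star b k A (s : R) : is_subalg br k -> Aut_inv Aut k -> 0 <= s <= 1 -> Bk br Aut b k A ->
  Bk br Aut b k ((1 - s) *: A + s *: chibar k).
Proof.
move=> sk ak /andP[s0 s1] BA; have pk := sk.1.
have kg : k <> gP R n by move=> kg; move: BA; rewrite kg => /Bk_gP.
have Bc := chibar_Bk b sk ak kg.
have [C CE] : exists C, C = chibar k by eexists.
rewrite -CE in Bc *.
have [->|s1'] := eqVneq s 1; first by rewrite subrr scale0r add0r scale1r.
have s1l : s < 1 by rewrite lt_neqAle s1'.
have [AT NA trA aA [kA adA]] := Bk_Dset BA.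
have [CT NC trC aC [kC adC]] := Bk_Dset Bc.
have T : ((1 - s) *: A + s *: C)^T = (1 - s) *: A + s *: C.
  by rewrite linearD /= linearZ /= [X in _ + X]linearZ /= AT CT.
have N : Defs.nonneg_spec ((1 - s) *: A + s *: C).
  apply/(nonneg_specP T) => x; rewrite mulmxDr -!scalemxAr QfDl !QfZl.
  have pA := (nonneg_specP AT).1 NA x; have pC := (nonneg_specP CT).1 NC x.
  by apply: addr_ge0; apply: mulr_ge0 => //; rewrite subr_ge0.
have tr1 : \tr ((1 - s) *: A + s *: C) = 1.
  by rewrite linearD /= linearZ /= [X in _ + X]linearZ /= trA trC !mulr1 subrK.
have D : Dset br Aut k ((1 - s) *: A + s *: C).
  split => //.
    by move=> a ha; rewrite mulmxDl mulmxDr -!scalemxAl -!scalemxAr aA// aC.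
  split; first by move=> x kx; rewrite mulmxDr -!scalemxAr kA// kC// !scaler0 addr0.
  by move=> x y kx; rewrite !mulmxDr -!scalemxAr adA// adC// (brDr hbr) !(brZr hbr).
move: BA; case: b {Bc} => //= -[_ [_ FA _ _]]; split => //; split => //.
rewrite CE /chibar scalerA; apply: star_filtering => //; first by rewrite subr_gt0.
by rewrite mulr_ge0.
Qed.

(** Positive multiples spare a renormalisation after each added vertex; the trace restores it once
    at the end. *)
Definition coneB b k (M : mat) := exists (w : R) A, [/\ 0 < w, Bk br Aut b k A & M = w *: A].

Lemma coneB_add b k M (t : R) : is_subalg br k -> Aut_inv Aut k -> 0 <= t -> coneB b k M ->
  coneB b k (M + t *: chibar k).
Proof.
move=> sk ak t0 [w [A [w0 BA ->]]]; have wt : 0 < w + t by rewrite ltr_wpDr.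
exists (w + t), ((1 - t / (w + t)) *: A + (t / (w + t)) *: chibar k); split => //.
  by apply: Bk_star => //; rewrite divr_ge0 ?(ltW wt)//= ler_pdivrMr// mul1r lerDr ltW.
by rewrite scalerDr 2!(scalerA (w + t)); congr (_ *: _ + _ *: _); field; rewrite gt_eqF.
Qed.

Lemma coneB_Bk b k M : coneB b k M -> \tr M = 1 -> Bk br Aut b k M.
Proof.
move=> [w [A [w0 BA ->]]]; have [_ _ trA _ _] := Bk_Dset BA.
by rewrite linearZ /= trA mulr1 => ->; rewrite scale1r.
Qed.

Lemma coneB_sub b k l M : subS k l -> coneB b l M -> coneB b k M.
Proof. by move=> kl [w [A [w0 BA ->]]]; exists w, A; split => //; exact: Bk_sub BA. Qed.

(* Adding the vertices of a flag from the largest to the smallest subalgebra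
   only uses the star-shapedness of each B[f]. *)
Lemma chain_Bk b (top A : mat) (s : R) (t : nat -> R) (F : nat -> mat) :
  0 <= s -> (forall d, 0 <= t d) -> (0 < s -> Bk br Aut b top A) ->
  (forall d, (d < n)%N -> 0 < t d -> [/\ is_subalg br (F d), Aut_inv Aut (F d), F d <> gP R n & (0 < s -> subS (F d) top)]) ->
  (forall d d', (d <= d')%N -> (d' < n)%N -> 0 < t d -> 0 < t d' -> subS (F d) (F d')) ->
  s + \sum_(0 <= d < n) t d = 1 -> \tr A = 1 ->
  exists2 f, (0 < s /\ f = top) \/ (exists2 d, (d < n)%N & 0 < t d /\ f = F d) &
    Bk br Aut b f (s *: A + \sum_(0 <= d < n) t d *: chibar (F d)).
Proof.
move=> s0 t0 hA hF hch tot trA.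
pose M j := s *: A + \sum_(j <= d < n) t d *: chibar (F d).
(* Descending induction on [j]: either nothing has been summed yet, or [f] is the smallest member
   met so far and contains every one still to come. *)
have main j : (j <= n)%N -> (s = 0 /\ forall d, (j <= d < n)%N -> t d = 0) \/
   exists f, [/\ (0 < s /\ f = top) \/ (exists2 d, (d < n)%N & 0 < t d /\ f = F d), coneB b f (M j) &
      forall d, (d < j)%N -> 0 < t d -> subS (F d) f].
  move=> jn; rewrite -(subKn jn); move: (n - j)%N (leq_subr j n) => i; elim: i => [_|i ih lin].
    rewrite subn0; have [->|sn0] := eqVneq s 0.
      by left; split => // d /andP[h1 h2]; move: h1; rewrite leqNgt h2.
    have sp : 0 < s by rewrite lt_neqAle eq_sym sn0.
    right; exists top; split; first by left.
      by exists s, A; split => //; [exact: hA|rewrite /M big_geq// addr0].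
    by move=> d dn td; have [_ _ _] := hF d dn td; apply.
  set j0 := (n - i.+1)%N.
  have j0E : (n - i = j0.+1)%N by rewrite /j0 subnSK.
  have j0n : (j0 < n)%N by rewrite -j0E leq_subr.
  have ME : M j0 = t j0 *: chibar (F j0) + M j0.+1 by rewrite /M big_ltn// addrCA.
  have {}ih := ih (ltnW lin); rewrite j0E in ih.
  have [tj|tj] := eqVneq (t j0) 0.
    case: ih => [[sz hz]|[f [h1 h2 h3]]].
      left; split => // d /andP[]; rewrite leq_eqVlt => /predU1P[<-//|jd dn].
      by apply: hz; rewrite jd.
    right; exists f; split => //; first by rewrite ME tj scale0r add0r.
    by move=> d dj; apply: h3; exact: ltnW.
  have tjp : 0 < t j0 by rewrite lt_neqAle eq_sym tj t0.
  have [sF aF nF _] := hF j0 j0n tjp.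
  right; exists (F j0); split.
  - by right; exists j0.
  - rewrite ME addrC; case: ih => [[sz hz]|[f [h1 h2 h3]]].
      exists (t j0), (chibar (F j0)); split => //; first exact: chibar_Bk.
      rewrite /M sz scale0r add0r big1_seq ?add0r// => d /andP[_].
      by rewrite mem_index_iota => /hz ->; rewrite scale0r.
    by apply: coneB_add => //; apply: coneB_sub h2; exact: h3.
  - by move=> d dj td; apply: hch => //; exact: ltnW.
case: (main 0%N (leq0n _)) => [[sz hz]|[f [h1 h2 _]]].
  exfalso; move/eqP: tot; rewrite sz add0r big1_seq; last first.
    by move=> d /andP[_]; rewrite mem_index_iota => /hz.
  by rewrite eq_sym oner_eq0.
exists f => //; apply: coneB_Bk => //.
rewrite /M linearD /= linearZ /= trA mulr1 raddf_sum /= -tot; congr (_ + _).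
apply: eq_big_nat => d /andP[_ dn]; rewrite linearZ /=.
have [->|td] := eqVneq (t d) 0; first by rewrite mul0r.
have tdp : 0 < t d by rewrite lt_neqAle eq_sym td t0.
by have [[pF _] _ nF _] := hF d dn tdp; rewrite chibar_tr// mulr1.
Qed.

End Subalgebras.

(** * Flags indexed by dimension, limits and compactness *)

Section Chains.
Variables (R : realType) (n : nat).
Local Notation mat := 'M[R]_n.
Implicit Types (S : set mat) (A : mat) (t : nat -> R) (F : nat -> mat).

(* A point of the union of the simplices of the flags of [S]; a flag is
   indexed by the dimensions of its members. *)
Definition chain_rep S t F A :=
  [/\ forall d, 0 <= t d, \sum_(0 <= d < n) t d = 1,
      A = \sum_(0 <= d < n) t d *: chibar (F d),
      forall d, (d < n)%N -> 0 < t d -> S (F d) /\ \rank (F d) = d &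
      forall d d', (d <= d')%N -> (d' < n)%N -> 0 < t d -> 0 < t d' -> subS (F d) (F d')].

Lemma sum_delta_nat (V : zmodType) (r m : nat) (x : V) : (r < m)%N ->
  \sum_(0 <= d < m) (if r == d then x else 0) = x.
Proof.
move=> rm; rewrite big_mkord (bigD1 (Ordinal rm))//= eqxx big1 ?addr0// => i ir.
by rewrite -[r]/(val (Ordinal rm)) (inj_eq val_inj) eq_sym (negbTE ir).
Qed.

Lemma subS_trans (P Q T : mat) : subS P Q -> subS Q T -> subS P T.
Proof. by move=> PQ QT x /PQ/QT. Qed.

Lemma flag_nested S (phi : seq mat) i j : (forall f, S f -> is_proj f) -> is_flag S phi ->
  (i < j)%N -> (j < size phi)%N ->
  subS (nth 0 phi j) (nth 0 phi i) /\ (\rank (nth 0%R phi j) < \rank (nth 0%R phi i))%N.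
Proof.
move=> Sp [_ hS hps]; elim: j => [//|j ih]; rewrite ltnS leq_eqVlt => /predU1P[->|ij] jn.
  have ps := hps j jn; split; first by case: ps.
  by apply: psubS_rank => //; apply: Sp; apply: hS; apply: mem_nth => //; exact: ltnW.
have [h1 h2] := ih ij (ltnW jn); have ps := hps j jn; split; first by apply: subS_trans h1; case: ps.
by apply: ltn_trans h2; apply: psubS_rank => //; apply: Sp; apply: hS; apply: mem_nth => //; exact: ltnW.
Qed.

(** Ranks strictly decrease along a flag, so its members can be relabelled by rank; a rank that does
    not occur gets the empty sum as weight. *)
Lemma flag_hull_chain S A : (forall f, S f -> is_proj f /\ (\rank f < n)%N) ->
  (exists phi, is_flag S phi /\ hull phi A) -> exists t F, chain_rep S t F A.
Proof.
move=> Sp [phi [fl [tau [tau0 tau1 AE]]]].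
have lti (i : 'I_(size (map (@chibar R n) phi))) : (i < size phi)%N.
  by have := ltn_ord i; rewrite [X in (_ < X)%N -> _]size_map.
have Sp1 f : S f -> is_proj f by move=> /Sp[].
have [_ hS _] := fl.
pose rk (i : 'I_(size (map (@chibar R n) phi))) := \rank (nth 0 phi i).
have Sn (i : 'I_(size (map (@chibar R n) phi))) : S (nth 0 phi i) by apply: hS; apply: mem_nth; exact: lti.
have rkn i : (rk i < n)%N by have [] := Sp _ (Sn i).
have rk_inj i j : rk i = rk j -> i = j.
  move=> rij; apply/val_inj/eqP; rewrite eqn_leq; apply/andP; split; rewrite leqNgt; apply/negP => ij.
    by have [_] := flag_nested Sp1 fl ij (lti i); rewrite -/(rk i) -/(rk j) rij ltnn.
  by have [_] := flag_nested Sp1 fl ij (lti j); rewrite -/(rk i) -/(rk j) rij ltnn.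
pose F d := nth 0 phi (find (fun f => \rank f == d) phi).
have FE i : F (rk i) = nth 0 phi i.
  rewrite /F; set p := fun f => _.
  have hp : has p phi by apply/hasP; exists (nth 0 phi i); [apply: mem_nth; exact: lti|rewrite /p eqxx].
  have fn : (find p phi < size (map (@chibar R n) phi))%N by rewrite size_map -has_find.
  have := nth_find 0 hp; rewrite /p => /eqP E.
  have /(congr1 val) /= <- : Ordinal fn = i by apply: rk_inj; exact: E.
  by [].
pose t d := \sum_(i | rk i == d) tau i.
have t0 d : 0 <= t d by exact: sumr_ge0.
have tpos d : 0 < t d -> exists i, rk i = d.
  move=> td; apply: contrapT => /forallNP hn; move: td; rewrite /t big1 ?ltxx// => i /eqP ri.
  by case: (hn i).
exists t, F; split => //.
- rewrite -tau1; under eq_bigr do rewrite /t big_mkcond.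
  by rewrite exchange_big /=; apply: eq_bigr => i _; exact: sum_delta_nat.
- rewrite AE.
  transitivity (\sum_(0 <= d < n) \sum_(i | rk i == d) tau i *: chibar (nth 0 phi i)).
    under [RHS]eq_bigr do rewrite big_mkcond.
    rewrite exchange_big /=; apply: eq_bigr => i _.
    by rewrite (sum_delta_nat _ (rkn i)) (nth_map 0)//; exact: lti.
  apply: eq_bigr => d _; rewrite /t scaler_suml; apply: eq_bigr => i /eqP <-.
  by rewrite FE.
- by move=> d dn /tpos[i <-]; rewrite FE.
- move=> d d' dd' d'n /tpos[i Ei] /tpos[j Ej]; subst d d'; rewrite !FE.
  have [ij|ij|/val_inj ->//] := ltngtP (val i) (val j).
    have [_] := flag_nested Sp1 fl ij (lti j); rewrite -/(rk i) -/(rk j) => lt.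
    by move: dd'; rewrite leqNgt lt.
  by have [] := flag_nested Sp1 fl ij (lti i).
Qed.

Lemma chain_flag_hull S t F A : (forall f, S f -> is_proj f) ->
  chain_rep S t F A -> exists phi, is_flag S phi /\ hull phi A.
Proof.
move=> Sp [t0 t1 AE hF hsub].
pose ds := [seq d <- rev (iota 0 n) | 0 < t d].
have dsP d : d \in ds = (d < n)%N && (0 < t d).
  by rewrite mem_filter mem_rev mem_iota /= add0n andbC.
have srt : sorted gtn ds.
  apply: sorted_filter; first by move=> x y z /= xy yz; exact: ltn_trans xy.
  by rewrite rev_sorted; exact: iota_ltn_sorted.
have sumds (V : zmodType) (G : nat -> V) : (forall d, t d = 0 -> G d = 0) ->
    \sum_(0 <= d < n) G d = \sum_(d <- ds) G d.
  move=> G0; rewrite /ds big_filter [RHS](perm_big (index_iota 0 n)); last first.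
    by rewrite /index_iota subn0 perm_rev.
  rewrite [RHS]big_mkcond; apply: eq_bigr => d _.
  case: ltP => // td; apply: G0; apply/eqP; by rewrite eq_le td t0.
pose phi := [seq F d | d <- ds].
have sz : size phi = size ds by rewrite size_map.
have nthphi i : (i < size ds)%N -> nth 0 phi i = F (nth 0%N ds i) by move=> hi; rewrite (nth_map 0%N).
have in_ds i : (i < size ds)%N -> (nth 0%N ds i < n)%N /\ 0 < t (nth 0%N ds i).
  by move=> hi; have := mem_nth 0%N hi; rewrite dsP => /andP.
exists phi; split.
  split.
  - rewrite sz lt0n; apply/eqP => s0.
    have ds0 : ds = [::] by apply/nilP; rewrite /nilp s0.
    move/eqP: t1; rewrite (sumds R t)//.
    by rewrite ds0 big_nil eq_sym oner_eq0.
  - by move=> _ /mapP[d + ->]; rewrite dsP => /andP[dn td]; case: (hF d dn td).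
  - move=> i; rewrite sz => hi; have hi' := ltnW hi.
    rewrite !nthphi//; have [n1 t1'] := in_ds _ hi; have [n2 t2'] := in_ds _ hi'.
    have lt : (nth 0%N ds i.+1 < nth 0%N ds i)%N by move/(sortedP 0%N): srt; exact.
    split; first by apply: hsub => //; exact: ltnW.
    move=> E; have [_ r1] := hF _ n1 t1'; have [_ r2] := hF _ n2 t2'.
    by move: lt; rewrite -{1}r1 -r2 E ltnn.
rewrite /hull /convS; have szc : size (map (@chibar R n) phi) = size ds by rewrite !size_map.
exists (fun i => t (nth 0%N ds i)); split => //.
- rewrite -t1 (sumds R t)// [RHS](big_nth 0%N) big_mkord szc//.
- rewrite AE (sumds mat (fun d => t d *: chibar (F d))); last by move=> d ->; rewrite scale0r.
  rewrite (big_nth 0%N) big_mkord szc; apply: eq_bigr => i _.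
  by rewrite (nth_map 0) ?sz// nthphi.
Qed.

Variables (I : Type) (U : set_system I).
Hypothesis uU : UltraFilter U.
Let pU : ProperFilter U. Proof. exact: ultra_proper. Qed.

Lemma proj_cvg (P : I -> mat) (Q : mat) : P @ U --> Q -> U [set i | is_proj (P i)] -> is_proj Q.
Proof.
move=> PQ hP; split.
  by apply: (cvg_mx_eq uU (cvgmxT PQ) PQ); apply: filterS hP => i [].
by apply: (cvg_mx_eq uU (cvgmxM PQ PQ) PQ); apply: filterS hP => i [].
Qed.

Lemma subS_cvg (P P' : I -> mat) (Q Q' : mat) : P @ U --> Q -> P' @ U --> Q' ->
  U [set i | is_proj (P i)] -> U [set i | subS (P i) (P' i)] -> subS Q Q'.
Proof.
move=> PQ PQ' hP hs; apply: sub_inS.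
apply: (cvg_mx_eq uU (cvgmxM PQ PQ') PQ); apply: filterS2 hP hs => i /= pP sP.
exact: inS_sub.
Qed.

(** The rank of a projection is its trace, which is continuous. *)
Lemma rank_cvg (P : I -> mat) (Q : mat) d : P @ U --> Q -> U [set i | is_proj (P i) /\ \rank (P i) = d] ->
  \rank Q = d.
Proof.
move=> PQ hP.
have pQ : is_proj Q by apply: (proj_cvg PQ); apply: filterS hP => i [].
have : \tr Q = d%:R :> R.
  apply: (cvg_r_eq uU (cvgmx_tr PQ) (cvg_cst _)); apply: filterS hP => i /= [pP <-].
  exact: proj_trace.
by rewrite proj_trace// => /eqP; rewrite eqr_nat => /eqP.
Qed.

Lemma chibar_cvg (P : I -> mat) (Q : mat) d : P @ U --> Q ->
  U [set i | is_proj (P i) /\ \rank (P i) = d] -> (fun i => chibar (P i)) @ U --> chibar Q.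
Proof.
move=> PQ hP; have rQ := rank_cvg PQ hP.
have h : (fun i => ((n - d)%:R : R)^-1 *: (1%:M - P i)) @ U --> chibar Q.
  by rewrite /chibar rQ; apply: cvgmxZ; [exact: cvg_cst|apply: cvgmxB => //; exact: cvg_cst].
apply: cvg_trans h; apply: near_eq_cvg; apply: filterS hP => i /= [_ <-] //.
Qed.

(** Nothing is claimed about members whose weight tends to [0]: they are only defined where the
    weight is positive. Their terms vanish in the limit because vertices of fixed rank are
    bounded. *)
Lemma chain_limit (t : I -> nat -> R) (F : I -> nat -> mat) :
  (forall i d, 0 <= t i d) -> (forall i, \sum_(0 <= d < n) t i d <= 1) ->
  (forall i d, (d < n)%N -> 0 < t i d -> is_proj (F i d) /\ \rank (F i d) = d) ->
  exists (T : nat -> R) (G : nat -> mat), [/\ forall d, (d < n)%N -> (fun i => t i d) @ U --> T d,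
    forall d, (d < n)%N -> 0 < T d -> U [set i | 0 < t i d] /\ (fun i => F i d) @ U --> G d,
    forall d, 0 <= T d &
    (fun i => \sum_(0 <= d < n) t i d *: chibar (F i d)) @ U --> \sum_(0 <= d < n) T d *: chibar (G d)].
Proof.
move=> t0 t1 hF.
have tle i d : (d < n)%N -> t i d <= 1.
  move=> dn; apply: le_trans (t1 i); rewrite big_mkord (bigD1 (Ordinal dn))//= lerDl.
  exact: sumr_ge0.
have /choice[T hT] : forall d, exists T : R, 0 <= T /\ ((d < n)%N -> (fun i => t i d) @ U --> T).
  move=> d; have [dn|_] := boolP (d < n)%N; last by exists 0.
  have [|T /andP[T0 _] hT] := @ultra_lim_itv R I U uU (fun i => t i d) 0 1.
    by apply: filterS (filterT : U setT) => i _ /=; rewrite t0 tle.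
  by exists T.
have Upos d : (d < n)%N -> 0 < T d -> U [set i | 0 < t i d].
  by move=> dn Td; apply: (cvgr_gt (T d)) => //; exact: (hT d).2.
have /choice[G hG] : forall d, exists G : mat, (d < n)%N -> 0 < T d -> (fun i => F i d) @ U --> G.
  move=> d; have [dn|_] := boolP (d < n)%N; last by exists 0.
  have [Td|_] := boolP (0 < T d); last by exists 0.
  have [|G hG] := @ultra_lim_mx R I U uU n n (fun i => F i d) 1; last by exists G.
  by apply: filterS (Upos d dn Td) => i /= ti; apply: proj_norm_le1; have [] := hF i d dn ti.
exists T, G; split.
- by move=> d dn; exact: (hT d).2.
- by move=> d dn Td; split; [exact: Upos|exact: hG].
- by move=> d; exact: (hT d).1.
rewrite big_mkord; under [X in X @ _ --> _]eq_fun do rewrite big_mkord.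
apply: cvgmx_sum => d; have dn := ltn_ord d; have Tc := (hT d).2 dn.
have [Td|Td] := boolP (0 < T d).
  apply: cvgmxZ => //; apply: (@chibar_cvg _ _ d); first exact: hG.
  by apply: filterS (Upos d dn Td) => i /= ti; exact: hF.
have Td0 : T d = 0 by apply/eqP; rewrite eq_le (hT d).1 andbT leNgt.
rewrite Td0 scale0r in Tc *; apply: cvg_mx => a b; rewrite mxE.
under [X in X @ _ --> _]eq_fun do rewrite mxE.
(* the vertices stay bounded, so a vanishing weight kills the term *)
have bd i : `|t i d * chibar (F i d) a b| <= t i d * 2.
  have [ti|ti] := boolP (0 < t i d); last first.
    by have -> : t i d = 0; [apply/eqP; rewrite eq_le t0 andbT leNgt|rewrite !mul0r normr0].
  have [pF rF] := hF i d dn ti.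
  rewrite normrM (ger0_norm (t0 i d)) ler_wpM2l//.
  rewrite /chibar mxE normrM rF.
  have c1 : `|((n - d)%:R : R)^-1| <= 1.
    by rewrite ger0_norm ?invr_ge0// invf_le1 ?ltr0n ?subn_gt0// ler1n subn_gt0.
  have c2 : `|(1%:M - F i d) a b| <= 1.
    apply: (le_trans (mx_entry_le _ _ _)); apply: proj_norm_le1.
    exact: (proj_subB pF (proj1 R n) (@subS1 R n _)).
  apply: (le_trans (ler_pM (normr_ge0 _) (normr_ge0 _) c1 c2)); rewrite mulr1 ler1n//.
apply/(@norm_cvg0P R R I U _ (fun i => t i d * chibar (F i d) a b)).
apply: (@squeeze_cvgr _ U _ R (fun=> 0) (fun i => t i d * 2)).
- by apply: filterS (filterT : U setT) => i _ /=; rewrite normr_ge0 bd.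
- exact: cvg_cst.
- by rewrite -[X in _ --> X](mul0r 2); apply: cvgM => //; exact: cvg_cst.
Qed.

End Chains.

Section Closedness.
Variables (R : realType) (n : nat) (br : 'rV[R]_n -> 'rV[R]_n -> 'rV[R]_n).
Variable Aut : set 'M[R]_n.
Local Notation mat := 'M[R]_n.
Hypothesis hbr : compact_lie_bracket br.

Lemma orth_norm_le1 (V : mat) : V *m V^T = 1%:M -> `|V| <= 1.
Proof.
move=> VV; apply/mx_norm_le => // i j.
have : \sum_j V i j ^+ 2 = 1.
  have /matrixP/(_ i i) := VV; rewrite !mxE eqxx => E; apply: etrans E.
  by apply: eq_bigr => l _; rewrite mxE expr2.
rewrite (bigD1 j)//= => E; rewrite -(@ler_pXn2r _ 2)// ?nnegrE// expr1n real_normK ?num_real//.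
by rewrite -E lerDl sumr_ge0// => l _; exact: sqr_ge0.
Qed.

(** Eigenframe and eigenvalues as witnesses for the spectral conditions. For trace [1] they are
    bounded, which serves the passage to limits; their conditions are polynomial equations and
    inequalities, which serves definability. *)
Definition spec_data (b : bool) (A V : mat) (d : 'rV[R]_n) :=
  [/\ V *m V^T = 1%:M, V *m A = diag_mx d *m V, forall i, 0 <= d 0 i &
   b -> forall i j k, d 0 k <= d 0 i + d 0 j \/ Qf (br (row i V) (row j V)) (row k V) = 0].

Lemma spec_data_sym b A V d : spec_data b A V d -> A^T = A.
Proof.
by move=> [VV VA _ _]; rewrite (spectral_decomp VV VA) !trmx_mul tr_diag_mx trmxK mulmxA.
Qed.

Lemma spec_data_norm b A V d : spec_data b A V d -> \tr A = 1 -> `|d| <= 1 /\ `|A| <= 1.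
Proof.
move=> [VV VA d0 _]; rewrite (spectral_trace VV VA) => d1.
have dle i : d 0 i <= 1 by rewrite -d1 (bigD1 i)//= lerDl sumr_ge0.
split; first by apply/mx_norm_le => // i j; rewrite ord1 ger0_norm.
have V1 := orth_norm_le1 VV.
apply/mx_norm_le => // i j; rewrite (spectral_decomp VV VA) mxE.
rewrite (le_trans (ler_norm_sum _ _ _))// -d1 ler_sum// => l _.
rewrite mul_mx_diag !mxE !normrM (ger0_norm (d0 l)).
rewrite -[leRHS]mul1r -[leRHS]mulr1 ler_pM ?mulr_ge0//; last first.
  exact: le_trans (mx_entry_le _ _ _) V1.
by rewrite ler_wpM2r//; exact: le_trans (mx_entry_le _ _ _) V1.
Qed.

Lemma Bk_specP b k A : Bk br Aut b k A <->
  [/\ exists V d, spec_data b A V d, \tr A = 1, forall a, Aut a -> A *m a = a *m A,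
      forall x, inS k x -> x *m A = 0 &
      forall x y, inS k x -> br x y *m A = br x (y *m A)].
Proof.
split.
  move=> hA; have [AT nA trA aA [kA adA]] := Bk_Dset hA.
  have [V [d [VV VA]]] := spectral AT; split => //.
  exists V, d; split => //; first exact/(spectral_nonneg VV VA).
  by move=> b1; move: hA; rewrite b1 => -[_ [_ /(filtering_spectral hbr VV VA)]].
move=> [[V [d sd]] trA aA kA adA]; have AT := spec_data_sym sd.
have [VV VA d0 fd] := sd.
have nA : Defs.nonneg_spec A by apply/(spectral_nonneg VV VA).
have D : Dset br Aut k A by split.
case: b sd fd => // sd fd; split => //; split => //.
by apply/(filtering_spectral hbr VV VA); exact: fd.
Qed.

Lemma Bk_norm_le1 b k A : Bk br Aut b k A -> `|A| <= 1.
Proof. by move=> /Bk_specP[[V [d /spec_data_norm hA]] /hA[]]. Qed.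

Variables (I : Type) (U : set_system I).
Hypothesis uU : UltraFilter U.
Let pU : ProperFilter U. Proof. exact: ultra_proper. Qed.

Lemma diag_cvg (d : I -> 'rV[R]_n) (e : 'rV[R]_n) : d @ U --> e ->
  (fun i => diag_mx (d i)) @ U --> diag_mx e.
Proof.
move=> de; apply: cvg_mx => a b; rewrite mxE.
rewrite (_ : (fun i => _) = (fun i => d i 0 a *+ (a == b))); last by apply/funext => i; rewrite mxE.
have c := cvg_coord (i := 0) (j := a) de; case: (a == b); last exact: (cvg_cst (0 : R)).
by move=> X /c.
Qed.

Lemma row_cvg m (V : I -> 'M[R]_(m, n)) (W : 'M[R]_(m, n)) j : V @ U --> W -> (fun i => row j (V i)) @ U --> row j W.
Proof.
move=> VW; apply: cvg_mx => a b; rewrite mxE.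
rewrite (_ : (fun i => _) = (fun i => V i j b)); last by apply/funext => i; rewrite mxE.
exact: cvg_coord.
Qed.

Lemma spec_data_cvg b (A : I -> mat) (B : mat) : A @ U --> B ->
  U [set i | (exists V d, spec_data b (A i) V d) /\ \tr (A i) = 1] -> exists V d, spec_data b B V d.
Proof.
move=> AB hA.
have /choice[Vd hVd] : forall i, exists Vd : mat * 'rV[R]_n,
    (exists V d, spec_data b (A i) V d) -> spec_data b (A i) Vd.1 Vd.2.
  move=> i; have [[V [d sd]]|nd] := pselect (exists V d, spec_data b (A i) V d).
    by exists (V, d).
  by exists (0, 0).
have hs : U [set i | spec_data b (A i) (Vd i).1 (Vd i).2 /\ \tr (A i) = 1].
  by apply: filterS hA => i /= [/hVd].
have [V hV] : exists V : mat, (fun i => (Vd i).1) @ U --> V.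
  by apply: (ultra_lim_mx uU (rho := 1)); apply: filterS hs => i /= [[VV _ _ _] _]; exact: orth_norm_le1.
have [d hd] : exists d : 'rV[R]_n, (fun i => (Vd i).2) @ U --> d.
  by apply: (ultra_lim_mx uU (rho := 1)); apply: filterS hs => i /= [sd trA]; have [] := spec_data_norm sd trA.
exists V, d; split.
- apply: (cvg_mx_eq uU (cvgmxM hV (cvgmxT hV)) (cvg_cst _)).
  by apply: filterS hs => i /= [[]].
- apply: (cvg_mx_eq uU (cvgmxM hV AB) (cvgmxM (diag_cvg hd) hV)).
  by apply: filterS hs => i /= [[]].
- move=> i; apply: (cvg_r_le uU (cvg_cst 0) (cvg_coord (i := 0) (j := i) hd)).
  by apply: filterS hs => j /= [[]].
- move=> b1 i j k; have [|dk] := leP (d 0 k) (d 0 i + d 0 j); [by left|right].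
  have c1 : (fun l => (Vd l).2 0 k - ((Vd l).2 0 i + (Vd l).2 0 j)) @ U --> d 0 k - (d 0 i + d 0 j).
    by apply: cvgB; [exact: cvg_coord|apply: cvgD; exact: cvg_coord].
  (* The strict inequality is open, so the structure constant already vanishes along the
     ultrafilter. *)
  have c2 : U [set l | 0 < (Vd l).2 0 k - ((Vd l).2 0 i + (Vd l).2 0 j)].
    by apply: (cvgr_gt _ c1); rewrite subr_gt0.
  have c3 := Qf_cvg (br_cvg hbr (row_cvg (j := i) hV) (row_cvg (j := j) hV)) (row_cvg (j := k) hV).
  apply: (cvg_r_eq uU (c3 _ _) (cvg_cst 0)); apply: filterS2 hs c2 => l /= [[_ _ _ fd] _].
  by rewrite subr_gt0 => lt; case: (fd b1 i j k) => //; rewrite leNgt lt.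
Qed.

Lemma Bk_cvg b (k A : I -> mat) (l B : mat) : k @ U --> l -> A @ U --> B ->
  U [set i | is_proj (k i) /\ Bk br Aut b (k i) (A i)] -> Bk br Aut b l B.
Proof.
move=> kl AB hB; apply/Bk_specP; split.
- apply: (spec_data_cvg AB); apply: filterS hB => i /= [_ /Bk_specP[sd trA _ _ _]].
  by split.
- have tB : (fun i => \tr (A i)) @ U --> \tr B by exact: cvgmx_tr.
  apply: (cvg_r_eq uU tB (cvg_cst (1 : R))); apply: filterS hB => i /= [_ /Bk_specP[]//].
- move=> a aA; apply: (cvg_mx_eq uU (cvgmxM AB (cvg_cst a)) (cvgmxM (cvg_cst a) AB)).
  by apply: filterS hB => i /= [_ /Bk_specP[_ _ ha _ _]]; exact: ha.
(* A vector of the limit [l] is approximated by its projections [x *m k i], which do lie in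
   [k i]. *)
- move=> x lx; have xk : (fun i => x *m k i *m A i) @ U --> x *m l *m B.
    by apply: cvgmxM => //; apply: cvgmxM => //; exact: cvg_cst.
  rewrite -{1}lx.
  apply: (cvg_mx_eq uU xk (cvg_cst (0 : 'rV[R]_n))).
  by apply: filterS hB => i /= [pk /Bk_specP[_ _ _ hk _]]; apply: hk; exact: inS_mul.
- move=> x y lx; have xk : (fun i => x *m k i) @ U --> x *m l by apply: cvgmxM => //; exact: cvg_cst.
  have c1 := @cvgmxM _ _ U _ _ _ _ _ _ _ _ (br_cvg hbr xk (cvg_cst y)) AB.
  have c2 := br_cvg hbr xk (@cvgmxM _ _ U _ _ _ _ _ _ _ _ (cvg_cst y) AB).
  rewrite -{1 2}lx.
  apply: (cvg_mx_eq uU (c1 _ _ _) (c2 _ _ _)).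
  by apply: filterS hB => i /= [pk /Bk_specP[_ _ _ _ hk]]; apply: hk; exact: inS_mul.
Qed.

End Closedness.

Section Compactness.
Variables (R : realType) (n : nat) (br : 'rV[R]_n -> 'rV[R]_n -> 'rV[R]_n).
Variable Aut : set 'M[R]_n.
Local Notation mat := 'M[R]_n.
Hypothesis hbr : compact_lie_bracket br.

Lemma mx_compact_closed (K : set mat) : compact K -> closed K.
Proof. by apply: compact_closed; exact: norm_hausdorff. Qed.

Lemma compact_cvg (K : set mat) (I : Type) (U : set_system I) (u : I -> mat) (p : mat) :
  UltraFilter U -> compact K -> u @ U --> p -> U [set i | K (u i)] -> K p.
Proof.
move=> uU cK up hK; have pU : ProperFilter U by exact: ultra_proper.
exact: (@closed_cvg _ _ U _ u K (mx_compact_closed cK) hK p up).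
Qed.

(** Both the subalgebra and the operator converge along an ultrafilter. The limit of the subalgebras
    is not the whole algebra, because B[g] is empty. *)
Lemma BK_compact b (K : set mat) : compact K -> (forall k, K k -> is_proj k) ->
  compact (BK br Aut b K).
Proof.
move=> cK Kp; rewrite compact_ultra => F uF hF; have pF : ProperFilter F by exact: ultra_proper.
have /choice[k hk] : forall A, exists k, BK br Aut b K A -> K k /\ Bk br Aut b k A.
  move=> A; have [[k [[Kk _] BA]]|nA] := pselect (BK br Aut b K A); first by exists k.
  by exists 0 => /nA.
have FK : F [set A | K (k A) /\ Bk br Aut b (k A) A] by apply: filterS hF => A /= /hk.
have [l Kl kl] : exists2 l, K l & k @ F --> l.
  by apply: (ultra_lim uF cK); apply: filterS FK => A [].
have [B hB] : exists B : mat, id @ F --> B.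
  apply: (ultra_lim_mx uF (u := id) (rho := 1)); apply: filterS FK => A /= [_].
  exact: Bk_norm_le1.
have BB : Bk br Aut b l B.
  apply: (Bk_cvg hbr uF kl hB); apply: filterS FK => A /= [KA BA]; split => //; exact: Kp.
exists B; split => //; exists l; split => //; split => // lg.
by move: BB; rewrite lg => /Bk_gP.
Qed.

Lemma hullK_chain (K : set mat) A : (forall k, K k -> is_proj k) ->
  hullK K A <-> exists t F, chain_rep (K `\` [set gP R n]) t F A.
Proof.
move=> Kp; split.
  apply: flag_hull_chain => f [Kf fg]; split; first exact: Kp.
  exact: (rank_lt_gP (Kp _ Kf)).
by move=> [t [F hF]]; apply: chain_flag_hull hF => f [/Kp].
Qed.

Lemma hullK_compact (K : set mat) : compact K -> (forall k, K k -> is_proj k) ->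
  compact (hullK K).
Proof.
move=> cK Kp; rewrite compact_ultra => W uW hW; have pW : ProperFilter W by exact: ultra_proper.
have /choice[tF htF] : forall A, exists tF : (nat -> R) * (nat -> mat), hullK K A ->
    chain_rep (K `\` [set gP R n]) tF.1 tF.2 A.
  move=> A; have [/(hullK_chain A Kp)[t [F hF]]|nA] := pselect (hullK K A); first by exists (t, F).
  by exists (fun=> 0, fun=> 0) => /nA.
(* Zero outside the set, so that the bounds demanded by [chain_limit] hold for every index and not
   only along the filter. *)
pose t A d := if `[< hullK K A >] then (tF A).1 d else 0.
have hullA : W [set A | hullK K A] by [].
have tE A : hullK K A -> t A = (tF A).1.
  by move=> hA; apply/funext => d; rewrite /t; case: asboolP.
have t0 A d : 0 <= t A d.
  by rewrite /t; case: asboolP => // /htF[].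
have t1 A : \sum_(0 <= d < n) t A d <= 1.
  have [hA|nA] := pselect (hullK K A).
    by rewrite tE//; have [_ -> _ _ _] := htF A hA.
  rewrite big1 ?ler01// => d _; rewrite /t; case: asboolP => //.
have hF A d : (d < n)%N -> 0 < t A d -> is_proj ((tF A).2 d) /\ \rank ((tF A).2 d) = d.
  move=> dn; have [hA|nA] := pselect (hullK K A); last by rewrite /t; case: asboolP => //; rewrite ltxx.
  rewrite tE// => td; have [_ _ _ hF _] := htF A hA.
  by have [[/Kp]] := hF d dn td.
have [T [G [hT hG T0 hlim]]] := chain_limit uW t0 t1 hF.
exists (\sum_(0 <= d < n) T d *: chibar (G d)); split; last first.
  apply: cvg_trans hlim; apply: near_eq_cvg; apply: filterS hullA => A /= hA.
  by rewrite tE//; have [_ _ <- _ _] := htF A hA.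
apply/(hullK_chain _ Kp); exists T, G; split => //.
- have c : (fun A => \sum_(0 <= d < n) t A d) @ W --> \sum_(0 <= d < n) T d.
    rewrite big_mkord (_ : (fun A => _) = (fun A => \sum_(d < n) t A d)); last by apply/funext => A; rewrite big_mkord.
    by apply: cvgr_sum => d; exact: hT.
  apply: (cvg_r_eq uW c (cvg_cst (1 : R))); apply: filterS hullA => A /= hA.
  by rewrite tE//; have [_ -> _ _ _] := htF A hA.
- move=> d dn Td; have [tp GF] := hG d dn Td.
  have rG : \rank (G d) = d by apply: (rank_cvg uW GF); apply: filterS tp => A /= td; exact: hF.
  split => //; split; last by move=> /= E; move: dn; rewrite -rG E mxrank1 ltnn.
  apply: (compact_cvg uW cK GF); apply: filterS2 tp hullA => A /= td hA.
  by rewrite tE// in td; have [_ _ _ hS _] := htF A hA; have [[]] := hS d dn td.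
- move=> d d' dd' d'n Td Td'; have dn := leq_ltn_trans dd' d'n.
  have [tp GF] := hG d dn Td; have [tp' GF'] := hG d' d'n Td'.
  apply: (subS_cvg uW GF GF'); first by apply: filterS tp => A /= td; have [] := hF A d dn td.
  apply: filterS3 tp tp' hullA => A /= td td' hA; rewrite tE// in td td'.
  by have [_ _ _ _ hs] := htF A hA; exact: hs.
Qed.

End Compactness.

(** * Definability of the sets of matrices *)

Section PolyMatrix.
Variable R : realType.
Local Notation env := (nat -> R).

Definition polymx m n (M : env -> 'M[R]_(m, n)) := forall i j, polyf (fun e => M e i j).

Lemma polyf_eq (p q : env -> R) : polyf p -> (forall e, p e = q e) -> polyf q.
Proof. by move=> hp /funext <-. Qed.

Lemma polyf_bsum (I : finType) (F : I -> env -> R) : (forall i, polyf (F i)) -> polyf (fun e => \sum_i F i e).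
Proof. exact: polyf_sum. Qed.

Lemma polymx_cst m n (M : 'M[R]_(m, n)) : polymx (fun=> M).
Proof. by move=> i j; exact: polyf_cst. Qed.

Lemma polymx_vec m n (f : 'I_(m * n) -> env -> R) : (forall k, polyf (f k)) ->
  polymx (fun e => vec_mx (\row_k f k e) : 'M[R]_(m, n)).
Proof. by move=> hf i j; apply: polyf_eq (hf (mxvec_index i j)) _ => e; rewrite !mxE. Qed.

Lemma polymx_mul m n p (M : env -> 'M[R]_(m, n)) (N : env -> 'M[R]_(n, p)) :
  polymx M -> polymx N -> polymx (fun e => M e *m N e).
Proof.
move=> hM hN i j; apply: (@polyf_eq (fun e => \sum_k M e i k * N e k j)).
  by apply: polyf_bsum => k; exact: polyf_mul.
by move=> e; rewrite mxE.
Qed.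

Lemma polymx_scale m n (a : env -> R) (M : env -> 'M[R]_(m, n)) : polyf a -> polymx M ->
  polymx (fun e => a e *: M e).
Proof. by move=> ha hM i j; apply: polyf_eq (polyf_mul ha (hM i j)) _ => e; rewrite mxE. Qed.

Lemma polymx_sub m n (M N : env -> 'M[R]_(m, n)) : polymx M -> polymx N -> polymx (fun e => M e - N e).
Proof.
by move=> hM hN i j; apply: polyf_eq (polyf_sub (hM i j) (hN i j)) _ => e; rewrite !mxE.
Qed.

Lemma polymx_tr m n (M : env -> 'M[R]_(m, n)) : polymx M -> polymx (fun e => (M e)^T).
Proof. by move=> hM i j; apply: polyf_eq (hM j i) _ => e; rewrite mxE. Qed.

Lemma polymx_diag n (d : env -> 'rV[R]_n) : polymx d -> polymx (fun e => diag_mx (d e)).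
Proof.
move=> hd i j; apply: (@polyf_eq (fun e => d e 0 i * (i == j)%:R)); last first.
  by move=> e; rewrite mxE mulr_natr.
by apply: polyf_mul => //; exact: polyf_cst.
Qed.

Lemma polymx_rowmx m n i (M : env -> 'M[R]_(m, n)) : polymx M -> polymx (fun e => row i (M e)).
Proof. by move=> hM k j; apply: polyf_eq (hM i j) _ => e; rewrite mxE. Qed.

Lemma polymx_mxvec m n (M : env -> 'M[R]_(m, n)) : polymx M -> polymx (fun e => mxvec (M e)).
Proof.
move=> hM i j; rewrite ord1; case/mxvec_indexP: j => j1 j2.
by apply: polyf_eq (hM j1 j2) _ => e; rewrite mxvecE.
Qed.

Lemma polymx_vecmx m n (M : env -> 'rV[R]_(m * n)) : polymx M -> polymx (fun e => vec_mx (M e) : 'M[R]_(m, n)).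
Proof. by move=> hM i j; apply: polyf_eq (hM 0 (mxvec_index i j)) _ => e; rewrite mxE. Qed.

Lemma polymx_sum m n (I : finType) (F : I -> env -> 'M[R]_(m, n)) : (forall i, polymx (F i)) ->
  polymx (fun e => \sum_i F i e).
Proof.
move=> hF i j; apply: (@polyf_eq (fun e => \sum_k F k e i j)); last by move=> e; rewrite summxE.
by apply: polyf_bsum => k; exact: hF.
Qed.

Lemma polyf_trace n (M : env -> 'M[R]_n) : polymx M -> polyf (fun e => \tr (M e)).
Proof. by move=> hM; apply: polyf_bsum => k. Qed.

Lemma dfn_eqmx m n (M N : env -> 'M[R]_(m, n)) : polymx M -> polymx N -> dfn (fun e => M e = N e).
Proof.
move=> hM hN; apply: (@dfn_ext _ (fun e => forall i j, M e i j = N e i j)).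
  by apply: dfn_allI => i; apply: dfn_allI => j; exact: dfn_eq.
by move=> e; split => [h|-> //]; apply/matrixP.
Qed.

Lemma dfn_exM m n (Q : env -> 'M[R]_(m, n) -> Prop) :
  dfn (fun e => Q (fun i => e (i + m * n)%N) (vec_mx (\row_(i < m * n) e i))) ->
  dfn (fun e => exists M, Q e M).
Proof.
move=> hQ; apply: dfn_ext (dfn_exV (Q := fun e v => Q e (vec_mx v)) hQ) _ => e; split.
  by move=> [v hv]; exists (vec_mx v).
by move=> [M hM]; exists (mxvec M); rewrite mxvecK.
Qed.

Lemma polymx_br n (br : 'rV[R]_n -> 'rV[R]_n -> 'rV[R]_n) (x y : env -> 'rV[R]_n) :
  compact_lie_bracket br -> polymx x -> polymx y -> polymx (fun e => br (x e) (y e)).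
Proof.
move=> hbr hx hy i j.
apply: (@polyf_eq (fun e => (\sum_k \sum_l (x e 0 k * y e 0 l) *: br (delta_mx 0 k) (delta_mx 0 l)) i j)).
  move: i j; apply: polymx_sum => k; apply: polymx_sum => l; apply: polymx_scale.
    by apply: polyf_mul.
  exact: polymx_cst.
by move=> e; rewrite -(brE hbr).
Qed.

Lemma polyf_Qf n (x y : env -> 'rV[R]_n) : polymx x -> polymx y -> polyf (fun e => Qf (x e) (y e)).
Proof. by move=> hx hy; apply: polymx_mul => //; exact: polymx_tr. Qed.

(** Quantifying over all polynomial families builds substitution into the definition, so the set can
    be used under any number of quantifiers without reindexing. *)
Definition dfn_mset m n (S : set 'M[R]_(m, n)) := forall M, polymx M -> dfn (fun e => S (M e)).

Lemma polyf_peval n (p : polyexpr R n) (M : env -> 'M[R]_n) : polymx M -> polyf (fun e => peval p (M e)).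
Proof.
move=> hM; elim: p => [c|i j|p hp q hq|p hp q hq] /=.
- exact: polyf_cst.
- exact: hM.
- exact: polyf_add.
- exact: polyf_mul.
Qed.

Lemma semialgebraic_dfn n (S : set 'M[R]_n) : semialgebraic S -> dfn_mset S.
Proof.
move=> [cells ->] M hM /=; elim: cells => [|c cells ih].
  by apply: dfn_ext (dfn_cst R False) _ => e; split => // -[c []].
have hc : dfn (fun e => peval c.1 (M e) = 0 /\ forall q, List.In q c.2 -> 0 < peval q (M e)).
  apply: dfn_and; first by apply: dfn_eq; [exact: polyf_peval|exact: polyf_cst].
  elim: c.2 => [|q s ihs]; first by apply: dfn_ext (dfn_cst R True) _ => e; split.
  apply: dfn_ext (dfn_and (dfn_pos (polyf_peval q hM)) ihs) _ => e; split.
    by move=> [h1 h2] q' /= [<-//|]; exact: h2.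
  by move=> h; split => [|q' hq']; apply: h; [left|right].
apply: dfn_ext (dfn_or hc ih) _ => e; split.
  by move=> [h|[c' [c1 c2]]]; [exists c; split => //; left|exists c'; split => //; right].
by move=> [c' [/= [<-|c1] c2]]; [left|right; exists c'].
Qed.

Lemma compact_dfn_nbhd_retract m n (S : set 'M[R]_(m, n)) : compact S -> dfn_mset S -> nbhd_retract S.
Proof.
move=> cS dS; pose T := [set v : 'rV[R]_(m * n) | S (vec_mx v)].
have TE : T = mxvec @` S.
  apply/seteqP; split => v /=; first by move=> hv; exists (vec_mx v) => //; rewrite vec_mxK.
  by move=> [M SM <-]; rewrite /T /= mxvecK.
have cT : compact T.
  rewrite TE; apply: continuous_compact => //; apply: continuous_subspaceT; exact: mxvec_continuous.
have dT : dfn (fun e => T (\row_(i < m * n) e i)).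
  by apply: dS; apply: polymx_vec => k; exact: polyf_var.
have [U [r [oU TU rc rT rid]]] := compact_definable_nbhd_retract cT dT.
exists (mxvec @^-1` U), (fun M => vec_mx (r (mxvec M))); split.
- by apply: open_comp => // M _; exact: mxvec_continuous.
- by move=> M SM; apply: TU; rewrite /T /= mxvecK.
- move=> M /= UM.
  apply: (@continuous_comp _ _ _ (fun M => r (mxvec M)) (@vec_mx R m n)); last exact: vec_mx_continuous.
  by apply: (@continuous_comp _ _ _ (@mxvec R m n) r); [exact: mxvec_continuous|exact: rc].
- by move=> M /= /rT.
- by move=> M SM; rewrite rid ?mxvecK// /T /= mxvecK.
Qed.

End PolyMatrix.

Section DefinableSets.
Variables (R : realType) (n : nat) (br : 'rV[R]_n -> 'rV[R]_n -> 'rV[R]_n).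
Variables (Aut : set 'M[R]_n).
Local Notation vec := 'rV[R]_n.
Local Notation mat := 'M[R]_n.
Local Notation env := (nat -> R).
Hypothesis hbr : compact_lie_bracket br.

(** [Aut] itself need not be definable, but its commutant is a linear subspace, hence the solution
    set of one linear equation with constant coefficients. *)
Lemma dfn_commutant : dfn_mset [set A : mat | forall a, Aut a -> A *m a = a *m A].
Proof.
move=> M hM.
have [||k [U [_ hU]]] := @proj_of_subspace R (n * n)
    (fun v : 'rV[R]_(n * n) => forall a : mat, Aut a -> vec_mx v *m a = a *m vec_mx v).
- by move=> a _; rewrite linear0 mul0mx mulmx0.
- by move=> c x y hx hy a aA; rewrite linearP /= mulmxDl mulmxDr -scalemxAl -scalemxAr hx// hy.
apply: (@dfn_ext _ (fun e => mxvec (M e) *m (U^T *m U) = mxvec (M e))).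
  by apply: dfn_eqmx; [apply: polymx_mul => //; [exact: polymx_mxvec|exact: polymx_cst]|exact: polymx_mxvec].
move=> e; split; first by move=> /hU /= h a aA; have := h a aA; rewrite !mxvecK.
by move=> h; apply/hU => a aA; rewrite mxvecK; exact: h.
Qed.

Lemma dfn_spec_data b (A V : env -> mat) (d : env -> vec) : polymx A -> polymx V -> polymx d ->
  dfn (fun e => spec_data br b (A e) (V e) (d e)).
Proof.
move=> hA hV hd.
pose c1 e := V e *m (V e)^T = 1%:M; pose c2 e := V e *m A e = diag_mx (d e) *m V e.
pose c3 e := forall i, 0 <= d e 0 i.
pose c4 e := b -> forall i j k, d e 0 k <= d e 0 i + d e 0 j \/
    Qf (br (row i (V e)) (row j (V e))) (row k (V e)) = 0.
apply: (@dfn_ext _ (fun e => c1 e /\ c2 e /\ c3 e /\ c4 e)); last first.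
  by move=> e; split=> [[h1 [h2 [h3 h4]]]|[h1 h2 h3 h4]].
apply: dfn_and; last apply: dfn_and; last apply: dfn_and.
- by apply: dfn_eqmx; [apply: polymx_mul => //; exact: polymx_tr|exact: polymx_cst].
- by apply: dfn_eqmx; apply: polymx_mul => //; exact: polymx_diag.
- by apply: dfn_allI => i; apply: dfn_le => //; exact: polyf_cst.
- apply: dfn_imp; first exact: dfn_cst.
  apply: dfn_allI => i; apply: dfn_allI => j; apply: dfn_allI => k; apply: dfn_or.
    by apply: dfn_le => //; exact: polyf_add.
  apply: dfn_eq; last exact: polyf_cst.
  by apply: polyf_Qf; [apply: polymx_br => //|]; exact: polymx_rowmx.
Qed.

(** Bilinearity reduces the conditions on all vectors to the rows of [k] and the standard basis, a
    finite list of polynomial equations. *)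
Lemma Bk_rowsP b k A : is_proj k -> Bk br Aut b k A <->
  [/\ exists V d, spec_data br b A V d, \tr A = 1, forall a, Aut a -> A *m a = a *m A,
      k *m A = 0 & forall i j, br (row i k) (delta_mx 0 j) *m A = br (row i k) (row j A)].
Proof.
move=> pk; rewrite (Bk_specP Aut hbr b k A); split.
  move=> [h1 h2 h3 h4 h5].
  have ki i : inS k (row i k) by rewrite /inS -row_mul pk.2.
  split => //; first by apply/row_matrixP => i; rewrite row_mul row0; exact: h4.
  by move=> i j; rewrite h5// -rowE.
move=> [h1 h2 h3 h4 h5]; split => //; first by move=> x <-; rewrite -mulmxA h4 mulmx0.
move=> x y kx; rewrite -kx (mulmx_sum_row x k) (row_sum_delta y).
rewrite !(br_suml hbr) !mulmx_suml; apply: eq_bigr => i _.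
rewrite !(br_sumr hbr) !mulmx_suml; apply: eq_bigr => j _.
by rewrite -scalemxAl !(brZl hbr) !(brZr hbr) -!scalemxAl h5 -rowE.
Qed.

Lemma dfn_BK b (K : set mat) : (forall k, K k -> is_proj k) -> dfn_mset K -> dfn_mset (BK br Aut b K).
Proof.
move=> Kp dK A hA.
pose c1 e := fun k : mat => exists V : mat, exists d : 'M[R]_(1, n), spec_data br b (A e) V d.
pose c5 e (k : mat) := forall i (j : 'I_n), br (row i k) (delta_mx 0 j) *m A e = br (row i k) (row j (A e)).
apply: (@dfn_ext _ (fun e => exists k : mat, K k /\ ~ (k = 1%:M) /\ c1 e k /\ \tr (A e) = 1 /\
   (forall a, Aut a -> A e *m a = a *m A e) /\ k *m A e = 0 /\ c5 e k)); last first.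
  move=> e; split.
    move=> [k [Kk [kg [h1 [h2 [h3 [h4 h5]]]]]]]; exists k; split => //.
    by apply/(Bk_rowsP _ _ (Kp _ Kk)).
  move=> [k [[Kk kg] /(Bk_rowsP _ _ (Kp _ Kk))[h1 h2 h3 h4 h5]]].
  by exists k; do 6 (split => //).
apply: dfn_exM.
have pA N : polymx (fun e => A (fun i => e (i + N)%N)).
  move=> i j; apply: (@polyf_subst R (fun e => A e i j) (fun i e => e (i + N)%N) (hA i j)) => k.
  exact: polyf_var.
have pk : polymx (fun e => vec_mx (\row_(k < n * n) e k) : mat).
  by apply: polymx_vec => k; exact: polyf_var.
apply: dfn_and; first exact: dK.
apply: dfn_and; first by apply: dfn_not; apply: dfn_eqmx => //; exact: polymx_cst.
apply: dfn_and.
  apply: dfn_exM; apply: dfn_exM; apply: dfn_spec_data.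
  (* The offset skips the three bound blocks: [k], the frame [V] and the eigenvalues [d]. *)
  - move=> i j; apply: (@polyf_subst R (fun e => A e i j) (fun i e => e (i + n * n + n * n + 1 * n)%N) (hA i j)) => k.
    exact: polyf_var.
  - by apply: polymx_vec => k; exact: polyf_var.
  - by apply: polymx_vec => k; exact: polyf_var.
apply: dfn_and; first by apply: dfn_eq; [exact: polyf_trace|exact: polyf_cst].
apply: dfn_and; first exact: (dfn_commutant (pA _)).
apply: dfn_and; first by apply: dfn_eqmx; [exact: polymx_mul|exact: polymx_cst].
apply: dfn_allI => i; apply: dfn_allI => j; apply: dfn_eqmx.
  by apply: polymx_mul => //; apply: polymx_br => //; [exact: polymx_rowmx|exact: polymx_cst].
by apply: polymx_br => //; exact: polymx_rowmx.
Qed.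

(** A flag is coded by a row of weights and a matrix whose row [d] is the flattened member of rank
    [d]. Rank is expressed by the trace and inclusion by a matrix product. *)
Lemma dfn_hullK (K : set mat) : (forall k, K k -> is_proj k) -> dfn_mset K -> dfn_mset (hullK K).
Proof.
move=> Kp dK A hA.
pose Fd (F : 'M[R]_(n, n * n)) (d : 'I_n) : mat := vec_mx (row d F).
pose c1 (t : 'M[R]_(1, n)) := forall d, 0 <= t 0 d.
pose c4 (t : 'M[R]_(1, n)) (F : 'M[R]_(n, n * n)) := forall d : 'I_n, 0 < t 0 d -> K (Fd F d) /\ \tr (Fd F d) = d%:R.
pose c5 (t : 'M[R]_(1, n)) (F : 'M[R]_(n, n * n)) := forall d d' : 'I_n, (d <= d')%N -> 0 < t 0 d -> 0 < t 0 d' -> Fd F d *m Fd F d' = Fd F d.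
apply: (@dfn_ext _ (fun e => exists (t : 'M[R]_(1, n)) (F : 'M[R]_(n, n * n)), c1 t /\ \sum_(d < n) t 0 d = 1 /\
  A e = \sum_(d < n) (t 0 d * ((n - d)%:R)^-1) *: (1%:M - Fd F d) /\ c4 t F /\ c5 t F)); last first.
  move=> e; split.
    move=> [t [F [h1 [h2 [h3 [h4 h5]]]]]]; apply/(hullK_chain _ Kp).
    pose t' d := if insub d is Some i then t 0 i else 0.
    pose F' d := if insub d is Some i then Fd F i else 0.
    have tE (d : 'I_n) : t' d = t 0 d by rewrite /t' valK.
    have FE (d : 'I_n) : F' d = Fd F d by rewrite /F' valK.
    have rk (d : 'I_n) : 0 < t 0 d -> \rank (Fd F d) = d.
      move=> /h4[/Kp pF]; rewrite (proj_trace pF) => /eqP; rewrite eqr_nat => /eqP//.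
    exists t', F'; split.
    - by move=> d; rewrite /t'; case: insub.
    - by rewrite big_mkord -h2; apply: eq_bigr => d _; rewrite tE.
    - rewrite h3 big_mkord; apply: eq_bigr => d _; rewrite tE FE.
      have := h1 d; rewrite le_eqVlt => /predU1P[<-|td]; first by rewrite mul0r !scale0r.
      by rewrite -scalerA /chibar rk.
    - move=> d dn; rewrite -[d]/(val (Ordinal dn)) tE FE => td; rewrite rk//; split => //.
      split; first by have [] := h4 _ td.
      by move=> E; have := rk _ td; rewrite E mxrank1 => E'; have := dn; rewrite [X in (_ < X)%N]E' /= ltnn.
    - move=> d d' dd' d'n; have dn := leq_ltn_trans dd' d'n.
      rewrite -[d]/(val (Ordinal dn)) -[d']/(val (Ordinal d'n)) !tE !FE => td td'.
      by apply: sub_inS; exact: h5.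
  move=> /(hullK_chain _ Kp)[t [F [h1 h2 h3 h4 h5]]].
  have FE d : Fd (\matrix_(d < n) mxvec (F d)) d = F d by rewrite /Fd rowK mxvecK.
  exists (\row_d t d), (\matrix_(d < n) mxvec (F d)); split; first by move=> d; rewrite mxE.
  split; first by rewrite -h2 big_mkord; apply: eq_bigr => d _; rewrite mxE.
  split.
    rewrite h3 big_mkord; apply: eq_bigr => d _; rewrite mxE FE.
    have := h1 d; rewrite le_eqVlt => /predU1P[<-|td]; first by rewrite mul0r !scale0r.
    by rewrite -scalerA /chibar; have [_ ->] := h4 d (ltn_ord d) td.
  split.
    move=> d; rewrite mxE FE => td; have [[Kd _] rd] := h4 d (ltn_ord d) td; split => //.
    by rewrite (proj_trace (Kp _ Kd)) rd.
  move=> d d' dd'; rewrite !mxE !FE => td td'; apply: inS_sub; last exact: h5.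
  by have [[/Kp]] := h4 d (ltn_ord d) td.
apply: dfn_exM; apply: dfn_exM.
have pt : polymx (fun e : env => vec_mx (\row_(k < 1 * n) e (k + n * (n * n))%N) : 'M[R]_(1, n)).
  by apply: polymx_vec => k; exact: polyf_var.
have pF d : polymx (fun e : env => Fd (vec_mx (\row_(k < n * (n * n)) e k)) d).
  by apply: polymx_vecmx; apply: polymx_rowmx; apply: polymx_vec => k; exact: polyf_var.
apply: dfn_and; first by apply: dfn_allI => d; apply: dfn_le; [exact: polyf_cst|exact: pt].
apply: dfn_and; first by apply: dfn_eq; [apply: polyf_bsum => d; exact: pt|exact: polyf_cst].
apply: dfn_and.
  apply: dfn_eqmx.
    move=> i j; apply: (@polyf_subst R (fun e => A e i j) (fun i e => e (i + 1 * n + n * (n * n))%N) (hA i j)) => k.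
    exact: polyf_var.
  apply: polymx_sum => d; apply: polymx_scale; first by apply: polyf_mul; [exact: pt|exact: polyf_cst].
  by apply: polymx_sub; [exact: polymx_cst|exact: pF].
apply: dfn_and.
  apply: dfn_allI => d; apply: dfn_imp; first by apply: dfn_lt; [exact: polyf_cst|exact: pt].
  apply: dfn_and; first exact: dK.
  by apply: dfn_eq; [exact: polyf_trace|exact: polyf_cst].
apply: dfn_allI => d; apply: dfn_allI => d'; apply: dfn_imp; first exact: dfn_cst.
do 2 (apply: dfn_imp; first by apply: dfn_lt; [exact: polyf_cst|exact: pt]).
by apply: dfn_eqmx; [exact: polymx_mul|exact: pF].
Qed.

End DefinableSets.

(** * Nets, defects and scales of separation *)

Section Nets.
Variables (R : realType) (n : nat).
Local Notation mat := 'M[R]_n.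

(** [S] need not be closed, so the centres of the cover come from [K]; each one whose ball meets [S]
    is replaced by a point of [S] in that ball, whence the halved radius. *)
Lemma compact_net (K S : set mat) (eps : R) : compact K -> S `<=` K -> 0 < eps ->
  exists s : seq mat, (forall k, k \in s -> S k) /\ forall k, S k -> exists2 k', k' \in s & `|k - k'| < eps.
Proof.
rewrite compact_cover => cK SK eps0.
have e2 : 0 < eps / 2 by rewrite divr_gt0.
have [||D _ KD] := cK _ K (fun c : mat => ball c (eps / 2)).
- by move=> c _; exact: ball_open.
- by move=> k Kk; exists k => //; exact: ballxx.
have /choice[phi hphi] : forall c : mat, exists k, (exists2 k, S k & ball c (eps / 2) k) -> S k /\ ball c (eps / 2) k.
  move=> c; have [[k Sk ck]|nk] := pselect (exists2 k, S k & ball c (eps / 2) k); first by exists k.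
  by exists 0 => /nk.
exists [seq phi c | c : mat <- (finmap.enum_fset D : seq mat) & `[< exists2 k, S k & ball c (eps / 2) k >]]; split.
  by move=> k /mapP[c]; rewrite mem_filter => /andP[/asboolP/hphi[hc _] _] ->.
move=> k Sk; have [c Dc ck] := KD _ (SK _ Sk).
have hc : exists2 k, S k & ball c (eps / 2) k by exists k.
exists (phi c); first by apply: map_f; rewrite mem_filter Dc andbT; apply/asboolP.
have [_] := hphi _ hc; move: ck; rewrite -!ball_normE /= => h1 h2.
rewrite -[k - _](subrKA c) (le_lt_trans (ler_normD _ _))// [ltRHS]splitr ltrD//.
by rewrite distrC.
Qed.

(** Shares of a unit stick are taken in decreasing order of the index, [sg d] being the fraction of
    what the larger indices have left. *)
Lemma stick_breaking (sg : nat -> R) m :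
  \sum_(0 <= d < m) sg d * \prod_(d.+1 <= d' < m) (1 - sg d') = 1 - \prod_(0 <= d < m) (1 - sg d).
Proof.
elim: m => [|m ih]; first by rewrite !big_geq// subrr.
rewrite big_nat_recr//= [X in _ + _ * X]big_geq// mulr1 [in RHS]big_nat_recr//=.
have -> : \sum_(0 <= d < m) sg d * \prod_(d.+1 <= d' < m.+1) (1 - sg d') =
    (1 - sg m) * \sum_(0 <= d < m) sg d * \prod_(d.+1 <= d' < m) (1 - sg d').
  rewrite mulr_sumr; apply: eq_big_nat => d /andP[_ dm].
  by rewrite big_nat_recr//= mulrA mulrC.
rewrite ih; ring.
Qed.

Lemma cvg_near (I : Type) (U : set_system I) {FU : Filter U} (u v : I -> mat) (a : mat) (ep : I -> R) :
  ep @ U --> (0 : R) -> U [set i | `|u i - v i| <= ep i] -> u @ U --> a -> v @ U --> a.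
Proof.
move=> ep0 uv ua; apply/(@cvgrPdist_lt R mat I U _ v a) => e e0.
have h1 : U [set i | `|a - u i| < e / 2].
  by have /(@cvgrPdist_lt R mat I U _ u a) := ua; apply; rewrite divr_gt0.
have h2 : U [set i | ep i < e / 2] by apply: (cvgr_lt _ ep0); rewrite divr_gt0.
apply: filterS3 uv h1 h2 => i /= h0 h1 h2.
rewrite -[a - _](subrKA (u i)) (le_lt_trans (ler_normD _ _))// [ltRHS]splitr ltr_leD//.
by rewrite (le_trans h0)// ltW.
Qed.

Lemma harmonic_cvg (U : set_system nat) : \oo `<=` U -> Filter U -> (fun j => j.+1%:R^-1 : R) @ U --> (0 : R).
Proof. move=> oU FU; apply: cvg_trans (@cvg_harmonic R); exact: (cvg_app _ oU). Qed.

End Nets.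

Section ApproximateFlags.
Variables (R : realType) (n : nat) (br : 'rV[R]_n -> 'rV[R]_n -> 'rV[R]_n).
Variables (Aut : set 'M[R]_n) (b : bool) (K : set 'M[R]_n).
Local Notation mat := 'M[R]_n.
Hypothesis hbr : compact_lie_bracket br.
Hypothesis cK : compact K.
Hypothesis Ksub : forall k, K k -> is_subalg br k.
Hypothesis Kjoin : upper_semilattice br K.
Local Notation K1 := (K `\` [set gP R n]).
Local Notation X := (BK br Aut b K).

Definition incidence : set (mat * mat) := [set p | K1 p.2 /\ Bk br Aut b p.2 p.1].

(* [defect A k] measures how far [A] is from lying in B[k], uniformly in [k]. *)
Definition defect (A k : mat) : R := dist incidence (A, k).

Lemma defect0 A k : K1 k -> Bk br Aut b k A -> defect A k = 0.
Proof. by move=> Kk BA; apply: dist0. Qed.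

Lemma defect_lipschitz A k k' : X !=set0 -> defect A k <= defect A k' + `|k - k'|.
Proof.
move=> [A0 [k0 [Kk0 BA0]]]; apply: le_trans (dist_lipschitz _ (A, k') _) _.
  by exists (A0, k0).
rewrite lerD2l prod_normE /= subrr normr0 ge_max normr_ge0/=; exact: lexx.
Qed.

Lemma defect_continuous k : continuous (fun A => defect A k).
Proof.
move=> A; apply: (@cvg_comp _ _ _ (fun A : mat => (A, k)) (dist incidence) (nbhs A) (nbhs (A, k))).
  by apply: (@cvg_pair mat mat mat (nbhs A) (nbhs A) (nbhs k) _ _ _ (fun x => x) (fun=> k)); [exact: cvg_id|exact: cvg_cst].
exact: dist_continuous.
Qed.

(** Each pair has a point of [incidence] within twice [ep i], and that relation is closed in the
    product. Nonemptiness of [X] matters because the distance to the empty set is [0]. *)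
Lemma defect_limit (I : Type) (U : set_system I) (A k : I -> mat) (A0 k0 : mat) (ep : I -> R) :
  UltraFilter U -> X !=set0 -> A @ U --> A0 -> k @ U --> k0 -> ep @ U --> (0 : R) ->
  (forall i, 0 < ep i) -> U [set i | defect (A i) (k i) <= ep i] -> K1 k0 /\ Bk br Aut b k0 A0.
Proof.
move=> uU [A1 [k1 [Kk1 BA1]]] AA0 kk0 ep0 epp hd; have pU : ProperFilter U by exact: ultra_proper.
have /choice[p hp] : forall i, exists p : mat * mat, defect (A i) (k i) <= ep i ->
    incidence p /\ `|(A i, k i) - p| < ep i + ep i.
  move=> i; have [di|di] := leP (defect (A i) (k i)) (ep i); last by exists (0, 0).
  have [||p Ep hp] := @dist_lt _ _ incidence (A i, k i) (ep i + ep i); first by exists (A1, k1).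
    by rewrite (le_lt_trans di)// ltrDl.
  by exists p.
have hU : U [set i | incidence (p i) /\ `|(A i, k i) - p i| < ep i + ep i].
  by apply: filterS hd => i /= /hp.
have ep2 : (fun i => ep i + ep i) @ U --> (0 : R) by rewrite -[X in _ --> X]addr0; exact: cvgD.
have pA : (fun i => (p i).1) @ U --> A0.
  apply: (cvg_near ep2 _ AA0); apply: filterS hU => i /= [_]; case: (p i) => a c.
  by rewrite prod_normE /= gt_max => /andP[/ltW].
have pk : (fun i => (p i).2) @ U --> k0.
  apply: (cvg_near ep2 _ kk0); apply: filterS hU => i /= [_]; case: (p i) => a c.
  by rewrite prod_normE /= gt_max => /andP[_ /ltW].
have B0 : Bk br Aut b k0 A0.
  apply: (Bk_cvg hbr uU pk pA); apply: filterS hU => i /= [[[Kp _] Bp] _]; split => //.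
  by have [] := Ksub Kp.
split => //; split; last by move=> kg; move: B0; rewrite kg => /Bk_gP.
by apply: (compact_cvg uU cK pk); apply: filterS hU => i /= [[[]]].
Qed.

(** The norm in the conclusion measures how far [k'] is from being contained in [k]. The [4] leaves
    room for nets of mesh [eta / 4]: a member with defect below a quarter of its scale has a point
    of the net nearby with defect below half of it. *)
Definition separated (dl : R) (eta : nat -> R) d := forall A k k', X A -> K1 k -> \rank k = d -> K1 k' ->
  defect A k <= eta d -> defect A k' <= eta d ->
  (forall m, K1 m -> (d < \rank m)%N -> eta (\rank m) / 4 <= defect A m) ->
  `|k' *m (1%:M - k)| <= dl.

Lemma Kproj k : K k -> is_proj k. Proof. by move=> /Ksub[]. Qed.

(* In the limit [A] lies in B[k] and B[k'], hence in B[k v k']; as no element of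
   larger rank has small defect, [k v k' = k]. *)
Lemma separation_step (dl : R) (eta : nat -> R) d : 0 < dl -> (forall i, 0 < eta i) ->
  exists2 r : R, 0 < r & forall A k k', X A -> K1 k -> \rank k = d -> K1 k' ->
  defect A k <= r -> defect A k' <= r ->
  (forall m, K1 m -> (d < \rank m)%N -> eta (\rank m) / 4 <= defect A m) ->
  `|k' *m (1%:M - k)| <= dl.
Proof.
move=> dl0 eta0; apply: contrapT => hn.
pose bad (j : nat) (q : mat * mat * mat) := [/\ X q.1.1, K1 q.1.2 /\ \rank q.1.2 = d, K1 q.2,
  defect q.1.1 q.1.2 <= j.+1%:R^-1 /\ defect q.1.1 q.2 <= j.+1%:R^-1 &
  (forall m, K1 m -> (d < \rank m)%N -> eta (\rank m) / 4 <= defect q.1.1 m) /\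
  dl < `|q.2 *m (1%:M - q.1.2)|].
have /choice[q hq] : forall j, exists q, bad j q.
  move=> j; apply: contrapT => hj; apply: hn; exists j.+1%:R^-1; first by rewrite invr_gt0.
  move=> A k k' XA Kk rk Kk' d1 d2 hm; rewrite leNgt; apply/negP => lt.
  by apply: hj; exists (A, k, k'); exact: (And5 XA (conj Kk rk) Kk' (conj d1 d2) (conj hm lt)).
have [U [uU oU]] := ultra_nat; have pU : ProperFilter U by exact: ultra_proper.
have UT P : (forall j : nat, P j) -> U [set j | P j] by move=> h; apply: filterS (filterT : U setT) => j _; exact: h.
have X0 : X !=set0 by exists (q 0).1.1; have [] := hq 0.
have [A hA] : exists A : mat, (fun j => (q j).1.1) @ U --> A.
  apply: (ultra_lim_mx uU (rho := 1)); apply: UT => j; have [[k [_ BA]] _ _ _ _] := hq j.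
  exact: (Bk_norm_le1 hbr BA).
have [k _ hk] : exists2 k, K k & (fun j => (q j).1.2) @ U --> k.
  by apply: (ultra_lim uU cK); apply: UT => j; have [_ [[]]] := hq j.
have [k' _ hk'] : exists2 k, K k & (fun j => (q j).2) @ U --> k.
  by apply: (ultra_lim uU cK); apply: UT => j; have [_ _ []] := hq j.
have h0 : (fun j => j.+1%:R^-1 : R) @ U --> (0 : R) by exact: harmonic_cvg.
have ip j : 0 < j.+1%:R^-1 :> R by rewrite invr_gt0.
have [Kk BkA] : K1 k /\ Bk br Aut b k A.
  apply: (defect_limit uU X0 hA hk h0 ip); apply: UT => j.
  by have [_ _ _ [d1 _] _] := hq j; exact: d1.
have [Kk' Bk'A] : K1 k' /\ Bk br Aut b k' A.
  apply: (defect_limit uU X0 hA hk' h0 ip); apply: UT => j.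
  by have [_ _ _ [_ d1] _] := hq j; exact: d1.
have rk : \rank k = d.
  apply: (rank_cvg uU hk); apply: UT => j; have [_ [[Kj _] rj] _ _ _] := hq j; split => //.
  exact: Kproj.
have [m jm] := join_exists br k k'.
have BmA := Bk_join hbr BkA Bk'A jm.
have Km : K1 m.
  split; first exact: (Kjoin Kk.1 Kk'.1 jm).
  by move=> mg; move: BmA; rewrite mg => /Bk_gP.
have [sm km k'm _] := jm.
have rm : \rank m = d.
  apply/eqP; rewrite eqn_leq -{2}rk (subS_rank (Kproj Kk.1) sm.1 km) andbT leqNgt; apply/negP => dm.
  have : eta (\rank m) / 4 <= defect A m.
    have cd : (fun j => defect (q j).1.1 m) @ U --> defect A m.
      apply: (@cvg_comp _ _ _ (fun j => (q j).1.1) (fun A => defect A m) U (nbhs A) (nbhs (defect A m)) hA).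
      exact: defect_continuous.
    apply: (cvg_r_le uU (cvg_cst _) cd).
    by apply: UT => j; have [_ _ _ _ [h _]] := hq j; exact: h.
  by rewrite (defect0 Km BmA) leNgt divr_gt0.
have mk : k = m by apply: (subS_rank_eq (Kproj Kk.1) sm.1 km); rewrite rm.
have c1 : (fun j => (q j).2 *m (1%:M - (q j).1.2)) @ U --> k' *m (1%:M - k).
  by apply: cvgmxM => //; apply: cvgmxB => //; exact: cvg_cst.
have : dl <= `|k' *m (1%:M - k)|.
  apply: (cvg_r_le uU (cvg_cst _) (cvg_norm c1)); apply: UT => j.
  by have [_ _ _ _ [_ /ltW]] := hq j.
rewrite mk mulmxBr mulmx1 (inS_sub (Kproj Kk'.1) k'm) subrr normr0.
by rewrite leNgt dl0.
Qed.

(** Separation at rank [d] involves the scales at [d] and above only, so they are fixed by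
    descending rank. Each step caps the scales of the current rank and of all lower ones at once,
    which keeps [eta] monotone. *)
Lemma separation_scales (dl : R) : 0 < dl -> exists eta : nat -> R,
  [/\ forall d, 0 < eta d <= dl, {homo eta : d d' / (d <= d')%N >-> d <= d'} &
      forall d, (d < n)%N -> separated dl eta d].
Proof.
move=> dl0; suff main j : (j <= n)%N -> exists eta : nat -> R,
  [/\ forall d, 0 < eta d <= dl, {homo eta : d d' / (d <= d')%N >-> d <= d'} &
      forall d, (n - j <= d < n)%N -> separated dl eta d].
  have [eta [h1 h2 h3]] := main n (leqnn n); exists eta; split => // d dn.
  by apply: h3; rewrite subnn.
elim: j => [|j ih] jn.
  exists (fun=> dl); split => //; first by move=> d; rewrite dl0 lexx.
  by move=> d; rewrite subn0 => /andP[nd dn]; move: dn; rewrite ltnNge nd.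
have [eta [h1 h2 h3]] := ih (ltnW jn).
set c := (n - j.+1)%N; have cE : (n - j = c.+1)%N by rewrite /c subnSK.
have eta0 d : 0 < eta d by have /andP[] := h1 d.
have [r r0 hr] := separation_step c dl0 eta0.
pose eta' d := if (d <= c)%N then Num.min r (eta d) else eta d.
have le' d : eta' d <= eta d by rewrite /eta'; case: ifP => // _; rewrite ge_min lexx orbT.
have gt' d : (c < d)%N -> eta' d = eta d by rewrite /eta' ltnNge; case: ifP.
exists eta'; split.
- move=> d; rewrite (le_trans (le' d)) ?andbT; last by have /andP[] := h1 d.
  by rewrite /eta'; case: ifP => _ //; rewrite lt_min r0 eta0.
- move=> d d' dd'; have [cd'|d'c] := ltnP c d'.
    by rewrite (gt' d')// (le_trans (le' d))// h2.
  rewrite /eta' d'c (leq_trans dd' d'c) le_min ge_min lexx/=.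
  by rewrite ge_min h2 ?orbT.
- move=> d /andP[]; rewrite leq_eqVlt => /predU1P[<-|cd] dn A k k' XA Kk rk Kk'.
    move=> d1 d2 hm; apply: (hr A k k' XA Kk rk Kk').
    + by rewrite (le_trans d1)// /eta' leqnn ge_min lexx.
    + by rewrite (le_trans d2)// /eta' leqnn ge_min lexx.
    + by move=> m Km rm; rewrite -gt'//; exact: hm.
  rewrite gt'// => d1 d2 hm; apply: (h3 d _ A k k' XA Kk rk Kk' d1 d2); first by rewrite cE cd.
  by move=> m Km rm; rewrite -gt' ?(ltn_trans cd)//; exact: hm.
Qed.

End ApproximateFlags.

(** * The approximate retraction *)

Section ApproximateRetraction.
Variables (R : realType) (n : nat) (br : 'rV[R]_n -> 'rV[R]_n -> 'rV[R]_n).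
Variables (Aut : set 'M[R]_n) (b : bool) (K : set 'M[R]_n).
Local Notation mat := 'M[R]_n.
Hypothesis hbr : compact_lie_bracket br.
Hypothesis cK : compact K.
Hypothesis Ksub : forall k, K k -> is_subalg br k.
Hypothesis Kjoin : upper_semilattice br K.
Local Notation K1 := (K `\` [set gP R n]).
Local Notation X := (BK br Aut b K).
Local Notation defect := (defect br Aut b K).

Lemma cvgr_prod (T : Type) (F : set_system T) {FF : Filter F} (I : Type) (r : seq I) (f : I -> T -> R) (a : I -> R) :
  (forall i, f i @ F --> a i) -> (fun x => \prod_(i <- r) f i x) @ F --> \prod_(i <- r) a i.
Proof.
move=> fa; elim: r => [|i r ih].
  by rewrite big_nil; under [X in X @ _ --> _]eq_fun do rewrite big_nil; exact: cvg_cst.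
by rewrite big_cons; under [X in X @ _ --> _]eq_fun do rewrite big_cons; apply: cvgM.
Qed.

Lemma chibar_close (k k' : mat) d : (d < n)%N -> \rank k = d -> \rank k' = d ->
  `|chibar k - chibar k'| <= `|k - k'|.
Proof.
move=> dn rk rk'; rewrite /chibar rk rk' -scalerBr.
rewrite (_ : 1%:M - k - (1%:M - k') = - (k - k')); last first.
  by rewrite !opprB addrC addrA addrNK.
rewrite normrZ normrN ger0_norm ?invr_ge0// ler_piMl// invf_le1 ?ltr0n ?subn_gt0//.
by rewrite ler1n subn_gt0.
Qed.

(* The vertices of a net of each rank are weighted by their defect at [A]; the
   ranks are processed downwards, each one receiving the share left over by the
   larger ones. *)
Lemma approx_flag (dl : R) : 0 < dl -> X !=set0 -> exists g : mat -> mat, continuous g /\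
  forall A, X A -> exists (t : nat -> R) (F : nat -> mat),
  [/\ forall d, 0 <= t d, \sum_(0 <= d < n) t d = 1,
      `|g A - \sum_(0 <= d < n) t d *: chibar (F d)| <= dl + dl,
      forall d, (d < n)%N -> 0 < t d -> [/\ K1 (F d), \rank (F d) = d & defect A (F d) <= dl] &
      forall d d', (d <= d')%N -> (d' < n)%N -> 0 < t d -> 0 < t d' -> `|F d *m (1%:M - F d')| <= dl].
Proof.
move=> dl0 X0; have [eta [eta1 etam sep]] := separation_scales Aut b hbr cK Ksub Kjoin dl0.
have eta0 d : 0 < eta d by have /andP[] := eta1 d.
have /choice[s hs] : forall d, exists s : seq mat, (forall k, k \in s -> K1 k /\ \rank k = d) /\
    forall k, K1 k /\ \rank k = d -> exists2 k', k' \in s & `|k - k'| < eta d / 4.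
  move=> d; have [] := @compact_net R n K [set k | K1 k /\ \rank k = d] (eta d / 4) cK.
  - by move=> k [[]].
  - by rewrite divr_gt0.
  - by move=> s hs; exists s.
pose w d k A := Num.max 0 (eta d - defect A k).
pose S d A := \sum_(k <- s d) w d k A.
(* The maximum avoids a division by zero and makes the share [sg d] equal to [1] as soon as the
   total weight reaches [eta d / 2]. *)
pose rho d A := (Num.max (S d A) (eta d / 2))^-1.
pose sg d A := rho d A * S d A.
pose pr d A := \prod_(d.+1 <= d' < n) (1 - sg d' A).
pose c d k A := pr d A * rho d A * w d k A.
pose g A : mat := \sum_(0 <= d < n) \sum_(k <- s d) c d k A *: chibar k.
have mx0 d A : 0 < Num.max (S d A) (eta d / 2) by rewrite lt_max divr_gt0 ?orbT.
have w0 d k A : 0 <= w d k A by rewrite le_max lexx.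
have S0 d A : 0 <= S d A by apply: sumr_ge0.
have rho0 d A : 0 < rho d A by rewrite invr_gt0.
have sg0 d A : 0 <= sg d A by rewrite mulr_ge0// ltW.
have sg1 d A : sg d A <= 1 by rewrite /sg mulrC ler_pdivrMr// mul1r le_max lexx.
have pr0 d A : 0 <= pr d A by apply: prodr_ge0 => i _; rewrite subr_ge0.
have c0 d k A : 0 <= c d k A by rewrite !mulr_ge0// ltW.
exists g; split.
  have wc d k : continuous (w d k).
    move=> A; apply: (@cvg_maxr _ _ (nbhs A) _ _ _ _ _ (cvg_cst _)).
    by apply: cvgB; [exact: cvg_cst|exact: defect_continuous].
  have Sc d : continuous (S d) by move=> A; apply: (@cvgr_sum _ _ (nbhs A)) => k; exact: wc.
  have rc d : continuous (rho d).
    move=> A; have nz : Num.max (S d A) (eta d / 2) != 0 by rewrite gt_eqF.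
    apply: (@cvgV R mat (nbhs A) _ _ _ nz); apply: (@cvg_maxr R mat (nbhs A) _ (S d) (fun=> eta d / 2)); first exact: Sc.
    exact: cvg_cst.
  have sc d : continuous (sg d) by move=> A; apply: (@cvgM R mat (nbhs A) _); [exact: rc|exact: Sc].
  have pc d : continuous (pr d).
    by move=> A; apply: (@cvgr_prod _ (nbhs A)) => i; apply: cvgB; [exact: cvg_cst|exact: sc].
  move=> A; apply: (@cvgmx_sum _ _ (nbhs A)) => d; apply: (@cvgmx_sum _ _ (nbhs A)) => k.
  apply: (@cvgmxZ _ _ (nbhs A)); last exact: cvg_cst.
  by apply: (@cvgM R mat (nbhs A) _); [apply: (@cvgM R mat (nbhs A) _); [exact: pc|exact: rc]|exact: wc].
move=> A XA.
(* A member with defect below [eta / 4] has a point of the net within [eta / 4], whose weight alone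
   exceeds [eta / 2]. *)
have full m : K1 m -> defect A m < eta (\rank m) / 4 -> sg (\rank m) A = 1.
  move=> Km dm; have [k' sk' kk'] := (hs (\rank m)).2 m (conj Km erefl).
  have dk' : defect A k' < eta (\rank m) / 2.
    rewrite (le_lt_trans (defect_lipschitz A k' m X0))// distrC.
    by move: dm kk'; set x := defect A m; set y := `|_|; lra.
  have : eta (\rank m) / 2 <= S (\rank m) A.
    rewrite /S (big_rem _ sk') /=; apply: ler_wpDr; first exact: sumr_ge0.
    by rewrite le_max; apply/orP; right; move: dk'; set x := defect A k'; lra.
  move=> h; have E : Num.max (S (\rank m) A) (eta (\rank m) / 2) = S (\rank m) A by apply/max_idPl.
  have := mx0 (\rank m) A; rewrite E => SP.
  by rewrite /sg /rho E mulVf// gt_eqF.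
(* If rank [d] is left anything, no larger rank has taken a full share; this is the condition under
   which the scales separate. *)
have high d m : 0 < pr d A -> K1 m -> (d < \rank m)%N -> eta (\rank m) / 4 <= defect A m.
  move=> pd Km dm; rewrite leNgt; apply/negP => /(full _ Km) E.
  have : pr d A == 0.
    rewrite prodf_seq_eq0; apply/hasP; exists (\rank m); last by rewrite /= E subrr.
    by rewrite mem_index_iota dm /= (rank_lt_gP (Kproj Ksub Km.1) Km.2).
  by rewrite gt_eqF.
pose t d := pr d A * sg d A.
have t0 d : 0 <= t d by rewrite mulr_ge0.
have tE d : t d = \sum_(k <- s d) c d k A.
  by rewrite /t /sg mulrA /S mulr_sumr.
have /choice[F hF] : forall d, exists k : mat, 0 < t d -> k \in s d /\ 0 < c d k A.
  move=> d; have [[k]|nk] := pselect (exists k : mat, k \in s d /\ 0 < c d k A); first by exists k.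
  exists 0; rewrite tE big_seq big1 ?ltxx// => k ks; apply/eqP; rewrite eq_le c0 andbT leNgt.
  by apply/negP => ck; apply: nk; exists k.
have cpos d k : 0 < c d k A -> 0 < pr d A /\ defect A k <= eta d.
  move=> ck; have pd : 0 < pr d A.
    by rewrite lt_neqAle pr0 andbT; apply/eqP => E; move: ck; rewrite /c -E !mul0r ltxx.
  split => //; rewrite leNgt; apply/negP => dk.
  move: ck; rewrite /c /w (_ : Num.max _ _ = 0) ?mulr0 ?ltxx//.
  by apply/max_idPl; rewrite subr_le0 ltW.
have near d k k' : (d < n)%N -> k \in s d -> k' \in s d -> 0 < c d k A -> 0 < c d k' A ->
    `|k - k'| <= dl + dl.
  move=> dn ks ks' ck ck'.
  have [[Kk rk] [Kk' rk']] := ((hs d).1 k ks, (hs d).1 k' ks').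
  have [[pd dk] [_ dk']] := (cpos _ _ ck, cpos _ _ ck').
  have hm m : K1 m -> (d < \rank m)%N -> eta (\rank m) / 4 <= defect A m by exact: high.
  have h1 := sep d dn A k k' XA Kk rk Kk' dk dk' hm.
  have h2 := sep d dn A k' k XA Kk' rk' Kk dk' dk hm.
  have [kT _] := Kproj Ksub Kk.1; have [kT' _] := Kproj Ksub Kk'.1.
  (* Members of equal rank that are nearly contained in each other are close, so their vertices may
     be merged into one. *)
  rewrite (_ : k - k' = k *m (1%:M - k') - (k' *m (1%:M - k))^T); last first.
    rewrite trmx_mul (_ : (1%:M - k)^T = 1%:M - k); last by rewrite raddfB /= kT tr_scalar_mx.
    rewrite kT' mulmxBr mulmxBl mulmx1 mul1mx.
    by rewrite opprB addrA addrNK.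
  rewrite (le_trans (ler_normB _ _))// lerD//.
  apply/mx_norm_le; first exact: ltW.
  by move=> i j; rewrite mxE (le_trans (mx_entry_le _ _ _)).
(* Nothing is left over: [A] lies in B[k] for some [k], and the rank of that [k] takes a full
   share. *)
have t1 : \sum_(0 <= d < n) t d = 1.
  rewrite (eq_bigr (fun d => sg d A * \prod_(d.+1 <= d' < n) (1 - sg d' A))); last first.
    by move=> d _; rewrite mulrC.
  rewrite (stick_breaking (fun d => sg d A)).
  have [k [Kk BA]] := XA; have rk := rank_lt_gP (Kproj Ksub Kk.1) Kk.2.
  have : \prod_(0 <= d < n) (1 - sg d A) == 0.
    rewrite prodf_seq_eq0; apply/hasP; exists (\rank k); first by rewrite mem_index_iota.
    by rewrite /= full ?subrr// (defect0 Kk BA) divr_gt0.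
  by move=> /eqP ->; rewrite subr0.
exists t, F; split => //.
- rewrite /g -sumrB.
  have -> : dl + dl = \sum_(0 <= d < n) t d * (dl + dl) by rewrite -mulr_suml t1 mul1r.
  rewrite (le_trans (ler_norm_sum _ _ _))// ler_sum_nat// => d /andP[_ dn].
  have := t0 d; rewrite le_eqVlt => /predU1P[td|td].
    rewrite -td scale0r subr0 mul0r big_seq big1 ?normr0// => k ks.
    suff -> : c d k A = 0 by rewrite scale0r.
    move: td; rewrite tE => /esym/eqP; rewrite psumr_eq0// => /allP/(_ k ks)/eqP//.
  have [Fs cF] := hF d td.
  rewrite [in leLHS]tE scaler_suml -sumrB tE mulr_suml (le_trans (ler_norm_sum _ _ _))//.
  rewrite big_seq [leRHS]big_seq; apply: ler_sum => k ks.
  rewrite -scalerBr normrZ (ger0_norm (c0 d k A)).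
  have := c0 d k A; rewrite le_eqVlt => /predU1P[<-|ck]; first by rewrite !mul0r.
  apply: ler_wpM2l; first exact: c0.
  apply: le_trans (near d k (F d) dn ks Fs ck cF).
  by apply: (chibar_close dn); [have [_ r] := (hs d).1 k ks|have [_ r] := (hs d).1 _ Fs]; exact: r.
- move=> d dn td; have [Fs cF] := hF d td; have [KF rF] := (hs d).1 _ Fs; split => //.
  have [_ h] := cpos _ _ cF; rewrite (le_trans h)//; by have /andP[] := eta1 d.
- move=> d d' dd' d'n td td'; have [Fs cF] := hF d td; have [Fs' cF'] := hF d' td'.
  have [[KF _] [KF' rF']] := ((hs d).1 _ Fs, (hs d').1 _ Fs').
  have [[_ dF] [pd dF']] := (cpos _ _ cF, cpos _ _ cF').
  apply: (sep d' d'n A _ _ XA KF' rF' KF dF'); first by rewrite (le_trans dF)// etam.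
  by move=> m; exact: high.
Qed.

End ApproximateRetraction.

(** * Deformation of B[K] onto the simplices *)

Section DeformationOfBK.
Variables (R : realType) (n : nat) (br : 'rV[R]_n -> 'rV[R]_n -> 'rV[R]_n).
Variables (h : 'M[R]_n) (Aut : set 'M[R]_n) (b : bool) (K : set 'M[R]_n).
Local Notation mat := 'M[R]_n.
Hypothesis hbr : compact_lie_bracket br.
Hypothesis hAut : is_aut_group br h Aut.
Hypothesis cK : compact K.
Hypothesis Ksub : forall k, K k -> is_subalg br k.
Hypothesis Kaut : forall k, K k -> Aut_inv Aut k.
Hypothesis Kjoin : upper_semilattice br K.
Local Notation K1 := (K `\` [set gP R n]).
Local Notation X := (BK br Aut b K).
Local Notation Y := (hullK K).

Let Kp k : K k -> is_proj k. Proof. exact: (Kproj Ksub). Qed.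

(** [A] is a sum of positive semidefinite terms, so [Qf (x *m A) x = 0] makes every term vanish at
    [x]. *)
Lemma chain_kill (S : set mat) t F A x d : (forall f, S f -> is_proj f) -> chain_rep S t F A ->
  x *m A = 0 -> (d < n)%N -> 0 < t d -> inS (F d) x.
Proof.
move=> Sp [t0 _ AE hF _] xA dn td.
have E : \sum_(d < n) t d * (((n - \rank (F d))%:R)^-1 * Qf (x *m (1%:M - F d)) x) = 0.
  transitivity (Qf (x *m A) x); last by rewrite xA Qf0l.
  rewrite AE big_mkord mulmx_sumr /Qf mulmx_suml summxE; apply: eq_bigr => i _.
  by rewrite /chibar -!scalemxAr -!scalemxAl !mxE.
have pF i : (i < n)%N -> 0 < t i -> is_proj (1%:M - F i).
  move=> ni ti; apply: proj_subB; [|exact: proj1|exact: subS1].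
  by have [/Sp] := hF i ni ti.
have nn (i : 'I_n) : 0 <= t i * (((n - \rank (F i))%:R)^-1 * Qf (x *m (1%:M - F i)) x).
  have := t0 i; rewrite le_eqVlt => /predU1P[<-|ti]; first by rewrite mul0r.
  by rewrite !mulr_ge0 ?invr_ge0// ?(ltW ti)//; apply: proj_psd; exact: pF.
move/eqP: E; rewrite psumr_eq0// => /allP/(_ (Ordinal dn) (mem_index_enum _)) /=.
have [_ rF] := hF d dn td.
rewrite !mulf_eq0 (gt_eqF td) invr_eq0 rF pnatr_eq0 subn_eq0 leqNgt dn /= => /eqP q0.
have [pT pp] := pF d dn td.
suff : x *m (1%:M - F d) = 0.
  by rewrite mulmxBr mulmx1 /inS => /eqP; rewrite subr_eq0 => /eqP.
by apply/eqP; rewrite -Qf_eq0 [X in X == _]Qf_mulmx pT -mulmxA pp QfC q0.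
Qed.

Lemma chain_support (S : set mat) t F A : chain_rep S t F A -> exists2 d, (d < n)%N & 0 < t d.
Proof.
move=> [t0 t1 _ _ _]; apply: contrapT => hn.
have : \sum_(0 <= d < n) t d = 0; last by rewrite t1 => /eqP; rewrite oner_eq0.
rewrite big_nat big1// => d /andP[_ dn]; apply/eqP; rewrite eq_le t0 andbT leNgt; apply/negP => td.
by apply: hn; exists d.
Qed.

(** Vectors of [G d] are killed by [A], so they lie in every member of the flag of [A]. Hence the
    flag of [B] fits below that of [A], sharing at most one member, and their union carries the
    whole segment. *)
Lemma hullK_segment t F A T G B (s : R) : chain_rep K1 t F A -> chain_rep K1 T G B ->
  (forall d x, (d < n)%N -> 0 < T d -> inS (G d) x -> x *m A = 0) -> 0 <= s <= 1 ->
  Y ((1 - s) *: A + s *: B).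
Proof.
move=> cA cB kill /andP[s0 s1]; have s1' : 0 <= 1 - s by rewrite subr_ge0.
have [t0 t1 AE hF nF] := cA; have [T0 T1 BE hG nG] := cB.
have GF d d' : (d < n)%N -> (d' < n)%N -> 0 < T d -> 0 < t d' -> subS (G d) (F d').
  move=> dn d'n Td td' x Gx; apply: (chain_kill _ cA _ d'n td'); last exact: (kill d).
  by move=> f [/Kp].
pose H d := if 0 < t d then F d else G d.
have HE d : (d < n)%N -> 0 < T d -> H d = G d.
  move=> dn Td; rewrite /H; case: ifP => // td.
  have [[[/Kp pF _] rF] [[/Kp pG _] rG]] := (hF d dn td, hG d dn Td).
  by apply/esym; apply: (subS_rank_eq pG pF (GF d d dn dn Td td)); rewrite rG rF.
have cas d : 0 < (1 - s) * t d + s * T d -> 0 < t d \/ 0 < T d.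
  have := t0 d; rewrite le_eqVlt => /predU1P[<-|]; last by left.
  rewrite mulr0 add0r => /[dup] p; have := T0 d; rewrite le_eqVlt => /predU1P[<-|]; last by right.
  by rewrite mulr0 ltxx.
apply/(hullK_chain _ Kp); exists (fun d => (1 - s) * t d + s * T d), H; split.
- by move=> d; rewrite addr_ge0// mulr_ge0.
- by rewrite big_split /= -!mulr_sumr t1 T1 !mulr1 subrK.
- rewrite AE BE !scaler_sumr -big_split /=; apply: eq_big_nat => d /andP[_ dn].
  rewrite [RHS]scalerDl -[X in _ = X + _]scalerA -[X in _ = _ + X]scalerA; congr (_ *: _ + _ *: _).
    by have := t0 d; rewrite /H le_eqVlt => /predU1P[<-|->//]; rewrite !scale0r.
  by have := T0 d; rewrite le_eqVlt => /predU1P[<-|Td]; [rewrite !scale0r|rewrite HE].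
- move=> d dn /cas[td|Td]; last by rewrite HE//; exact: hG.
  by rewrite /H td; exact: hF.
- move=> d d' dd' d'n p p'; have dn := leq_ltn_trans dd' d'n.
  have [Td|Td] := boolP (0 < T d).
    rewrite HE//; case: (cas _ p') => [td'|Td']; last by rewrite HE//; exact: nG.
    by rewrite /H td'; exact: GF.
  case: (cas _ p) => [td|]; last by rewrite (negbTE Td).
  rewrite {1}/H td; case: (cas _ p') => [td'|Td']; first by rewrite /H td'; exact: nF.
  rewrite HE//; have [[[/Kp pF _] rF] [[/Kp pG _] rG]] := (hF d dn td, hG d' d'n Td').
  have sGF := GF d' d d'n dn Td' td; have := subS_rank pG pF sGF; rewrite rG rF => d'd.
  by rewrite -(subS_rank_eq pG pF sGF) // rG rF; apply/eqP; rewrite eqn_leq d'd.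
Qed.

(** [A] lies in B of the largest member [G m]; the vertices of the flag are then added to it by
    star-shapedness while the subalgebra shrinks. *)
Lemma BK_segment T G A B (s : R) : X A -> chain_rep K1 T G B ->
  (forall d, (d < n)%N -> 0 < T d -> Bk br Aut b (G d) A) -> 0 <= s <= 1 ->
  X ((1 - s) *: A + s *: B).
Proof.
move=> XA cB BA /andP[s0 s1]; have [T0 T1 BE hG nG] := cB.
have [k0 [_ Bk0]] := XA; have [_ _ trA _ _] := Bk_Dset Bk0.
have [d0 d0n Td0] := chain_support cB.
have [m /andP[mn Tm] mmax] : exists2 m, (m < n)%N && (0 < T m) &
    forall d, (d < n)%N && (0 < T d) -> (d <= m)%N.
  have ex : exists d, (d < n)%N && (0 < T d) by exists d0; rewrite d0n.
  have ub d : (d < n)%N && (0 < T d) -> (d <= n)%N by move=> /andP[/ltnW].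
  by case: (ex_maxnP ex ub) => m hm hmax; exists m.
have pos d : 0 < s * T d -> 0 < T d.
  by have := T0 d; rewrite le_eqVlt => /predU1P[<-|//]; rewrite mulr0 ltxx.
have [|||||||f hf Bf] := @chain_Bk R n br h Aut hbr hAut b (G m) A (1 - s) (fun d => s * T d) G.
- by rewrite subr_ge0.
- by move=> d; rewrite mulr_ge0.
- by move=> _; exact: BA.
- move=> d dn /pos Td; have [[KG Gg] _] := hG d dn Td; split => //; [exact: Ksub|exact: Kaut|].
  by move=> _; apply: nG => //; apply: mmax; rewrite dn.
- by move=> d d' dd' d'n /pos Td /pos Td'; exact: nG.
- by rewrite -mulr_sumr T1 mulr1 subrK.
- exact: trA.
exists f; split; last first.
  by rewrite BE scaler_sumr; under eq_bigr do rewrite scalerA.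
by case: hf => [[_ ->]|[d dn [/pos Td ->]]]; [have [] := hG m mn Tm|have [] := hG d dn Td].
Qed.

(** If the maps of precision [1 / (j + 1)] all failed, the failures would have a limit: a point [A],
    a time [s] and an exact flag [G] with [A] in every B[G d]. There the segment lies in the compact
    set in question, so it cannot have left the open neighbourhood shortly before. *)
Lemma BK_approx UX UY : open UX -> open UY -> X `<=` UX -> Y `<=` UY ->
  exists g : mat -> mat, [/\ cont_on X g,
      (forall A t, X A -> 0 <= t <= 1 -> UX ((1 - t) *: A + t *: g A)),
      (forall A, X A -> UY (g A)) &
      (forall A t, X A -> Y A -> 0 <= t <= 1 -> UY ((1 - t) *: A + t *: g A))].
Proof.
move=> oUX oUY XUX YUY.
have [X0|nX] := pselect (X !=set0); last first.
  by exists id; split => A *; exfalso; apply: nX; exists A.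
have ip (j : nat) : 0 < j.+1%:R^-1 :> R by rewrite invr_gt0.
have /choice[g hg] := fun j => approx_flag hbr cK Ksub Kjoin (ip j) X0.
apply: contrapT => hn.
pose bad j (p : mat * R) := [/\ X p.1, 0 <= p.2 <= 1 &
  ~ [/\ UX ((1 - p.2) *: p.1 + p.2 *: g j p.1), UY (g j p.1) &
     Y p.1 -> UY ((1 - p.2) *: p.1 + p.2 *: g j p.1)]].
have /choice[p hp] : forall j, exists p, bad j p.
  move=> j; apply: contrapT => hj; apply: hn; exists (g j).
  have good A t : X A -> 0 <= t <= 1 -> [/\ UX ((1 - t) *: A + t *: g j A), UY (g j A) &
     Y A -> UY ((1 - t) *: A + t *: g j A)].
    by move=> XA t01; apply: contrapT => nb; apply: hj; exists (A, t).
  split.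
  - move=> A _; apply: cvg_within_filter; exact: (hg j).1.
  - by move=> A t XA t01; have [] := good A t XA t01.
  - by move=> A XA; have [] := good A 0 XA; rewrite ?lexx ?ler01.
  - by move=> A t XA YA t01; have [_ _] := good A t XA t01; apply.
have /choice[tF htF] : forall j, exists tF : (nat -> R) * (nat -> mat), let t := tF.1 in let F := tF.2 in
  [/\ forall d, 0 <= t d, \sum_(0 <= d < n) t d = 1,
      `|g j (p j).1 - \sum_(0 <= d < n) t d *: chibar (F d)| <= j.+1%:R^-1 + j.+1%:R^-1,
      forall d, (d < n)%N -> 0 < t d -> [/\ K1 (F d), \rank (F d) = d & defect br Aut b K (p j).1 (F d) <= j.+1%:R^-1] &
      forall d d', (d <= d')%N -> (d' < n)%N -> 0 < t d -> 0 < t d' -> `|F d *m (1%:M - F d')| <= j.+1%:R^-1].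
  by move=> j; have [Xj _ _] := hp j; have [t [F tF]] := (hg j).2 _ Xj; exists (t, F).
pose t j := (tF j).1; pose F j := (tF j).2.
have t0 j d : 0 <= t j d by have [hj _ _ _ _] := htF j; exact: hj.
have t1 j : \sum_(0 <= d < n) t j d = 1 by have [_ hj _ _ _] := htF j; exact: hj.
have hF j d : (d < n)%N -> 0 < t j d ->
  [/\ K1 (F j d), \rank (F j d) = d & defect br Aut b K (p j).1 (F j d) <= j.+1%:R^-1].
  by have [_ _ _ hF _] := htF j; exact: hF.
have [U [uU oU]] := ultra_nat; have pU : ProperFilter U by exact: ultra_proper.
have UT P : (forall j : nat, P j) -> U [set j | P j].
  by move=> hP; apply: filterS (filterT : U setT) => j _; exact: hP.
have h0 : (fun j => j.+1%:R^-1 : R) @ U --> (0 : R) by exact: harmonic_cvg.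
have h00 : (fun j => j.+1%:R^-1 + j.+1%:R^-1 : R) @ U --> (0 : R).
  by rewrite -[X in _ --> X]addr0; exact: cvgD.
have cX : compact X by exact: BK_compact.
have [A XA hA] : exists2 A, X A & (fun j => (p j).1) @ U --> A.
  by apply: (ultra_lim uU cX); apply: UT => j; have [] := hp j.
have [s s01 hs] : exists2 s : R, 0 <= s <= 1 & (fun j => (p j).2) @ U --> s.
  by apply: (ultra_lim_itv uU); apply: UT => j; have [_ h01 _] := hp j; exact: h01.
have t1' j : \sum_(0 <= d < n) t j d <= 1 by rewrite t1.
have hF' j d : (d < n)%N -> 0 < t j d -> is_proj (F j d) /\ \rank (F j d) = d.
  by move=> dn td; have [[Kj _] rj _] := hF j d dn td; split => //; exact: Kp.
have [T [G [hT hG T0 hlim]]] := chain_limit uU t0 t1' hF'.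
set B := \sum_(0 <= d < n) T d *: chibar (G d) in hlim.
have gB : (fun j => g j (p j).1) @ U --> B.
  apply: (cvg_near h00 _ hlim); apply: UT => j; rewrite distrC.
  by have [_ _ hj _ _] := htF j; exact: hj.
have hGd d : (d < n)%N -> 0 < T d -> [/\ K1 (G d), \rank (G d) = d & Bk br Aut b (G d) A].
  move=> dn Td; have [tp GF] := hG d dn Td.
  have [KG BG] : K1 (G d) /\ Bk br Aut b (G d) A.
    apply: (defect_limit hbr cK Ksub uU X0 hA GF h0 ip); apply: filterS tp => j td.
    by have [_ _ dj] := hF j d dn td; exact: dj.
  by split => //; apply: (rank_cvg uU GF); apply: filterS tp => j td; exact: hF'.
have cB : chain_rep K1 T G B.
  split => //.
  - have c : (fun j => \sum_(0 <= d < n) t j d) @ U --> \sum_(0 <= d < n) T d.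
      rewrite big_mkord (_ : (fun j => _) = (fun j => \sum_(d < n) t j d)); last first.
        by apply/funext => j; rewrite big_mkord.
      by apply: cvgr_sum => d; exact: hT.
    by apply: (cvg_r_eq uU c (cvg_cst (1 : R))); apply: UT => j; exact: t1.
  - by move=> d dn Td; have [] := hGd d dn Td.
  - move=> d d' dd' d'n Td Td'; have dn := leq_ltn_trans dd' d'n.
    have [[tp GF] [tp' GF']] := (hG d dn Td, hG d' d'n Td').
    have c1 : (fun j => F j d *m (1%:M - F j d')) @ U --> G d *m (1%:M - G d').
      by apply: cvgmxM => //; apply: cvgmxB => //; exact: cvg_cst.
    have : `|G d *m (1%:M - G d')| <= 0.
      apply: (cvg_r_le uU (cvg_norm c1) h0); apply: filterS2 tp tp' => j td td'.
      by have [_ _ _ _ hj] := htF j; exact: hj.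
    rewrite normr_le0 mulmxBr mulmx1 subr_eq0 => /eqP E.
    by apply: sub_inS; rewrite -E.
have segc : (fun j => (1 - (p j).2) *: (p j).1 + (p j).2 *: g j (p j).1) @ U --> (1 - s) *: A + s *: B.
  exact: segment_cvg.
have opn (W : set mat) (u : nat -> mat) (a : mat) : open W -> W a -> u @ U --> a -> U [set j | W (u j)].
  by move=> oW Wa ua; apply: (ua W); apply: open_nbhs_nbhs.
have u1 : U [set j | UX ((1 - (p j).2) *: (p j).1 + (p j).2 *: g j (p j).1)].
  apply: (opn UX _ _ oUX _ segc); apply: XUX; apply: (BK_segment XA cB) => // d dn Td.
  by have [] := hGd d dn Td.
have u2 : U [set j | UY (g j (p j).1)].
  by apply: (opn UY _ _ oUY _ gB); apply: YUY; apply/(hullK_chain _ Kp); exists T, G.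
have u3 : U [set j | Y (p j).1 -> UY ((1 - (p j).2) *: (p j).1 + (p j).2 *: g j (p j).1)].
  (* An ultrafilter decides whether the counterexamples lie in [Y]; if they do, so does their
     limit. *)
  have [YU|nYU] := in_ultra_setVsetC [set j | Y (p j).1] uU; last by apply: filterS nYU => j nY /nY.
  have YA : Y A by apply: (compact_cvg uU (hullK_compact cK Kp) hA YU).
  have [ta [Fa cA]] := (hullK_chain A Kp).1 YA.
  have : U [set j | UY ((1 - (p j).2) *: (p j).1 + (p j).2 *: g j (p j).1)].
    apply: (opn UY _ _ oUY _ segc); apply: YUY; apply: (hullK_segment cA cB) => // d x dn Td Gx.
    by have [_ _ /Bk_Dset[_ _ _ _ [kl _]]] := hGd d dn Td; exact: kl.
  by apply: filterS => j uj _; exact: uj.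
have : U set0.
  apply: filterS3 u1 u2 u3 => j a1 a2 a3; have [_ _ nj] := hp j.
  by apply: nj; split.
exact: filter_not_empty.
Qed.

Lemma hullK_sub_BK : Y `<=` X.
Proof.
move=> A /(hullK_chain _ Kp)[t [F cA]]; have [t0 t1 AE hF nF] := cA.
have [d0 d0n td0] := chain_support cA; have [[K0 g0] _] := hF d0 d0n td0.
(* All the weight is on the vertices: with [s = 0] the matrix [chibar (F d0)] enters with
   coefficient [0] and supplies the required trace [1]. *)
have [|||||||f hf Bf] := @chain_Bk R n br h Aut hbr hAut b 0 (chibar (F d0)) 0 t F => //.
- by rewrite ltxx.
- move=> d dn td; have [[Kd gd] _] := hF d dn td.
  by split; [exact: Ksub|exact: Kaut|exact: gd|rewrite ltxx].
- by rewrite add0r.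
- by apply: chibar_tr => //; exact: Kp.
exists f; split; last by rewrite AE; move: Bf; rewrite scale0r add0r.
case: hf => [[]|[d dn [td ->]]]; first by rewrite ltxx.
by have [] := hF d dn td.
Qed.

Lemma BK_deform : semialgebraic K -> strong_def_retract Y X.
Proof.
move=> /semialgebraic_dfn dK.
have cX : compact X by exact: BK_compact.
have cY : compact Y by exact: hullK_compact.
apply: sdr_of_approx => //.
- exact: hullK_sub_BK.
- by apply: compact_dfn_nbhd_retract => //; exact: dfn_BK.
- by apply: compact_dfn_nbhd_retract => //; exact: dfn_hullK.
- move=> UX UY oUX oUY XUX YUY; have [g [g1 g2 g3 g4]] := BK_approx oUX oUY XUX YUY.
  exists g; split => // A t YA; apply: g4 => //; exact: hullK_sub_BK.
Qed.

End DeformationOfBK.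

(** * Uniqueness of the decomposition of points of X_eps *)

Section SpectralSplitting.
Variables (R : realType) (n : nat).
Local Notation mat := 'M[R]_n.

Definition split_form (q f N B A : mat) (c s : R) :=
  [/\ [/\ is_proj q, is_proj f & subS q f], [/\ N^T = N, forall x, 0 <= Qf (x *m N) x & N *m q = N],
      [/\ B^T = B, forall x, 0 <= Qf (x *m B) x & f *m B = 0], 0 < s & A = c%:M - N + s *: B].

(* [A <= c] on [f] and [A >= c'] on the orthogonal complement of [q'], so
   comparing traces over these two invariant subspaces forces [f] into [q']. *)
Lemma split_form_lt q f N B A c s q' f' N' B' c' s' :
  split_form q f N B A c s -> split_form q' f' N' B' A c' s' -> c < c' -> subS f q'.
Proof.
move=> [[pq pf qf] [NT Np Nq] [BT Bp fB] s0 AE] [[pq' pf' qf'] [NT' Np' Nq'] [BT' Bp' fB'] s0' AE'] cc'.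
set e := 1%:M - q'; have pe : is_proj e by apply: proj_subB; [|exact: proj1|exact: subS1].
have Nf : N *m f = N by rewrite -{1}Nq -mulmxA (inS_sub pq qf).
have fN : f *m N = N by have := congr1 trmx Nf; rewrite trmx_mul NT pf.1.
have N'e : N' *m e = 0 by rewrite mulmxBr mulmx1 Nq' subrr.
have qB' : q' *m B' = 0 by rewrite -(inS_sub pq' qf') -mulmxA fB' mulmx0.
have B'q : B' *m q' = 0 by rewrite -[LHS]trmxK trmx_mul BT' pq'.1 qB' trmx0.
have B'e : B' *m e = B' by rewrite mulmxBr mulmx1 B'q subr0.
have E1 : f *m A = c *: f - N.
  by rewrite AE mulmxDr mulmxBr fN -scalemxAr fB scaler0 addr0 mul_mx_scalar.
have E2 : A *m e = c' *: e + s' *: B'.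
  by rewrite AE' mulmxDl mulmxBl N'e subr0 -scalemxAl B'e mul_scalar_mx.
have T1 : \tr (f *m A *m e) = c * \tr (f *m e) - \tr (N *m e).
  by rewrite E1 mulmxBl -scalemxAl raddfB /= mxtraceZ.
have T2 : \tr (f *m A *m e) = c' * \tr (f *m e) + s' * \tr (f *m B').
  by rewrite -mulmxA E2 mulmxDr -!scalemxAr raddfD /= !mxtraceZ.
have n1 : 0 <= \tr (N *m e) by apply: tr_psd_ge0 => // x; exact: proj_psd.
have n2 : 0 <= \tr (f *m B') by apply: tr_psd_ge0 => //; [exact: pf.1|move=> x; exact: proj_psd].
have fe0 : f *m e = 0.
  apply: tr_proj_eq0 => //; rewrite leNgt; apply/negP => fe.
  have n3 : 0 <= s' * \tr (f *m B') by rewrite mulr_ge0// ltW.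
  have n4 : 0 < (c' - c) * \tr (f *m e) by rewrite mulr_gt0// subr_gt0.
  by move: n1 n3 n4 T1; rewrite T2; lra.
by apply: sub_inS; apply/eqP; rewrite eq_sym -subr_eq0 -{1}[f]mulmx1 -mulmxBr fe0.
Qed.

(** [N *m B] and [N' *m B'] vanish. So for [D = N - N' = s *: B - s' *: B'] the trace of [D *m D] is
    minus a nonnegative combination of traces of products of positive semidefinite matrices, and [D]
    is zero. *)
Lemma split_form_unique q f N B A c s q' f' N' B' s' :
  split_form q f N B A c s -> split_form q' f' N' B' A c s' -> \tr B = 1 -> \tr B' = 1 -> s = s' /\ B = B'.
Proof.
move=> [[pq pf qf] [NT Np Nq] [BT Bp fB] s0 AE] [[pq' pf' qf'] [NT' Np' Nq'] [BT' Bp' fB'] s0' AE'] t t'.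
have NB : N *m B = 0 by rewrite -Nq -(inS_sub pq qf) -!mulmxA fB !mulmx0.
have NB' : N' *m B' = 0 by rewrite -Nq' -(inS_sub pq' qf') -!mulmxA fB' !mulmx0.
set D := N - N'.
have DE : D = s *: B - s' *: B'.
  have /eqP : c%:M - N + s *: B = c%:M - N' + s' *: B' by rewrite -AE AE'.
  rewrite -!addrA (inj_eq (addrI _)) => /eqP E.
  apply/eqP; rewrite /D -subr_eq0; apply/eqP.
  rewrite -[LHS]opprK -(subrr (- N + s *: B)) {1}E; apply/matrixP => i j; rewrite !mxE; ring.
have DT : D^T = D by rewrite /D raddfB /= NT NT'.
have D0 : D = 0.
  apply: tr_mulT_eq0; apply/eqP; rewrite eq_le tr_mulT_ge0 andbT DT.
  have -> : D *m D = D *m (s *: B - s' *: B') by rewrite -DE.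
  rewrite /D mulmxBr !mulmxBl -!scalemxAr NB NB' !scaler0 !raddfB /= !mxtraceZ mxtrace0.
  have n1 : 0 <= \tr (N *m B') by exact: tr_psd_ge0.
  have n2 : 0 <= \tr (N' *m B) by exact: tr_psd_ge0.
  have := mulr_ge0 (ltW s0) n2; have := mulr_ge0 (ltW s0') n1; lra.
have E : s *: B = s' *: B' by apply/eqP; rewrite -subr_eq0 -DE D0.
have ss' : s = s' by have := congr1 (fun M => \tr M) E; rewrite /= !mxtraceZ t t' !mulr1.
split => //; move: E; rewrite -ss' => /scalerI; apply; exact: lt0r_neq0.
Qed.

End SpectralSplitting.

Section KappaRep.
Variables (R : realType) (n : nat) (br : 'rV[R]_n -> 'rV[R]_n -> 'rV[R]_n).
Variables (h : 'M[R]_n) (Aut : set 'M[R]_n) (b : bool).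
Local Notation mat := 'M[R]_n.
Local Notation P := (Pset br h Aut).
Local Notation I := (Iset br h Aut).

(** The weights [t d] absorb the factor [1 - s], so flags of length one, where [s = 1], and longer
    ones share one formula. *)
Definition kappa_rep (c s : R) (f B : mat) (t : nat -> R) (F : nat -> mat) (A : mat) :=
  [/\ c <= s <= 1, (P `\` I) f /\ Bk br Aut b f B,
      (forall d, 0 <= t d) /\ \sum_(0 <= d < n) t d = 1 - s,
      A = \sum_(0 <= d < n) t d *: chibar (F d) + s *: B &
      (forall d, (d < n)%N -> 0 < t d -> [/\ I (F d), \rank (F d) = d & subS (F d) f]) /\
      (forall d d', (d <= d')%N -> (d' < n)%N -> 0 < t d -> 0 < t d' -> subS (F d) (F d'))].

Lemma P_proj k : P k -> is_proj k. Proof. by move=> [[]]. Qed.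

Lemma kappa_rep_self c f A : c <= 1 -> (P `\` I) f -> Bk br Aut b f A ->
  kappa_rep c 1 f A (fun=> 0) (fun=> 0) A.
Proof.
move=> c1 Pf BA; split => //; first by rewrite c1 lexx.
- by split => //; rewrite subrr; exact: big1.
- by rewrite big1 ?add0r ?scale1r// => d _; rewrite scale0r.
- by split => [d _|d d' _ _]; rewrite ltxx.
Qed.

(** A positive [c] excludes the flags of length above one with top [g], where [kappa] is [0].
    Conversely the members of positive weight, being toral, differ from [f], and together with [f]
    they form the flag. *)
Lemma kappa_ge_rep c A : 0 < c -> kappa_ge br h Aut b c A <-> exists s f B t F, kappa_rep c s f B t F A.
Proof.
move=> c0; split.
  move=> [[|f tl] [[flP [nflI tlI]]]]; first by [].
  have Pf : P f by have [_ hP _] := flP; apply: hP; exact: mem_head.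
  have nI : ~ I f.
    move=> If; apply: nflI; have [h1 _ h3] := flP; split => // g; rewrite inE => /predU1P[->//|].
    exact: tlI.
  case: tl flP nflI tlI => [|g tl] flP nflI tlI.
    by move=> [BA c1]; exists 1, f, A, (fun=> 0), (fun=> 0); exact: kappa_rep_self.
  case: eqP => [_ [_]|fg]; first by rewrite leNgt c0.
  move=> [s [A1 [A2 [/andP[cs s1] hA1 BA2 AE]]]].
  pose I' := [set k | I k /\ psubS k f].
  have [||t [F [t0 t1 A1E hF nF]]] := @flag_hull_chain R n I' A1.
  - move=> k [[Pk _] kf]; split; first exact: P_proj.
    apply: leq_trans (psubS_rank (P_proj Pk) (P_proj Pf) kf) _; exact: rank_leq_row.
  - exists (g :: tl); split => //; split => //.
    + move=> k ktl; split; first exact: tlI.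
      have [i ig <-] := nthP 0 ktl.
      have [sub rk] := flag_nested (S := P) P_proj flP (ltn0Sn i) (ig : (i.+1 < size (f :: g :: tl))%N).
      by split => // E; move: rk; rewrite /= E ltnn.
    + by move=> i ig; have [_ _ hps] := flP; exact: (hps i.+1).
  have s1' : 0 <= 1 - s by rewrite subr_ge0.
  have pos d : 0 < (1 - s) * t d -> 0 < t d.
    by have := t0 d; rewrite le_eqVlt => /predU1P[<-|//]; rewrite mulr0 ltxx.
  exists s, f, A2, (fun d => (1 - s) * t d), F; split => //.
  - by rewrite cs.
  - by split => [d|]; rewrite ?mulr_ge0// -mulr_sumr t1 mulr1.
  - by rewrite AE A1E scaler_sumr; congr (_ + _); apply: eq_bigr => d _; rewrite scalerA.
  - split; first by move=> d dn /pos td; have [[IF [sF _]] rF] := hF d dn td.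
    by move=> d d' dd' d'n /pos td /pos td'; exact: nF.
move=> [s [f [B [t [F [/andP[cs s1] [[Pf nI] BB] [t0 t1] AE [hF nF]]]]]]].
have fg : f <> gP R n by move=> E; move: BB; rewrite E => /Bk_gP.
move: s1; rewrite le_eqVlt => /predU1P[s1|s1].
  exists [:: f]; split.
    split; first by split => // g; rewrite inE => /eqP ->.
    by split => // -[_ hI _]; apply: nI; apply: hI; exact: mem_head.
  split; last by rewrite -s1.
  suff -> : A = B by [].
  rewrite AE s1 scale1r big_nat big1 ?add0r// => d /andP[_ dn].
  move: t1; rewrite s1 subrr big_mkord => /eqP; rewrite psumr_eq0// => /allP/(_ (Ordinal dn) (mem_index_enum _)).
  by move=> /eqP /= ->; rewrite scale0r.
have s0 : 0 < 1 - s by rewrite subr_gt0.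
pose I' := [set k | I k /\ psubS k f].
pose A1 : mat := (1 - s)^-1 *: \sum_(0 <= d < n) t d *: chibar (F d).
have pos d : 0 < (1 - s)^-1 * t d -> 0 < t d by rewrite pmulr_rgt0// invr_gt0.
have [||tl [fltl htl]] := @chain_flag_hull R n I' (fun d => (1 - s)^-1 * t d) F A1.
- by move=> k [[/P_proj]].
- split.
  + by move=> d; rewrite mulr_ge0// invr_ge0 ltW.
  + by rewrite -mulr_sumr t1 mulVf// gt_eqF.
  + by rewrite /A1 scaler_sumr; apply: eq_bigr => d _; rewrite scalerA.
  + move=> d dn /pos td; have [IF rF sF] := hF d dn td; split => //; split => //; split => //.
    by move=> E; apply: nI; rewrite -E.
  + by move=> d d' dd' d'n /pos td /pos td'; exact: nF.
have [sz mem ord] := fltl.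
exists (f :: tl); split.
  split; last split.
  - split => //; first by move=> g; rewrite inE => /predU1P[->//|/mem[[]]].
    move=> [|i]; last by move=> ig; exact: ord.
    by move=> ig /=; have [|_ ps] := mem (nth 0 tl 0); first exact: mem_nth.
  - by move=> [_ hI _]; apply: nI; apply: hI; exact: mem_head.
  - by move=> g /= /mem[].
case: tl fltl htl sz mem ord => // g tl fltl htl sz mem ord.
case: eqP => // _; exists s, A1, B; split => //; first by rewrite cs ltW.
by rewrite AE /A1 scalerA mulfV ?scale1r// gt_eqF.
Qed.

End KappaRep.

Section KappaRepTheory.
Variables (R : realType) (n : nat) (br : 'rV[R]_n -> 'rV[R]_n -> 'rV[R]_n).
Variables (h : 'M[R]_n) (Aut : set 'M[R]_n) (b : bool).
Local Notation mat := 'M[R]_n.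
Hypothesis hbr : compact_lie_bracket br.
Hypothesis hsub : is_subalg br h.
Hypothesis hAut : is_aut_group br h Aut.
Local Notation P := (Pset br h Aut).
Local Notation I := (Iset br h Aut).
Local Notation kappa_rep := (kappa_rep br h Aut b).

(** [q] is the largest toral member of positive weight, or [0] when there is none. *)
Lemma kappa_rep_top (c s : R) f B t F A : kappa_rep c s f B t F A -> exists q : mat,
  [/\ is_proj q, subS q f, (forall x y, inS q x -> inS q y -> inS h (br x y)) &
      forall d, (d < n)%N -> 0 < t d -> subS (F d) q].
Proof.
move=> [_ _ _ _ [hF nF]].
have [[d0 /andP[d0n td0]]|nd] := pselect (exists d, (d < n)%N && (0 < t d)); last first.
  have inS0E x : inS (0 : mat) x -> x = 0 by rewrite /inS mulmx0.
  exists 0; split.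
  - by split; rewrite ?trmx0 ?mulmx0.
  - by move=> x /inS0E ->; exact: inS0.
  - by move=> x y /inS0E -> /inS0E ->; rewrite (br0l hbr); exact: inS0.
  - by move=> d dn td; exfalso; apply: nd; exists d; rewrite dn.
have [m /andP[mn tm] mmax] : exists2 m, (m < n)%N && (0 < t m) &
    forall d, (d < n)%N && (0 < t d) -> (d <= m)%N.
  have ex : exists d, (d < n)%N && (0 < t d) by exists d0; rewrite d0n.
  have ub d : (d < n)%N && (0 < t d) -> (d <= n)%N by move=> /andP[/ltnW].
  by case: (ex_maxnP ex ub) => m hm hmax; exists m.
have [[Pm tor] _ mf] := hF m mn tm.
exists (F m); split => //; first exact: P_proj Pm.
by move=> d dn td; apply: nF => //; apply: mmax; rewrite dn.
Qed.

(** Since [chibar k] is [1%:M - k] divided by the codimension, each weight contributes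
    [nu d = t d / (n - d)] to the constant and the same multiple of the projection to [N]. *)
Lemma kappa_rep_split (c s : R) f B t F A : 0 < c -> kappa_rep c s f B t F A -> exists q N (c' : R),
  split_form q f N B A c' s /\ forall x y, inS q x -> inS q y -> inS h (br x y).
Proof.
move=> c0 kA; have [q [pq qf tor Fq]] := kappa_rep_top kA.
have [/andP[cs _] [[Pf nI] BB] [t0 t1] AE [hF nF]] := kA.
pose nu (d : nat) : R := t d / (n - d)%:R.
pose N : mat := \sum_(d < n) nu d *: F d.
have cas (d : 'I_n) : nu d = 0 \/ is_proj (F d) /\ subS (F d) q.
  have := t0 d; rewrite le_eqVlt => /predU1P[td|td]; first by left; rewrite /nu -td mul0r.
  by right; have [[/P_proj pF _] _ _] := hF d (ltn_ord d) td; split => //; exact: Fq.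
have nu0 d : 0 <= nu d by rewrite mulr_ge0// invr_ge0.
have [[V [d0 sd]] _ _ fB _] := (Bk_rowsP Aut hbr b B (P_proj Pf)).1 BB.
have [BT nB _ _ _] := Bk_Dset BB.
exists q, N, (\sum_(d < n) nu d); split => //; split.
- by split => //; exact: P_proj Pf.
- split.
  + rewrite raddf_sum /=; apply: eq_bigr => d _; case: (cas d) => [->|[[FT _] _]]; first by rewrite !scale0r trmx0.
    by rewrite linearZ /= FT.
  + move=> x; rewrite /N mulmx_sumr /Qf mulmx_suml summxE; apply: sumr_ge0 => d _.
    rewrite -scalemxAr -scalemxAl mxE; case: (cas d) => [->|[pF _]]; first by rewrite mul0r.
    by rewrite mulr_ge0//; exact: (proj_psd x pF).
  + rewrite mulmx_suml; apply: eq_bigr => d _; case: (cas d) => [->|[pF sF]]; first by rewrite !scale0r mul0mx.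
    by rewrite -scalemxAl (inS_sub pF sF).
- by split => //; apply/(nonneg_specP BT).
- exact: lt_le_trans cs.
- rewrite AE; congr (_ + _); rewrite big_mkord raddf_sum -sumrB; apply: eq_bigr => d _.
  have := t0 d; rewrite le_eqVlt => /predU1P[td|td].
    by rewrite /nu -td mul0r !scale0r raddf0 subr0.
  have [_ rF _] := hF d (ltn_ord d) td.
  by rewrite /chibar rF scalerA -/(nu d) scalerBr scalemx1.
Qed.

(** Different constants would put the top of one representation inside the toral support of the
    other, although it is not toral; for equal constants the splitting is unique. *)
Lemma kappa_rep_unique (c s s' : R) f f' B B' t t' F F' A : 0 < c ->
  kappa_rep c s f B t F A -> kappa_rep c s' f' B' t' F' A -> s = s' /\ B = B'.
Proof.
move=> c0 kA kA'.
have [q [N [e [sf tor]]]] := kappa_rep_split c0 kA.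
have [q' [N' [e' [sf' tor']]]] := kappa_rep_split c0 kA'.
have [_ [[Pf nI] BB] _ _ _] := kA; have [_ [[Pf' nI'] BB'] _ _ _] := kA'.
have [_ _ tB _ _] := Bk_Dset BB; have [_ _ tB' _ _] := Bk_Dset BB'.
case: (ltgtP e e') => ee'.
- exfalso; apply: nI; split => // x y fx fy; have sub := split_form_lt sf sf' ee'.
  by apply: tor'; exact: sub.
- exfalso; apply: nI'; split => // x y fx fy; have sub := split_form_lt sf' sf ee'.
  by apply: tor; exact: sub.
- by move: sf'; rewrite -ee' => sf'; exact: (split_form_unique sf sf').
Qed.

Lemma minimal_below f : (P `\` I) f -> exists2 m, minimal_in (P `\` I) m & subS m f.
Proof.
move: {2}(\rank f).+1 (ltnSn (\rank f)) => r; elim: r f => // r ih f; rewrite ltnS => fr Pf.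
have [mf|nm] := pselect (minimal_in (P `\` I) f); first by exists f.
have [l [Pl lf nl]] : exists l, [/\ (P `\` I) l, subS l f & l <> f].
  apply: contrapT => hn; apply: nm; split => // l Pl lf; apply: contrapT => nl.
  by apply: hn; exists l.
have lt : (\rank l < \rank f)%N by apply: psubS_rank; [exact: P_proj Pl.1|exact: P_proj Pf.1|].
have [m mm ml] := ih l (leq_trans lt fr) Pl.
by exists m => //; exact: subS_trans lf.
Qed.

(** B[f] grows as [f] shrinks, so the minimal non-toral subalgebras already give the union, and they
    all belong to [Kmin]. *)
Lemma B_PminusI_BK (K : set mat) : Kmin br h Aut `<=` K -> K `<=` P `\` I ->
  B_PminusI br h Aut b = BK br Aut b K.
Proof.
move=> KK KP; apply/seteqP; split => A; last first.
  by move=> [k [[Kk _] BA]]; exists k; split => //; exact: KP.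
move=> [f [Pf BA]]; have [m mm mf] := minimal_below Pf.
have BmA := Bk_sub mf BA; exists m; split => //; split.
  by apply: KK => S _ _ _ hS; exact: hS.
by move=> E; move: BmA; rewrite E => /Bk_gP.
Qed.

Section Limits.
Variables (J : Type) (U : set_system J).
Hypothesis uU : UltraFilter U.
Let pU : ProperFilter U. Proof. exact: ultra_proper. Qed.

Lemma inS_br_cvg (k p : J -> mat) (l q : mat) x y : k @ U --> l -> p @ U --> q ->
  U [set i | is_proj (k i)] ->
  U [set i | forall x y, inS (k i) x -> inS (k i) y -> inS (p i) (br x y)] ->
  inS l x -> inS l y -> inS q (br x y).
Proof.
move=> kl pq pk hk lx ly.
have cx z : (fun i => z *m k i) @ U --> z *m l by apply: cvgmxM => //; exact: cvg_cst.
have c1 : (fun i => br (x *m k i) (y *m k i)) @ U --> br (x *m l) (y *m l) by exact: br_cvg.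
have c2 : (fun i => br (x *m k i) (y *m k i) *m p i) @ U --> br (x *m l) (y *m l) *m q by exact: cvgmxM.
rewrite -lx -ly; apply: (cvg_mx_eq uU c2 c1); apply: filterS2 pk hk => i /= pk hk.
by apply: hk; exact: inS_mul.
Qed.

Lemma P_cvg (k : J -> mat) (l : mat) : k @ U --> l -> U [set i | P (k i)] -> P l.
Proof.
move=> kl hk; have pk : U [set i | is_proj (k i)] by apply: filterS hk => i /P_proj.
have pl := proj_cvg uU kl pk; have ph := hsub.1; split; last split.
- split => // x y lx ly; apply: (inS_br_cvg kl kl pk _ lx ly).
  by apply: filterS hk => i /= [[_ s] _]; exact: s.
- move=> a x aA lx.
  have c1 : (fun i => x *m k i *m a) @ U --> x *m l *m a.
    by apply: cvgmxM; [apply: cvgmxM => //; exact: cvg_cst|exact: cvg_cst].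
  have c2 : (fun i => x *m k i *m a *m k i) @ U --> x *m l *m a *m l by exact: cvgmxM.
  rewrite -lx; apply: (cvg_mx_eq uU c2 c1); apply: filterS hk => i /= Pi.
  have [_ [ak _]] := Pi; apply: ak => //; apply: inS_mul; exact: P_proj Pi.
- split.
    apply: (subS_cvg uU (cvg_cst h) kl); first by apply: filterE => i.
    by apply: filterS hk => i /= [_ [_ []]].
  move=> E; have tk : (fun i => \tr (k i)) @ U --> \tr l by exact: cvgmx_tr.
  (* Strictness of the inclusion of [h] survives the limit because it costs a whole unit of
     trace. *)
  have : (\rank h).+1%:R <= \tr l :> R.
    apply: (cvg_r_le uU (cvg_cst _) tk); apply: filterS hk => i /= Pi.
    rewrite (proj_trace (P_proj Pi)) ler_nat; have [_ [_ hp]] := Pi.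
    exact: psubS_rank ph (P_proj Pi) hp.
  by rewrite -E (proj_trace ph) ler_nat ltnn.
Qed.

Lemma I_cvg (k : J -> mat) (l : mat) : k @ U --> l -> U [set i | I (k i)] -> I l.
Proof.
move=> kl hk; split; first by apply: (P_cvg kl); apply: filterS hk => i [].
move=> x y lx ly; apply: (inS_br_cvg kl (cvg_cst h) _ _ lx ly).
  by apply: filterS hk => i [/P_proj].
by apply: filterS hk => i /= [_ s]; exact: s.
Qed.

(* The limit of the top members may be toral; joining it with a limit of
   members of the compact set [K] repairs this. *)
Lemma kappa_rep_limit (K : set mat) (c : R) (s : J -> R) (f B : J -> mat) t F (A : J -> mat) (A0 : mat) :
  0 < c -> compact K -> K `<=` P `\` I -> (forall f, (P `\` I) f -> exists2 k, K k & subS k f) ->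
  (forall i, kappa_rep c (s i) (f i) (B i) (t i) (F i) (A i)) -> A @ U --> A0 ->
  exists s0 f0 B0 t0 F0, kappa_rep c s0 f0 B0 t0 F0 A0 /\ B @ U --> B0.
Proof.
move=> c0 cK KP Kf kA AA0.
have UT Q : (forall j : J, Q j) -> U [set j | Q j].
  by move=> hQ; apply: filterS (filterT : U setT) => j _; exact: hQ.
have Pf i : (P `\` I) (f i) by have [_ []] := kA i.
have BB i : Bk br Aut b (f i) (B i) by have [_ []] := kA i.
have /choice[k hk] : forall i, exists k, K k /\ subS k (f i).
  by move=> i; have [k Kk kf] := Kf _ (Pf i); exists k.
have [k0 Kk0 kk0] : exists2 k0, K k0 & k @ U --> k0.
  by apply: (ultra_lim uU cK); apply: UT => i; have [] := hk i.
have [f0 ff0] : exists f0 : mat, f @ U --> f0.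
  apply: (ultra_lim_mx uU (rho := 1)); apply: UT => i; apply: proj_norm_le1; exact: P_proj (Pf i).1.
have [B0 BB0] : exists B0 : mat, B @ U --> B0.
  apply: (ultra_lim_mx uU (rho := 1)); apply: UT => i; exact: (Bk_norm_le1 hbr (BB i)).
have [s0 s01 ss0] : exists2 s0 : R, c <= s0 <= 1 & s @ U --> s0.
  by apply: (ultra_lim_itv uU); apply: UT => i; have [] := kA i.
have t0 i d : 0 <= t i d by have [_ _ [t0 _] _ _] := kA i; exact: t0.
have t1 i : \sum_(0 <= d < n) t i d = 1 - s i by have [_ _ [_ t1] _ _] := kA i; exact: t1.
have t1' i : \sum_(0 <= d < n) t i d <= 1.
  by rewrite t1 gerBl; have [/andP[cs _] _ _ _ _] := kA i; exact/ltW/(lt_le_trans c0).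
have hF i d : (d < n)%N -> 0 < t i d -> [/\ I (F i d), \rank (F i d) = d & subS (F i d) (f i)].
  by have [_ _ _ _ [hF _]] := kA i; exact: hF.
have hF' i d : (d < n)%N -> 0 < t i d -> is_proj (F i d) /\ \rank (F i d) = d.
  by move=> dn td; have [[/P_proj pF _] rF _] := hF i d dn td.
have [T [G [hT hG T0 hlim]]] := chain_limit uU t0 t1' hF'.
have Pf0 : P f0 by apply: (P_cvg ff0); apply: UT => i; exact: (Pf i).1.
have [Pk0 nIk0] := KP _ Kk0.
have Bf0 : Bk br Aut b f0 B0.
  apply: (Bk_cvg hbr uU ff0 BB0); apply: UT => i; split => //; exact: P_proj (Pf i).1.
have Bk0 : Bk br Aut b k0 B0.
  apply: (Bk_cvg hbr uU kk0 BB0); apply: UT => i; have [Kk kf] := hk i; split.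
    exact: P_proj (KP _ Kk).1.
  exact: Bk_sub kf (BB i).
have [m jm] := join_exists br f0 k0; have [sm fm km _] := jm.
have Pm : P m.
  split => //; split; first exact: (join_Aut_inv hAut Pf0.2.1 Pk0.2.1 jm).
  have [_ [_ [hk0 nhk0]]] := Pk0; split; first exact: subS_trans hk0 km.
  move=> E; apply: nhk0; apply: (subS_anti hsub.1 (P_proj Pk0) hk0); by rewrite E.
have nIm : ~ I m by move=> [_ tor]; apply: nIk0; split => // x y /km mx /km my; exact: tor.
exists s0, m, B0, T, G; split => //; split => //.
- by split => //; exact: (Bk_join hbr Bf0 Bk0 jm).
- split => //.
  have c1 : (fun j => \sum_(0 <= d < n) t j d) @ U --> \sum_(0 <= d < n) T d.
    rewrite big_mkord (_ : (fun j => _) = (fun j => \sum_(d < n) t j d)); last first.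
      by apply/funext => j; rewrite big_mkord.
    by apply: cvgr_sum => d; exact: hT.
  have c2 : (fun j => 1 - s j) @ U --> 1 - s0 by apply: cvgB => //; exact: cvg_cst.
  by apply: (cvg_r_eq uU c1 c2); apply: UT => j; exact: t1.
- have c1 : (fun j => \sum_(0 <= d < n) t j d *: chibar (F j d) + s j *: B j) @ U -->
      \sum_(0 <= d < n) T d *: chibar (G d) + s0 *: B0.
    by apply: cvgmxD => //; exact: cvgmxZ.
  by apply: (cvg_mx_eq uU AA0 c1); apply: UT => j; have [_ _ _ AE _] := kA j; exact: AE.
- split.
    move=> d dn Td; have [tp GF] := hG d dn Td; split.
    + by apply: (I_cvg GF); apply: filterS tp => i td; have [] := hF i d dn td.
    + by apply: (rank_cvg uU GF); apply: filterS tp => i td; exact: hF'.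
    + apply: subS_trans fm; apply: (subS_cvg uU GF ff0).
        by apply: filterS tp => i td; have [] := hF' i d dn td.
      by apply: filterS tp => i td; have [] := hF i d dn td.
  move=> d d' dd' d'n Td Td'; have dn := leq_ltn_trans dd' d'n.
  have [[tp GF] [tp' GF']] := (hG d dn Td, hG d' d'n Td').
  apply: (subS_cvg uU GF GF'); first by apply: filterS tp => i td; have [] := hF' i d dn td.
  apply: filterS2 tp tp' => i td td'; have [_ _ _ _ [_ nF]] := kA i; exact: nF.
Qed.

End Limits.
End KappaRepTheory.

(** If a neighbourhood were missed, an ultrafilter containing the set of failures would refute the
    hypothesis. Continuity can thus be tested where all auxiliary data have limits. *)
Lemma cvg_ultra (T : Type) (V : topologicalType) (F : set_system T) (f : T -> V) (l : V) : Filter F ->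
  (forall U : set_system T, UltraFilter U -> F `<=` U -> f @ U --> l) -> f @ F --> l.
Proof.
move=> FF hU N Nl; apply: contrapT => nN; pose D := ~` (f @^-1` N).
have pW : ProperFilter (within D F).
  have FW : Filter (within D F) by exact: within_filter.
  apply: (@Build_ProperFilter _ _ _ FW) => h0.
  have h1 : F [set x | D x -> False] by exact: h0.
  apply: nN; apply: (@filterS T F FF [set x | D x -> False] (f @^-1` N) _ h1) => x hx.
  by apply: contrapT => nx; exact: hx.
have [U [uU WU]] := ultraFilterLemma pW; have pU : ProperFilter U by exact: ultra_proper.
have UD : U D.
  by apply: WU; have : F [set x | D x -> D x] by apply: filterE => x Dx; exact: Dx.
have UN : U (f @^-1` N).
  by apply: (hU U uU _ N Nl) => A FA; apply: WU; have : F [set x | D x -> A x] by apply: filterS FA => x ? _.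
have : U set0 by apply: filterS2 UD UN => x nx; exact: nx.
exact: filter_not_empty.
Qed.

(** * Deformation of X_eps onto X_1, and the conclusion *)

Section Deformation.
Variables (R : realType) (n : nat) (br : 'rV[R]_n -> 'rV[R]_n -> 'rV[R]_n).
Variables (h : 'M[R]_n) (Aut : set 'M[R]_n) (b : bool) (K : set 'M[R]_n).
Local Notation mat := 'M[R]_n.
Hypothesis hbr : compact_lie_bracket br.
Hypothesis hsub : is_subalg br h.
Hypothesis hAut : is_aut_group br h Aut.
Hypothesis cK : compact K.
Local Notation P := (Pset br h Aut).
Local Notation I := (Iset br h Aut).
Hypothesis KKmin : Kmin br h Aut `<=` K.
Hypothesis KPI : K `<=` P `\` I.

Lemma kappa_ge_deform (c : R) : 0 < c <= 1 ->
  strong_def_retract (B_PminusI br h Aut b) (kappa_ge br h Aut b c).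
Proof.
move=> /andP[c0 c1]; set X := kappa_ge br h Aut b c.
have rep A : X A <-> exists s f B t F, kappa_rep br h Aut b c s f B t F A by exact: kappa_ge_rep.
have Kf f : (P `\` I) f -> exists2 k, K k & subS k f.
  move=> /minimal_below[m mm mf]; exists m => //; apply: KKmin => S _ _ _; exact.
have sub : B_PminusI br h Aut b `<=` X.
  by move=> A [f [Pf BA]]; apply/rep; exists 1, f, A, (fun=> 0), (fun=> 0); exact: kappa_rep_self.
split => //.
have [[A1 XA1]|nX] := pselect (X !=set0); last first.
  have nX' A : ~ X A by move=> XA; apply: nX; exists A.
  exists (fun _ A => A); split => //; try by move=> ? ? ? /nX'.
  - by apply/subspace_continuousP => -[t x] [_ /nX'].
  - by move=> A /nX'.
(* A map onto [X], not continuous, which provides a representation for every matrix;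
   [kappa_rep_limit] then applies to families indexed by all matrices. *)
pose pi A := if `[< X A >] then A else A1.
have Xpi A : X (pi A) by rewrite /pi; case: asboolP.
have piE A : X A -> pi A = A by rewrite /pi; case: asboolP.
have /choice[S hS] : forall A, exists q : (R * mat * mat) * ((nat -> R) * (nat -> mat)),
    kappa_rep br h Aut b c q.1.1.1 q.1.1.2 q.1.2 q.2.1 q.2.2 (pi A).
  by move=> A; have /rep[s [f [B [t [F kA]]]]] := Xpi A; exists ((s, f, B), (t, F)).
pose g A := (S A).1.2.
have gE A s f B t F : X A -> kappa_rep br h Aut b c s f B t F A -> g A = B.
  move=> XA kA; have kA' := hS A; rewrite (piE _ XA) in kA'.
  by have [_] := kappa_rep_unique hbr c0 kA' kA.
have gB A : X A -> B_PminusI br h Aut b (g A).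
  by move=> XA; have [_ [Pf BA] _ _ _] := hS A; exists (S A).1.1.2.
have gid A : B_PminusI br h Aut b A -> g A = A.
  move=> BA; have XA := sub _ BA; have [f [Pf BfA]] := BA.
  exact: (gE A _ _ _ _ _ XA (kappa_rep_self c1 Pf BfA)).
have gc : cont_on X g.
  move=> x Xx; apply: cvg_ultra => U uU XU; have pU : ProperFilter U by exact: ultra_proper.
  have UX : U X.
    by apply: XU; have : nbhs x [set y | X y -> X y] by apply: filterE => y Xy; exact: Xy.
  have idU : id @ U --> x by move=> N Nx; apply: XU; have : nbhs x [set y | X y -> N y] by apply: filterS Nx => y Ny _.
  have piU : pi @ U --> x.
    by apply: cvg_trans idU; apply: near_eq_cvg; apply: filterS UX => A /piE /= ->.
  (* The family is indexed by the matrices themselves. The limit of the parts [B] belongs to a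
     representation of [x], and uniqueness identifies it with [g x]. *)
  have [s0 [f0 [B0 [t0 [F0 [k0 BB0]]]]]] := kappa_rep_limit hbr hsub hAut uU c0 cK KPI Kf hS piU.
  by rewrite (gE x _ _ _ _ _ Xx k0).
exists (fun t A => (1 - t) *: A + t *: g A); split.
- apply/subspace_continuousP => -[t x] [/= _ Xx].
  set F := within _ _; have FF : Filter F by exact: within_filter.
  have sndF : (fun q : R * mat => q.2) @ F --> within X (nbhs x) by exact: within_snd.
  have snd0 : (fun q : R * mat => q.2) @ F --> x by apply: cvg_trans sndF _; exact: cvg_within.
  have fst0 : (fun q : R * mat => q.1) @ F --> t by exact: within_fst.
  apply: segment_cvg => //.
  exact: (@cvg_comp _ _ _ (fun q : R * mat => q.2) g F (within X (nbhs x)) (nbhs (g x)) sndF (gc x Xx)).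
- move=> t A /andP[t0 t1] XA; have t1' : 0 <= 1 - t by rewrite subr_ge0.
  have := hS A; rewrite piE// -/(g A).
  move: (S A).1.1.1 (S A).1.1.2 (S A).2.1 (S A).2.2 => s f tau F [/andP[cs s1] Pf [tau0 tau1] AE [hF nF]].
  have pos d : 0 < (1 - t) * tau d -> 0 < tau d.
    by have := tau0 d; rewrite le_eqVlt => /predU1P[<-|//]; rewrite mulr0 ltxx.
  (* Along the segment the toral weights shrink by the factor [1 - t] while [f] and [g A] stay, so
     the coefficient only grows and remains at least [c]. *)
  apply/rep; exists ((1 - t) * s + t), f, (g A), (fun d => (1 - t) * tau d), F; split => //.
  + apply/andP; split; last by nra.
    by rewrite (le_trans cs)//; nra.
  + split; first by move=> d; rewrite mulr_ge0.
    by rewrite -mulr_sumr tau1; ring.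
  + rewrite {1}AE scalerDr scaler_sumr scalerA scalerDl addrA; congr (_ + _ + _).
    by apply: eq_bigr => d _; rewrite scalerA.
  + by split => [d dn /pos|d d' dd' d'n /pos td /pos]; [exact: hF|exact: nF].
- by move=> A _; rewrite subr0 scale1r scale0r addr0.
- by move=> A XA; rewrite subrr scale0r add0r scale1r; exact: gB.
- by move=> t A _ /gid ->; rewrite -scalerDl subrK scale1r.
Qed.

End Deformation.

Theorem theorem6p6 (R : realType) (n : nat)
  (br : 'rV[R]_n -> 'rV[R]_n -> 'rV[R]_n) (h : 'M[R]_n) (Aut : set 'M[R]_n)
  (L : nat) (b : bool) (K : set 'M[R]_n) :
  compact_lie_bracket br ->
  is_subalg br h -> h <> gP R n ->
  is_aut_group br h Aut ->
  (forall phi, is_flag (Iset br h Aut) phi -> (size phi <= L)%N) ->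
  K `<=` Pset br h Aut -> K (gP R n) ->
  compact K -> semialgebraic K -> upper_semilattice br K ->
  [/\ compact (hullK K),
      strong_def_retract (hullK K) (BK br Aut b K) &
      ((exists x y, ~ inS h (br x y)) ->
       Kmin br h Aut `<=` K -> K `<=` Pset br h Aut `\` Iset br h Aut ->
       (forall eps : R, 0 < eps <= 1 ->
          strong_def_retract (hullK K) (X_eps br h Aut b L eps)) /\
       strong_def_retract (hullK K) (B_PminusI br h Aut b))].
Proof.
move=> hbr hsub _ hAut _ KP _ cK sK jK.
have Ksub k : K k -> is_subalg br k by move=> /KP[].
have Kaut k : K k -> Aut_inv Aut k by move=> /KP[_ []].
have Kp k : K k -> is_proj k by move=> /Ksub[].
have main : strong_def_retract (hullK K) (BK br Aut b K) by exact: (BK_deform b hbr hAut cK Ksub Kaut jK sK).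
split => //; first exact: hullK_compact.
move=> _ KK KPI; have E := B_PminusI_BK b KK KPI; split; last by rewrite E.
(* [X_eps] at [eps] is [kappa_ge] at [eps ^+ L], a number in ]0, 1]; its deformation onto
   [B_PminusI] is followed by the one of [BK]. *)
move=> eps /andP[e0 e1]; apply: (sdr_trans (Y := B_PminusI br h Aut b)); last by rewrite E.
by apply: (kappa_ge_deform b hbr hsub hAut cK KK KPI); rewrite exprn_gt0//= exprn_ile1// ltW.
Qed.
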